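(* Let $n\ge 1$. The group $W_n=\pi_1\mathcal W_n$ has a presentation with generators $\rho_i,\sigma_i$ ($1\le i\le n-1$) and $\tau_i$ ($1\le i\le n$) and the following relations (for all indices for which the symbols are defined): \begin{itemize} \item $[\rho_i,\rho_j]=[\sigma_i,\sigma_j]=[\rho_i,\sigma_j]=1$ if $|i-j|>1$; \item $\rho_i\rho_{i+1}\rho_i=\rho_{i+1}\rho_i\rho_{i+1}$ and $\sigma_i\sigma_{i+1}\sigma_i=\sigma_{i+1}\sigma_i\sigma_{i+1}$; \item $\rho_i\sigma_{i+1}\sigma_i=\sigma_{i+1}\sigma_i\rho_{i+1}$, $\ \sigma_i\sigma_{i+1}\rho_i=\rho_{i+1}\sigma_i\sigma_{i+1}$, $\ \sigma_i\rho_{i+1}\rho_i=\rho_{i+1}\rho_i\sigma_{i+1}$; \item $[\tau_i,\tau_j]=1$ for $i\ne j$; \item $[\rho_i,\tau_j]=1$ and $[\sigma_i,\tau_j]=1$ for $j\ne i,i+1$; \item $\tau_i^{\varepsilon}\sigma_i^{\eta}=\sigma_i^{\eta}\tau_{i+1}^{\varepsilon}$ and $\tau_{i+1}^{\varepsilon}\sigma_i^{\eta}=\sigma_i^{\eta}\tau_i^{\varepsilon}$ for $\varepsilon,\eta=\pm1$; \item $\tau_i^{\varepsilon}\rho_i=\rho_i\tau_{i+1}^{\varepsilon}$ and $\tau_{i+1}^{\varepsilon}\rho_i=\sigma_i^{-\varepsilon}\rho_i^{-1}\sigma_i^{\varepsilon}\tau_i^{\varepsilon}$ for $\varepsilon=\pm1$;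 \item $\tau_i^{\varepsilon}\rho_i^{-1}=\sigma_i^{-\varepsilon}\rho_i\sigma_i^{\varepsilon}\tau_{i+1}^{\varepsilon}$ and $\tau_{i+1}^{\varepsilon}\rho_i^{-1}=\rho_i^{-1}\tau_i^{\varepsilon}$ for $\varepsilon=\pm1$. \end{itemize}
   Context: $\mathbb R^3_+=\{(x,y,z): z\ge 0\}$. A wicket is a semicircle in $\mathbb R^3_+$ that is the upper half of a round circle lying in a vertical plane (a plane parallel to the $z$-axis) with center in the $xy$-plane. $\mathcal W_n$ is the space of unordered configurations of $n$ disjoint wickets in $\mathbb R^3_+$, topologized by their endpoints; it is path-connected. Products of loops are composed from left to right. Take as basepoint the configuration in which the $i$th wicket has radius $1$, center $(4i,0,0)$ and lies in the plane $x=4i$, $i=1,\dots,n$. For $1\le i\le n-1$, $\rho_i$ and $\sigma_i$ are represented by loops of configurations in which all wickets stay in planes perpendicular to the $x$-axis, all wickets other than the $i$th and $(i+1)$st are fixed, and the $i$th and $(i+1)$st wickets exchange places, their planes coinciding at exactly one moment and not coinciding with the planes of other wickets. For $\rho_i$, at that moment the $i$th wicket (the one moving in the positive $x$-direction) is nested inside the $(i+1)$st, so it passes through it. For $\sigma_i$, at that moment the two wickets are not nested and the $i$th wicket lies on the side of larger $y$-coordinate, so it passes around the $(i+1)$st. For $1\le i\le n$, $\tau_i$ is represented by the loop rotating the $i$th wicket by $180$ degrees about its vertical axis of symmetry, clockwise as seen from above, with the other wickets fixed. *)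

(* Defs.v *)
From HB Require Import structures.
From mathcomp Require Import all_boot all_order all_algebra generic_quotient.
From mathcomp Require Import all_classical all_reals.
From mathcomp Require Import topology normedtype homotopy trigo.
From mathcomp Require Import ring lra.

Set Implicit Arguments.
Unset Strict Implicit.
Unset Printing Implicit Defensive.

Import Order.TTheory GRing.Theory Num.Theory.
Import numFieldNormedType.Exports.

Local Open Scope classical_set_scope.
Local Open Scope ring_scope.
Local Open Scope quotient_scope.

Definition unit_interval (R : realType) : Type := `[0, 1]%classic : set R.

HB.instance Definition _ (R : realType) :=
  Topological.copy (unit_interval R) (`[0, 1]%classic : set R).

Section UnitInterval.
Context {R : realType}.
Local Notation I := (unit_interval R).

Definition ival (t : I) : R := set_val t.

Lemma clamp_subproof (x : R) :
  Num.max 0 (Num.min 1 x) \in (`[0, 1]%classic : set R).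
Proof. by rewrite inE /= in_itv /= le_max lexx ge_max ler01 ge_min lexx. Qed.

(* The nearest-point retraction of R onto [0, 1]. *)
Definition clamp (x : R) : I :=
  exist (fun x => x \in (`[0, 1]%classic : set R)) _ (clamp_subproof x).

Lemma ival_itv (t : I) : 0 <= ival t <= 1.
Proof.
have := set_valP t; rewrite /= in_itv /=.
by [].
Qed.

Lemma ivalK (x : R) : 0 <= x <= 1 -> ival (clamp x) = x.
Proof.
case/andP=> x0 x1; rewrite /ival /clamp set_valE /=.
by rewrite (min_idPr x1) (max_idPr x0).
Qed.

Lemma ival_inj : injective ival.
Proof. by move=> s t; rewrite /ival set_valE => h; exact: val_inj. Qed.

Lemma clampK (t : I) : clamp (ival t) = t.
Proof. by apply: ival_inj; rewrite ivalK// ival_itv. Qed.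

Lemma ival_continuous : continuous ival.
Proof. exact: initial_continuous. Qed.

Lemma clamp_continuous : continuous clamp.
Proof.
apply: continuous_comp_initial.
have -> : set_val \o clamp = (fun=> 0 : R) \max ((fun=> 1 : R) \min id).
  by apply/funext => x; rewrite /= set_valE.
move=> x; apply: continuous_max; first exact: cvg_cst.
apply: continuous_min; [exact: cvg_cst|exact: cvg_id].
Qed.

Lemma unit_interval_neq01 : clamp 0 != clamp 1.
Proof.
apply/eqP => /(congr1 ival); rewrite !ivalK ?lexx ?ler01//.
by move/eqP; rewrite eq_sym oner_eq0.
Qed.

HB.instance Definition _ :=
  @isBiPointed.Build I (clamp 0) (clamp 1) unit_interval_neq01.

Lemma ival0 : ival zero = 0.
Proof. by rewrite ivalK// lexx ler01. Qed.

Lemma ival1 : ival one = 1.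
Proof. by rewrite ivalK// lexx ler01. Qed.

End UnitInterval.

Section ContinuityHelpers.
Context {R : realType}.
Local Notation I := (unit_interval R).

Lemma compose_continuous (S T U : topologicalType) (f : S -> T) (g : T -> U) :
  continuous f -> continuous g -> continuous (fun s => g (f s)).
Proof. by move=> cf cg s; exact: (continuous_comp (cf s) (cg _)). Qed.

Lemma pair_continuous (S T U : topologicalType) (f : S -> T) (g : S -> U) :
  continuous f -> continuous g -> continuous (fun s => (f s, g s)).
Proof. by move=> cf cg s; apply: cvg_pair; [exact: cf|exact: cg]. Qed.

Lemma clamp_comp_continuous (T : topologicalType) (f : T -> R) :
  continuous f -> continuous (fun t => clamp (f t)).
Proof. by move=> cf; apply: compose_continuous cf _; exact: clamp_continuous. Qed.

Lemma ival_fst_continuous (T : topologicalType) :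
  continuous (fun s : I * T => ival s.1).
Proof.
apply: (@compose_continuous _ _ _ fst ival); last exact: ival_continuous.
by move=> ?; exact: cvg_fst.
Qed.

Lemma ival_snd_continuous (T : topologicalType) :
  continuous (fun s : T * I => ival s.2).
Proof.
apply: (@compose_continuous _ _ _ snd ival); last exact: ival_continuous.
by move=> ?; exact: cvg_snd.
Qed.

Lemma mul2_continuous (T : topologicalType) (f : T -> R) :
  continuous f -> continuous (fun t => 2 * f t).
Proof. by move=> cf t; apply: cvgM; [exact: cvg_cst|exact: cf]. Qed.

Lemma subr_continuous (T : topologicalType) (f g : T -> R) :
  continuous f -> continuous g -> continuous (fun t => f t - g t).
Proof. by move=> cf cg t; apply: cvgB; [exact: cf|exact: cg]. Qed.

Lemma addr_continuous (T : topologicalType) (f g : T -> R) :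
  continuous f -> continuous g -> continuous (fun t => f t + g t).
Proof. by move=> cf cg t; apply: cvgD; [exact: cf|exact: cg]. Qed.

Lemma mulr_continuous (T : topologicalType) (f g : T -> R) :
  continuous f -> continuous g -> continuous (fun t => f t * g t).
Proof. by move=> cf cg t; apply: cvgM; [exact: cf|exact: cg]. Qed.

Lemma max_continuous (T : topologicalType) (f g : T -> R) :
  continuous f -> continuous g -> continuous (fun t => Num.max (f t) (g t)).
Proof. by move=> cf cg t; exact: (continuous_max (cf t) (cg t)). Qed.

Lemma min_continuous (T : topologicalType) (f g : T -> R) :
  continuous f -> continuous g -> continuous (fun t => Num.min (f t) (g t)).
Proof. by move=> cf cg t; exact: (continuous_min (cf t) (cg t)). Qed.

Lemma cst_fun_continuous (S T : topologicalType) (a : T) :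
  continuous (fun _ : S => a).
Proof. by move=> s; exact: cvg_cst. Qed.

End ContinuityHelpers.

Section Loops.
Context {R : realType} {X : topologicalType}.
Local Notation I := (unit_interval R).

Lemma paste_continuous (T : topologicalType) (h : T -> R) (c : R) (f g : T -> X) :
  continuous h -> continuous f -> continuous g ->
  (forall t, h t = c -> f t = g t) ->
  continuous (fun t => if h t <= c then f t else g t).
Proof.
move=> ch cf cg fg t U.
have [htc|cht|htc] := ltgtP (h t) c.
- have hc : \forall s \near t, h s < c by apply: (cvgr_lt (h t)) htc; exact: ch.
  move=> /cf; move: hc; apply: filterS2 => s /= hs.
  by rewrite ltW.
- have hc : \forall s \near t, c < h s by apply: (cvgr_gt (h t)) cht; exact: ch.
  move=> /cg; move: hc; apply: filterS2 => s /= hs.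
  by rewrite leNgt hs.
- move=> fU; have gU : \forall s \near t, U (g s) by apply: cg; rewrite -fg.
  have {}fU : \forall s \near t, U (f s) by exact: cf.
  by move: gU fU; apply: filterS2 => s /= gs fs; case: ifP.
Qed.

Definition homotopic (x y : X) (p q : {path I from x to y in X}) : Prop :=
  exists H : I * I -> X, [/\ continuous H,
    forall t, H (zero, t) = p t, forall t, H (one, t) = q t,
    forall s, H (s, zero) = x & forall s, H (s, one) = y].

Lemma path_comp_continuous (T : topologicalType) (x y : X)
    (p : {path I from x to y in X}) (f : T -> R) :
  continuous f -> continuous (fun t => p (clamp (f t))).
Proof.
move=> cf; apply: (compose_continuous (clamp_comp_continuous cf)).
exact: cts_fun.
Qed.

Section Concat.
Variables (x y z : X) (p : {path I from x to y in X})
  (q : {path I from y to z in X}).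

Definition concat_fun (t : I) : X :=
  if ival t <= 2^-1 then p (clamp (2 * ival t)) else q (clamp (2 * ival t - 1)).

Lemma concat_continuous : continuous concat_fun.
Proof.
have c2 := mul2_continuous (@ival_continuous R).
apply: paste_continuous; first exact: ival_continuous.
- exact: path_comp_continuous c2.
- by apply: path_comp_continuous; apply: subr_continuous c2 _;
    exact: cst_fun_continuous.
- move=> t ->; rewrite mulfV ?pnatr_eq0// subrr.
  by rewrite -[clamp 1]/one -[clamp 0]/zero path_one path_zero.
Qed.

Lemma concat_zero : concat_fun zero = x.
Proof.
by rewrite /concat_fun ival0 invr_ge0 ler0n mulr0 -[clamp 0]/zero path_zero.
Qed.

Lemma concat_one : concat_fun one = z.
Proof.
rewrite /concat_fun ival1 leNgt invf_lt1 ?ltr0n// ltr1n /=.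
by rewrite mulr1 (_ : 2 - 1 = 1 :> R) -?[clamp 1]/one ?path_one//; ring.
Qed.

Definition concat : {path I from x to z in X} :=
  mk_path concat_continuous concat_zero concat_one.

Lemma concatE t : concat t =
  if ival t <= 2^-1 then p (clamp (2 * ival t)) else q (clamp (2 * ival t - 1)).
Proof. by []. Qed.

End Concat.

Section Reverse.
Variables (x y : X) (p : {path I from x to y in X}).

Definition reverse_fun (t : I) : X := p (clamp (1 - ival t)).

Lemma reverse_continuous : continuous reverse_fun.
Proof.
apply: path_comp_continuous; apply: subr_continuous.
  exact: cst_fun_continuous.
exact: ival_continuous.
Qed.

Lemma reverse_zero : reverse_fun zero = y.
Proof. by rewrite /reverse_fun ival0 subr0 -[clamp 1]/one path_one. Qed.

Lemma reverse_one : reverse_fun one = x.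
Proof. by rewrite /reverse_fun ival1 subrr -[clamp 0]/zero path_zero. Qed.

Definition reverse : {path I from y to x in X} :=
  mk_path reverse_continuous reverse_zero reverse_one.

Lemma reverseE t : reverse t = p (clamp (1 - ival t)).
Proof. by []. Qed.

End Reverse.

Definition const_path (x : X) : {path I from x to x in X} :=
  [the {path I from x to x in X} of cst x].

Section HomotopyTheory.
Variables x y : X.
Implicit Types p q r : {path I from x to y in X}.

Lemma homotopic_refl p : homotopic p p.
Proof.
exists (fun s => p s.2); split=> //= [|s|s]; [|exact: path_zero|exact: path_one].
by apply: (@compose_continuous _ _ _ snd p); [move=> ?; exact: cvg_snd
  |exact: cts_fun].
Qed.

Lemma homotopic_sym p q : homotopic p q -> homotopic q p.
Proof.
move=> [H [cH H0 H1 Hx Hy]].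
exists (fun s => H (clamp (1 - ival s.1), s.2)); split=> //=.
- apply: (@compose_continuous _ _ _ (fun s : I * I => (_, _)) H) => //.
  apply: pair_continuous; last by move=> ?; exact: cvg_snd.
  apply/clamp_comp_continuous/subr_continuous; first exact: cst_fun_continuous.
  exact: ival_fst_continuous.
- by move=> t; rewrite ival0 subr0 -[clamp 1]/one H1.
- by move=> t; rewrite ival1 subrr -[clamp 0]/zero H0.
Qed.

Lemma homotopic_trans q p r : homotopic p q -> homotopic q r -> homotopic p r.
Proof.
move=> [H [cH H0 H1 Hx Hy]] [K [cK K0 K1 Kx Ky]].
exists (fun s => if ival s.1 <= 2^-1 then H (clamp (2 * ival s.1), s.2)
                 else K (clamp (2 * ival s.1 - 1), s.2)); split=> //=.
- have c1 := @ival_fst_continuous R I; have c2 := mul2_continuous c1.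
  apply: (@paste_continuous _ (fun s : I * I => ival s.1)) => //.
  + apply: (@compose_continuous _ _ _ (fun s : I * I => (_, _)) H) => //.
    apply: pair_continuous; last by move=> ?; exact: cvg_snd.
    exact: clamp_comp_continuous.
  + apply: (@compose_continuous _ _ _ (fun s : I * I => (_, _)) K) => //.
    apply: pair_continuous; last by move=> ?; exact: cvg_snd.
    apply/clamp_comp_continuous/subr_continuous => //.
    exact: cst_fun_continuous.
  + move=> s ->; rewrite mulfV ?pnatr_eq0// subrr.
    by rewrite -[clamp 1]/one -[clamp 0]/zero H1 K0.
- by move=> t; rewrite ival0 invr_ge0 ler0n mulr0 -[clamp 0]/zero H0.
- move=> t; rewrite ival1 leNgt invf_lt1 ?ltr0n// ltr1n /=.
  by rewrite mulr1 (_ : 2 - 1 = 1 :> R) -?[clamp 1]/one ?K1//; ring.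
- by move=> s; case: ifP.
- by move=> s; case: ifP.
Qed.

(* p and q run through the same path c, with time changes f and g. *)
Lemma homotopic_reparam (u v : X) (c : {path I from u to v in X})
    (f g : I -> R) p q :
  continuous f -> continuous g -> f zero = g zero -> f one = g one ->
  (forall t, p t = c (clamp (f t))) -> (forall t, q t = c (clamp (g t))) ->
  homotopic p q.
Proof.
move=> cf cg fg0 fg1 pE qE.
exists (fun s => c (clamp ((1 - ival s.1) * f s.2 + ival s.1 * g s.2))).
have cf2 : continuous (fun s : I * I => f s.2).
  by apply: (@compose_continuous _ _ _ snd f) => // ?; exact: cvg_snd.
have cg2 : continuous (fun s : I * I => g s.2).
  by apply: (@compose_continuous _ _ _ snd g) => // ?; exact: cvg_snd.
have c1 := @ival_fst_continuous R I.
split=> /=.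
- apply: path_comp_continuous => s; apply: cvgD; apply: cvgM.
  + by apply: cvgB; [exact: cvg_cst|exact: c1].
  + exact: cf2.
  + exact: c1.
  + exact: cg2.
- by move=> t; rewrite ival0 subr0 mul1r mul0r addr0 pE.
- by move=> t; rewrite ival1 subrr mul1r mul0r add0r qE.
- by move=> s; rewrite -fg0 -mulrDl subrK mul1r -pE path_zero.
- by move=> s; rewrite -fg1 -mulrDl subrK mul1r -pE path_one.
Qed.

End HomotopyTheory.

Lemma homotopic_concat (x y z : X) (p p' : {path I from x to y in X})
    (q q' : {path I from y to z in X}) :
  homotopic p p' -> homotopic q q' -> homotopic (concat p q) (concat p' q').
Proof.
move=> [H [cH H0 H1 Hx Hy]] [K [cK K0 K1 Kx Ky]].
exists (fun s => if ival s.2 <= 2^-1 then H (s.1, clamp (2 * ival s.2))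
                 else K (s.1, clamp (2 * ival s.2 - 1))); split=> //=.
- have c1 := @ival_snd_continuous R I; have c2 := mul2_continuous c1.
  apply: (@paste_continuous _ (fun s : I * I => ival s.2)) => //.
  + apply: (@compose_continuous _ _ _ (fun s : I * I => (_, _)) H) => //.
    apply: pair_continuous; first by move=> ?; exact: cvg_fst.
    exact: clamp_comp_continuous.
  + apply: (@compose_continuous _ _ _ (fun s : I * I => (_, _)) K) => //.
    apply: pair_continuous; first by move=> ?; exact: cvg_fst.
    apply/clamp_comp_continuous/subr_continuous => //.
    exact: cst_fun_continuous.
  + move=> s ->; rewrite mulfV ?pnatr_eq0// subrr.
    by rewrite -[clamp 1]/one -[clamp 0]/zero Hy Kx.
- by move=> t; rewrite H0 K0.
- by move=> t; rewrite H1 K1.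
- by move=> s; rewrite ival0 invr_ge0 ler0n mulr0 -[clamp 0]/zero.
- move=> s; rewrite ival1 leNgt invf_lt1 ?ltr0n// ltr1n /=.
  by rewrite mulr1 (_ : 2 - 1 = 1 :> R) -?[clamp 1]/one//; ring.
Qed.

Lemma homotopic_reverse (x y : X) (p q : {path I from x to y in X}) :
  homotopic p q -> homotopic (reverse p) (reverse q).
Proof.
move=> [H [cH H0 H1 Hx Hy]].
exists (fun s => H (s.1, clamp (1 - ival s.2))); split=> //=.
- apply: (@compose_continuous _ _ _ (fun s : I * I => (_, _)) H) => //.
  apply: pair_continuous; first by move=> ?; exact: cvg_fst.
  apply/clamp_comp_continuous/subr_continuous; first exact: cst_fun_continuous.
  exact: ival_snd_continuous.
- by move=> t; rewrite H0.
- by move=> t; rewrite H1.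
- by move=> s; rewrite ival0 subr0 -[clamp 1]/one Hy.
- by move=> s; rewrite ival1 subrr -[clamp 0]/zero Hx.
Qed.

Lemma concat_cst_left (x y : X) (p : {path I from x to y in X}) :
  homotopic (concat (const_path x) p) p.
Proof.
have c2 := mul2_continuous (@ival_continuous R).
have cc (a : R) := @cst_fun_continuous I R a.
apply: (@homotopic_reparam x y x y p (fun t => Num.max 0 (2 * ival t - 1)) ival).
- exact: max_continuous (cc _) (subr_continuous c2 (cc _)).
- exact: ival_continuous.
- by cbv beta; rewrite ival0 mulr0 add0r; apply/max_idPl; lra.
- by cbv beta; rewrite ival1 mulr1 (_ : 2 - 1 = 1 :> R); [apply/max_idPr; lra|ring].
- move=> t; rewrite concatE /=; case: ifPn => ht.
    by rewrite (max_idPl _) -?[clamp 0]/zero ?path_zero//; lra.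
  by rewrite (max_idPr _)//; lra.
- by move=> t; rewrite clampK.
Qed.

Lemma concat_cst_right (x y : X) (p : {path I from x to y in X}) :
  homotopic (concat p (const_path y)) p.
Proof.
have c2 := mul2_continuous (@ival_continuous R).
have cc (a : R) := @cst_fun_continuous I R a.
apply: (@homotopic_reparam x y x y p (fun t => Num.min 1 (2 * ival t)) ival).
- exact: min_continuous (cc _) c2.
- exact: ival_continuous.
- by cbv beta; rewrite ival0 mulr0; apply/min_idPr; lra.
- by cbv beta; rewrite ival1 mulr1; apply/min_idPl; lra.
- move=> t; rewrite concatE /=; case: ifPn => ht.
    by rewrite (min_idPr _)//; lra.
  by rewrite (min_idPl _) -?[clamp 1]/one ?path_one//; lra.
- by move=> t; rewrite clampK.
Qed.

Lemma concat_reverse_right (x y : X) (p : {path I from x to y in X}) :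
  homotopic (concat p (reverse p)) (const_path x).
Proof.
have c2 := mul2_continuous (@ival_continuous R).
have cc (a : R) := @cst_fun_continuous I R a.
apply: (@homotopic_reparam x x x y p
  (fun t => Num.min (2 * ival t) (2 - 2 * ival t)) (fun=> 0)).
- exact: min_continuous c2 (subr_continuous (cc _) c2).
- exact: cst_fun_continuous.
- by cbv beta; rewrite ival0 mulr0; apply/min_idPl; lra.
- by cbv beta; rewrite ival1 mulr1 subrr; apply/min_idPr; lra.
- move=> t; rewrite concatE reverseE.
  have := ival_itv t; case: ifPn => ht /andP[t0 t1].
    by rewrite (min_idPl _)//; lra.
  rewrite ivalK; last by apply/andP; split; lra.
  by rewrite (min_idPr _); [congr (p (clamp _)); lra|lra].
- by move=> t; rewrite -[clamp 0]/zero path_zero.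
Qed.

Lemma concat_reverse_left (x y : X) (p : {path I from x to y in X}) :
  homotopic (concat (reverse p) p) (const_path y).
Proof.
have c2 := mul2_continuous (@ival_continuous R).
have cc (a : R) := @cst_fun_continuous I R a.
apply: (@homotopic_reparam y y x y p
  (fun t => Num.max (1 - 2 * ival t) (2 * ival t - 1)) (fun=> 1)).
- exact: max_continuous (subr_continuous (cc _) c2) (subr_continuous c2 (cc _)).
- exact: cst_fun_continuous.
- by cbv beta; rewrite ival0 mulr0 subr0; apply/max_idPl; lra.
- by cbv beta; rewrite ival1 mulr1 (_ : 2 - 1 = 1 :> R); [apply/max_idPr; lra|ring].
- move=> t; rewrite concatE reverseE.
  have := ival_itv t; case: ifPn => ht /andP[t0 t1].
    rewrite ivalK; last by apply/andP; split; lra.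
    by rewrite (max_idPl _)//; lra.
  by rewrite (max_idPr _)//; lra.
- by move=> t; rewrite -[clamp 1]/one path_one.
Qed.

Lemma concat_assoc (x y z w : X) (p : {path I from x to y in X})
    (q : {path I from y to z in X}) (r : {path I from z to w in X}) :
  homotopic (concat p (concat q r)) (concat (concat p q) r).
Proof.
have ci := @ival_continuous R.
have cc (a : R) := @cst_fun_continuous I R a.
apply/homotopic_sym.
pose f (t : I) := Num.min (2 * ival t)
  (Num.min (ival t + 4^-1) ((ival t + 1) * 2^-1)).
have f1 t : ival t <= 4^-1 -> f t = 2 * ival t.
  by move=> h; apply/min_idPl; rewrite le_min; apply/andP; split; lra.
have f2 t : 4^-1 <= ival t <= 2^-1 -> f t = ival t + 4^-1.
  case/andP=> h h'; rewrite /f (min_idPl (_ : _ <= (ival t + 1) * 2^-1)).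
    by apply/min_idPr; lra.
  lra.
have f3 t : 2^-1 <= ival t -> f t = (ival t + 1) * 2^-1.
  move=> h; rewrite /f (min_idPr (_ : _ <= ival t + 4^-1)).
    by apply/min_idPr; lra.
  lra.
apply: (@homotopic_reparam x w x w (concat p (concat q r)) f ival).
- apply: min_continuous (mul2_continuous ci) (min_continuous _ _).
    exact: addr_continuous ci (cc _).
  exact: mulr_continuous (addr_continuous ci (cc _)) (cc _).
- exact: ci.
- by rewrite f1 ival0 ?mulr0//; lra.
- by rewrite f3 ival1; lra.
- move=> t; have /andP[t0 t1] := ival_itv t.
  have [h1|h1] := lerP (ival t) 4^-1.
    rewrite f1// concatE ifT; last by lra.
    rewrite concatE ivalK ?ifT; [|lra..].
    by rewrite concatE ivalK ?ifT; [|lra..].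
  have [h2|h2] := lerP (ival t) 2^-1.
    rewrite f2 ?(ltW h1)// concatE ifT; last by lra.
    rewrite concatE ivalK ?ifF; [|lra..].
    rewrite concatE ivalK ?ifF; [|lra..].
    rewrite concatE ivalK ?ifT; [|lra..].
    by congr (q (clamp _)); lra.
  rewrite f3 ?(ltW h2)// concatE ifF; last by lra.
  rewrite concatE ivalK ?ifF; [|lra..].
  rewrite concatE ivalK ?ifF; [|lra..].
  by congr (r (clamp _)); lra.
- by move=> t; rewrite clampK.
Qed.

End Loops.

Section FundamentalGroup.
Context {R : realType} {X : topologicalType} (x0 : X).

Definition loop : Type := {path unit_interval R from x0 to x0 in X}.

HB.instance Definition _ := Choice.on loop.

Definition homotopic_rel (p q : loop) : bool := `[< homotopic p q >].

Lemma homotopic_rel_refl : reflexive homotopic_rel.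
Proof. by move=> p; apply/asboolP; exact: homotopic_refl. Qed.

Lemma homotopic_rel_sym : symmetric homotopic_rel.
Proof. by move=> p q; apply/asboolP/asboolP; exact: homotopic_sym. Qed.

Lemma homotopic_rel_trans : transitive homotopic_rel.
Proof.
by move=> q p r /asboolP pq /asboolP qr; apply/asboolP/(homotopic_trans pq qr).
Qed.

Canonical homotopic_equiv :=
  EquivRel homotopic_rel homotopic_rel_refl homotopic_rel_sym homotopic_rel_trans.

Definition pi1 : Type := {eq_quot homotopic_rel}.

HB.instance Definition _ := Choice.on pi1.

Definition pi1_class (p : loop) : pi1 := \pi_{eq_quot homotopic_rel} p.

Lemma pi1_classP (p q : loop) : pi1_class p = pi1_class q <-> homotopic p q.
Proof. by split=> [/eqmodP/asboolP|h]; [|apply/eqmodP/asboolP]. Qed.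

Lemma pi1_class_surj (g : pi1) : exists p, g = pi1_class p.
Proof. by exists (repr (g : {eq_quot homotopic_rel})); rewrite /pi1_class reprK. Qed.

Definition pi1_mul (g h : pi1) : pi1 :=
  pi1_class (concat (repr (g : {eq_quot homotopic_rel}))
                    (repr (h : {eq_quot homotopic_rel}))).
Definition pi1_one : pi1 := pi1_class (const_path x0).
Definition pi1_inv (g : pi1) : pi1 :=
  pi1_class (reverse (repr (g : {eq_quot homotopic_rel}))).

Lemma pi1_mulE (p q : loop) :
  pi1_mul (pi1_class p) (pi1_class q) = pi1_class (concat p q).
Proof. by apply/pi1_classP/homotopic_concat; apply/pi1_classP; rewrite /pi1_class reprK. Qed.

Lemma pi1_invE (p : loop) : pi1_inv (pi1_class p) = pi1_class (reverse p).
Proof. by apply/pi1_classP/homotopic_reverse; apply/pi1_classP; rewrite /pi1_class reprK. Qed.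

Lemma pi1_mulA : associative pi1_mul.
Proof.
move=> g h k; have [p ->] := pi1_class_surj g; have [q ->] := pi1_class_surj h.
by have [r ->] := pi1_class_surj k; rewrite !pi1_mulE; exact/pi1_classP/concat_assoc.
Qed.

Lemma pi1_mul1g : left_id pi1_one pi1_mul.
Proof.
move=> g; have [p ->] := pi1_class_surj g.
by rewrite pi1_mulE; exact/pi1_classP/concat_cst_left.
Qed.

Lemma pi1_mulg1 : right_id pi1_one pi1_mul.
Proof.
move=> g; have [p ->] := pi1_class_surj g.
by rewrite pi1_mulE; exact/pi1_classP/concat_cst_right.
Qed.

Lemma pi1_mulVg : left_inverse pi1_one pi1_inv pi1_mul.
Proof.
move=> g; have [p ->] := pi1_class_surj g.
by rewrite pi1_invE pi1_mulE; exact/pi1_classP/concat_reverse_left.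
Qed.

Lemma pi1_mulgV : right_inverse pi1_one pi1_inv pi1_mul.
Proof.
move=> g; have [p ->] := pi1_class_surj g.
by rewrite pi1_invE pi1_mulE; exact/pi1_classP/concat_reverse_right.
Qed.

HB.instance Definition _ :=
  isGroup.Build pi1 pi1_mulA pi1_mul1g pi1_mulg1 pi1_mulVg pi1_mulgV.

End FundamentalGroup.

Section Presentations.
Variable S : Type.

(* The letter (s, true) stands for s and (s, false) for its inverse. *)
Definition word := seq (S * bool).

Definition letter (s : S) (e : bool) : word := [:: (s, e)].

Definition word_inv (w : word) : word := rev [seq (l.1, ~~ l.2) | l <- w].

Definition word_comm (u v : word) : word := u ++ v ++ word_inv u ++ word_inv v.

(* Equality, in the group with generators S and relations u = v for rel u v,
   of the elements represented by two words. *)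
Inductive presented_eq (rel : word -> word -> Prop) : word -> word -> Prop :=
| peq_refl u : presented_eq rel u u
| peq_sym u v : presented_eq rel u v -> presented_eq rel v u
| peq_trans u v w :
    presented_eq rel u v -> presented_eq rel v w -> presented_eq rel u w
| peq_cat u u' v v' : presented_eq rel u u' -> presented_eq rel v v' ->
    presented_eq rel (u ++ v) (u' ++ v')
| peq_cancel s e : presented_eq rel (letter s e ++ letter s (~~ e)) [::]
| peq_rel u v : rel u v -> presented_eq rel u v.

Definition word_eval (G : groupType) (f : S -> G) (w : word) : G :=
  foldr (fun l g => ((if l.2 then f l.1 else (f l.1)^-1) * g)%g) 1%g w.

(* f induces an isomorphism from the group presented by S and rel onto G. *)
Definition has_presentation (rel : word -> word -> Prop) (G : groupType)
    (f : S -> G) : Prop :=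
  (forall g, exists w, word_eval f w = g) /\
  (forall u v, word_eval f u = word_eval f v <-> presented_eq rel u v).

End Presentations.

Section Wickets.
Variable R : realType.

(* A wicket in upper half-space is determined by its two endpoints in the
   xy-plane. *)
Definition endpoints : Type := ((R * R) * (R * R))%type.

HB.instance Definition _ := Topological.on endpoints.

(* The upper half of the circle with diameter the segment from (a, b) to (c, d),
   in the vertical plane through this segment. *)
Definition wicket (e : endpoints) : set (R * R * R) :=
  let: ((a, b), (c, d)) := e in
  [set p | let: (x, y, z) := p in
    [/\ 0 <= z,
        (x - a) * (d - b) = (y - b) * (c - a) &
        (x - (a + c) / 2) ^+ 2 + (y - (b + d) / 2) ^+ 2 + z ^+ 2 =
        ((c - a) ^+ 2 + (d - b) ^+ 2) / 4]].

Definition disjoint_wickets (n : nat) : set {ptws 'I_n -> endpoints} :=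
  [set e | (forall i, (e i).1 <> (e i).2) /\
           (forall i j, i != j -> wicket (e i) `&` wicket (e j) = set0)].

Section WicketSpace.
Variable n : nat.

Definition ordered_wickets : Type := set_type (@disjoint_wickets n).

HB.instance Definition _ := Topological.on ordered_wickets.

(* The unordered configuration underlying an ordered one: a set of wickets. *)
Definition wicket_set (c : ordered_wickets) : set (set (R * R * R)) :=
  [set wicket (set_val c i) | i in [set: 'I_n]].

Definition same_wickets (c d : ordered_wickets) : bool :=
  `[< wicket_set c = wicket_set d >].

Lemma same_wickets_refl : reflexive same_wickets.
Proof. by move=> c; apply/asboolP. Qed.

Lemma same_wickets_sym : symmetric same_wickets.
Proof. by move=> c d; apply/asboolP/asboolP. Qed.

Lemma same_wickets_trans : transitive same_wickets.
Proof. by move=> d c e /asboolP cd /asboolP de; apply/asboolP; rewrite cd. Qed.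

Canonical same_wickets_equiv :=
  EquivRel same_wickets same_wickets_refl same_wickets_sym same_wickets_trans.

(* The unordered configurations, with the quotient of the topology given by
   the endpoints. *)
Definition wicket_space : Type :=
  quotient_topology {eq_quot same_wickets}.

HB.instance Definition _ := Topological.on wicket_space.

Definition unordered (c : ordered_wickets) : wicket_space :=
  \pi_{eq_quot same_wickets} c.

(* The wicket with center (a, b, 0) and radius r in the plane x = a. *)
Definition xwicket (a b r : R) : endpoints := ((a, b - r), (a, b + r)).

(* Wickets are numbered from 0: wicket i has its center at x = 4 (i + 1). *)
Definition base_x (i : 'I_n) : R := 4 * i.+1%:R.

Definition base_endpoints : {ptws 'I_n -> endpoints} :=
  fun i => xwicket (base_x i) 0 1.

Lemma base_disjoint : base_endpoints \in @disjoint_wickets n.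
Proof.
rewrite inE; split=> [i|i j ij].
  by rewrite /= => -[] h; lra.
rewrite -subset0 => -[[x y] z] [[_ + _] [_ + _]] /=.
rewrite !subrr !mulr0 => /eqP; rewrite mulf_eq0 => /orP[/eqP xi|/eqP]; last by lra.
move=> /eqP; rewrite mulf_eq0 => /orP[/eqP xj|/eqP]; last by lra.
have : base_x i = base_x j by lra.
rewrite /base_x => /(mulfI _) -/(_ _)/eqP; rewrite pnatr_eq0 => /(_ isT).
by rewrite eqr_nat eqSS => /eqP/val_inj/eqP; rewrite (negbTE ij).
Qed.

Definition base_config : wicket_space :=
  unordered (exist (fun e => e \in @disjoint_wickets n) _ base_disjoint).

End WicketSpace.
End Wickets.

Definition left_wicket n (i : 'I_n.-1) : 'I_n := widen_ord (leq_pred n) i.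

Lemma right_wicket_subproof n (i : 'I_n.-1) : (i.+1 < n)%N.
Proof. by rewrite -ltn_predRL. Qed.

Definition right_wicket n (i : 'I_n.-1) : 'I_n :=
  Ordinal (right_wicket_subproof i).

Definition wicket_group (R : realType) (n : nat) : Type :=
  @pi1 R _ (base_config R n).

HB.instance Definition _ (R : realType) (n : nat) :=
  Group.on (wicket_group R n).

Section StandardGenerators.
Context {R : realType} {n : nat}.
Local Notation I := (unit_interval R).
Local Notation wicket_group := (wicket_group R n).

(* The loop p of unordered configurations is given by the motion e of
   individual wickets; in particular these stay disjoint. *)
Definition follows (p : loop (R := R) (base_config R n))
    (e : I -> 'I_n -> endpoints R) : Prop :=
  forall t, exists c : ordered_wickets R n, set_val c = e t /\ p t = unordered c.

(* All wickets stay in planes perpendicular to the x-axis, wicket j having at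
   time t center (x j t, y j t, 0) and radius r j t; wickets k and l exchange
   places, their planes coinciding exactly at time t0. *)
Definition exchange (k l : 'I_n) (t0 : I) (x y r : 'I_n -> I -> R) : Prop :=
  [/\ forall j, [/\ continuous (x j), continuous (y j) & continuous (r j)],
      forall j t, 0 < r j t,
      forall j t, j != k -> j != l ->
        [/\ x j t = base_x R j, y j t = 0, r j t = 1,
            x k t <> x j t & x l t <> x j t] &
   [/\ [/\ x k zero = base_x R k, y k zero = 0 & r k zero = 1],
       [/\ x l zero = base_x R l, y l zero = 0 & r l zero = 1],
       [/\ x k one = base_x R l, y k one = 0 & r k one = 1],
       [/\ x l one = base_x R k, y l one = 0 & r l one = 1] &
       forall t, x k t = x l t <-> t = t0]].

Definition is_rho (i : 'I_n.-1) (g : wicket_group) : Prop :=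
  let k := left_wicket i in let l := right_wicket i in
  exists p t0 x y r,
    [/\ g = pi1_class p,
        follows p (fun t j => xwicket (x j t) (y j t) (r j t)),
        exchange k l t0 x y r &
        y l t0 - r l t0 < y k t0 - r k t0 /\ y k t0 + r k t0 < y l t0 + r l t0].

Definition is_sigma (i : 'I_n.-1) (g : wicket_group) : Prop :=
  let k := left_wicket i in let l := right_wicket i in
  exists p t0 x y r,
    [/\ g = pi1_class p,
        follows p (fun t j => xwicket (x j t) (y j t) (r j t)),
        exchange k l t0 x y r &
        y l t0 + r l t0 < y k t0 - r k t0].

(* The wicket with center (a, 0, 0) and radius 1 in the plane x = a, rotated by
   the angle th about its vertical axis, clockwise as seen from above. *)
Definition rotated_wicket (a th : R) : endpoints R :=
  ((a - sin th, - cos th), (a + sin th, cos th)).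

Definition is_tau (i : 'I_n) (g : wicket_group) : Prop :=
  exists p, g = pi1_class p /\
    follows p (fun t j => rotated_wicket (base_x R j)
                            (if j == i then pi * ival t else 0)).

End StandardGenerators.

Inductive wicket_generator (n : nat) : Type :=
| Rho of 'I_n.-1
| Sigma of 'I_n.-1
| Tau of 'I_n.

Section Relations.
Variable n : nat.
Implicit Types (i j : 'I_n.-1) (a b : 'I_n) (e h : bool).

Local Notation word := (word (wicket_generator n)).
(* The exponent true stands for 1 and false for -1. *)
Local Notation rho := (fun i e => letter (Rho i) e : word).
Local Notation sigma := (fun i e => letter (Sigma i) e : word).
Local Notation tau := (fun a e => letter (Tau a) e : word).

Definition far_apart i j : bool := (i.+1 < j)%N || (j.+1 < i)%N.

Inductive wicket_relation : word -> word -> Prop :=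
| rel_rho_rho i j : far_apart i j ->
    wicket_relation (word_comm (rho i true) (rho j true)) [::]
| rel_sigma_sigma i j : far_apart i j ->
    wicket_relation (word_comm (sigma i true) (sigma j true)) [::]
| rel_rho_sigma i j : far_apart i j ->
    wicket_relation (word_comm (rho i true) (sigma j true)) [::]
| rel_braid_rho i j : j = i.+1 :> nat -> wicket_relation
    (rho i true ++ rho j true ++ rho i true)
    (rho j true ++ rho i true ++ rho j true)
| rel_braid_sigma i j : j = i.+1 :> nat -> wicket_relation
    (sigma i true ++ sigma j true ++ sigma i true)
    (sigma j true ++ sigma i true ++ sigma j true)
| rel_rho_sigma_sigma i j : j = i.+1 :> nat -> wicket_relation
    (rho i true ++ sigma j true ++ sigma i true)
    (sigma j true ++ sigma i true ++ rho j true)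
| rel_sigma_sigma_rho i j : j = i.+1 :> nat -> wicket_relation
    (sigma i true ++ sigma j true ++ rho i true)
    (rho j true ++ sigma i true ++ sigma j true)
| rel_sigma_rho_rho i j : j = i.+1 :> nat -> wicket_relation
    (sigma i true ++ rho j true ++ rho i true)
    (rho j true ++ rho i true ++ sigma j true)
| rel_tau_tau a b : a != b ->
    wicket_relation (word_comm (tau a true) (tau b true)) [::]
| rel_rho_tau i a : a != left_wicket i -> a != right_wicket i ->
    wicket_relation (word_comm (rho i true) (tau a true)) [::]
| rel_sigma_tau i a : a != left_wicket i -> a != right_wicket i ->
    wicket_relation (word_comm (sigma i true) (tau a true)) [::]
| rel_tau_left_sigma i e h : wicket_relation
    (tau (left_wicket i) e ++ sigma i h)
    (sigma i h ++ tau (right_wicket i) e)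
| rel_tau_right_sigma i e h : wicket_relation
    (tau (right_wicket i) e ++ sigma i h)
    (sigma i h ++ tau (left_wicket i) e)
| rel_tau_left_rho i e : wicket_relation
    (tau (left_wicket i) e ++ rho i true)
    (rho i true ++ tau (right_wicket i) e)
| rel_tau_right_rho i e : wicket_relation
    (tau (right_wicket i) e ++ rho i true)
    (sigma i (~~ e) ++ rho i false ++ sigma i e ++ tau (left_wicket i) e)
| rel_tau_left_rhoV i e : wicket_relation
    (tau (left_wicket i) e ++ rho i false)
    (sigma i (~~ e) ++ rho i true ++ sigma i e ++ tau (right_wicket i) e)
| rel_tau_right_rhoV i e : wicket_relation
    (tau (right_wicket i) e ++ rho i false)
    (rho i false ++ tau (left_wicket i) e).

End Relations.

Definition standard_generators (R : realType) (n : nat)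
    (f : wicket_generator n -> wicket_group R n) : Prop :=
  [/\ forall i, is_rho i (f (Rho i)),
      forall i, is_sigma i (f (Sigma i)) &
      forall i, is_tau i (f (Tau i))].

(* Main.v *)
(* Recording the center, the radius and the angle of each wicket gives a covering
   of the space of wickets, so loops and homotopies lift to motions of labelled
   wickets.  Call a configuration flat if all its angles are 0.  A compact family
   of configurations can be made flat, relative to the part that is flat already:
   under the flow r^2 |-> r^2 - s on the radii the smallest wickets become tiny
   and isolated, hence free to turn and to follow any motion of the others, and
   one can induct on the number of wickets.

   The flat configurations with a given order of the planes form a cone over a
   standard one.  Where two planes coincide, the two wickets are nested or side by
   side, and crossing such a configuration is one of rho, sigma and their
   inverses; three coinciding planes give the relations without tau.  Hence
   straightened loops are products of generators, up to half turns.

   Conversely, let a word represent 1.  Modulo the relations it is a product of a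
   word in the rho and sigma and a word in the tau.  The null homotopy lifts, so
   all angles return to 0 and the second factor is trivial.  After straightening,
   the null homotopy of the first factor is a disc of flat configurations, over
   which the group defined by the presentation has a locally constant section;
   its monodromy along the boundary is the first factor, which is thus trivial. *)

From HB Require Import structures.
From mathcomp Require Import all_boot all_order all_algebra generic_quotient.
From mathcomp Require Import all_classical all_reals.
From mathcomp Require Import topology normedtype homotopy realfun trigo.
From mathcomp Require Import ring lra zify.
Require Import Defs.

Set Implicit Arguments.
Unset Strict Implicit.
Unset Printing Implicit Defensive.

Import Order.TTheory GRing.Theory Num.Theory.
Import numFieldNormedType.Exports.

Local Open Scope classical_set_scope.
Local Open Scope ring_scope.

(** * Preliminaries on continuity *)

(** Which wicket is smallest does not depend continuously on the configuration, so no fixed set of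
    wickets can be shrunk over a compact family. Isolation is measured instead by a continuous
    function of the label; the sets of labels set apart by a gap in its values form a chain at each
    point, and they are treated by decreasing size, with cutoffs. The relative form of straightening
    makes these steps compatible. In a nested exchange the outer wicket is not free to turn, so the
    relations in which it is turned do not come from a product of two motions. All of them follow
    from one square, in which a small wicket moves along the axis of a turning one. Charts on the
    flat configurations are indexed by the orders of the labels compatible with the planes, and
    their transition words must compose. A shear makes all pairs of wickets comparable; sorting then
    attaches a group element to every order, and transitions are quotients of these elements. The
    generators are arbitrary loops of a prescribed shape, so their classes are identified with those
    of explicit models. *)

Section RealInduction.
Variable R : realType.

(** [P] is transferred in both directions between nearby parameters, so the set where it holds and
    its complement are relatively open in the segment, which is connected. *)
Lemma real_induction (P : R -> Prop) :
  (forall u, 0 <= u <= 1 -> exists2 d : R, 0 < d & forall v w : R,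
     0 <= v <= 1 -> 0 <= w <= 1 -> `|v - u| < d -> `|w - u| < d -> P v -> P w) ->
  P 0 -> forall u, 0 <= u <= 1 -> P u.
Proof.
move=> loc P0; pose B := [set u : R | 0 <= u <= 1 /\ P u].
have /choice[d dP] (u : R) : exists d : R, 0 <= u <= 1 -> 0 < d /\ forall v w : R,
     0 <= v <= 1 -> 0 <= w <= 1 -> `|v - u| < d -> `|w - u| < d -> P v -> P w.
  have [u01|nu] := pselect (0 <= u <= 1); last by exists 0.
  by have [d d0 h] := loc u u01; exists d.
have in01 (v : R) : `[0, 1]%classic v <-> 0 <= v <= 1 by rewrite /= in_itv.
suff BE : B = `[0, 1]%classic by move=> u u01; have [] : B u by rewrite BE in01.
apply: (@segment_connected R 0 1).
- by exists 0; split=> //; rewrite lexx ler01.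
- exists (\bigcup_(u in B) ball u (d u)).
    by apply: bigcup_open => u _; exact: ball_open.
  apply/seteqP; split=> v.
    move=> Bv; split; first by apply/in01; case: Bv.
    exists v => //; apply: ballxx; case: Bv => v01 _; exact: (dP v v01).1.
  move=> -[/in01 v01] [u [u01 Pu]]; rewrite /ball /= distrC => h; split=> //.
  by apply: ((dP u u01).2 u v) => //; rewrite subrr normr0 (dP u u01).1.
- exists (~` \bigcup_(u in [set u | 0 <= u <= 1 /\ ~ P u]) ball u (d u)).
    by apply/open_closedC/bigcup_open => u _; exact: ball_open.
  apply/seteqP; split=> v.
    move=> [v01 Pv]; split; first exact/in01.
    move=> [u [u01 nPu]]; rewrite /ball /= distrC => h; apply: nPu.
    by apply: ((dP u u01).2 v u) => //; rewrite subrr normr0 (dP u u01).1.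
  move=> -[/in01 v01] nv; split=> //; apply: contrapT => nPv; apply: nv.
  by exists v => //; apply: ballxx; exact: (dP v v01).1.
Qed.

(** The tube lemma; it is the source of the uniform constants in the straightening. *)
Lemma tube (T : topologicalType) (K : set T) (Q : T -> R -> Prop) (u0 : R) :
  compact K -> (forall x, K x -> \forall y \near (x, u0), Q y.1 y.2) ->
  exists2 d : R, 0 < d & forall u : R, `|u - u0| < d -> forall x, K x -> Q x u.
Proof.
move=> /compact_near_coveringP cK h.
have : \forall u \near u0, K `<=` (fun x => Q x u).
  apply: (cK R (nbhs u0) (fun u x => Q x u)) => x Kx.
  exact: h.
move=> /nbhs_ballP[d d0 hd]; exists d => // u ud x Kx; apply: (hd u) => //.
by rewrite /ball /= distrC.
Qed.

End RealInduction.

Section Continuity.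
Context {R : realType}.
Implicit Types T : topologicalType.

Lemma oppr_cts T (f : T -> R) : continuous f -> continuous (fun t => - f t).
Proof. by move=> cf t; apply: cvgN; exact: cf. Qed.
Lemma exprn_cts T (f : T -> R) k : continuous f -> continuous (fun t => f t ^+ k).
Proof.
move=> cf; elim: k => [|k IH]; first exact: cst_fun_continuous.
by under eq_fun do rewrite exprS; exact: mulr_continuous.
Qed.

Lemma norm_cts T (f : T -> R) : continuous f -> continuous (fun t => `|f t|).
Proof. by move=> cf; apply: compose_continuous cf _; exact: norm_continuous. Qed.
Lemma sqrt_cts T (f : T -> R) : continuous f -> continuous (fun t => Num.sqrt (f t)).
Proof. by move=> cf; apply: compose_continuous cf _; exact: sqrt_continuous. Qed.
Lemma sin_cts T (f : T -> R) : continuous f -> continuous (fun t => sin (f t)).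
Proof. by move=> cf; apply: compose_continuous cf _; exact: continuous_sin. Qed.
Lemma cos_cts T (f : T -> R) : continuous f -> continuous (fun t => cos (f t)).
Proof. by move=> cf; apply: compose_continuous cf _; exact: continuous_cos. Qed.
Lemma sum_cts T (I : Type) (r : seq I) (P : pred I) (f : I -> T -> R) :
  (forall i, continuous (f i)) -> continuous (fun t => \sum_(i <- r | P i) f i t).
Proof.
move=> cf; elim: r => [|i r IH].
  by under eq_fun do rewrite big_nil; exact: cst_fun_continuous.
under eq_fun do rewrite big_cons; case: (P i) => //.
exact: addr_continuous.
Qed.

Lemma bigmin_cts T (I : Type) (r : seq I) (P : pred I) (a : T -> R) (f : I -> T -> R) :
  continuous a -> (forall i, continuous (f i)) ->
  continuous (fun t => \big[Num.min/a t]_(i <- r | P i) f i t).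
Proof.
move=> ca cf; elim: r => [|i r IH].
  by under eq_fun do rewrite big_nil; exact: ca.
under eq_fun do rewrite big_cons; case: (P i) => //.
exact: min_continuous.
Qed.

Lemma bigmax_cts T (I : Type) (r : seq I) (P : pred I) (a : T -> R) (f : I -> T -> R) :
  continuous a -> (forall i, continuous (f i)) ->
  continuous (fun t => \big[Num.max/a t]_(i <- r | P i) f i t).
Proof.
move=> ca cf; elim: r => [|i r IH].
  by under eq_fun do rewrite big_nil; exact: ca.
under eq_fun do rewrite big_cons; case: (P i) => //.
exact: max_continuous.
Qed.

Lemma inv_cts T (f : T -> R) : (forall t, f t != 0) -> continuous f ->
  continuous (fun t => (f t)^-1).
Proof. by move=> f0 cf t; apply: cvgV; [exact: f0|exact: cf]. Qed.
Lemma fst_cts T (U V : topologicalType) (f : T -> U * V) :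
  continuous f -> continuous (fun t => (f t).1).
Proof. by move=> cf; apply: (compose_continuous cf) => x; exact: cvg_fst. Qed.
Lemma snd_cts T (U V : topologicalType) (f : T -> U * V) :
  continuous f -> continuous (fun t => (f t).2).
Proof. by move=> cf; apply: (compose_continuous cf) => x; exact: cvg_snd. Qed.
Lemma id_cts T : continuous (fun t : T => t).
Proof. by move=> t; exact: cvg_id. Qed.
Lemma near_lt T (f g : T -> R) (t : T) :
  continuous f -> continuous g -> f t < g t -> \forall s \near t, f s < g s.
Proof.
move=> cf cg fg.
have c : continuous (fun s => g s - f s) by exact: subr_continuous.
have h : \forall s \near t, 0 < g s - f s.
  by apply: (cvgr_gt (g t - f t)); [exact: c|rewrite subr_gt0].
by apply: filterS h => s; rewrite subr_gt0.
Qed.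

Lemma if_cts T (U : topologicalType) (h : T -> R) (c : R) (f g : T -> U) :
  continuous h -> continuous f -> continuous g ->
  (forall t, h t = c -> f t = g t) ->
  continuous (fun t => if h t <= c then f t else g t).
Proof. exact: paste_continuous. Qed.

End Continuity.

Ltac cts := repeat (match goal with
    | |- continuous (fun _ => ?c) => exact: (@cst_fun_continuous _ _ c)
    | |- continuous (fun t => t) => exact: id_cts
    | |- continuous fst => by move=> ?; exact: cvg_fst
    | |- continuous snd => by move=> ?; exact: cvg_snd
    | |- continuous (fun t => (_, _)) => apply: pair_continuous
    | |- continuous (fun t => _ - _) => apply: subr_continuous
    | |- continuous (fun t => _ + _) => apply: addr_continuous
    | |- continuous (fun t => _ * _) => apply: mulr_continuous
    | |- continuous (fun t => - _) => apply: oppr_cts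
    | |- continuous (fun t => _ ^+ _) => apply: exprn_cts
    | |- continuous (fun t => `|_|) => apply: norm_cts
    | |- continuous (fun t => Num.sqrt _) => apply: sqrt_cts
    | |- continuous (fun t => sin _) => apply: sin_cts
    | |- continuous (fun t => cos _) => apply: cos_cts
    | |- continuous (fun t => Num.max _ _) => apply: max_continuous
    | |- continuous (fun t => Num.min _ _) => apply: min_continuous
    | |- continuous (fun t => clamp _) => apply: clamp_comp_continuous
    | |- continuous (fun t => \sum_(_ <- _ | _) _) => apply: sum_cts => ?
    | |- continuous (fun t => \big[Num.min/_]_(_ <- _ | _) _) => apply: bigmin_cts; [|move=> ?]
    | |- continuous (fun t => \big[Num.max/_]_(_ <- _ | _) _) => apply: bigmax_cts; [|move=> ?]
    | |- continuous (fun t => (_).1) => apply: fst_cts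
    | |- continuous (fun t => (_).2) => apply: snd_cts
    | |- continuous (fun t => ival _) => apply: (fun f => @compose_continuous _ _ _ f ival); [|exact: ival_continuous]
    | |- continuous (@ival _) => exact: ival_continuous
    | H : continuous ?f |- continuous ?f => exact: H
    | H : forall i, continuous (fun t => ?f t i) |- continuous (fun t => ?f t ?j) => exact: H
    | H : forall i, continuous (?f i) |- continuous (?f ?j) => exact: H
    | H : forall i, continuous (fun t => ?f t i) |- continuous (fun s => ?f (@?g s) ?j) =>
        refine (@compose_continuous _ _ _ g (fun t => f t j) _ _); [|exact: H]
    | H : forall i, continuous (?f i) |- continuous (fun s => ?f ?j (@?g s)) =>
        refine (@compose_continuous _ _ _ g (f j) _ _); [|exact: H]
    | H : continuous ?f |- continuous (fun s => ?f (@?g s)) =>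
        refine (@compose_continuous _ _ _ g f _ _); [|exact: H]
    | H : continuous _ |- continuous _ => exact: H
    end).

(** * Wickets with angles *)

Notation cx a := (a.1.1.1) (only parsing).
Notation cy a := (a.1.1.2) (only parsing).
Notation rd a := (a.1.2) (only parsing).
Notation an a := (a.2) (only parsing).

Section Geometry.
Variable R : realType.
(* (x, y, r, th): center (x, y), radius r, direction (sin th, cos th). *)
Definition wk : Type := (R * R * R * R)%type.
HB.instance Definition _ := Topological.on wk.
Implicit Types a b : wk.

(** A common point is recorded by its positions [l] and [m] on the two diameters. The last equation
    equates the squares of the heights, so the height itself never appears. *)
Definition meet a b : Prop := exists l m : R,
  [/\ -1 <= l <= 1, -1 <= m <= 1,
      cx a + l * rd a * sin (an a) = cx b + m * rd b * sin (an b),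
      cy a + l * rd a * cos (an a) = cy b + m * rd b * cos (an b) &
      rd a ^+ 2 * (1 - l ^+ 2) = rd b ^+ 2 * (1 - m ^+ 2)].

Definition dst2 a b : R := (cx a - cx b) ^+ 2 + (cy a - cy b) ^+ 2.
Definition along a b : R :=
  (cx a - cx b) * sin (an b) + (cy a - cy b) * cos (an b).

Lemma sincos (t : R) : sin t ^+ 2 = 1 - cos t ^+ 2.
Proof. by have := cos2Dsin2 t; lra. Qed.

Lemma meet_sym a b : meet a b -> meet b a.
Proof. by move=> [l [m [hl hm hx hy hz]]]; exists m, l; split. Qed.

Lemma dst2C a b : dst2 a b = dst2 b a.
Proof. by rewrite /dst2; ring. Qed.

(** Cauchy-Schwarz: the difference is the square of the component perpendicular to [b]. *)
Lemma along_le a b : `|along a b| ^+ 2 <= dst2 a b.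
Proof.
rewrite real_normK ?num_real// -subr_ge0.
have -> : dst2 a b - along a b ^+ 2 =
  ((cx a - cx b) * cos (an b) - (cy a - cy b) * sin (an b)) ^+ 2.
  transitivity (((cx a - cx b) * cos (an b) - (cy a - cy b) * sin (an b)) ^+ 2 +
      dst2 a b * (1 - cos (an b) ^+ 2 - sin (an b) ^+ 2)).
    by rewrite /dst2 /along; ring.
  by rewrite sincos subrr mulr0 addr0.
exact: sqr_ge0.
Qed.

(* An affine function of the position along b that agrees with the square of
   the distance to the center of a on b is minimal at an endpoint of b. *)
Lemma clear_nmeet a b : 0 <= rd b ->
  rd a ^+ 2 < dst2 a b + rd b ^+ 2 - 2 * rd b * `|along a b| -> ~ meet a b.
Proof.
move=> rb0 + [l [m [/andP[l0 l1] /andP[m0 m1] hx hy hz]]]; apply/negP; rewrite -leNgt.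
have E : rd a ^+ 2 = dst2 a b + rd b ^+ 2 - 2 * rd b * (m * along a b).
  have ex : l * rd a * sin (an a) = cx b + m * rd b * sin (an b) - cx a by lra.
  have ey : l * rd a * cos (an a) = cy b + m * rd b * cos (an b) - cy a by lra.
  have : (l * rd a) ^+ 2 = (cx b + m * rd b * sin (an b) - cx a) ^+ 2 +
      (cy b + m * rd b * cos (an b) - cy a) ^+ 2.
    by rewrite -ex -ey !exprMn sincos; ring.
  have -> : (cx b + m * rd b * sin (an b) - cx a) ^+ 2 +
      (cy b + m * rd b * cos (an b) - cy a) ^+ 2 =
      dst2 a b - 2 * rd b * (m * along a b) + (m * rd b) ^+ 2.
    transitivity (dst2 a b - 2 * rd b * (m * along a b) +
        (m * rd b) ^+ 2 * (sin (an b) ^+ 2 + cos (an b) ^+ 2)).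
      by rewrite /dst2 /along; ring.
    by rewrite sincos subrK mulr1.
  by move: hz; rewrite !exprMn; lra.
rewrite E lerD2l lerN2 -!mulrA ler_pM2l// ler_wpM2l//.
apply: le_trans (ler_norm _) _; rewrite normrM ler_piMl// ler_norml.
by rewrite m0.
Qed.

(** Over a fixed point of the plane the flow lowers the square of the height by [s] on each wicket,
    so a common point of the shrunk wickets lies below a common point of the original ones. Hence
    disjointness survives the flow. *)
Lemma flow_meet a b a' b' (s : R) : 0 <= s -> 0 < rd a -> 0 < rd b ->
  cx a' = cx a -> cy a' = cy a -> an a' = an a -> rd a' ^+ 2 = rd a ^+ 2 - s ->
  cx b' = cx b -> cy b' = cy b -> an b' = an b -> rd b' ^+ 2 = rd b ^+ 2 - s ->
  0 <= rd a' -> 0 <= rd b' -> meet a' b' -> meet a b.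
Proof.
move=> s0 ra rb xa ya ta Ra xb yb tb Rb ra' rb' [l [m [l1 m1 hx hy hz]]].
have le (r r' k : R) : 0 < r -> 0 <= r' -> r' ^+ 2 = r ^+ 2 - s -> -1 <= k <= 1 ->
    -1 <= k * r' / r <= 1.
  move=> r0 r0' E; have : r' <= r by rewrite -ler_sqr ?nnegrE ?(ltW r0)// E; lra.
  move=> h /andP[k0 k1]; rewrite ler_pdivlMr// ler_pdivrMr// mulN1r mul1r.
  apply/andP; split.
    by rewrite lerNl -mulNr; apply: le_trans h; apply: ler_piMl; lra.
  by apply: le_trans h; apply: ler_piMl.
(* The same horizontal position, measured in the larger radii. *)
exists (l * rd a' / rd a), (m * rd b' / rd b); split; [exact: le|exact: le|..].
- by rewrite !divfK ?gt_eqF// -xa -ta -xb -tb.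
- by rewrite !divfK ?gt_eqF// -ya -ta -yb -tb.
- have E (x y : R) : x ^+ 2 * (1 - y ^+ 2) = x ^+ 2 - (y * x) ^+ 2 by ring.
  rewrite !E !divfK ?gt_eqF// !exprMn.
  by move: hz; rewrite !E !exprMn Ra Rb; lra.
Qed.

Definition endpt a (b : bool) : R * R :=
  (cx a + (-1) ^+ b * rd a * sin (an a), cy a + (-1) ^+ b * rd a * cos (an a)).

Lemma sign_bound (b : bool) : -1 <= ((-1) ^+ b : R) <= 1.
Proof. by case: b => /=; rewrite ?expr0 ?expr1; lra. Qed.

Lemma endpt_meet a b u v : endpt a u = endpt b v -> meet a b.
Proof.
move=> [ex ey]; exists ((-1) ^+ u), ((-1) ^+ v); split=> //; [exact: sign_bound..|].
by rewrite !sqrr_sign !subrr !mulr0.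
Qed.

Lemma endpt_inj a u v : 0 < rd a -> endpt a u = endpt a v -> u = v.
Proof.
move=> ra [] /addrI hx /addrI hy; apply/eqP; move: hx hy.
have F : rd a * sin (an a) = 0 -> rd a * cos (an a) = 0 -> False.
  move=> s0 c0; have : rd a ^+ 2 * (sin (an a) ^+ 2 + cos (an a) ^+ 2) = 0.
    by rewrite mulrDr -!exprMn s0 c0; ring.
  by rewrite sincos subrK mulr1 => /eqP; rewrite sqrf_eq0 gt_eqF.
by case: u; case: v => //=; rewrite ?expr0 ?expr1 => hx hy; exfalso; apply: F; lra.
Qed.

End Geometry.

(** * Motions of the plane that follow moving points *)

Section Following.
Variable R : realType.
Implicit Types y : R * R.

Definition nrm y : R := Num.max `|y.1| `|y.2|.

Lemma nrm_ge0 y : 0 <= nrm y.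
Proof. by rewrite /nrm le_max normr_ge0. Qed.

Lemma nrm_eq0 y : nrm y <= 0 -> y = (0, 0).
Proof.
by case: y => a b; rewrite /nrm ge_max !normr_le0 => /andP[/eqP /= -> /eqP ->].
Qed.

Definition subp y z : R * R := (y.1 - z.1, y.2 - z.2).

Lemma subp_eq0 y z : nrm (subp y z) <= 0 -> y = z.
Proof.
by move=> /nrm_eq0; case: y z => a b [c d] [] /subr0_eq -> /subr0_eq ->.
Qed.

Lemma nrm_subpC y z : nrm (subp y z) = nrm (subp z y).
Proof. by rewrite /nrm /= distrC [X in Num.max _ X]distrC. Qed.

Lemma nrm_subp_le y z w : nrm (subp y z) <= nrm (subp y w) + nrm (subp w z).
Proof.
rewrite /nrm /= ge_max; apply/andP; split.
  by apply: le_trans (ler_distD w.1 _ _) _; apply: lerD; rewrite le_max lexx.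
by apply: le_trans (ler_distD w.2 _ _) _; apply: lerD; rewrite le_max lexx orbT.
Qed.

Lemma nrm_cts (T : topologicalType) (f : T -> R * R) :
  continuous f -> continuous (fun t => nrm (f t)).
Proof. by move=> cf; rewrite /nrm; cts. Qed.

Lemma subp_cts (T : topologicalType) (f g : T -> R * R) :
  continuous f -> continuous g -> continuous (fun t => subp (f t) (g t)).
Proof. by move=> cf cg; rewrite /subp; cts. Qed.

Variables (L : finType) (act : pred L) (d : R) (d_gt0 : 0 < d).

(** The identity perturbed by tent functions of radius [d / 2] around the active points. When these
    are [d] apart, each of them is moved by its own tent only. *)
Definition push (p p' : L -> R * R) y : R * R :=
  (y.1 + \sum_(l | act l) Num.max 0 (1 - 2 / d * nrm (subp y (p l))) * ((p' l).1 - (p l).1),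
   y.2 + \sum_(l | act l) Num.max 0 (1 - 2 / d * nrm (subp y (p l))) * ((p' l).2 - (p l).2)).

Lemma push_id p y : push p p y = y.
Proof.
by case: y => a b; rewrite /push /= !big1 ?addr0// => l _; rewrite subrr mulr0.
Qed.

Lemma push_pt p p' l : act l ->
  (forall k, act k -> k != l -> d <= nrm (subp (p l) (p k))) ->
  push p p' (p l) = p' l.
Proof.
move=> al sep.
have S (D : L -> R) :
    \sum_(k | act k) Num.max 0 (1 - 2 / d * nrm (subp (p l) (p k))) * D k = D l.
  rewrite (bigD1 l)//= big1 => [|k /andP[ak kl]].
    have -> : nrm (subp (p l) (p l)) = 0 by rewrite /nrm /= !subrr normr0 maxxx.
    by rewrite mulr0 subr0 (max_idPr _) ?ler01// mul1r addr0.
  rewrite (max_idPl _) ?mul0r//.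
  have : 2 / d * d <= 2 / d * nrm (subp (p l) (p k)).
    by apply: ler_wpM2l; [rewrite divr_ge0// ltW|exact: sep].
  by rewrite divfK ?gt_eqF//; lra.
by rewrite /push !S !subrKC; case: (p' l).
Qed.

Lemma bump_lip y z w :
  `|Num.max 0 (1 - 2 / d * nrm (subp y w)) - Num.max 0 (1 - 2 / d * nrm (subp z w))|
    <= 2 / d * nrm (subp y z).
Proof.
have h0 : 0 <= 2 / d by rewrite divr_ge0// ltW.
have h1 := nrm_subp_le y w z; have h2 := nrm_subp_le z w y.
rewrite (nrm_subpC z y) in h2.
have {}h1 := ler_wpM2l h0 h1; have {}h2 := ler_wpM2l h0 h2.
have h3 := mulr_ge0 h0 (nrm_ge0 (subp y z)).
rewrite mulrDr in h1; rewrite mulrDr in h2.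
set a := 2 / d * nrm (subp y w) in h1 h2 *; set b := 2 / d * nrm (subp z w) in h1 h2 *.
by rewrite ler_norml; case: (leP 0 (1 - a)); case: (leP 0 (1 - b)); lra.
Qed.

(** The displacement is a strict contraction: a tent has slope [2 / d] and multiplies a vector of
    norm at most [d / (4 * N.+1)], with [N] the number of labels, so the total Lipschitz constant is
    below 1/2. The identity plus such a displacement is injective. *)
Lemma push_inj p p' y z :
  (forall l, act l -> nrm (subp (p' l) (p l)) * (4 * #|L|.+1%:R) <= d) ->
  push p p' y = push p p' z -> y = z.
Proof.
move=> small [e1 e2]; apply: subp_eq0; rewrite leNgt; apply/negP => n0.
have B (D : L -> R) : (forall l, act l -> `|D l| <= nrm (subp (p' l) (p l))) ->
  `|\sum_(l | act l) Num.max 0 (1 - 2 / d * nrm (subp y (p l))) * D l -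
   \sum_(l | act l) Num.max 0 (1 - 2 / d * nrm (subp z (p l))) * D l| <
   nrm (subp y z).
  move=> hD; rewrite -sumrB; apply: le_lt_trans (ler_norm_sum _ _ _) _.
  apply: (@le_lt_trans _ _ (\sum_(l : L) nrm (subp y z) / (2 * #|L|.+1%:R))).
    rewrite [leLHS]big_mkcond/=; apply: ler_sum => l _; case: ifP => al; last first.
      by rewrite divr_ge0 ?(ltW n0)// mulr_ge0.
    rewrite -mulrBl normrM ler_pdivlMr ?mulr_gt0//.
    apply: (@le_trans _ _ (2 / d * nrm (subp y z) * nrm (subp (p' l) (p l)) * (2 * #|L|.+1%:R))).
      apply: ler_wpM2r; first by rewrite mulr_ge0.
      by apply: ler_pM => //; [exact: bump_lip|exact: hD].
    have -> : 2 / d * nrm (subp y z) * nrm (subp (p' l) (p l)) * (2 * #|L|.+1%:R) =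
      nrm (subp y z) * ((nrm (subp (p' l) (p l)) * (4 * #|L|.+1%:R)) / d).
      by field; rewrite gt_eqF.
    by rewrite ler_piMr ?(ltW n0)// ler_pdivrMr// mul1r small.
  rewrite sumr_const -[ltLHS]mulr_natr -mulrA -[ltRHS]mulr1 ltr_pM2l// mulrC.
  rewrite ltr_pdivrMr ?mulr_gt0// mul1r.
  have : #|L|%:R < #|L|.+1%:R :> R by rewrite ltr_nat.
  have : 0 <= #|L|%:R :> R by [].
  lra.
have n1 : `|y.1 - z.1| < nrm (subp y z).
  have -> : y.1 - z.1 =
    - (\sum_(l | act l) Num.max 0 (1 - 2 / d * nrm (subp y (p l))) * ((p' l).1 - (p l).1) -
     \sum_(l | act l) Num.max 0 (1 - 2 / d * nrm (subp z (p l))) * ((p' l).1 - (p l).1)).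
    by move: e1; lra.
  by rewrite normrN; apply: B => l al; rewrite /nrm /= le_max lexx.
have n2 : `|y.2 - z.2| < nrm (subp y z).
  have -> : y.2 - z.2 =
    - (\sum_(l | act l) Num.max 0 (1 - 2 / d * nrm (subp y (p l))) * ((p' l).2 - (p l).2) -
     \sum_(l | act l) Num.max 0 (1 - 2 / d * nrm (subp z (p l))) * ((p' l).2 - (p l).2)).
    by move: e2; lra.
  by rewrite normrN; apply: B => l al; rewrite /nrm /= le_max lexx orbT.
have : nrm (subp y z) < nrm (subp y z) by rewrite {1}/nrm gt_max /= n1 n2.
by rewrite ltxx.
Qed.

Lemma push_cts (T : topologicalType) (p p' : T -> L -> R * R) (f : T -> R * R) :
  (forall l, continuous (fun t => p t l)) ->
  (forall l, continuous (fun t => p' t l)) -> continuous f ->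
  continuous (fun t => push (p t) (p' t) (f t)).
Proof.
move=> cp cp' cf; rewrite /push.
have cb l : continuous (fun t => Num.max 0 (1 - 2 / d * nrm (subp (f t) (p t l)))).
  have c := nrm_cts (subp_cts cf (cp l)).
  by cts.
apply: pair_continuous.
  by apply: addr_continuous; [cts|apply: sum_cts => l; apply: mulr_continuous; [exact: cb|cts]].
by apply: addr_continuous; [cts|apply: sum_cts => l; apply: mulr_continuous; [exact: cb|cts]].
Qed.

End Following.

Section FollowLemma.
Variables (R : realType) (T : topologicalType) (K : set T) (L I : finType)
  (act : pred L) (p : T * R -> L -> R * R) (q : T -> I -> R * R).
Hypotheses (cK : compact K) (cp : forall l, continuous (fun t => p t l))
  (cq : forall i, continuous (fun t => q t i))
  (p_inj : forall t u l k, K t -> 0 <= u <= 1 -> act l -> act k ->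
    p (t, u) l = p (t, u) k -> l = k).

(** Isotopy extension for points of the plane over a compact family: the moving points [p] drag the
    points [q] along without new coincidences. On a short time interval [push] is the ambient
    motion, and [real_induction] composes these motions. *)
Lemma follow : exists q' : T * R -> I -> R * R,
  [/\ forall i, continuous (fun t => q' t i),
      forall t, q' (t, 0) = q t,
      forall t u i l, K t -> 0 <= u <= 1 -> act l ->
        q t i <> p (t, 0) l -> q' (t, u) i <> p (t, u) l &
      forall t u i j, K t -> 0 <= u <= 1 ->
        q t i <> q t j -> q' (t, u) i <> q' (t, u) j].
Proof.
pose P (v : R) := exists q' : T * R -> I -> R * R,
  [/\ forall i, continuous (fun t => q' t i),
      forall t, q' (t, 0) = q t,
      forall t (u : R) i l, K t -> 0 <= u <= v -> act l ->
        q t i <> p (t, 0) l -> q' (t, u) i <> p (t, u) l &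
      forall t (u : R) i j, K t -> 0 <= u <= v ->
        q t i <> q t j -> q' (t, u) i <> q' (t, u) j].
suff : P 1 by [].
apply: (@real_induction R P); last 2 first.
- exists (fun t => q t.1); split=> //.
  + by move=> i; cts.
  + by move=> t u i l _ /andP[u0 u1]; have -> : u = 0 by lra.
- by rewrite ler01 lexx.
move=> u0 u01.
(* The least distance between active points is positive at time [u0], hence bounded below over [K]
   by some [d]. *)
pose g (t : T * R) := \big[Num.min/1 : R]_(lk : L * L | [&& act lk.1, act lk.2 & lk.1 != lk.2])
  nrm (subp (p t lk.1) (p t lk.2)).
have cg : continuous g.
  apply: bigmin_cts => [|lk]; first by cts.
  by apply/nrm_cts/subp_cts; exact: cp.
have [d d0 hd] : exists2 d, 0 < d & forall t, K t -> d < g (t, u0).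
  have [|d d0 hd] := @tube R T K (fun t e => e < g (t, u0)) 0 cK.
    move=> x Kx; apply: (@near_lt R _ (fun t : T * R => t.2)) => /=.
    - by cts.
    - by apply: (@compose_continuous _ _ _ (fun t : T * R => (t.1, u0)) g) => //; cts.
    - apply/bigmin_gtP; split=> // -[l k] /= /and3P[al ak lk].
      rewrite ltNge; apply/negP => /subp_eq0 e; move: lk.
      by rewrite (p_inj Kx u01 al ak e) eqxx.
  exists (d / 2); first lra.
  by move=> t Kt; apply: hd => //; rewrite subr0 gtr0_norm; lra.
(* Two displacements of size [e], from [v] to [u0] and from [u0] onwards, add up to the bound
   required by [push_inj]. *)
pose e := d / (8 * #|L|.+1%:R).
have e0 : 0 < e by rewrite divr_gt0// mulr_gt0.
pose h (t : T * R) := \big[Num.max/0 : R]_(l : L) nrm (subp (p t l) (p (t.1, u0) l)).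
have ch : continuous h.
  apply: bigmax_cts => [|l]; first by cts.
  apply/nrm_cts/subp_cts; first exact: cp.
  by refine (@compose_continuous _ _ _ (fun t : T * R => (t.1, u0)) (fun t => p t l) _ _); [cts|].
have [|r r0 hr] := @tube R T K (fun t u => d < g (t, u) /\ h (t, u) < e) u0 cK.
  move=> x Kx.
  have h1 : \forall t \near (x, u0), d < g t.
    by apply: (@near_lt R _ (fun=> d) g) => //; [cts|exact: hd].
  have h2 : \forall t \near (x, u0), h t < e.
    apply: (@near_lt R _ h (fun=> e)) => //; first by cts.
    by apply/bigmax_ltP; split=> // l _; rewrite /nrm /= !subrr normr0 maxxx.
  by apply: filterS2 h1 h2 => -[a b].
exists r => // v w v01 w01 hv hw [q' [cq' q0 qp qq]].
have [wv|vw] := leP w v.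
  exists q'; split=> //.
  - by move=> t u i l Kt /andP[u_ge u_le]; apply: qp => //; lra.
  - by move=> t u i l Kt /andP[u_ge u_le]; apply: qq => //; lra.
(* Up to time [v] the given motion is kept; afterwards its position at time [v] is moved by
   [push]. *)
pose s := fun u : R => Num.max v (Num.min w u) : R.
have cs : continuous (fun u : R => s u) by apply: max_continuous; cts; apply: min_continuous; cts.
pose q'' (t : T * R) i := push act d (p (t.1, v)) (p (t.1, s t.2)) (q' (t.1, Num.min t.2 v) i).
have sl u : u <= v -> s u = v.
  by move=> uv; rewrite /s; apply/max_idPl; rewrite ge_min uv orbT.
have sr u : v <= u <= w -> s u = u.
  by move=> /andP[uv uw]; rewrite /s (min_idPr uw) (max_idPr uv).
have ql t u i : u <= v -> q'' (t, u) i = q' (t, u) i.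
  by move=> uv; rewrite /q'' /= sl// push_id (min_idPl uv).
have small t u l : K t -> v <= u <= w ->
    nrm (subp (p (t, u) l) (p (t, v) l)) * (4 * #|L|.+1%:R) <= d.
  move=> Kt /andP[vu uw]; rewrite -ler_pdivlMr ?mulr_gt0//.
  have B u' : v <= u' <= w -> nrm (subp (p (t, u') l) (p (t, u0) l)) < e.
    move=> /andP[vu' uw']; have hu' : `|u' - u0| < r.
      by move: hv hw; rewrite !ltr_norml => /andP[? ?] /andP[? ?]; lra.
    by have [_ /bigmax_ltP[_ /(_ l)]] := hr u' hu' t Kt; apply.
  apply: (le_trans (nrm_subp_le _ _ (p (t, u0) l))).
  have b1 := B u; have b2 := B v; rewrite (nrm_subpC (p (t, u0) l)).
  have -> : d / (4 * #|L|.+1%:R) = e + e by rewrite /e; field; rewrite nat1r pnatr_eq0.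
  by apply: lerD; apply/ltW; apply: B; lra.
have sep t l k : K t -> act l -> act k -> k != l -> d <= nrm (subp (p (t, v) l) (p (t, v) k)).
  move=> Kt al ak kl; have [h1 _] := hr v hv t Kt.
  by move/bigmin_gtP: h1 => [_ /(_ (l, k))] /= H; apply/ltW/H; rewrite al ak eq_sym.
exists q''; split.
- move=> i; rewrite /q''.
  apply: push_cts => [l|l|].
  + by refine (@compose_continuous _ _ _ (fun t : T * R => (t.1, v)) (fun t => p t l) _ _); [cts|].
  + by refine (@compose_continuous _ _ _ (fun t : T * R => (t.1, s t.2)) (fun t => p t l) _ _); [cts|].
  + by refine (@compose_continuous _ _ _ (fun t : T * R => (t.1, Num.min t.2 v)) (fun t => q' t i) _ _); [cts|].
- by move=> t; apply/funext => i; rewrite ql ?q0//; lra.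
- move=> t u i l Kt /andP[u_ge u_le] al ne.
  have [uv|vu] := leP u v; first by rewrite ql//; apply: qp => //; rewrite u_ge.
  rewrite /q'' /= sr; last by rewrite u_le ltW.
  (* The point [p (t, u) l] is itself the image of [p (t, v) l], so a collision would contradict the
     injectivity of [push]. *)
  rewrite (min_idPr (ltW vu)) -(@push_pt R L act d d0 (p (t, v)) (p (t, u)) l)//; last first.
    by move=> k ak kl; apply: sep.
  move/(push_inj d0) => H; apply: (qp t v i l Kt _ al ne); first by case/andP: v01 => -> _ /=.
  by apply: H => k _; apply: small => //; rewrite u_le ltW.
- move=> t u i j Kt /andP[u_ge u_le] ne.
  have [uv|vu] := leP u v; first by rewrite !ql//; apply: qq => //; rewrite u_ge.
  rewrite /q'' /= sr; last by rewrite u_le ltW.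
  rewrite (min_idPr (ltW vu)).
  move/(push_inj d0) => H; apply: (qq t v i j Kt _ ne); first by case/andP: v01 => -> _ /=.
  by apply: H => k _; apply: small => //; rewrite u_le ltW.
Qed.

End FollowLemma.

(** * Straightening compact families *)

Section Straightening.
Variables (R : realType) (I : finType).
Implicit Types (A S : {set I}) (c : I -> wk R).

Definition valid A c : Prop :=
  (forall i, i \in A -> 0 < rd (c i)) /\
  (forall i j, i \in A -> j \in A -> i != j -> ~ meet (c i) (c j)).

Definition flat A c : Prop := forall i, i \in A -> an (c i) = 0.

(* After the flow r^2 |-> r^2 - s, the endpoints of wicket j keep a distance
   greater than three times the radius of i from the center of i. *)
Definition margin (s : R) (a b : wk R) : R :=
  dst2 a b + (rd b ^+ 2 - s) - 2 * Num.sqrt (rd b ^+ 2 - s) * `|along a b| -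
  9 * (rd a ^+ 2 - s).

Definition isolation A (s : R) c i : R :=
  \big[Num.min/1]_(j in A | j != i) margin s (c i) (c j).

(** The default value of the minimum exceeds every term, so for nonempty [A] this is the true
    minimum; it is also continuous in [c]. *)
Definition least A c : R :=
  \big[Num.min/1 + \sum_(i in A) rd (c i) ^+ 2]_(i in A) rd (c i) ^+ 2.

(** The flow time [least A c] is the moment at which the smallest wicket of [A] shrinks to a
    point. *)
Definition isolated A S c : Prop := forall i, i \in S -> 0 < isolation A (least A c) c i.

Lemma margin_cts (T : topologicalType) (s : T -> R) (a b : T -> wk R) :
  continuous s -> continuous (a : T -> R * R * R * R) ->
  continuous (b : T -> R * R * R * R) ->
  continuous (fun t => margin (s t) (a t) (b t)).
Proof.
move=> cs ca cb; rewrite /margin /dst2 /along.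
by cts.
Qed.

Lemma isolation_cts (T : topologicalType) A (s : T -> R) (f : T -> I -> wk R) i :
  continuous s -> (forall i, continuous (fun t => f t i : R * R * R * R)) ->
  continuous (fun t => isolation A (s t) (f t) i).
Proof.
by move=> cs cf; apply: bigmin_cts => [|j]; [cts|apply: margin_cts].
Qed.

Lemma least_cts (T : topologicalType) A (f : T -> I -> wk R) :
  (forall i, continuous (fun t => f t i : R * R * R * R)) ->
  continuous (fun t => least A (f t)).
Proof.
move=> cf; apply: bigmin_cts => [|i]; last by cts.
by apply: addr_continuous; [cts|apply: sum_cts => i; cts].
Qed.

Lemma least_le A c i : i \in A -> least A c <= rd (c i) ^+ 2.
Proof. by move=> iA; apply: bigmin_le_cond. Qed.

Lemma least_eq A c : (0 < #|A|)%N -> exists2 i, i \in A & least A c = rd (c i) ^+ 2.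
Proof.
case/card_gt0P => i iA; rewrite /least (@bigmin_eq_arg _ _ _ _ i _ _ iA).
  by exists [arg min_(j < i | j \in A) rd (c j) ^+ 2]%O => //; case: arg_minP.
move=> j jA; apply: ler_wpDl => //; rewrite (bigD1 j)//= lerDl.
by apply: sumr_ge0 => k _; exact: sqr_ge0.
Qed.

Lemma least_gt0 A c : valid A c -> 0 < least A c.
Proof.
move=> [r0 _]; apply/bigmin_gtP; split=> [|i iA]; last by rewrite exprn_gt0// r0.
by apply: ltr_pwDl => //; apply: sumr_ge0 => k _; exact: sqr_ge0.
Qed.

Lemma isolationP A s c i :
  0 < isolation A s c i <-> forall j, j \in A -> j != i -> 0 < margin s (c i) (c j).
Proof.
split; first by move=> /bigmin_gtP[_ h] j jA ji; apply: h; rewrite jA.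
by move=> h; apply/bigmin_gtP; split=> // j /andP[]; exact: h.
Qed.

(** At that moment wicket [i] is reduced to its center. If a margin were not positive, the center
    would be an endpoint of the shrunk wicket [j], so before the flow the top of [i] would lie on
    [j]. *)
Lemma isolated_least A c i : valid A c -> i \in A -> rd (c i) ^+ 2 = least A c ->
  0 < isolation A (least A c) c i.
Proof.
move=> [r0 nm] iA E; apply/isolationP => j jA ji.
rewrite /margin E subrr mulr0 subr0.
have mj := least_le c jA.
set m := least A c in E mj *; set D := along (c i) (c j).
pose rho := Num.sqrt (rd (c j) ^+ 2 - m).
have rho2 : rho ^+ 2 = rd (c j) ^+ 2 - m by rewrite sqr_sqrtr// subr_ge0.
rewrite -/rho -rho2 ltNge; apply/negP => h.
have Dle := along_le (c i) (c j).
have r0j := r0 j jA.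
(* By Cauchy-Schwarz this square is a lower bound for a margin that is assumed not to be positive;
   equality holds throughout. *)
have sq : (`|D| - rho) ^+ 2 <= 0.
  by rewrite sqrrB; move: Dle; rewrite -/D; lra.
have {sq} Dr : `|D| = rho.
  by apply/eqP; rewrite -subr_eq0 -sqrf_eq0 eq_le sq sqr_ge0.
have W : dst2 (c i) (c j) = rho ^+ 2 by move: Dle; rewrite -/D Dr => ?; rewrite Dr in h; lra.
have perp : ((cx (c i) - cx (c j)) * cos (an (c j)) -
             (cy (c i) - cy (c j)) * sin (an (c j))) ^+ 2 = 0.
  have : dst2 (c i) (c j) - D ^+ 2 = 0.
    by rewrite -[D ^+ 2]real_normK ?num_real// Dr W subrr.
  have -> : dst2 (c i) (c j) - D ^+ 2 = ((cx (c i) - cx (c j)) * cos (an (c j)) -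
      (cy (c i) - cy (c j)) * sin (an (c j))) ^+ 2 +
      dst2 (c i) (c j) * (1 - cos (an (c j)) ^+ 2 - sin (an (c j)) ^+ 2).
    by rewrite /dst2 /D /along; ring.
  by rewrite sincos subrr mulr0 addr0.
move/eqP: perp; rewrite sqrf_eq0 subr_eq0 => /eqP perp.
apply: (nm i j iA jA _); first by rewrite eq_sym.
have c1 : sin (an (c j)) ^+ 2 + cos (an (c j)) ^+ 2 = 1 by rewrite sincos subrK.
(* The top of [i], and the point of [j] above the center of [i]. *)
exists 0, (D / rd (c j)); split.
- by lra.
- rewrite ler_pdivlMr// ler_pdivrMr// mulN1r mul1r -ler_norml Dr.
  rewrite -ler_sqr ?nnegrE ?sqrtr_ge0 ?(ltW r0j)// rho2 gerBl -E; exact: sqr_ge0.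
- rewrite !mul0r addr0 divfK ?gt_eqF//.
  have -> : cx (c i) = cx (c j) + (cx (c i) - cx (c j)) * (sin (an (c j)) ^+ 2 + cos (an (c j)) ^+ 2).
    by rewrite c1; ring.
  rewrite mulrDr [_ * cos _ ^+ 2]mulrA perp; rewrite /D /along; ring.
- rewrite !mul0r addr0 divfK ?gt_eqF//.
  have -> : cy (c i) = cy (c j) + (cy (c i) - cy (c j)) * (sin (an (c j)) ^+ 2 + cos (an (c j)) ^+ 2).
    by rewrite c1; ring.
  rewrite mulrDr [_ * sin _ ^+ 2]mulrA -perp; rewrite /D /along; ring.
- rewrite expr0n /= subr0 mulr1 E mulrBr mulr1 -exprMn mulrC divfK ?gt_eqF//.
  by rewrite -[D ^+ 2]real_normK ?num_real// Dr rho2; lra.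
Qed.

(** Radii enter the margin only through their squares diminished by the time, so the flow merely
    shifts the time. *)
Lemma margin_flow (s m : R) (a b a' b' : wk R) :
  cx a' = cx a -> cy a' = cy a -> rd a' ^+ 2 = rd a ^+ 2 - s ->
  cx b' = cx b -> cy b' = cy b -> rd b' ^+ 2 = rd b ^+ 2 - s -> an b' = an b ->
  margin m a' b' = margin (m + s) a b.
Proof.
move=> xa ya ra xb yb rb tb; rewrite /margin /dst2 /along xa ya ra xb yb rb tb.
have E (x : R) : x - s - m = x - (m + s) by ring.
by rewrite !E.
Qed.

Lemma margin0_clear (a b : wk R) : 0 <= rd b -> 0 < margin 0 a b -> ~ meet a b.
Proof.
move=> rb; rewrite /margin !subr0 sqrtr_sqr (ger0_norm rb) => h.
apply: clear_nmeet => //; have := sqr_ge0 (rd a); lra.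
Qed.

(** Passing to time [m] gains [8 * m] from the squared radii and decreases the square root in front
    of the negative term. *)
Lemma margin0 (m : R) (a b : wk R) : 0 <= rd b -> 0 <= m <= rd b ^+ 2 ->
  0 < margin 0 a b -> 0 < margin m a b.
Proof.
move=> rb /andP[m0 mb]; rewrite /margin !subr0 sqrtr_sqr (ger0_norm rb) => h.
have : Num.sqrt (rd b ^+ 2 - m) <= rd b.
  by rewrite -[leRHS]ger0_norm// -sqrtr_sqr ler_wsqrtr// gerBl.
by move/(ler_wpM2r (normr_ge0 (along a b))); lra.
Qed.

Lemma margin_isolated A S c : (forall i, i \in A -> 0 < rd (c i)) ->
  (forall i j, i \in S -> j \in A -> j != i -> 0 < margin 0 (c i) (c j)) ->
  isolated A S c.
Proof.
move=> r0 h i iS; apply/isolationP => j jA ji.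
apply: margin0; [exact/ltW/r0| |exact: h].
rewrite least_le// andbT; apply: le_bigmin => [|k _]; last exact: sqr_ge0.
by apply: addr_ge0 => //; apply: sumr_ge0 => k _; exact: sqr_ge0.
Qed.

Lemma valid_sub A A' c : A' \subset A -> valid A c -> valid A' c.
Proof.
move=> /fintype.subsetP s [r0 nm]; split=> [i iA|i j iA jA]; first exact/r0/s.
by apply: nm; exact: s.
Qed.

Lemma margin_valid A S c c' : valid (A :\: S) c ->
  (forall i, i \in A -> i \notin S -> c' i = c i) ->
  (forall i, i \in A -> 0 < rd (c' i)) ->
  (forall i j, i \in S -> j \in A -> j != i -> 0 < margin 0 (c' i) (c' j)) ->
  valid A c'.
Proof.
move=> [_ nm] same r0 h; split=> // i j iA jA ij.
have [iS|iS] := boolP (i \in S).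
  by apply: margin0_clear; [exact/ltW/r0|apply: h; rewrite // eq_sym].
have [jS|jS] := boolP (j \in S).
  by move/meet_sym; apply: margin0_clear; [exact/ltW/r0|apply: h].
by rewrite !same//; apply: nm; rewrite // inE ?iS ?jS.
Qed.

(** As a function of [k] the new margin is concave when [rd b ^+ 2 <= 9 * rd a ^+ 2], and positive
    at 0 and 1. Otherwise the margin of [b] relative to [a] puts the centers so far apart that
    completing a square suffices. *)
Lemma margin_scale_right (k : R) (a b a' b' : wk R) : 0 <= k <= 1 -> 0 <= rd b ->
  cx a' = cx a -> cy a' = cy a -> rd a' = k * rd a ->
  cx b' = cx b -> cy b' = cy b -> rd b' = k * rd b -> an b' = an b ->
  0 < margin 0 a b -> 0 < margin 0 b a -> 0 < margin 0 a' b'.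
Proof.
move=> /andP[k0 k1] rb xa ya ra xb yb Rb tb; rewrite /margin !subr0 !sqrtr_sqr Rb.
rewrite (ger0_norm rb) (ger0_norm (mulr_ge0 k0 rb)) ra /dst2 /along xa ya xb yb tb.
rewrite -/(dst2 a b) -/(along a b) -/(dst2 b a) -/(along b a) (dst2C b a).
have := along_le a b; have := normr_ge0 (along a b); set D := `|_| => D0 DW h1 h2.
have {}h2 : 9 * rd b ^+ 2 < dst2 a b + rd a ^+ 2.
  have := mulr_ge0 (normr_ge0 (rd a)) (normr_ge0 (along b a)); lra.
rewrite !exprMn; set W := dst2 a b in DW h1 h2 *.
set x := rd a ^+ 2 in h1 h2 *; set y := rd b ^+ 2 in h1 h2 *.
have k2 : k ^+ 2 <= k by rewrite expr2 ler_piMl.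
have [c|c] := leP y (9 * x).
  have : 0 <= (k - k ^+ 2) * (9 * x - y) by apply: mulr_ge0; lra.
  have : 0 <= (1 - k) * W by apply: mulr_ge0; [lra|have := sqr_ge0 D; lra].
  have : k * (9 * x) <= k * (W + y - 2 * rd b * D) by apply: ler_wpM2l => //; lra.
  have [->|kn] := eqVneq k 0.
    have := sqr_ge0 (rd b); rewrite -/y; have := sqr_ge0 (rd a); rewrite -/x; nra.
  have : 0 < k by rewrite lt_def kn.
  nra.
have y0 : 0 <= y by exact: sqr_ge0.
have x0 : 0 <= x by exact: sqr_ge0.
have W0 : 8 * y < W by lra.
have : 0 <= (D - 2 * rd b) ^+ 2 by exact: sqr_ge0.
rewrite sqrrB exprMn -/y => h.
have : 0 <= rd b * D by exact: mulr_ge0.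
have : k * (rd b * D) <= rd b * D by apply: ler_piMl => //; exact: mulr_ge0.
have : k ^+ 2 * (9 * x) <= k ^+ 2 * y by apply: ler_wpM2l; [exact: sqr_ge0|exact: ltW].
nra.
Qed.

(** Dividing radii by 4 turns the factor 9 of the margin into [144 = 9 * 16]. Adding the margins of
    a pair in both orders bounds the squared distance below by 4 times the sum of the squared radii,
    hence [64 = 4 * 16]. The angles of the wickets of [S] do not enter, so these may turn. *)
Definition tiny A S c : Prop := forall i, i \in S ->
  (forall j, j \in A -> j \notin S -> 144 * rd (c i) ^+ 2 <
     dst2 (c i) (c j) + rd (c j) ^+ 2 - 2 * rd (c j) * `|along (c i) (c j)|) /\
  (forall j, j \in S -> j != i -> 64 * (rd (c i) ^+ 2 + rd (c j) ^+ 2) < dst2 (c i) (c j)).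

Lemma margin0_far (a b : wk R) : 0 < rd a -> 0 <= rd b ->
  10 * rd a ^+ 2 <= dst2 a b + rd b ^+ 2 - 2 * rd b * `|along a b| -> 0 < margin 0 a b.
Proof.
move=> ra rb; rewrite /margin !subr0 sqrtr_sqr (ger0_norm rb).
by have := exprn_gt0 2 ra; lra.
Qed.

Lemma margin0_tiny_pair (a b : wk R) : 0 < rd a -> 0 <= rd b ->
  25 * rd a ^+ 2 <= dst2 a b -> 25 * rd b ^+ 2 <= dst2 a b -> 0 < margin 0 a b.
Proof.
move=> ra rb h1 h2; apply: margin0_far => //.
have := along_le a b; have := normr_ge0 (along a b); set D := `|_| => D0 DW.
have : 0 <= (D - 2 * rd b) ^+ 2 by exact: sqr_ge0.
by rewrite sqrrB exprMn; have := sqr_ge0 (rd a); have := sqr_ge0 (rd b); nra.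
Qed.

Lemma tiny_margin A S c : S \subset A -> (forall i, i \in A -> 0 < rd (c i)) ->
  tiny A S c -> forall i j, i \in S -> j \in A -> j != i -> 0 < margin 0 (c i) (c j).
Proof.
move=> /fintype.subsetP SA r0 h i j iS jA ji; have [h1 h2] := h i iS.
have ri := r0 i (SA i iS); have rj := r0 j jA.
have := sqr_ge0 (rd (c i)); have := sqr_ge0 (rd (c j)) => qj qi.
have [jS|jS] := boolP (j \in S).
  by apply: margin0_tiny_pair; rewrite ?(ltW rj)//; have := h2 j jS ji; lra.
by apply: margin0_far => //; [exact: ltW|have := h1 j jA jS; lra].
Qed.

Local Notation ctsF f := (forall i, continuous (fun t => f t i : R * R * R * R)).

Lemma at_cts (T : topologicalType) (F : T * R -> I -> wk R) (u : T -> R) :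
  continuous u -> ctsF F -> ctsF (fun t => F (t, u t)).
Proof.
move=> cu cF i.
refine (@compose_continuous T (T * R)%type (R * R * R * R)%type
  (fun t : T => (t, u t)) (fun x => F x i) _ (cF i)).
by cts.
Qed.

Section Deforms.
Variables (T : topologicalType) (K B : set T) (P : (I -> wk R) -> Prop) (A : {set I}).
Implicit Types f g : T -> I -> wk R.

(** The homotopy is continuous on the whole of [T], while [P] is demanded over [K] only; it can thus
    be cut off by functions on [T]. Over [B] everything is kept flat. *)
Definition deforms f g : Prop := exists F : T * R -> I -> wk R,
  [/\ ctsF F, forall t, F (t, 0) = f t, forall t, F (t, 1) = g t,
      forall t (u : R), K t -> 0 <= u <= 1 -> P (F (t, u)) &
      forall t (u : R), B t -> 0 <= u <= 1 -> flat A (F (t, u))].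

Lemma deforms_trans f g f' : deforms f g -> deforms g f' -> deforms f f'.
Proof.
move=> [F [cF F0 F1 FK FB]] [G [cG G0 G1 GK GB]].
exists (fun t => if t.2 <= 2^-1 then F (t.1, 2 * t.2) else G (t.1, 2 * t.2 - 1)).
split=> /=.
- move=> i; under eq_fun do rewrite (fun_if (fun c : I -> wk R => c i)).
  apply: if_cts; first by cts.
  + by refine (@compose_continuous _ _ _ (fun t : T * R => (t.1, 2 * t.2)) (fun t => F t i) _ _); [cts|exact: cF].
  + by refine (@compose_continuous _ _ _ (fun t : T * R => (t.1, 2 * t.2 - 1)) (fun t => G t i) _ _); [cts|exact: cG].
  + by move=> t ->; rewrite divff ?pnatr_eq0// subrr F1 G0.
- by move=> t; rewrite invr_ge0 ler0n mulr0 F0.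
- move=> t; rewrite leNgt invf_lt1 ?ltr0n// ltr1n /= mulr1.
  by have -> : 2 - 1 = 1 :> R by ring.
- move=> t u Kt u01; case: ifP => h; [apply: FK => //|apply: GK => //]; lra.
- move=> t u Bt u01; case: ifP => h; [apply: FB => //|apply: GB => //]; lra.
Qed.

End Deforms.

Lemma wk_eq (a b : wk R) : cx a = cx b -> cy a = cy b -> rd a = rd b -> an a = an b -> a = b.
Proof. by case: a b => [[[? ?] ?] ?] [[[? ?] ?] ?] /= -> -> -> ->. Qed.

Lemma nrm_sqr_le (y : R * R) : nrm y ^+ 2 <= y.1 ^+ 2 + y.2 ^+ 2.
Proof.
rewrite /nrm -[y.1 ^+ 2]real_normK ?num_real// -[y.2 ^+ 2]real_normK ?num_real//.
have h1 := sqr_ge0 `|y.1|; have h2 := sqr_ge0 `|y.2|.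
by case: (leP `|y.1| `|y.2|) => _; lra.
Qed.

Lemma nrm_sqr_ge (y : R * R) : y.1 ^+ 2 + y.2 ^+ 2 <= 2 * nrm y ^+ 2.
Proof.
have h (x : R) : `|x| <= nrm y -> x ^+ 2 <= nrm y ^+ 2.
  by move=> h; rewrite -[x ^+ 2]real_normK ?num_real// ler_sqr ?nnegrE ?nrm_ge0.
have h1 : y.1 ^+ 2 <= nrm y ^+ 2 by apply: h; rewrite /nrm le_max lexx.
have h2 : y.2 ^+ 2 <= nrm y ^+ 2 by apply: h; rewrite /nrm le_max lexx orbT.
lra.
Qed.

Lemma endpt_dist (a b : wk R) (e : bool) :
  (cx a - (endpt b e).1) ^+ 2 + (cy a - (endpt b e).2) ^+ 2 =
  dst2 a b + rd b ^+ 2 - 2 * rd b * ((-1) ^+ e * along a b).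
Proof.
transitivity (dst2 a b + rd b ^+ 2 * (sin (an b) ^+ 2 + cos (an b) ^+ 2) -
    2 * rd b * ((-1) ^+ e * along a b)); last by rewrite sincos subrK mulr1.
by rewrite /dst2 /along /endpt; case: e => /=; rewrite ?expr0 ?expr1; ring.
Qed.

Definition ctr (a : wk R) : R * R := (cx a, cy a).

Lemma endpt_near (a b : wk R) (e : bool) : 0 <= rd b ->
  dst2 a b + rd b ^+ 2 - 2 * rd b * `|along a b| <= 2 * nrm (subp (ctr a) (endpt b e)) ^+ 2.
Proof.
move=> rb; apply: le_trans (nrm_sqr_ge _); rewrite /= endpt_dist.
have : (-1) ^+ e * along a b <= `|along a b|.
  case: e; rewrite ?expr0 ?expr1 ?mul1r ?mulN1r; last exact: ler_norm.
  by rewrite -normrN ler_norm.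
by move/(ler_wpM2l rb); lra.
Qed.

(** The right-hand side of the conclusion is the squared distance from the center of [a] to the
    nearer endpoint of [b], so margins are conditions on points of the plane, which [follow] can
    control. *)
Lemma endpt_far (a b : wk R) (d : R) : 0 <= d -> 0 <= rd b ->
  (forall e, d <= nrm (subp (ctr a) (endpt b e))) ->
  d ^+ 2 <= dst2 a b + rd b ^+ 2 - 2 * rd b * `|along a b|.
Proof.
move=> d0 rb h; pose e := along a b < 0.
have -> : `|along a b| = (-1) ^+ e * along a b.
  by rewrite /e; case: ltP => c; rewrite ?expr0 ?expr1 ?mul1r ?mulN1r;
    [rewrite ltr0_norm|rewrite ger0_norm].
rewrite -endpt_dist; apply: le_trans (nrm_sqr_le (subp (ctr a) (endpt b e))).
by rewrite ler_sqr ?nnegrE ?nrm_ge0.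
Qed.

Definition straightens (A : {set I}) : Prop :=
  forall (T : topologicalType) (K B : set T) (f : T -> I -> wk R),
  compact K -> ctsF f -> (forall t, K t -> valid A (f t)) ->
  (forall t, B t -> flat A (f t)) ->
  exists g, deforms K B (valid A) A f g /\ forall t, K t -> flat A (g t).

Section Steps.
Variables (A S : {set I}) (SA : S \subset A).
Variables (T : topologicalType) (K B : set T).
Hypothesis cK : compact K.
Implicit Types f g : T -> I -> wk R.

Definition good c : Prop := valid A c /\ isolated A S c.

Local Notation deforms := (deforms K B good A).

(** The flow is stopped at the fraction [1 - e] of the time at which the smallest wicket vanishes.
    By compactness one [e] keeps the margins of all wickets of [S] positive. *)
Lemma flow_step f : ctsF f -> (forall t, K t -> good (f t)) ->
  (forall t, B t -> flat A (f t)) -> exists g, [/\ deforms f g, ctsF g &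
    forall t i j, K t -> i \in S -> j \in A -> j != i -> 0 < margin 0 (g t i) (g t j)].
Proof.
move=> cf fK fB.
have cm := @least_cts T A f cf.
pose h (t : T * R) := \big[Num.min/1]_(i in S) isolation A ((1 - t.2) * least A (f t.1)) (f t.1) i.
have ch : continuous h.
  apply: bigmin_cts => [|i]; first by cts.
  apply: (@isolation_cts _ A (fun t : T * R => (1 - t.2) * least A (f t.1)) (fun t => f t.1)) => [|j].
    apply: mulr_continuous; first by cts.
    by refine (@compose_continuous _ _ _ fst (fun t => least A (f t)) _ cm); cts.
  by cts.
have [|d d0 hd] := @tube R T K (fun t e => 0 < h (t, e)) 0 cK.
  move=> x Kx.
  have : \forall t \near (x, 0 : R), 0 < h t.
    apply: (@near_lt R _ (fun=> 0) h) => //; first by cts.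
    apply/bigmin_gtP; split=> // i iS; rewrite /= subr0 mul1r.
    by have [_ /(_ i iS)] := fK x Kx.
  by apply: filterS => -[].
pose e := Num.min (d / 2) 2^-1.
have e0 : 0 < e by rewrite lt_min invr_gt0 ltr0n divr_gt0.
have e1 : e <= 2^-1 by rewrite ge_min lexx orbT.
have ed : e < d.
  by apply: (@le_lt_trans _ _ (d / 2)); [rewrite ge_min lexx|lra].
pose s t := (1 - e) * least A (f t).
(* For [r > 0] and [x <= r ^+ 2] this is the radius after the flow. The formula is continuous
   everywhere and gives [r] at [x = 0] whatever the sign of [r]. *)
pose psi (r x : R) := r - `|r| + Num.sqrt (Num.max (r ^+ 2 - x) 0).
have cs : continuous s by rewrite /s; cts.
pose F (t : T * R) i : wk R :=
  (cx (f t.1 i), cy (f t.1 i), psi (rd (f t.1 i)) (t.2 * s t.1), an (f t.1 i)).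
have cF : ctsF F by move=> i; rewrite /F /psi; cts.
have F0 t : F (t, 0) = f t.
  apply/funext => i; apply: wk_eq => //=.
  by rewrite /psi mul0r subr0 (max_idPl _) ?sqr_ge0// sqrtr_sqr subrK.
have us t u i : K t -> 0 <= u <= 1 -> i \in A -> 0 <= u * s t < rd (f t i) ^+ 2.
  move=> Kt /andP[u0 u1] iA; have [v _] := fK t Kt.
  have m0 := least_gt0 v; have := least_le (f t) iA.
  have s0 : 0 <= s t by rewrite /s mulr_ge0 ?(ltW m0)//; lra.
  have : s t < least A (f t) by rewrite /s; nra.
  move=> ? ?; rewrite mulr_ge0//=; apply: (@le_lt_trans _ _ (s t)); last lra.
  by rewrite ler_piMl.
have Frd t u i : K t -> 0 <= u <= 1 -> i \in A ->
    0 < rd (F (t, u) i) /\ rd (F (t, u) i) ^+ 2 = rd (f t i) ^+ 2 - u * s t.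
  move=> Kt u01 iA; have /andP[h0 h1] := us t u i Kt u01 iA.
  have [[r0 _] _] := fK t Kt.
  rewrite /F /= /psi (gtr0_norm (r0 i iA)) subrr add0r (max_idPl _) ?subr_ge0 ?(ltW h1)//.
  by rewrite sqrtr_gt0 subr_gt0 h1 sqr_sqrtr// subr_ge0 ltW.
have Fmargin t u m i j : K t -> 0 <= u <= 1 -> i \in A -> j \in A ->
    margin m (F (t, u) i) (F (t, u) j) = margin (m + u * s t) (f t i) (f t j).
  move=> Kt u01 iA jA; apply: margin_flow => //; first exact: (Frd t u i Kt u01 iA).2.
  exact: (Frd t u j Kt u01 jA).2.
exists (fun t => F (t, 1)); split.
- exists F; split=> //.
    move=> t u Kt u01; have [[r0 nm] iso] := fK t Kt; split.
      split=> [i iA|i j iA jA ij]; first exact: (Frd t u i Kt u01 iA).1.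
      move=> /flow_meet - /(_ (f t i) (f t j) (u * s t)) H; apply: (nm i j iA jA ij).
      have [ri Ri] := Frd t u i Kt u01 iA; have [rj Rj] := Frd t u j Kt u01 jA.
      have /andP[? _] := us t u i Kt u01 iA.
      by apply: H => //; [exact: r0|exact: r0|exact: ltW|exact: ltW].
    (* All squared radii lose the same amount, so the time left until the smallest wicket vanishes
       drops by exactly the time elapsed. *)
    have lm (i0 : I) : i0 \in A -> least A (F (t, u)) + u * s t = least A (f t).
      move=> i0A; have A0 : (0 < #|A|)%N by apply/card_gt0P; exists i0.
      have [i iA ei] := least_eq (f t) A0; have [j jA ej] := least_eq (F (t, u)) A0.
      have := least_le (f t) jA; have := least_le (F (t, u)) iA.
      by rewrite ei ej (Frd t u i Kt u01 iA).2 (Frd t u j Kt u01 jA).2; lra.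
    move=> i iS; have iA := fintype.subsetP SA i iS.
    apply/isolationP => j jA ji; rewrite Fmargin// (lm i iA).
    by have /isolationP := iso i iS; apply.
  move=> t u Bt u01 i iA; exact: fB.
- by apply: at_cts => //; cts.
- move=> t i j Kt iS jA ji; have iA := fintype.subsetP SA i iS.
  rewrite Fmargin ?ler01 ?lexx// add0r mul1r.
  have e_d : `|e - 0| < d by rewrite subr0 gtr0_norm.
  have /bigmin_gtP[_ /(_ i iS) /isolationP] := hd e e_d t Kt; exact.
Qed.

Lemma good_margin c c' : valid (A :\: S) c ->
  (forall i, i \in A -> i \notin S -> c' i = c i) ->
  (forall i, i \in A -> 0 < rd (c' i)) ->
  (forall i j, i \in S -> j \in A -> j != i -> 0 < margin 0 (c' i) (c' j)) -> good c'.
Proof.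
by move=> v same r0 h; split; [exact: margin_valid v same r0 h|exact: margin_isolated].
Qed.

Lemma scale_step f : ctsF f -> (forall t, K t -> good (f t)) ->
  (forall t i j, K t -> i \in S -> j \in A -> j != i -> 0 < margin 0 (f t i) (f t j)) ->
  (forall t, B t -> flat A (f t)) ->
  exists g, [/\ deforms f g, ctsF g & forall t, K t -> tiny A S (g t)].
Proof.
move=> cf fK fm fB.
pose F (t : T * R) i : wk R := (cx (f t.1 i), cy (f t.1 i),
  (1 - (if i \in S then t.2 * (3 / 4) else 0)) * rd (f t.1 i), an (f t.1 i)).
have cF : ctsF F by move=> i; rewrite /F; case: (i \in S); cts.
exists (fun t => F (t, 1)); split.
- exists F; split=> //.
  + move=> t; apply/funext => i; apply: wk_eq => //=.
    by rewrite mul0r if_same subr0 mul1r.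
  + move=> t u Kt u01; have [v iso] := fK t Kt; have [r0 nm] := v.
    have r0' i : i \in A -> 0 < rd (F (t, u) i).
      by move=> iA; rewrite /F /= mulr_gt0 ?r0//; case: ifP => _; lra.
    apply: (good_margin (valid_sub (subsetDl A S) v)) => //.
      move=> i iA /negbTE iS; apply: wk_eq => //=.
      by rewrite iS subr0 mul1r.
    move=> i j iS jA ji; have iA := fintype.subsetP SA i iS.
    have m1 := fm t i j Kt iS jA ji.
    have [jS|jS] := boolP (j \in S).
      have m2 : 0 < margin 0 (f t j) (f t i) by apply: fm => //; rewrite eq_sym.
      apply: (@margin_scale_right (1 - u * (3 / 4)) (f t i) (f t j)) => //=.
      - by lra.
      - exact/ltW/r0.
      - by rewrite iS.
      - by rewrite jS.
    move: m1; rewrite /margin /dst2 /along /= (negbTE jS) !subr0 !mul1r iS exprMn.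
    set k := 1 - _; have : k ^+ 2 <= 1 by rewrite /k; nra.
    move/(ler_wpM2r (sqr_ge0 (rd (f t i)))); lra.
  + by move=> t u Bt u01 i iA; apply: fB.
- by apply: at_cts => //; cts.
- move=> t Kt i iS; have iA := fintype.subsetP SA i iS.
  have [[r0 _] _] := fK t Kt.
  split=> j.
    move=> jA jS; have ji : j != i by apply: contraNneq jS => ->.
    have := fm t i j Kt iS jA ji.
    rewrite /margin !subr0 sqrtr_sqr (gtr0_norm (r0 j jA)) /dst2 /along /= iS (negbTE jS).
    by rewrite subr0 !mul1r exprMn; lra.
  move=> jS ji; have jA := fintype.subsetP SA j jS.
  have ij : i != j by rewrite eq_sym.
  have := fm t i j Kt iS jA ji; have := fm t j i Kt jS iA ij.
  rewrite /margin !subr0 !sqrtr_sqr /= iS jS.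
  have := mulr_ge0 (normr_ge0 (rd (f t i))) (normr_ge0 (along (f t j) (f t i))).
  have := mulr_ge0 (normr_ge0 (rd (f t j))) (normr_ge0 (along (f t i) (f t j))).
  by rewrite (dst2C (f t j)) /dst2 /= !exprMn; lra.
Qed.

(** Being tiny does not involve the angles of [S], so these can be contracted linearly to 0; angles
    that are 0 already remain so. *)
Lemma rotate_step f : ctsF f -> (forall t, K t -> good (f t)) ->
  (forall t, K t -> tiny A S (f t)) -> (forall t, B t -> flat A (f t)) ->
  exists g, [/\ deforms f g, ctsF g, forall t, K t -> tiny A S (g t) &
    forall t i, i \in S -> an (g t i) = 0].
Proof.
move=> cf fK ft fB.
pose F (t : T * R) i : wk R := (cx (f t.1 i), cy (f t.1 i), rd (f t.1 i),
  (1 - (if i \in S then t.2 else 0)) * an (f t.1 i)).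
have cF : ctsF F by move=> i; rewrite /F; case: (i \in S); cts.
have Ft t u : K t -> tiny A S (F (t, u)).
  move=> Kt i iS; have [h1 h2] := ft t Kt i iS; split=> j; last exact: h2.
  move=> jA jS; have := h1 j jA jS.
  by rewrite /F /dst2 /along /= (negbTE jS) subr0 !mul1r.
exists (fun t => F (t, 1)); split.
- exists F; split=> //.
  + move=> t; apply/funext => i; apply: wk_eq => //=.
    by rewrite if_same subr0 mul1r.
  + move=> t u Kt u01; have [v iso] := fK t Kt; have [r0 nm] := v.
    apply: (good_margin (valid_sub (subsetDl A S) v)) => //.
      by move=> i iA /negbTE iS; apply: wk_eq => //=; rewrite iS subr0 mul1r.
    by apply: tiny_margin => //; exact: Ft.
  + by move=> t u Bt u01 i iA; rewrite /F /= fB// mulr0.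
- by apply: at_cts => //; cts.
- by move=> t; exact: Ft.
- by move=> t i iS; rewrite /F /= iS subrr mul0r.
Qed.

(** The wickets outside [S] are straightened by induction. Those of [S] follow: their centers avoid
    one another and the moving endpoints of the others, and each radius is a fifth of the distance
    to the nearest obstacle, capped so that the motion starts from the given radius. *)
Lemma rest_step f : straightens (A :\: S) -> ctsF f ->
  (forall t, K t -> good (f t)) -> (forall t, K t -> tiny A S (f t)) ->
  (forall t i, i \in S -> an (f t i) = 0) -> (forall t, B t -> flat A (f t)) ->
  exists g, [/\ deforms f g, ctsF g & forall t, K t -> flat A (g t)].
Proof.
move=> IH cf fK ft fS fB.
have [|t Bt i /setDP[iA _]|g0 [[F [cF F0 F1 FK FB]] g0K]] := IH T K B f cK cf.
- by move=> t Kt; apply: (valid_sub (subsetDl A S)); case: (fK t Kt).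
- exact: fB.
pose act (l : I * bool) := l.1 \in A :\: S.
pose p (t : T * R) (l : I * bool) := endpt (F t l.1) l.2.
pose q t i := ctr (f t i).
have cp l : continuous (fun t => p t l) by rewrite /p /endpt; cts.
have cq i : continuous (fun t => q t i) by rewrite /q /ctr; cts.
have p_inj t (u : R) l k : K t -> 0 <= u <= 1 -> act l -> act k ->
    p (t, u) l = p (t, u) k -> l = k.
  case: l k => [i b] [j b'] Kt u01 /= ai aj; rewrite /p /= => e.
  have [r0 nm] := FK t u Kt u01; have [ij|ij] := eqVneq i j.
    by move: e; rewrite -ij => /endpt_inj -> //; exact: r0.
  by case: (nm i j ai aj ij); exact: endpt_meet e.
have [q' [cq' q0 qp qq]] := follow cK cp cq p_inj.
pose z (t : T * R) i : R := Num.min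
  (\big[Num.min/5 * rd (f t.1 i)]_(l | act l) nrm (subp (q' t i) (p t l)))
  (\big[Num.min/5 * rd (f t.1 i)]_(j | (j \in S) && (j != i)) nrm (subp (q' t i) (q' t j))).
have cz i : continuous (fun t => z t i).
  apply: min_continuous.
    apply: bigmin_cts => [|l]; first by cts.
    by apply/nrm_cts/subp_cts.
  apply: bigmin_cts => [|l]; first by cts.
  by apply/nrm_cts/subp_cts.
(* Tiny wickets are far enough from all obstacles for the cap to be attained at time 0. *)
have z0 t i : K t -> i \in S -> z (t, 0) i = 5 * rd (f t i).
  move=> Kt iS; have iA := fintype.subsetP SA i iS.
  have [[r0 _] _] := fK t Kt; have [h1 h2] := ft t Kt i iS; have ri := r0 i iA.
  have sq (x : R) : (5 * rd (f t i)) ^+ 2 <= x ^+ 2 -> 0 <= x -> 5 * rd (f t i) <= x.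
    by move=> h x0; rewrite -ler_sqr ?nnegrE// mulr_ge0// ltW.
  have qi := sqr_ge0 (rd (f t i)).
  apply/eqP; rewrite eq_le ge_min bigmin_le_id /= le_min; apply/andP; split.
    apply/bigmin_geP; split=> // -[j b] /= /setDP[jA jS].
    apply: sq; last exact: nrm_ge0.
    have := h1 j jA jS; rewrite q0 /p F0 /=.
    have := @endpt_near (f t i) (f t j) b (ltW (r0 j jA)).
    by rewrite exprMn; lra.
  apply/bigmin_geP; split=> // j /andP[jS ji].
  apply: sq; last exact: nrm_ge0.
  have := h2 j jS ji; rewrite q0 /=.
  have := nrm_sqr_ge (subp (ctr (f t i)) (ctr (f t j))).
  by rewrite /= -/(dst2 _ _) exprMn; have := sqr_ge0 (rd (f t j)); lra.
have qne t i : K t -> i \in S -> (forall l, act l -> q t i <> p (t, 0) l) /\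
    (forall j, j \in S -> j != i -> q t i <> q t j).
  move=> Kt iS; have := z0 t i Kt iS.
  have [[r0 _] _] := fK t Kt; have ri := r0 i (fintype.subsetP SA i iS).
  move=> e; have : 0 < z (t, 0) i by rewrite e mulr_gt0.
  have n0 (y : R * R) : nrm (subp y y) = 0 by rewrite /nrm /= !subrr normr0 maxxx.
  rewrite /z lt_min => /andP[/bigmin_gtP[_ hp] /bigmin_gtP[_ hq]]; split.
    by move=> l al E; have := hp l al; rewrite q0 /= E n0 ltxx.
  by move=> j jS ji E; have := hq j; rewrite jS ji q0 /= E n0 ltxx => /(_ isT).
(* The difference added to the radius is 0 over [K]; it makes [G] agree with [f] at time 0 over all
   of [T]. *)
pose G (t : T * R) i : wk R := if i \in S then
  ((q' t i).1, (q' t i).2, z t i / 5 + (rd (f t.1 i) - z (t.1, 0) i / 5), an (f t.1 i))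
  else F t i.
have cz0 i : continuous (fun t : T * R => z (t.1, 0) i).
  refine (@compose_continuous (T * R)%type (T * R)%type R
    (fun t : T * R => (t.1, 0)) (fun t => z t i) _ (cz i)); cts.
have cG : ctsF G by move=> i; rewrite /G; case: (i \in S); cts.
have zK t (u : R) i : K t -> 0 <= u <= 1 -> i \in S -> rd (G (t, u) i) = z (t, u) i / 5.
  move=> Kt u01 iS; rewrite /G iS /= z0//; lra.
have zpos t (u : R) i : K t -> 0 <= u <= 1 -> i \in S -> 0 < z (t, u) i.
  move=> Kt u01 iS; have [n1 n2] := qne t i Kt iS.
  have [[r0 _] _] := fK t Kt; have ri := r0 i (fintype.subsetP SA i iS).
  rewrite /z lt_min; apply/andP; split; apply/bigmin_gtP.
    split=> [|l al]; first by rewrite mulr_gt0.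
    rewrite ltNge; apply/negP => /subp_eq0.
    by apply: qp => //; exact: n1.
  split=> [|j /andP[jS ji]]; first by rewrite mulr_gt0.
  rewrite ltNge; apply/negP => /subp_eq0.
  by apply: qq => //; exact: n2.
have GK t (u : R) : K t -> 0 <= u <= 1 -> good (G (t, u)).
  move=> Kt u01; apply: (good_margin (FK t u Kt u01)).
  - by move=> i _ /negbTE iS; rewrite /G iS.
  - move=> i iA; have [iS|iS] := boolP (i \in S).
      by rewrite zK// divr_gt0// zpos.
    by rewrite /G (negbTE iS); apply: (FK t u Kt u01).1; rewrite inE iS.
  - move=> i j iS jA ji; have zi := zpos t u i Kt u01 iS.
    have ri : 0 < rd (G (t, u) i) by rewrite zK// divr_gt0.
    have cE : ctr (G (t, u) i) = q' (t, u) i by rewrite /G iS /ctr; case: (q' _ _).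
    have [jS|jS] := boolP (j \in S).
      have zj := zpos t u j Kt u01 jS.
      have cE' : ctr (G (t, u) j) = q' (t, u) j by rewrite /G jS /ctr; case: (q' _ _).
      have E (x y : I) : y \in S -> y != x -> x \in S ->
          z (t, u) x ^+ 2 <= nrm (subp (q' (t, u) x) (q' (t, u) y)) ^+ 2.
        move=> yS yx xS; rewrite ler_sqr ?nnegrE ?nrm_ge0 ?(ltW (zpos t u x Kt u01 xS))//.
        by rewrite /z ge_min (bigmin_le_cond _ (j := y)) ?orbT// yS yx.
      have := nrm_sqr_le (subp (ctr (G (t, u) i)) (ctr (G (t, u) j))).
      rewrite /= -/(dst2 (G (t, u) i) (G (t, u) j)) cE cE' => le.
      apply: margin0_tiny_pair => //.
      + by rewrite zK// divr_ge0// ltW.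
      + by rewrite zK// exprMn; have := E i j jS ji iS; lra.
      + by rewrite zK// exprMn; have := E j i iS; rewrite eq_sym ji nrm_subpC => /(_ isT jS); lra.
    have rj : 0 < rd (G (t, u) j).
      by rewrite /G (negbTE jS); apply: (FK t u Kt u01).1; rewrite inE jS.
    apply: margin0_far => //; first exact: ltW.
    have : z (t, u) i ^+ 2 <= dst2 (G (t, u) i) (G (t, u) j) + rd (G (t, u) j) ^+ 2 -
        2 * rd (G (t, u) j) * `|along (G (t, u) i) (G (t, u) j)|.
      apply: endpt_far; [exact: ltW|exact: ltW|move=> e].
      rewrite cE /z ge_min; apply/orP; left.
      have -> : endpt (G (t, u) j) e = p (t, u) (j, e) by rewrite /p /G (negbTE jS).
      by apply: (bigmin_le_cond _ (j := (j, e))); rewrite /act /= inE jS.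
    by rewrite (zK t u i)// exprMn; have := sqr_ge0 (z (t, u) i); lra.
exists (fun t => G (t, 1)); split.
- exists G; split=> //.
  + move=> t; apply/funext => i; rewrite /G; case: ifP => iS; last by rewrite F0.
    by apply: wk_eq => /=; rewrite ?q0//; ring.
  + move=> t u Bt u01 i iA; rewrite /G; case: ifP => iS; first exact: fS.
    by apply: FB => //; rewrite inE iS.
- by apply: at_cts => //; cts.
- move=> t Kt i iA; rewrite /G; case: ifP => iS; first exact: fS.
  by rewrite F1; apply: g0K => //; rewrite inE iS.
Qed.

Lemma isolated_step f : straightens (A :\: S) -> ctsF f ->
  (forall t, K t -> good (f t)) -> (forall t, B t -> flat A (f t)) ->
  exists g, deforms f g /\ forall t, K t -> flat A (g t).
Proof.
move=> IH cf fK fB.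
have ends f1 f2 : deforms f1 f2 ->
    (forall t, K t -> good (f2 t)) /\ (forall t, B t -> flat A (f2 t)).
  move=> [F [_ _ F1 FK FB]]; split=> t ?; rewrite -F1; [apply: FK|apply: FB] => //;
    by rewrite ler01 lexx.
have [g1 [d1 c1 m1]] := flow_step cf fK fB; have [k1 b1] := ends _ _ d1.
have [g2 [d2 c2 m2]] := scale_step c1 k1 m1 b1; have [k2 b2] := ends _ _ d2.
have [g3 [d3 c3 m3 a3]] := rotate_step c2 k2 m2 b2; have [k3 b3] := ends _ _ d3.
have [g4 [d4 c4 fl]] := rest_step IH c3 k3 m3 a3 b3.
exists g4; split=> //.
exact: deforms_trans d1 (deforms_trans d2 (deforms_trans d3 d4)).
Qed.

End Steps.

(** * Patching the deformations over a compact family *)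

Section Gluing.
Variables (A : {set I}) (IH : forall A' : {set I}, (#|A'| < #|A|)%N -> straightens A').
Variables (T : topologicalType) (K : set T).
Hypothesis cK : compact K.

Variables (f : T -> I -> wk R) (cf : ctsF f) (fK : forall t, K t -> valid A (f t)).

Let phi t i : R := Num.max 0 (isolation A (least A (f t)) (f t) i).

(** When this is positive, every label of [S] has a larger [phi] than every label of [A] outside
    [S]. It is computed from the initial family [f] and never from its deformations. *)
Let gap (S : {set I}) t : R :=
  \big[Num.min/1]_(i in S) phi t i - \big[Num.max/0]_(i in A :\: S) phi t i.

Let phi_cts i : continuous (fun t => phi t i).
Proof.
apply: max_continuous; first by cts.
by apply: isolation_cts => //; exact: least_cts.
Qed.

Let gap_cts S : continuous (gap S).
Proof.
apply: subr_continuous; first by apply: bigmin_cts => [|i]; [cts|exact: phi_cts].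
by apply: bigmax_cts => [|i]; [cts|exact: phi_cts].
Qed.

Let gap_lt S t i j : 0 < gap S t -> i \in S -> j \in A -> j \notin S -> phi t j < phi t i.
Proof.
rewrite subr_gt0 => g0 iS jA jS.
apply: le_lt_trans (lt_le_trans g0 _); last exact: bigmin_le_cond.
by apply: (le_bigmax_cond _ (j := j)); rewrite inE jS.
Qed.

Let gap_isolated S t : 0 < gap S t -> isolated A S (f t).
Proof.
rewrite subr_gt0 => g0 i iS.
suff : 0 < phi t i by rewrite /phi lt_max ltxx.
apply: le_lt_trans (lt_le_trans g0 _); last exact: bigmin_le_cond.
exact: bigmax_ge_id.
Qed.

(** Both sets are upper level sets of [phi] at [t]: two labels lying in one set each but not in the
    other would have contradictory values. *)
Let gap_nested S S' t : S \subset A -> S' \subset A ->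
  0 < gap S t -> 0 < gap S' t -> (#|S'| <= #|S|)%N -> S' \subset S.
Proof.
move=> /fintype.subsetP SA /fintype.subsetP SA' g g' le.
apply/fintype.subsetP => i iS'; apply: contraT => iS.
have sub : S \subset S'.
  apply/fintype.subsetP => j jS; apply: contraT => jS'.
  have := gap_lt g jS (SA' i iS') iS; have := gap_lt g' iS' (SA j jS) jS'.
  by move=> h1 h2; move: (lt_trans h1 h2); rewrite ltxx.
have /eqP E : S == S' by rewrite eqEcard sub le.
by rewrite E iS' in iS.
Qed.

(* Pigeonhole: n + 1 thresholds, but only n values. *)
Let gap_exists (d : R) t : 0 < d -> (exists2 i, i \in A & d <= phi t i) ->
  exists S, [/\ (0 < #|S|)%N, S \subset A & d / #|A|.+1%:R <= gap S t].
Proof.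
move=> d0 [i0 i0A di0].
pose n := #|A|; pose th (k : nat) : R := d * k%:R / n.+1%:R.
pose L k := [set i in A | th k <= phi t i]%SET.
have th0 k : 0 <= th k by rewrite divr_ge0// mulr_ge0// ltW.
have thS k : th k.+1 = th k + d / n.+1%:R by rewrite /th -natr1; field; rewrite nat1r pnatr_eq0.
have LA k : L k \subset A by apply/fintype.subsetP => i; rewrite inE => /andP[].
have i0L k : (k <= n.+1)%N -> i0 \in L k.
  move=> kn; rewrite inE i0A; apply: le_trans di0.
  by rewrite /th ler_pdivrMr// ler_pM2l// ler_nat.
have sub k : L k.+1 \subset L k.
  apply/fintype.subsetP => i; rewrite !inE => /andP[-> h] /=.
  by apply: le_trans h; rewrite thS lerDl divr_ge0// ltW.
have [[k kn E]|noE] := pselect (exists2 k, (k <= n)%N & L k = L k.+1).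
  exists (L k); split=> //.
    by apply/card_gt0P; exists i0; apply: i0L; exact: leqW.
  rewrite /gap lerBrDr.
  apply/bigmin_geP; split=> [|i].
    suff : \big[Num.max/0]_(i in A :\: L k) phi t i <= 1 - d / n.+1%:R by rewrite lerBrDl.
    have phi1 i : phi t i <= 1 by rewrite ge_max ler01 bigmin_le_id.
    have dn : th n.+1 <= 1.
      by apply: le_trans (phi1 i0); apply: le_trans di0; rewrite /th -mulrA divff ?mulr1// pnatr_eq0.
    have thk : th k <= 1 - d / n.+1%:R.
      rewrite lerBrDr -thS; apply: le_trans dn.
      by rewrite /th ler_pM2r ?invr_gt0// ler_pM2l// ler_nat.
    apply/bigmax_leP; split=> [|i /setDP[iA]]; first exact: le_trans (th0 k) thk.
    by rewrite inE iA /= -ltNge => /ltW h; apply: le_trans thk.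
  rewrite E inE => /andP[iA h]; apply: le_trans h; rewrite thS -/n addrC lerD2r.
  apply/bigmax_leP; split=> // j /setDP[jA]; rewrite -E inE jA /= -ltNge; exact: ltW.
(* If no two consecutive level sets agree, each step down from the highest threshold adds a label,
   which ends with more labels than [A] has. *)
have card m : (m <= n.+1)%N -> (m < #|L (n.+1 - m)%N|)%N.
  elim: m => [|m IHm] mn; first by apply/card_gt0P; exists i0; apply: i0L; rewrite subn0.
  apply: leq_ltn_trans (IHm (ltnW mn)) _.
  have e : (n.+1 - m = (n.+1 - m.+1).+1)%N by rewrite subnSK.
  rewrite e; apply: proper_card; rewrite finset.properEneq sub andbT; apply/eqP => H; apply: noE.
  by exists (n.+1 - m.+1)%N; rewrite ?subSS ?leq_subr.
have := card n.+1 (leqnn _); rewrite subnn => h.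
by have := leq_trans h (subset_leq_card (LA 0%N)); rewrite ltnNge leqW.
Qed.

(** Over [KS] the first set [S] is straightened, with the time cut off by [mu]: the full deformation
    where the gap is at least [k], none where it is below [k / 2]. A later set with positive gap
    over [KS] is no larger, hence contained in [S], and so remains isolated. What has become flat
    joins [B] and is kept flat by the following steps. *)
Lemma glue (k : R) (r : seq {set I}) : 0 < k ->
  pairwise (fun X Y : {set I} => #|Y| <= #|X|)%N r ->
  (forall S, S \in r -> (0 < #|S|)%N /\ S \subset A) ->
  forall (f' : T -> I -> wk R) (B : set T), ctsF f' ->
  (forall t, K t -> valid A (f' t)) ->
  (forall S t, S \in r -> K t -> 0 < gap S t -> isolated A S (f' t)) ->
  (forall t, B t -> flat A (f' t)) ->
  exists g, deforms K B (valid A) A f' g /\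
    forall S t, S \in r -> K t -> k <= gap S t -> flat A (g t).
Proof.
move=> k0; elim: r => [|S r IHr] /= => [_ _ f' B cf' fK' _ fB'|].
  exists f'; split=> //; exists (fun t => f' t.1); split=> //.
  - by move=> i; cts.
  - by move=> t u Kt _; exact: fK'.
  - by move=> t u Bt _; exact: fB'.
move=> /andP[/allP le pw] rS f' B cf' fK' fI fB.
have [S0 SA] : (0 < #|S|)%N /\ S \subset A by apply: rS; rewrite mem_head.
pose KS := K `&` [set t | k / 2 <= gap S t].
have cKS : compact KS.
  apply: compact_closedI => //.
  by apply: (@preimage_closed _ _ (gap S) [set x | k / 2 <= x]).
have card : (#|A :\: S| < #|A|)%N.
  rewrite cardsD (finset.setIidPr SA) ltn_subrL S0 /=.
  exact: leq_trans (subset_leq_card SA).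
have [|g1 [[F [cF F0 F1 FK FB]] g1K]] :=
  @isolated_step A S SA T KS B cKS f' (IH card) cf' _ fB.
  move=> t [Kt /= gt]; split; first exact: fK'.
  by apply: fI => //; [rewrite mem_head|lra].
pose mu t : R := Num.max 0 (Num.min 1 (2 / k * gap S t - 1)).
have cmu : continuous mu.
  have c : continuous (gap S) by exact: gap_cts.
  by rewrite /mu; cts.
have mu01 t : 0 <= mu t <= 1 by rewrite /mu le_max lexx ge_max ler01 ge_min lexx.
have mu0 t : ~ (k / 2 <= gap S t) -> mu t = 0.
  move/negP; rewrite -ltNge => h; apply/max_idPl; rewrite ge_min; apply/orP; right.
  have : 2 / k * gap S t <= 2 / k * (k / 2) by apply: ler_wpM2l; [rewrite divr_ge0// ltW|exact: ltW].
  have -> : 2 / k * (k / 2) = 1 by field; rewrite gt_eqF.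
  lra.
have mu1 t : k <= gap S t -> mu t = 1.
  move=> h; rewrite /mu (min_idPl _) ?(max_idPr _)//.
  have : 2 / k * k <= 2 / k * gap S t by apply: ler_wpM2l => //; rewrite divr_ge0// ltW.
  by rewrite divfK ?gt_eqF//; lra.
pose g2 t := F (t, mu t).
have d1 : deforms K B (valid A) A f' g2.
  exists (fun t => F (t.1, t.2 * mu t.1)); split.
  - move=> i.
    refine (@compose_continuous (T * R)%type (T * R)%type (R * R * R * R)%type
      (fun t : T * R => (t.1, t.2 * mu t.1)) (fun x => F x i) _ (cF i)); by cts.
  - by move=> t; rewrite mul0r F0.
  - by move=> t; rewrite mul1r.
  - move=> t u Kt /andP[u0 u1] /=.
    have [gt|ngt] := pselect (k / 2 <= gap S t); last by rewrite mu0// mulr0 F0; exact: fK'.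
    by apply: (FK t (u * mu t) _ _).1 => //; have /andP[m0 m1] := mu01 t; rewrite mulr_ge0// mulr_ile1.
  - move=> t u Bt /andP[u0 u1] /=; apply: FB => //.
    by have /andP[m0 m1] := mu01 t; rewrite mulr_ge0// mulr_ile1.
pose B2 := B `|` (K `&` [set t | k <= gap S t]).
have [|||||g3 [d2 g3K]] := IHr pw _ g2 B2.
- by move=> S' S'r; apply: rS; rewrite inE S'r orbT.
- by apply: at_cts.
- case: d1 => [F' [_ _ F1' FK' _]] t Kt; rewrite -F1'; apply: FK' => //; by rewrite ler01 lexx.
- move=> S' t S'r Kt gt'.
  have [gt|ngt] := pselect (k / 2 <= gap S t); last first.
    by rewrite /g2 mu0// F0; apply: fI => //; rewrite inE S'r orbT.
  have [_ S'A] : (0 < #|S'|)%N /\ S' \subset A by apply: rS; rewrite inE S'r orbT.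
  have sub : S' \subset S by apply: (@gap_nested S S' t) => //; [lra|exact: le].
  have [_ iso] := FK t (mu t) (conj Kt gt) (mu01 t).
  by move=> i iS'; apply: iso; exact: fintype.subsetP sub i iS'.
- move=> t [Bt|[Kt /= gt]]; first exact: FB.
  by rewrite /g2 mu1// F1; apply: g1K; split=> //=; lra.
exists g3; split.
  apply: (deforms_trans d1); case: d2 => [G [cG G0 G1 GK GB]].
  by exists G; split=> // t u Bt; apply: GB; left.
move=> S' t; rewrite inE => /orP[/eqP ->|S'r] Kt gt; last exact: (g3K S' t).
case: d2 => [G [cG G0 G1 GK GB]]; rewrite -G1; apply: GB; last by rewrite ler01 lexx.
by right.
Qed.

(** The smallest wicket is isolated, so the maximum of [phi] is positive, and bounded below over
    [K]. By [gap_exists] each point of [K] then has a set with a gap at least [k]. *)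
Lemma glue_all (B : set T) : (0 < #|A|)%N -> (forall t, B t -> flat A (f t)) ->
  exists g, deforms K B (valid A) A f g /\ forall t, K t -> flat A (g t).
Proof.
move=> A0 fB.
pose h t : R := \big[Num.max/0]_(i in A) phi t i.
have ch : continuous h by apply: bigmax_cts => [|i]; [cts|exact: phi_cts].
have h0 t : K t -> 0 < h t.
  move=> Kt; have [i iA E] := least_eq (f t) A0.
  apply/bigmax_gtP; right; exists i => //.
  by rewrite /phi lt_max ltxx /= isolated_least//; exact: fK.
have [|d d0 hd] := @tube R T K (fun t e => e < h t) 0 cK.
  move=> x Kx; apply: (@near_lt R _ (fun t : T * R => t.2) (fun t => h t.1)) => //=; first by cts.
    by cts.
  exact: h0.
pose k : R := (d / 2) / #|A|.+1%:R.
have k0 : 0 < k by rewrite divr_gt0// divr_gt0.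
pose r := sort (fun X Y : {set I} => #|Y| <= #|X|)%N
  [seq S : {set I} <- enum {: {set I}} | ((0 < #|S|)%N) && (S \subset A)].
have mem_r S : (S \in r) = ((0 < #|S|)%N) && (S \subset A).
  by rewrite mem_sort mem_filter mem_enum andbT.
have [|S|||g [dg gK]] := @glue k r k0 _ _ f B cf fK.
- rewrite -sorted_pairwise; first by apply: sort_sorted => X Y; exact: leq_total.
  by move=> X Y Z h1 h2; exact: leq_trans h2 h1.
- by rewrite mem_r => /andP[].
- by move=> S t _ _; exact: gap_isolated.
- exact: fB.
exists g; split=> // t Kt.
have hdt : d / 2 < h t by apply: hd => //; rewrite subr0 gtr0_norm; lra.
have [||S [S0 SA gS]] := @gap_exists (d / 2) t.
- by rewrite divr_gt0.
- move/bigmax_gtP: hdt => [|[i iA hi]]; first by rewrite ltNge divr_ge0// ltW.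
  by exists i => //; exact: ltW.
by apply: (gK S t) => //; rewrite mem_r S0.
Qed.

End Gluing.

Theorem straighten (A : {set I}) : straightens A.
Proof.
have [n] := ubnP #|A|; elim: n A => // n IHn A An T K B f cK cf fK fB.
have [A0|A0] := posnP #|A|; last first.
  apply: glue_all => // A' A'A; apply: IHn; exact: leq_trans A'A An.
exists f; split.
  exists (fun t => f t.1); split=> //.
  - by move=> i; cts.
  - by move=> t u Kt _; exact: fK.
  - by move=> t u Bt _; exact: fB.
by move=> t _ i; rewrite (card0_eq A0 i).
Qed.
End Straightening.

(** * The covering of the space of wickets *)

Section WicketSets.
Variable R : realType.
Implicit Types a b : wk R.

Definition ends a : endpoints R := (endpt a true, endpt a false).

Lemma mem_wicket a (x y z : R) : 0 < rd a -> wicket (ends a) (x, y, z) <->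
  exists l, [/\ -1 <= l <= 1, x = cx a + l * rd a * sin (an a),
    y = cy a + l * rd a * cos (an a), 0 <= z & z ^+ 2 = rd a ^+ 2 * (1 - l ^+ 2)].
Proof.
move=> ra; have sc := sincos (an a).
rewrite /wicket /ends /endpt /= expr0 expr1 !mul1r !mulN1r.
set s := sin (an a) in sc *; set c := cos (an a) in sc *; set r := rd a in ra *.
split=> [[z0 pl sp]|[l [/andP[l0 l1] -> -> z0 hz]]].
  have {}pl : (x - cx a) * c = (y - cy a) * s.
    have : r * ((x - cx a) * c - (y - cy a) * s) = 0 by lra.
    by move/eqP; rewrite mulf_eq0 gt_eqF//= subr_eq0 => /eqP.
  have {}sp : (x - cx a) ^+ 2 + (y - cy a) ^+ 2 + z ^+ 2 = r ^+ 2.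
    have e1 : (cx a + - r * s + (cx a + r * s)) / 2 = cx a by field.
    have e2 : (cy a + - r * c + (cy a + r * c)) / 2 = cy a by field.
    rewrite e1 e2 in sp; rewrite sp.
    transitivity (r ^+ 2 * (s ^+ 2 + c ^+ 2)); first by field.
    by rewrite sc subrK mulr1.
  pose l := ((x - cx a) * s + (y - cy a) * c) / r.
  have lr : l * r = (x - cx a) * s + (y - cy a) * c by rewrite /l divfK ?gt_eqF.
  have ex : l * r * s = x - cx a.
    transitivity ((x - cx a) * s ^+ 2 + ((y - cy a) * s) * c); first by rewrite lr; ring.
    by rewrite -pl sc; ring.
  have ey : l * r * c = y - cy a.
    transitivity (((x - cx a) * c) * s + (y - cy a) * c ^+ 2); first by rewrite lr; ring.
    by rewrite pl -mulrA -expr2 sc; ring.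
  have zz : z ^+ 2 = r ^+ 2 * (1 - l ^+ 2).
    have : (l * r * s) ^+ 2 + (l * r * c) ^+ 2 = r ^+ 2 - z ^+ 2 by rewrite ex ey; lra.
    rewrite !(exprMn _ _ s) !(exprMn _ _ c) sc => h.
    have {}h : (l * r) ^+ 2 = r ^+ 2 - z ^+ 2 by rewrite -h; ring.
    by rewrite mulrBr mulr1 -exprMn mulrC h; ring.
  exists l; split=> //; [|by rewrite ex; ring|by rewrite ey; ring].
  rewrite -ler_norml -(expr_le1 (n := 2))// real_normK ?num_real//.
  have : 0 <= r ^+ 2 * (1 - l ^+ 2) by rewrite -zz sqr_ge0.
  by rewrite pmulr_rge0 ?exprn_gt0// subr_ge0.
split=> //; first by ring.
transitivity (l ^+ 2 * r ^+ 2 * (s ^+ 2 + c ^+ 2) + z ^+ 2); first by field.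
rewrite hz sc subrK mulr1; transitivity (r ^+ 2 * (s ^+ 2 + c ^+ 2)); last by field.
by rewrite sc subrK; ring.
Qed.

Lemma wicket_meet a b : 0 < rd a -> 0 < rd b ->
  wicket (ends a) `&` wicket (ends b) = set0 <-> ~ meet a b.
Proof.
move=> ra rb; split=> [E [l [m [hl hm hx hy hz]]]|nm].
  have z0 : 0 <= rd a ^+ 2 * (1 - l ^+ 2).
    by rewrite mulr_ge0 ?sqr_ge0//; nra.
  suff : (wicket (ends a) `&` wicket (ends b))
    (cx a + l * rd a * sin (an a), cy a + l * rd a * cos (an a),
     Num.sqrt (rd a ^+ 2 * (1 - l ^+ 2))) by rewrite E.
  split; apply/mem_wicket => //; [exists l|exists m]; split=> //.
  - exact: sqrtr_ge0.
  - by rewrite sqr_sqrtr.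
  - exact: sqrtr_ge0.
  - by rewrite sqr_sqrtr// hz.
apply/seteqP; split=> // -[[x y] z] [/(mem_wicket _ _ _ ra) [l [hl hx hy _ hz]]].
move=> /(mem_wicket _ _ _ rb) [m [hm hx' hy' _ hz']].
by apply: nm; exists l, m; split=> //; rewrite -?hx -?hy -?hz.
Qed.

(** Angles equal modulo [pi], expressed by a common sign of sine and cosine. *)
Definition same a b : Prop := [/\ cx a = cx b, cy a = cy b, rd a = rd b &
  exists e : bool, sin (an a) = (-1) ^+ e * sin (an b) /\
                   cos (an a) = (-1) ^+ e * cos (an b)].

Lemma same_endpt a b : same a b -> exists e : bool, forall u, endpt a u = endpt b (e (+) u).
Proof.
move=> [ex ey er [e [es ec]]]; exists e => u; rewrite /endpt ex ey er es ec signr_addb.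
by congr (_ + _, _ + _); ring.
Qed.

Lemma wicket_swap (p q : R * R) : wicket (p, q) = wicket (q, p).
Proof.
case: p q => a b [c d]; apply/seteqP; split=> -[[x y] z] [z0 h1 h2]; split=> //.
- by lra.
- by rewrite (addrC c) (addrC d) h2; congr (_ / _); ring.
- by lra.
- by rewrite (addrC a) (addrC b) h2; congr (_ / _); ring.
Qed.

(** The points of height 0 of a wicket are its two endpoints, so the set of points determines the
    unordered pair of endpoints. *)
Lemma same_wicket a b : 0 < rd a -> 0 < rd b ->
  wicket (ends a) = wicket (ends b) <-> same a b.
Proof.
move=> ra rb; split=> [E|/same_endpt[[] E]]; last 2 first.
- have -> : ends a = (endpt b false, endpt b true) by rewrite /ends !E.
  exact: wicket_swap.
- by rewrite /ends !E.
have ground e : wicket (ends a) ((endpt a e).1, (endpt a e).2, 0).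
  apply/mem_wicket => //; exists ((-1) ^+ e); split=> //; first exact: sign_bound.
  by rewrite sqrr_sign subrr mulr0 expr0n.
have {}ground e : exists u, endpt a e = endpt b u.
  have := ground e; rewrite E => /(mem_wicket _ _ _ rb) [l [hl hx hy _]].
  rewrite expr0n /= => /esym/eqP; rewrite mulf_eq0 sqrf_eq0 gt_eqF//= subr_eq0 eq_sym.
  rewrite sqrf_eq1 => /orP[] /eqP el; [exists false|exists true];
    by rewrite [LHS]surjective_pairing hx hy el /endpt.
have [u hu] := ground true; have [v hv] := ground false.
have uv : v = ~~ u.
  case: (eqVneq u v) => [uv|]; last by case: (u); case: (v).
  by have := endpt_inj ra (etrans hu (etrans (congr1 _ uv) (esym hv))).
rewrite {}uv in hv; move: hu hv; rewrite /endpt /= expr0 expr1 => -[h1 h2] [h3 h4].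
have ex : cx a = cx b by case: (u) h1 h3 => /= ; rewrite ?expr0 ?expr1; lra.
have ey : cy a = cy b by case: (u) h2 h4 => /= ; rewrite ?expr0 ?expr1; lra.
have hs : rd a * sin (an a) = (-1) ^+ (~~ u) * (rd b * sin (an b)).
  by case: (u) h1 h3 => /= ; rewrite ?expr0 ?expr1; lra.
have hc : rd a * cos (an a) = (-1) ^+ (~~ u) * (rd b * cos (an b)).
  by case: (u) h2 h4 => /= ; rewrite ?expr0 ?expr1; lra.
have er : rd a = rd b.
  apply/eqP; rewrite -(@eqrXn2 _ 2) ?ltW//; apply/eqP.
  have F (r t : R) : r ^+ 2 = (r * sin t) ^+ 2 + (r * cos t) ^+ 2.
    by rewrite !exprMn sincos; ring.
  by rewrite (F (rd a) (an a)) (F (rd b) (an b)) hs hc !(exprMn _ ((-1) ^+ _)) !sqrr_sign !mul1r.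
split=> //; exists (~~ u); split; apply: (mulfI (lt0r_neq0 rb)).
  by rewrite -{1}er hs; ring.
by rewrite -{1}er hc; ring.
Qed.

Lemma same_refl a : same a a.
Proof. by split=> //; exists false; rewrite expr0 !mul1r. Qed.

Lemma same_sym a b : same a b -> same b a.
Proof.
move=> [? ? ? [e [es ec]]]; split=> //; exists e.
by rewrite es ec !mulrA -!expr2 !sqrr_sign !mul1r.
Qed.

Lemma same_trans a b d : same a b -> same b d -> same a d.
Proof.
move=> [h1 h2 h3 [e [es ec]]] [k1 k2 k3 [f [fs fc]]]; split.
- by rewrite h1.
- by rewrite h2.
- by rewrite h3.
- by exists (e (+) f); rewrite es ec fs fc !signr_addb !mulrA.
Qed.

(* The deck transformation matching b' to a, applied to b. *)
Definition transport_angle a b b' : wk R := (cx b, cy b, rd b, an a + (an b - an b')).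

Lemma same_transport a b b' : same a b' -> same (transport_angle a b b') b.
Proof.
move=> [_ _ _ [e [es ec]]]; split=> //; exists e.
rewrite /transport_angle /=; set t := an b - an b'.
have -> : an b = an b' + t by rewrite /t; ring.
by rewrite !sinD !cosD es ec; split; ring.
Qed.

(** The sine of the difference of the angles vanishes, and [1 <= pi / 2] keeps this difference where
    sine is injective. *)
Lemma same_angle a b : same a b -> `|an a - an b| < 1 -> a = b.
Proof.
move=> [ex ey er [e [es ec]]] lt1; apply: wk_eq => //; apply/eqP; rewrite -subr_eq0; apply/eqP.
have pi2 : (1 : R) <= pi / 2 by exact: pihalf_ge1.
have S0 : sin (an a - an b) = 0 by rewrite sinB es ec; ring.
apply: sin_inj; rewrite ?in_itv /= ?sin0//.
  by move: lt1; rewrite ltr_norml => /andP[h1 h2]; apply/andP; split; lra.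
by apply/andP; split; lra.
Qed.

End WicketSets.

Section ConfigSpace.
Variables (R : realType) (n : nat).
Local Notation cfg := ('I_n -> wk R).
Local Notation W := (wicket_space R n).
Local Notation valid := (@valid R _ [set: 'I_n]%SET).
Local Notation ctsF f := (forall i, continuous (fun t => f t i : R * R * R * R)).
Implicit Types c : cfg.

Lemma valid_rd c i : valid c -> 0 < rd (c i).
Proof. by case=> r0 _; apply: r0. Qed.

Lemma valid_meet c i j : valid c -> i != j -> ~ meet (c i) (c j).
Proof. by case=> _ h; apply: h. Qed.

Lemma validP c : (forall i, 0 < rd (c i)) -> (forall i j, i != j -> ~ meet (c i) (c j)) ->
  valid c.
Proof. by move=> h1 h2; split=> [i _|i j _ _]; [exact: h1|exact: h2]. Qed.

Definition ends_of c : {ptws 'I_n -> endpoints R} := fun i => ends (c i).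

Lemma valid_ends c : valid c -> ends_of c \in @disjoint_wickets R n.
Proof.
move=> v; rewrite inE; split=> [i E|i j ij].
  by have := endpt_inj (valid_rd i v) E.
by apply/(wicket_meet (valid_rd i v) (valid_rd j v)); exact: valid_meet.
Qed.

Definition ordered c (v : valid c) : ordered_wickets R n :=
  exist (fun e => e \in @disjoint_wickets R n) (ends_of c) (valid_ends v).

(** The covering map. The base configuration is a default value for families that are not valid. *)
Definition U c : W :=
  if pselect (valid c) is left v then unordered (ordered v) else base_config R n.

Lemma UE c (v : valid c) : U c = unordered (ordered v).
Proof.
rewrite /U; case: pselect => // v'.
by rewrite (Prop_irrelevance v v').
Qed.

Lemma unordered_eq (e e' : ordered_wickets R n) :
  unordered e = unordered e' <-> wicket_set e = wicket_set e'.
Proof.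
split; first by move=> /eqmodP/asboolP.
by move=> h; apply/eqmodP/asboolP.
Qed.

(** Disjoint wickets are distinct as sets, so two labellings of one set of wickets differ by a
    bijection of the labels and by half turns. *)
Lemma U_eqP c c' : valid c -> valid c' ->
  U c' = U c <-> exists s : 'I_n -> 'I_n, injective s /\ forall i, same (c' i) (c (s i)).
Proof.
move=> v v'; rewrite !UE; split=> [/unordered_eq E|[s [s_inj hs]]]; last first.
  apply/unordered_eq/seteqP; split=> _ [i _ <-] /=.
    exists (s i) => //; rewrite set_valE /=.
    by apply/(same_wicket (valid_rd _ v) (valid_rd _ v')); exact: same_sym.
  exists (invF s_inj i) => //; rewrite set_valE /=.
  apply/(same_wicket (valid_rd _ v') (valid_rd _ v)).
  by have := hs (invF s_inj i); rewrite f_invF.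
have /choice[s hs] i : exists j, same (c' i) (c j).
  have : wicket_set (ordered v') (wicket (ends (c' i))) by exists i.
  rewrite E => -[j _]; rewrite set_valE /= => h; exists j.
  by apply/(same_wicket (valid_rd _ v') (valid_rd _ v)).
exists s; split=> //.
  move=> i j ij; apply/eqP; apply: contraT => nij.
  have S : same (c' i) (c' j).
    by apply: same_trans (hs i) _; rewrite ij; exact: same_sym.
  have [e he] := same_endpt S.
  by case: (valid_meet v' nij); exact: endpt_meet (he true).
Qed.

Lemma ptws_cts (T : topologicalType) (f : T -> {ptws 'I_n -> endpoints R}) :
  (forall i, continuous (fun t => f t i)) -> continuous f.
Proof.
move=> cf x; apply/cvg_sup => i A /= [B [[C oC CB] Bx BA]].
rewrite -CB in Bx.
have h : \forall t \near x, C (f t i) by apply: (cf i x); exact: open_nbhs_nbhs.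
apply: (@filterS _ (nbhs x) _ [set t | C (f t i)] [set t | A (f t)]) h.
by move=> t Ct; apply: BA; rewrite -CB.
Qed.

Lemma U_cts (T : topologicalType) (f : T -> cfg) :
  ctsF f -> (forall t, valid (f t)) -> continuous (fun t => U (f t)).
Proof.
move=> cf v.
have -> : (fun t => U (f t)) = (fun t => unordered (ordered (v t))).
  by apply/funext => t; rewrite UE.
apply: (@compose_continuous _ _ _ (fun t => ordered (v t)) (@unordered R n)); last exact: pi_continuous.
apply: continuous_comp_initial.
apply: ptws_cts => i.
have -> : (fun t => (set_val \o (fun t => ordered (v t))) t i) = (fun t => ends (f t i)).
  by apply/funext => t /=; rewrite set_valE.
by rewrite /ends /endpt; cts.
Qed.

Lemma proj_cts i : continuous (fun e : ordered_wickets R n =>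
  set_val e i : (R * R) * (R * R)).
Proof.
apply: (@compose_continuous _ _ _ (fun e : ordered_wickets R n => set_val e)
  (fun e : {ptws 'I_n -> endpoints R} => e i)); first exact: initial_continuous.
exact: (@proj_continuous _ (fun _ : 'I_n => endpoints R) i).
Qed.

End ConfigSpace.

(** * Local polar coordinates of pairs of endpoints *)

Section Polar.
Variable R : realType.
Implicit Types (t : R) (sg : bool) (p q : R * R).

Definition pdir sg p q : R * R := ((-1) ^+ sg * (q.1 - p.1), (-1) ^+ sg * (q.2 - p.2)).
Definition pdot t sg p q : R := (pdir sg p q).1 * sin t + (pdir sg p q).2 * cos t.
Definition pcross t sg p q : R := (pdir sg p q).1 * cos t - (pdir sg p q).2 * sin t.

(* Polar coordinates with angle near t; dividing by the maximum makes this
   continuous everywhere. *)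
Definition pol (d : R) t sg p q : wk R :=
  ((p.1 + q.1) / 2, (p.2 + q.2) / 2,
   Num.sqrt ((pdir sg p q).1 ^+ 2 + (pdir sg p q).2 ^+ 2) / 2,
   t + atan (pcross t sg p q / Num.max d (pdot t sg p q))).

(** As [pdot] is positive, the polar angle lies within a quarter turn of [t], where it is recovered
    by the arc tangent. *)
Lemma pol_ends d t sg p q : 0 < d <= pdot t sg p q ->
  0 < rd (pol d t sg p q) /\ forall e, endpt (pol d t sg p q) e = if sg (+) e then p else q.
Proof.
move=> /andP[d0 dd]; have p0 := lt_le_trans d0 dd.
rewrite /pol (max_idPr dd).
set vx := (pdir sg p q).1; set vy := (pdir sg p q).2.
set phi := atan _; set rho := Num.sqrt _.
have E : vx ^+ 2 + vy ^+ 2 = pdot t sg p q ^+ 2 + pcross t sg p q ^+ 2.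
  rewrite /pdot /pcross -/vx -/vy.
  transitivity ((vx ^+ 2 + vy ^+ 2) * (sin t ^+ 2 + cos t ^+ 2)); last by ring.
  by rewrite sincos subrK mulr1.
have rho0 : 0 < rho.
  by rewrite sqrtr_gt0 E ltr_pwDl ?sqr_ge0// exprn_gt0.
have rho2 : rho ^+ 2 = pdot t sg p q ^+ 2 + pcross t sg p q ^+ 2.
  by rewrite sqr_sqrtr ?E// addr_ge0 ?sqr_ge0.
have cphi : cos phi = pdot t sg p q / rho.
  rewrite cos_atan; have -> : 1 + (pcross t sg p q / pdot t sg p q) ^+ 2 = (rho / pdot t sg p q) ^+ 2.
    by rewrite !expr_div_n rho2; field; rewrite gt_eqF.
  by rewrite sqrtr_sqr gtr0_norm ?divr_gt0// invf_div.
have sphi : sin phi = pcross t sg p q / rho.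
  have c0 : cos phi != 0 by rewrite cphi gt_eqF// divr_gt0.
  have := atanK (pcross t sg p q / pdot t sg p q); rewrite -/phi /tan => h.
  have -> : sin phi = sin phi / cos phi * cos phi by rewrite divfK.
  by rewrite h cphi; field; rewrite !gt_eqF.
have sE : rho * sin (t + phi) = vx.
  rewrite sinD sphi cphi; transitivity (sin t * pdot t sg p q + cos t * pcross t sg p q).
    by field; rewrite gt_eqF.
  transitivity (vx * (sin t ^+ 2 + cos t ^+ 2)); last by rewrite sincos subrK mulr1.
  by rewrite /pdot /pcross -/vx -/vy; ring.
have cE : rho * cos (t + phi) = vy.
  rewrite cosD sphi cphi; transitivity (cos t * pdot t sg p q - sin t * pcross t sg p q).
    by field; rewrite gt_eqF.
  transitivity (vy * (sin t ^+ 2 + cos t ^+ 2)); last by rewrite sincos subrK mulr1.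
  by rewrite /pdot /pcross -/vx -/vy; ring.
split=> [|e] /=; first by rewrite divr_gt0.
have -> : endpt ((p.1 + q.1) / 2, (p.2 + q.2) / 2, rho / 2, t + phi) e =
    ((p.1 + q.1) / 2 + (-1) ^+ e * vx / 2, (p.2 + q.2) / 2 + (-1) ^+ e * vy / 2).
  by rewrite /endpt /= -sE -cE; congr (_ + _, _ + _); field.
rewrite /vx /vy /pdir; case: sg {vx vy phi rho E rho0 rho2 cphi sphi sE cE dd p0} => /=;
  case: e; case: p => p1 p2; case: q => q1 q2 /=; rewrite ?expr0 ?expr1;
  by congr pair; field.
Qed.

Lemma pol_wicket d t sg p q : 0 < d <= pdot t sg p q ->
  wicket (ends (pol d t sg p q)) = wicket (p, q).
Proof.
move=> /pol_ends[_ h]; rewrite /ends !h; case: sg h => _ //=.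
exact: wicket_swap.
Qed.

(** One of the two coordinate directions is not orthogonal to the segment; [sg] orients the segment
    accordingly. *)
Lemma polar_dir p q : p <> q -> exists t sg, 0 < pdot t sg p q.
Proof.
move=> pq; have F (x : R) : x != 0 -> 0 < (-1) ^+ (x < 0)%R * x.
  move=> x0; have [h|h] := ltP x 0; rewrite ?expr0 ?expr1; first by rewrite mulN1r oppr_gt0.
  by rewrite mul1r lt_def x0.
have [e|ne] := eqVneq (q.2 - p.2) 0; last first.
  exists 0, (q.2 - p.2 < 0); rewrite /pdot sin0 cos0 mulr0 add0r mulr1 /=.
  exact: F.
exists (pi / 2), (q.1 - p.1 < 0).
rewrite /pdot sin_pihalf cos_pihalf mulr0 addr0 mulr1 /=; apply: F.
apply/eqP => e1; apply: pq; move: e e1; case: p q => p1 p2 [q1 q2] /=.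
by move=> /subr0_eq -> /subr0_eq ->.
Qed.

Lemma polar_exists p q : p <> q -> exists a : wk R, 0 < rd a /\ wicket (ends a) = wicket (p, q).
Proof.
move=> /polar_dir[t [sg h]].
exists (pol (pdot t sg p q) t sg p q); split; last by rewrite pol_wicket// h lexx.
by apply: (pol_ends _).1; rewrite h lexx.
Qed.

Lemma pol_self (a : wk R) d sg p q : 0 < rd a -> 0 < d ->
  (forall e, endpt a e = if sg (+) e then p else q) ->
  pol d (an a) sg p q = a /\ pdot (an a) sg p q = 2 * rd a.
Proof.
move=> ra d0 h.
have hf := h false; have ht := h true; rewrite addbF in hf; rewrite addbT in ht.
have [v1 v2] : (pdir sg p q).1 = 2 * rd a * sin (an a) /\ (pdir sg p q).2 = 2 * rd a * cos (an a).
  rewrite /pdir /=; case: sg {h} hf ht => /= <- <-; rewrite /endpt /= ?expr0 ?expr1; split; ring.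
have dE : pdot (an a) sg p q = 2 * rd a.
  rewrite /pdot v1 v2; transitivity (2 * rd a * (sin (an a) ^+ 2 + cos (an a) ^+ 2)); first by ring.
  by rewrite sincos subrK mulr1.
split=> //; apply: wk_eq => /=.
- by case: sg {h v1 v2 dE} hf ht => /= <- <-; rewrite /endpt /= ?expr0 ?expr1; field.
- by case: sg {h v1 v2 dE} hf ht => /= <- <-; rewrite /endpt /= ?expr0 ?expr1; field.
- rewrite /pdir /= in v1 v2; rewrite v1 v2; have -> : (2 * rd a * sin (an a)) ^+ 2 + (2 * rd a * cos (an a)) ^+ 2 =
      (2 * rd a) ^+ 2 by rewrite !(exprMn _ (2 * rd a)) sincos; ring.
  by rewrite sqrtr_sqr gtr0_norm ?mulr_gt0//; field.
- have -> : pcross (an a) sg p q = 0 by rewrite /pcross v1 v2; ring.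
  by rewrite mul0r atan0 addr0.
Qed.

Lemma atan_cts (T : topologicalType) (f : T -> R) :
  continuous f -> continuous (fun t : T => atan (f t) : R).
Proof. by move=> cf; apply: compose_continuous cf _; exact: continuous_atan. Qed.

Lemma pol_cts (T : topologicalType) d t sg (f : T -> (R * R) * (R * R)) : 0 < d ->
  continuous f -> continuous (fun x => pol d t sg (f x).1 (f x).2 : R * R * R * R).
Proof.
move=> d0 cf; rewrite /pol /pcross /pdot /pdir.
apply: pair_continuous; first by cts.
apply: addr_continuous; first by cts.
apply: atan_cts; apply: mulr_continuous; first by cts.
apply: inv_cts; last by cts.
by move=> x; rewrite gt_eqF// lt_max d0.
Qed.

End Polar.

(** * Local injectivity and openness of the covering map *)

Section Nearness.
Variables (R : realType) (n : nat).
Local Notation cfg := ('I_n -> wk R).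
Local Notation W := (wicket_space R n).
Local Notation valid := (@valid R _ [set: 'I_n]%SET).
Local Notation ctsF f := (forall i, continuous (fun t => f t i : R * R * R * R)).
Implicit Types c : cfg.

(** A distance that ignores angles and is therefore invariant under half turns. *)
Definition gapd (a b : wk R) : R :=
  Num.max (Num.max `|cx a - cx b| `|cy a - cy b|) `|rd a - rd b|.

Lemma gapdC a b : gapd a b = gapd b a.
Proof. by rewrite /gapd (distrC (cx a)) (distrC (cy a)) (distrC (rd a)). Qed.

Lemma gapd_tri a b d : gapd a d <= gapd a b + gapd b d.
Proof.
rewrite /gapd !ge_max -andbA; apply/and3P; split.
- by apply: le_trans (ler_distD (cx b) _ _) _; apply: lerD; rewrite !le_max lexx.
- by apply: le_trans (ler_distD (cy b) _ _) _; apply: lerD; rewrite !le_max lexx orbT.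
- by apply: le_trans (ler_distD (rd b) _ _) _; apply: lerD; rewrite !le_max lexx orbT.
Qed.

Lemma gapd0 a : gapd a a = 0.
Proof. by rewrite /gapd !subrr normr0 !maxxx. Qed.

Lemma gapd_same a b d : same a b -> gapd a d = gapd b d.
Proof. by move=> [h1 h2 h3 _]; rewrite /gapd h1 h2 h3. Qed.

Lemma gapd_cts (T : topologicalType) (a b : T -> wk R) :
  continuous (a : T -> R * R * R * R) -> continuous (b : T -> R * R * R * R) ->
  continuous (fun t => gapd (a t) (b t)).
Proof. by move=> ca cb; rewrite /gapd; cts. Qed.

(** Displacements smaller than this cannot permute the wickets of [c]. *)
Definition sep c : R :=
  (\big[Num.min/1]_(ij : 'I_n * 'I_n | ij.1 != ij.2) gapd (c ij.1) (c ij.2)) / 4.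

(** Two wickets with the same center and radius share their highest point. *)
Lemma sep_gt0 c : valid c -> 0 < sep c.
Proof.
move=> v; rewrite divr_gt0//; apply/bigmin_gtP; split=> // -[i j] /= ij.
rewrite ltNge; apply/negP; rewrite /gapd !ge_max !normr_le0 !subr_eq0.
move=> /andP[/andP[/eqP ex /eqP ey] /eqP er]; apply: (valid_meet v ij).
exists 0, 0; rewrite ex ey er; split; rewrite ?mul0r//; lra.
Qed.

Lemma sep_le c i j : i != j -> 4 * sep c <= gapd (c i) (c j).
Proof.
move=> ij; rewrite /sep mulrC divfK ?pnatr_eq0//.
exact: (bigmin_le_cond _ (j := (i, j))).
Qed.

Definition near (d : R) c c' : Prop :=
  forall i, gapd (c i) (c' i) < d /\ `|an (c i) - an (c' i)| < 2^-1.

(** Closeness of centers and radii excludes a permutation of the labels, closeness of angles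
    excludes a half turn. *)
Lemma near_inj c c1 c2 : valid c -> valid c1 -> valid c2 ->
  near (sep c) c c1 -> near (sep c) c c2 -> U c1 = U c2 -> c1 = c2.
Proof.
move=> v v1 v2 n1 n2 /(U_eqP v2 v1)[s [_ hs]]; apply/funext => i.
have si : s i = i.
  apply/eqP; apply: contraT => si.
  have h1 := gapd_tri (c i) (c1 i) (c (s i)); have := sep_le c si.
  rewrite (gapd_same _ (hs i)) (gapdC (c2 (s i))) in h1 => h2.
  have := (n2 (s i)).1; have := (n1 i).1; have := sep_gt0 v; rewrite gapdC in h2; lra.
apply: same_angle; first by have := hs i; rewrite si.
have := (n1 i).2; have := (n2 i).2; rewrite !ltr_norml => /andP[? ?] /andP[? ?].
by apply/andP; split; lra.
Qed.

Lemma U_surj (w : W) : exists2 c, valid c & U c = w.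
Proof.
have [e ->] : exists e, w = unordered e.
  by exists (repr (w : {eq_quot @same_wickets R n}%qT)); rewrite /unordered reprK.
have : set_val e \in @disjoint_wickets R n by rewrite set_valE; apply: valP.
rewrite inE => -[d1 d2].
have /choice[c cP] i : exists a, 0 < rd a /\ wicket (ends a) = wicket (set_val e i).
  have := @d1 i; case: (set_val e i) => p q /= pq; exact: polar_exists pq.
have v : valid c.
  apply: validP => [i|i j ij]; first by case: (cP i).
  by apply/wicket_meet; rewrite ?(cP _).1// !(cP _).2; exact: d2.
exists c => //; rewrite UE; apply/unordered_eq.
have E i : wicket (set_val (ordered v) i) = wicket (set_val e i).
  by rewrite -(cP i).2 [in LHS]set_valE.
by apply/seteqP; split=> _ [i _ <-]; exists i => //; rewrite E.
Qed.

(** Close to a given configuration, with a fixed numbering and orientation of the endpoint pairs,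
    polar coordinates depend continuously on the endpoints. They give a local section of [U] through
    the given labelled configuration. *)
Lemma U_open c0 (d : R) : 0 < d -> open [set w : W | exists c,
  [/\ valid c, U c = w & forall i, gapd (c0 i) (c i) < d /\ `|an (c0 i) - an (c i)| < d]].
Proof.
move=> d0; rewrite /open /= /quotient_open.
rewrite openE => e [c [v Ue hc]]; rewrite /interior.
have [c1 v1 U1] := U_surj (unordered e).
have E1 : wicket_set (ordered v) = wicket_set e by apply/unordered_eq; rewrite -UE.
have De (e' : ordered_wickets R n) : disjoint_wickets (set_val e').
  by apply/set_mem; rewrite set_valE; exact: valP.
(* The numbering of [e] is matched with the labels of [c] by [s], and below the order of the two
   endpoints with the orientation by [sg]. *)
have /choice[s sP] i : exists j, wicket (ends (c j)) = wicket (set_val e i).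
  have : wicket_set e (wicket (set_val e i)) by exists i.
  by rewrite -E1 => -[j _]; rewrite set_valE /=; exists j.
have s_inj : injective s.
  move=> i j ij; apply/eqP; apply: contraT => nij.
  have := (De e).2 i j nij; rewrite -!sP ij setIid => E0.
  have rj := valid_rd (s j) v.
  suff : wicket (ends (c (s j))) (cx (c (s j)), cy (c (s j)), rd (c (s j))) by rewrite E0.
  apply/mem_wicket => //; exists 0; rewrite !mul0r !addr0 expr0n subr0 mulr1.
  by split=> //; [lra|exact: ltW].
have /choice[sg sgP] i : exists sg : bool, forall b,
    endpt (c (s i)) b = if sg (+) b then (set_val e i).1 else (set_val e i).2.
  have pq : (set_val e i).1 <> (set_val e i).2 by apply: (De e).1.
  have [a [ra aE]] : exists a : wk R, 0 < rd a /\ exists sg : bool, forall b,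
      endpt a b = if sg (+) b then (set_val e i).1 else (set_val e i).2.
    have [t [g h]] := polar_dir pq.
    exists (pol (pdot t g (set_val e i).1 (set_val e i).2) t g (set_val e i).1 (set_val e i).2).
    have hh : 0 < pdot t g (set_val e i).1 (set_val e i).2 <= pdot t g (set_val e i).1 (set_val e i).2.
      by rewrite h lexx.
    by split; [exact: (pol_ends hh).1|exists g; exact: (pol_ends hh).2].
  have [g gE] := aE.
  have W1 : wicket (ends (c (s i))) = wicket (ends a).
    rewrite sP /ends !gE; case: (set_val e i) => p q; case: (g) => //=; exact: wicket_swap.
  have /(same_wicket (valid_rd _ v) ra)/same_endpt[u hu] := W1.
  by exists (g (+) u) => b; rewrite hu gE addbA.
pose t i := an (c (s i)); pose r i := rd (c (s i)).
pose P i (e' : ordered_wickets R n) := pol (r i) (t i) (sg i) (set_val e' i).1 (set_val e' i).2.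
have r0 i : 0 < r i by exact: valid_rd.
have cP i : continuous (fun e' => P i e' : R * R * R * R).
  by apply: pol_cts => //; exact: proj_cts.
have Pe i : P i e = c (s i) /\ pdot (t i) (sg i) (set_val e i).1 (set_val e i).2 = 2 * r i.
  exact: (pol_self (valid_rd (s i) v) (r0 i) (sgP i)).
have cdot i : continuous (fun e' : ordered_wickets R n =>
    pdot (t i) (sg i) (set_val e' i).1 (set_val e' i).2).
  have c' := @proj_cts R n i; rewrite /pdot /pdir.
  by cts.
have H : \forall e' \near e, forall i,
    [/\ r i < pdot (t i) (sg i) (set_val e' i).1 (set_val e' i).2,
        gapd (c0 (s i)) (P i e') < d & `|an (c0 (s i)) - an (P i e')| < d].
  apply: (@filter_forall _ _ (fun i e' =>
    [/\ r i < pdot (t i) (sg i) (set_val e' i).1 (set_val e' i).2,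
        gapd (c0 (s i)) (P i e') < d & `|an (c0 (s i)) - an (P i e')| < d]) _ (nbhs_filter e)) => i.
  have h1 : \forall e' \near e, r i < pdot (t i) (sg i) (set_val e' i).1 (set_val e' i).2.
    apply: (@near_lt R _ (fun=> r i) _ e _ (cdot i)); first by cts.
    by rewrite (Pe i).2; have := r0 i; lra.
  have h2 : \forall e' \near e, gapd (c0 (s i)) (P i e') < d.
    apply: (@near_lt R _ (fun e' => gapd (c0 (s i)) (P i e')) (fun=> d)); [|by cts|].
      by apply: gapd_cts; [cts|].
    by rewrite (Pe i).1; exact: (hc (s i)).1.
  have h3 : \forall e' \near e, `|an (c0 (s i)) - an (P i e')| < d.
    apply: (@near_lt R _ (fun e' => `|an (c0 (s i)) - an (P i e')|) (fun=> d)); [|by cts|].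
      by have c' := cP i; apply: norm_cts; apply: subr_continuous; cts.
    by rewrite (Pe i).1; exact: (hc (s i)).2.
  by apply: filterS3 h1 h2 h3.
apply: filterS H => e' H; rewrite /preimage /=.
pose c' j := P (invF s_inj j) e'.
have pd i : 0 < r i <= pdot (t i) (sg i) (set_val e' i).1 (set_val e' i).2.
  by rewrite r0 ltW//; case: (H i).
have PW i : wicket (ends (P i e')) = wicket (set_val e' i).
  by rewrite pol_wicket//; case: (set_val e' i).
have v' : valid c'.
  apply: validP => [j|j k jk]; first exact: (pol_ends (pd _)).1.
  apply/wicket_meet; rewrite ?(pol_ends (pd _)).1// !PW; apply: (De e').2.
  by apply: contra_neq jk => E; rewrite -(f_invF s_inj j) E f_invF.
exists c'; split=> //.
  rewrite UE; apply/unordered_eq; apply/seteqP; split=> _ [i _ <-].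
    by exists (invF s_inj i) => //; rewrite set_valE /= -PW.
  by exists (s i) => //; rewrite -PW [in LHS]set_valE /= /ends_of /c' invF_f.
move=> j; have [_ h2 h3] := H (invF s_inj j).
by move: h2 h3; rewrite f_invF.
Qed.

End Nearness.

(** * Sections of coverings of compact contractible spaces *)

Section LocalSections.
Variables (R : realType) (T : topologicalType) (E : Type).
(** A covering is given through its germs: [loc x s] means that [s] is a section near [x], and
    [Fib x] is the fibre. As [E] carries no topology, the argument applies both to labelled
    configurations and to elements of a group. *)
Variable loc : T -> (T -> E) -> Prop.
Variable Fib : T -> E -> Prop.
Hypothesis loc_germ : forall x s s', (\forall y \near x, s y = s' y) -> loc x s -> loc x s'.
Hypothesis loc_fib : forall x s, loc x s -> Fib x (s x).
Hypothesis loc_uniq : forall x s s', loc x s -> loc x s' ->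
  \forall y \near x, s y = s' y <-> s x = s' x.

Definition evenly (V : set T) : Prop :=
  forall y e, V y -> Fib y e -> exists2 s, s y = e & forall z, V z -> loc z s.
Hypothesis loc_ex : forall x : T, exists2 V : set T, nbhs x V & evenly V.

Lemma section_eq_path (a : R -> T) s s' : continuous a ->
  (forall t : R, 0 <= t <= 1 -> loc (a t) s) -> (forall t : R, 0 <= t <= 1 -> loc (a t) s') ->
  s (a 0) = s' (a 0) -> s (a 1) = s' (a 1).
Proof.
move=> ca l l' e0; apply: (@real_induction R (fun t => s (a t) = s' (a t))) => //; last by lra.
move=> u u01; have := ca u _ (loc_uniq (l u u01) (l' u u01)).
move=> /nbhs_ballP[d d0 hd]; exists d => // v w _ _; rewrite !(distrC _ u) => hv hw.
by move=> /(hd v hv).1/(hd w hw).2.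
Qed.

Lemma section_eq_segment (ct : R * T -> T) (v w : R) x s s' : continuous ct ->
  (forall t : R, Num.min v w <= t <= Num.max v w -> loc (ct (t, x)) s) ->
  (forall t : R, Num.min v w <= t <= Num.max v w -> loc (ct (t, x)) s') ->
  s (ct (v, x)) = s' (ct (v, x)) -> s (ct (w, x)) = s' (ct (w, x)).
Proof.
move=> cct l l' e0.
have b (t : R) : 0 <= t <= 1 -> Num.min v w <= v + t * (w - v) <= Num.max v w.
  move=> /andP[t0 t1]; rewrite /Num.min /Num.max; case: ltP => h; apply/andP; split; nra.
have := @section_eq_path (fun t => ct (v + t * (w - v), x)) s s'.
rewrite !mul0r !mul1r addr0 addrCA subrr addr0; apply.
- by apply: compose_continuous cct; cts.
- by move=> t t01; apply/l/b.
- by move=> t t01; apply/l'/b.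
- exact: e0.
Qed.

Variables (ct : R * T -> T) (x0 : T).
Hypothesis T_compact : compact [set: T].
Hypothesis ct_cts : continuous ct.
Hypothesis ct0 : forall x, ct (0, x) = x0.
Hypothesis ct1 : forall x, ct (1, x) = x.
Hypothesis ctx0 : forall u, ct (u, x0) = x0.

(** Sections of the covering pulled back along stage [u] of the contraction. *)
Definition pullback_section (u : R) (g : T -> E) : Prop := forall x, exists s V,
  [/\ nbhs (ct (u, x)) V, forall z, V z -> loc z s & \forall y \near x, g y = s (ct (u, y))].

(** At stage 0 the contraction is constant and so is the section; stage 1 is the identity. Between
    two stages close to [u] the value at each point is continued along its track inside an evenly
    covered set, and uniqueness makes the continuations at nearby points agree. *)
Lemma section_exists e0 : Fib x0 e0 -> exists2 g : T -> E, g x0 = e0 & forall x, loc x g.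
Proof.
move=> F0.
suff [g [g0 hg]] : exists g, g x0 = e0 /\ pullback_section 1 g.
  exists g => // x; have [s [V [nV lV gs]]] := hg x; rewrite ct1 in nV.
  apply: (loc_germ (s := s)); last exact: (lV _ (nbhs_singleton nV)).
  by apply: filterS gs => y ->; rewrite ct1.
apply: (@real_induction R (fun u => exists g, g x0 = e0 /\ pullback_section u g)); last by lra.
  move=> u _.
  (* The absolute value of [r] makes the condition meaningful on both sides of 0, as [tube]
     requires. *)
  pose Q (x : T) (r : R) := exists V, evenly V /\ open V /\
    \forall x' \near x, forall t : R, `|t - u| <= `|r| -> V (ct (t, x')).
  have Qn x : [set: T] x -> \forall y \near (x, 0 : R), Q y.1 y.2.
    move=> _; have [V nV eV] := loc_ex (ct (u, x)).
    have [B [nB BV]] : exists B, nbhs (ct (u, x)) B /\ evenly B /\ open B.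
      exists V°; split; first exact: nbhs_interior.
      split; last exact: open_interior.
      by move=> y e /interior_subset Vy /(eV _ _ Vy)[s sy hs]; exists s => // z /interior_subset/hs.
    have : nbhs (u, x) (ct @^-1` B) by exact: ct_cts.
    move=> [[C D] /= [nC nD] CD].
    have /nbhs_ballP[d d0 hd] := nC.
    rewrite /Q; exists (D°, ball (0 : R) d); first by split; [exact: nbhs_interior|exact: nbhsx_ballx].
    move=> -[y t] /= [Dy]; rewrite /ball /= sub0r normrN => td.
    exists B; split; [exact: BV.1|split; first exact: BV.2].
    apply: filterS (Dy) => x' Dx' t' tt; apply: (CD (t', x')); split=> //=.
    by apply: hd; rewrite /ball /= distrC; apply: le_lt_trans tt td.
  have [d d0 hd] := tube T_compact Qn.
  have d2 : `|d / 2| = d / 2 by rewrite gtr0_norm// divr_gt0.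
  have hV0 (x : T) : exists V : set T, evenly V /\ open V /\
      \forall x' \near x, forall t : R, `|t - u| <= d / 2 -> V (ct (t, x')).
    by have := hd (d / 2) _ x Logic.I; rewrite /Q subr0 d2; apply; lra.
  have [V hV1] := choice hV0.
  exists (d / 2); first by rewrite divr_gt0.
  move=> v w v01 w01 hv hw [g [g0 hg]].
  have Fg x : Fib (ct (v, x)) (g x).
    have [s [A [nA lA gs]]] := hg x.
    by rewrite (nbhs_singleton gs); exact: (loc_fib (lA _ (nbhs_singleton nA))).
  have tb (t : R) : Num.min v w <= t <= Num.max v w -> `|t - u| <= d / 2.
    move: hv hw; rewrite !ltr_norml ler_norml => /andP[? ?] /andP[? ?].
    by rewrite ge_min le_max => /andP[/orP[] h1 /orP[] h2]; apply/andP; split; lra.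
  have Vv x : V x (ct (v, x)) by have [_ [_ /nbhs_singleton]] := hV1 x; apply; exact: ltW.
  have /choice[s sP] x : exists s, s (ct (v, x)) = g x /\ forall z, V x z -> loc z s.
    by have [e _] := hV1 x; have [s] := e _ _ (Vv x) (Fg x); exists s.
  exists (fun x => s x (ct (w, x))); split; first by rewrite ctx0 -g0 -(sP x0).1 ctx0.
  move=> x1; have [e [oV nV]] := hV1 x1.
  have Vw : V x1 (ct (w, x1)) by apply: (nbhs_singleton nV); exact: ltW.
  exists (s x1), (V x1); split; [exact: open_nbhs_nbhs|exact: (sP x1).2|].
  have [s'' [A [nA lA gs]]] := hg x1.
  have ag : \forall y \near x1, s'' (ct (v, y)) = s x1 (ct (v, y)).
    have := loc_uniq (lA _ (nbhs_singleton nA)) ((sP x1).2 _ (Vv x1)).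
    have cv : continuous (fun y : T => ct (v, y)).
      by apply: (@compose_continuous _ _ _ (fun y : T => (v, y)) ct) => //; cts.
    move=> un; have un' : nbhs x1 ((fun y => ct (v, y)) @^-1` _) := cv x1 _ un.
    apply: filterS un' => y /= ->.
    by rewrite -(nbhs_singleton gs) (sP x1).1.
  (* The sections chosen at [y] and at [x1] agree at stage [v] over [y], hence along the whole track
     to stage [w]. *)
  apply: filterS3 ag gs nV => y ag gy Vy.
  apply: (section_eq_segment ct_cts (v := v)).
  - by move=> t /tb tt; apply: (sP y).2; apply: (nbhs_singleton (hV1 y).2.2).
  - by move=> t /tb tt; apply: (sP x1).2; apply: Vy.
  - by rewrite (sP y).1 gy ag.
exists (fun=> e0); split=> // x; rewrite ct0.
have [V nV eV] := loc_ex x0; have [s s0 ls] := eV x0 e0 (nbhs_singleton nV) F0.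
exists s, V; split=> //; apply: nearW => y; by rewrite ct0.
Qed.

End LocalSections.

Section Contractions.
Variable R : realType.
Local Notation I := (unit_interval R).

Lemma unit_interval_compact : compact [set: I].
Proof.
have -> : [set: I] = @clamp R @` `[0, 1].
  apply/seteqP; split=> // t _; exists (ival t); last exact: clampK.
  by rewrite /= in_itv /= ival_itv.
apply: continuous_compact; last exact: segment_compact.
by apply: continuous_subspaceT; exact: clamp_continuous.
Qed.

Lemma unit_square_compact : compact [set: I * I].
Proof.
have -> : [set: I * I] = [set: I] `*` [set: I] by apply/seteqP.
by apply: compact_setX; exact: unit_interval_compact.
Qed.

Definition contract1 (z : R * I) : I := clamp (z.1 * ival z.2).
Definition contract2 (z : R * (I * I)) : I * I :=
  (clamp (z.1 * ival z.2.1), clamp (z.1 * ival z.2.2)).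

Lemma contract1_cts : continuous contract1.
Proof. by rewrite /contract1; cts. Qed.
Lemma contract2_cts : continuous contract2.
Proof. by rewrite /contract2; cts. Qed.
Lemma contract1_0 x : contract1 (0, x) = zero.
Proof. by rewrite /contract1 mul0r. Qed.
Lemma contract2_0 x : contract2 (0, x) = (zero, zero).
Proof. by rewrite /contract2 !mul0r. Qed.
Lemma contract1_1 x : contract1 (1, x) = x.
Proof. by rewrite /contract1 mul1r clampK. Qed.
Lemma contract2_1 x : contract2 (1, x) = x.
Proof. by case: x => a b; rewrite /contract2 !mul1r !clampK. Qed.
Lemma contract1_zero u : contract1 (u, zero) = zero.
Proof. by rewrite /contract1 ival0 mulr0. Qed.
Lemma contract2_zero u : contract2 (u, (zero, zero)) = (zero, zero).
Proof. by rewrite /contract2 ival0 mulr0. Qed.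

End Contractions.

(** * Lifting paths and homotopies to labelled wickets *)

Section Lifting.
Variables (R : realType) (n : nat).
Local Notation cfg := ('I_n -> wk R).
Local Notation W := (wicket_space R n).
Local Notation valid := (@valid R _ [set: 'I_n]%SET).
Local Notation ctsF f := (forall i, continuous (fun t => f t i : R * R * R * R)).
Local Notation I := (unit_interval R).
Implicit Types c : cfg.

Definition dist c c' : R :=
  \big[Num.max/0]_i Num.max (gapd (c i) (c' i)) `|an (c i) - an (c' i)|.

Lemma dist_ltP c c' d : 0 < d ->
  dist c c' < d <-> forall i, gapd (c i) (c' i) < d /\ `|an (c i) - an (c' i)| < d.
Proof.
move=> d0; split=> [/bigmax_ltP[_ h] i|h].
  by have := h i isT; rewrite gt_max => /andP[].
by apply/bigmax_ltP; split=> // i _; rewrite gt_max; apply/andP; exact: h.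
Qed.

Lemma dist_ge0 c c' : 0 <= dist c c'.
Proof. exact: bigmax_ge_id. Qed.

Lemma dist_ge c c' i : gapd (c i) (c' i) <= dist c c' /\ `|an (c i) - an (c' i)| <= dist c c'.
Proof.
have : Num.max (gapd (c i) (c' i)) `|an (c i) - an (c' i)| <= dist c c'.
  by apply: (le_bigmax _ (fun i => Num.max (gapd (c i) (c' i)) `|an (c i) - an (c' i)|)).
by rewrite ge_max => /andP[].
Qed.

Lemma dist_tri c c' c'' : dist c c'' <= dist c c' + dist c' c''.
Proof.
apply/bigmax_leP; split=> [|i _]; first by rewrite addr_ge0 ?dist_ge0.
have [h1 h2] := dist_ge c c' i; have [h3 h4] := dist_ge c' c'' i.
rewrite ge_max; apply/andP; split.
  by apply: le_trans (gapd_tri _ (c' i) _) _; exact: lerD.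
by apply: le_trans (ler_distD (an (c' i)) _ _) _; exact: lerD.
Qed.

Lemma distxx c : dist c c = 0.
Proof.
apply: le_anti; rewrite dist_ge0 andbT; apply/bigmax_leP; split=> // i _.
by rewrite gapd0 subrr normr0 maxxx.
Qed.

Lemma dist_eq0 c c' : dist c c' <= 0 -> c = c'.
Proof.
move=> d0; apply/funext => i; have [+ h2] := dist_ge c c' i; move=> h1.
have := le_trans h1 d0; rewrite /gapd !ge_max !normr_le0 !subr_eq0.
move=> /andP[/andP[/eqP ex /eqP ey] /eqP er]; apply: wk_eq => //.
by apply/eqP; rewrite -subr_eq0 -normr_le0; exact: le_trans d0.
Qed.

Lemma near_dist c c' : dist c c' < Num.min (sep c) 2^-1 -> near (sep c) c c'.
Proof.
by rewrite lt_min => /andP[h1 h2] i; have [k1 k2] := dist_ge c c' i; split; lra.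
Qed.

Lemma valid_same c c' (s : 'I_n -> 'I_n) : valid c -> injective s ->
  (forall i, same (c' i) (c (s i))) -> valid c'.
Proof.
move=> v s_inj h; have r' i : 0 < rd (c' i) by have [_ _ -> _] := h i; exact: valid_rd.
apply: validP => // i j ij; apply/wicket_meet => //.
have E k : wicket (ends (c' k)) = wicket (ends (c (s k))).
  by apply/same_wicket => //; exact: valid_rd.
rewrite !E; apply/wicket_meet; [exact: valid_rd..|apply: (valid_meet v)].
by rewrite (inj_eq s_inj).
Qed.

Section Along.
Variables (T : topologicalType) (p : T -> W).
Implicit Types s : T -> cfg.

Definition lifts_at (x : T) s : Prop :=
  (forall d : R, 0 < d -> \forall y \near x, dist (s x) (s y) < d) /\
  \forall y \near x, valid (s y) /\ U (s y) = p y.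

Lemma lifts_at_germ x s s' : (\forall y \near x, s y = s' y) -> lifts_at x s -> lifts_at x s'.
Proof.
move=> e [h1 h2]; have ex := nbhs_singleton e; split=> [d d0|].
  by apply: filterS2 e (h1 d d0) => y <-; rewrite ex.
by apply: filterS2 e h2 => y <-.
Qed.

Lemma lifts_at_uniq x s s' : lifts_at x s -> lifts_at x s' ->
  \forall y \near x, s y = s' y <-> s x = s' x.
Proof.
move=> [c1 l1] [c2 l2]; have [e|ne] := pselect (s x = s' x); last first.
  have d0 : 0 < dist (s x) (s' x).
    by rewrite lt_neqAle dist_ge0 andbT eq_sym; apply/eqP => h; apply/ne/dist_eq0; rewrite h.
  apply: filterS2 (c1 _ (divr_gt0 d0 (ltr0Sn R 1))) (c2 _ (divr_gt0 d0 (ltr0Sn R 1))).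
  move=> y h1 h2; split=> // ey; exfalso.
  have := dist_tri (s x) (s y) (s' x); move: h1 h2; rewrite -ey.
  have -> : dist (s y) (s' x) = dist (s' x) (s y).
    by apply: eq_bigr => i _; rewrite gapdC distrC.
  by move=> h1 h2; lra.
have v := (nbhs_singleton l1).1.
have d0 : 0 < Num.min (sep (s x)) 2^-1 by rewrite lt_min sep_gt0//= invr_gt0.
apply: filterS3 (c1 _ d0) (c2 _ d0) (filterI l1 l2) => y h1 h2 [[v1 u1] [v2 u2]]; split=> // _.
rewrite -e in h2; by apply: (near_inj v v1 v2); [exact: near_dist|exact: near_dist|rewrite u1 u2].
Qed.

Hypothesis p_cts : continuous p.

(** The preimages within [d] of one fixed [c0] are unique by [near_inj] and form a section. A
    section through another point of the fibre is obtained by permuting the labels and adding a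
    constant to each angle, which does not increase [dist]. *)
Lemma lifts_at_ex (x : T) : exists2 V : set T, nbhs x V &
  evenly lifts_at (fun x c => valid c /\ U c = p x) V.
Proof.
have [c0 v0 U0] := U_surj (p x).
pose d := Num.min (sep c0) 2^-1.
have d0 : 0 < d by rewrite lt_min sep_gt0//= invr_gt0.
have near_p c y (e : R) : 0 < e -> valid c -> U c = p y ->
    \forall z \near y, exists c', [/\ valid c', U c' = p z & dist c c' < e].
  move=> e0 v Uc; pose O := [set w : W | exists c',
    [/\ valid c', U c' = w & forall i, gapd (c i) (c' i) < e /\ `|an (c i) - an (c' i)| < e]].
  have : nbhs (p y) O.
    apply: open_nbhs_nbhs; split; first exact: U_open.
    by exists c; split=> // i; rewrite gapd0 subrr normr0.
  move=> Op; have : nbhs y (p @^-1` O) by exact: (@p_cts y).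
  apply: filterS => z [c' [v' U' h]]; exists c'; split=> //.
  exact/dist_ltP.
exists [set z | exists c', [/\ valid c', U c' = p z & dist c0 c' < d]]; first exact: near_p.
(* A choice made pointwise; its continuity follows from uniqueness. *)
have /choice[s0 s0P] z : exists c : cfg,
    (exists c', [/\ valid c', U c' = p z & dist c0 c' < d]) ->
    [/\ valid c, U c = p z & dist c0 c < d].
  by have [[c' h]|] := pselect (exists c', [/\ valid c', U c' = p z & dist c0 c' < d]);
    [exists c' | exists c0].
move=> y e /s0P[vy Uy dy] [ve Ue].
have [t [t_inj ht]] : exists t : 'I_n -> 'I_n, injective t /\ forall i, same (e i) (s0 y (t i)).
  by apply/(U_eqP vy ve); rewrite Ue Uy.
pose s z : cfg := fun i => transport_angle (e i) (s0 z (t i)) (s0 y (t i)).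
exists s.
  apply/funext => i; have [h1 h2 h3 _] := ht i.
  by apply: wk_eq; rewrite /s /transport_angle //= subrr addr0.
have sz z : valid (s0 z) -> valid (s z) /\ U (s z) = U (s0 z).
  move=> vz; have hs i : same (s z i) (s0 z (t i)) by exact: same_transport.
  have v' := valid_same vz t_inj hs; split=> //.
  by apply/(U_eqP vz v'); exists t.
have dist_s z z' : dist (s z) (s z') <= dist (s0 z) (s0 z').
  apply/bigmax_leP; split=> [|i _]; first exact: dist_ge0.
  have [h1 h2] := dist_ge (s0 z) (s0 z') (t i).
  rewrite ge_max; apply/andP; split; first exact: h1.
  by apply: le_trans h2; rewrite /s /transport_angle /= opprD addrACA subrr add0r opprB addrA subrK.
move=> z /s0P[vz Uz dz].
have near_z (r : R) : 0 < r -> \forall z' \near z,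
    [/\ valid (s0 z'), U (s0 z') = p z' & dist (s0 z) (s0 z') < r].
  move=> r0; have m0 : 0 < Num.min r (d - dist c0 (s0 z)) by rewrite lt_min r0 subr_gt0.
  apply: filterS (near_p _ _ _ m0 vz Uz) => z' [c' [v' U']]; rewrite lt_min => /andP[h1 h2].
  have dc' : dist c0 c' < d by have := dist_tri c0 (s0 z) c'; lra.
  have [v'' U'' d''] : [/\ valid (s0 z'), U (s0 z') = p z' & dist c0 (s0 z') < d].
    by apply: s0P; exists c'.
  split=> //; suff -> : s0 z' = c' by [].
  by apply: (near_inj v0 v'' v'); rewrite ?U'' ?U'//; exact: near_dist.
split=> [r r0|].
  by apply: filterS (near_z _ r0) => z' [_ _]; exact: le_lt_trans.
by apply: filterS (near_z _ ltr01) => z' [v' U' _]; have [? ->] := sz _ v'.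
Qed.

Lemma lifts_at_cts s i : (forall x, lifts_at x s) -> continuous (fun x => s x i : R * R * R * R).
Proof.
move=> h x; apply/cvg_ballP => e e0; apply: filterS ((h x).1 e e0) => y.
move=> /(dist_ltP _ _ e0)/(_ i)[]; rewrite /gapd !gt_max => /andP[/andP[h1 h2] h3] h4.
by split=> //; split=> //; split.
Qed.

Lemma cts_lifts_at s : (forall i, continuous (fun x => s x i : R * R * R * R)) ->
  (forall x, valid (s x) /\ U (s x) = p x) -> forall x, lifts_at x s.
Proof.
move=> cs h x; split=> [d d0|]; last by apply: nearW; exact: h.
have c : continuous (fun y => dist (s x) (s y)).
  rewrite /dist; apply: bigmax_cts => [|i]; first by cts.
  apply: max_continuous; last by have c := cs i; cts.
  by apply: gapd_cts => //; cts.
by apply: (near_lt c (@cst_fun_continuous _ _ d)); rewrite distxx.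
Qed.

Variables (ct : R * T -> T) (x0 : T).
Hypothesis T_compact : compact [set: T].
Hypothesis ct_cts : continuous ct.
Hypothesis ct0 : forall x, ct (0, x) = x0.
Hypothesis ct1 : forall x, ct (1, x) = x.
Hypothesis ctx0 : forall u, ct (u, x0) = x0.

Lemma lift_exists c0 : valid c0 -> U c0 = p x0 ->
  exists f, [/\ f x0 = c0, forall i, continuous (fun x => f x i : R * R * R * R) &
    forall x, valid (f x) /\ U (f x) = p x].
Proof.
move=> v0 U0; have F x s : lifts_at x s -> valid (s x) /\ U (s x) = p x by move=> [_ /nbhs_singleton].
have [f f0 hf] := section_exists lifts_at_germ F lifts_at_uniq lifts_at_ex
  T_compact ct_cts ct0 ct1 ctx0 (conj v0 U0).
exists f; split=> // [i|x]; first exact: lifts_at_cts.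
exact: (nbhs_singleton (hf x).2).
Qed.

End Along.

Lemma lift_unique (f g : I -> cfg) : ctsF f -> ctsF g ->
  (forall t, valid (f t)) -> (forall t, valid (g t)) -> (forall t, U (f t) = U (g t)) ->
  f zero = g zero -> f =1 g.
Proof.
move=> cf cg vf vg U_eq e0 t.
have cl : continuous (fun s : R => clamp (s * ival t)) by cts.
have := section_eq_path (@lifts_at_uniq I (fun t => U (f t))) (s := f) (s' := g) cl.
rewrite mul0r mul1r clampK; apply=> //.
  by move=> s _; exact: (cts_lifts_at cf (fun x => conj (vf x) erefl)).
by move=> s _; exact: (cts_lifts_at cg (fun x => conj (vg x) (esym (U_eq x)))).
Qed.

End Lifting.

(** * Classes of paths with arbitrary endpoints *)

Section PathClasses.
Context {R : realType} {X : topologicalType} (x0 : X).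
Local Notation I := (unit_interval R).
Local Notation "{ x ~> y }" := ({path I from x to y in X}) (at level 0).
Local Notation P := (@pi1 R X x0).
Local Notation "p ~~ q" := (homotopic p q) (at level 70).

Lemma homotopic_ext (x y : X) (p q : {x ~> y}) : p =1 q -> p ~~ q.
Proof.
move=> e; have [H [cH H0 H1 Hx Hy]] := homotopic_refl p.
by exists H; split=> // t; rewrite H1.
Qed.

Definition connected_to (x : X) : Prop := exists p : {x0 ~> x}, True.
Definition basepath (x : X) (h : connected_to x) : {x0 ~> x} := projT1 (cid h).

(* The class of an arbitrary path, completed to a loop by a fixed path from x0
   to each endpoint; it is 1 outside the component of x0. *)
Definition path_class (x y : X) (p : {x ~> y}) : P :=
  match pselect (connected_to x), pselect (connected_to y) with
  | left hx, left hy => pi1_class (concat (concat (basepath hx) p) (reverse (basepath hy)))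
  | _, _ => 1%g
  end.

Lemma path_class_homotopic (x y : X) (p q : {x ~> y}) : p ~~ q -> path_class p = path_class q.
Proof.
move=> pq; rewrite /path_class; case: pselect => // hx; case: pselect => // hy.
apply/pi1_classP/homotopic_concat; last exact: homotopic_refl.
by apply: homotopic_concat => //; exact: homotopic_refl.
Qed.

(** Up to homotopy the fixed path to the common endpoint cancels against its reverse. *)
Lemma path_class_concat (x y z : X) (p : {x ~> y}) (q : {y ~> z}) :
  path_class (concat p q) = (path_class p * path_class q)%g.
Proof.
have conn (u v : X) (r : {u ~> v}) : connected_to u -> connected_to v.
  by move=> [s _]; exists (concat s r).
rewrite /path_class; case: (pselect (connected_to x)) => [hx|nx]; last first.
  case: (pselect (connected_to y)) => [hy|ny]; last by rewrite mulg1.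
  by case: nx; exact: conn (reverse p) hy.
have hy' := conn _ _ p hx; have hz' := conn _ _ q hy'.
case: (pselect (connected_to y)) => // hy; case: (pselect (connected_to z)) => // hz.
rewrite -[RHS]/(pi1_mul _ _) pi1_mulE; apply/pi1_classP.
set A := basepath hx; set B := basepath hy; set C := basepath hz.
have r (u v : X) (s : {u ~> v}) : s ~~ s by exact: homotopic_refl.
apply/homotopic_sym.
apply: homotopic_trans (concat_assoc _ _ _) _; apply: homotopic_concat (r _ _ _).
apply: homotopic_trans (homotopic_sym (concat_assoc _ _ _)) _.
apply: homotopic_trans (homotopic_concat (r _ _ _) (concat_assoc _ _ _)) _.
apply: homotopic_trans (homotopic_concat (r _ _ _)
  (homotopic_concat (concat_reverse_left _) (r _ _ _))) _.
apply: homotopic_trans (homotopic_concat (r _ _ _) (concat_cst_left _)) _.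
exact: homotopic_sym (concat_assoc _ _ _).
Qed.

Lemma path_class_ext (x y x' y' : X) (p : {x ~> y}) (p' : {x' ~> y'}) :
  p =1 p' -> path_class p = path_class p'.
Proof.
move=> e; have ex : x = x' by have := e zero; rewrite !path_zero.
have ey : y = y' by have := e one; rewrite !path_one.
by subst x' y'; apply/path_class_homotopic/homotopic_ext.
Qed.

Definition path_of (a : R -> X) (ca : continuous a) : {a 0 ~> a 1}.
Proof.
refine (@mk_path I X (a 0) (a 1) (fun t => a (ival t)) _ _ _).
- by cts.
- by rewrite ival0.
- by rewrite ival1.
Defined.

Lemma path_ofE a (ca : continuous a) t : path_of ca t = a (ival t).
Proof. by []. Qed.

(** The fixed path from [x0] to itself need not be trivial; conjugation by its class makes [cls] of
    a loop at [x0] the class of that loop. *)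
Definition base_correction : P :=
  pi1_class (basepath (ex_intro (fun _ : {x0 ~> x0} => True) (const_path x0) Logic.I)).

Definition cls (a : R -> X) : P :=
  if pselect (continuous a) is left ca
  then (base_correction^-1 * path_class (path_of ca) * base_correction)%g else 1%g.

Lemma clsE a (ca : continuous a) :
  cls a = (base_correction^-1 * path_class (path_of ca) * base_correction)%g.
Proof. by rewrite /cls; case: pselect => // ca'; rewrite (Prop_irrelevance ca ca'). Qed.

Lemma cls_ext (a b : R -> X) : continuous a -> continuous b ->
  (forall t, 0 <= t <= 1 -> a t = b t) -> cls a = cls b.
Proof.
move=> ca cb e; rewrite (clsE ca) (clsE cb); congr (_ * _ * _)%g.
by apply: path_class_ext => t; rewrite !path_ofE e// ival_itv.
Qed.

Lemma cls_loop (a : R -> X) (p : loop x0) : continuous a -> (forall t : I, p t = a (ival t)) ->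
  cls a = pi1_class p.
Proof.
move=> ca e; rewrite (clsE ca).
have -> : path_class (path_of ca) = path_class p by apply: path_class_ext => t; rewrite e.
have -> : path_class p = (base_correction * pi1_class p * base_correction^-1)%g.
  rewrite /path_class; case: pselect => [h|[]]; last by exists (const_path x0).
  rewrite /base_correction (Prop_irrelevance (ex_intro _ _ _) h).
  by rewrite -pi1_mulE -pi1_mulE -pi1_invE.
by rewrite !mulgA mulVg mul1g -mulgA mulVg mulg1.
Qed.

(** Two paths between the same corners of a square are homotopic by linear interpolation. *)
Lemma cls_diag (F : R * R -> X) : continuous F ->
  (cls (fun t => F (t, 0)) * cls (fun t => F (1%R, t)))%g = cls (fun t => F (t, t)).
Proof.
move=> cF.
have c1 : continuous (fun t => F (t, 0)) by cts.
have c2 : continuous (fun t => F (1, t)) by cts.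
have c3 : continuous (fun t => F (t, t)) by cts.
rewrite (clsE c1) (clsE c2) (clsE c3) !mulgA; congr (_ * _)%g.
rewrite -(mulgA _ base_correction) mulgV mulg1 -!mulgA; congr (_ * _)%g.
rewrite -path_class_concat; apply: path_class_homotopic.
pose al (t : R) := Num.min 1 (2 * t); pose be (t : R) := Num.max 0 (2 * t - 1).
exists (fun s => F ((1 - ival s.1) * al (ival s.2) + ival s.1 * ival s.2,
                    (1 - ival s.1) * be (ival s.2) + ival s.1 * ival s.2)); split.
- by rewrite /al /be; cts.
- move=> t; rewrite concatE !path_ofE ival0 subr0 !mul1r !mul0r !addr0 /al /be.
  have /andP[t0 t1] := ival_itv t; case: ifPn => h.
    by rewrite ivalK ?(min_idPr _) ?(max_idPl _)//; lra.
  by rewrite ivalK ?(min_idPl _) ?(max_idPr _)//; lra.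
- by move=> t; rewrite path_ofE ival1 subrr !mul0r !mul1r !add0r.
- move=> s; rewrite ival0 /al /be !mulr0 (min_idPr _) ?(max_idPl _) ?mulr0 ?addr0//; lra.
- move=> s; rewrite ival1 /al /be !mulr1 (min_idPl _) ?(max_idPr _); [|lra..].
  by congr (F (_, _)); ring.
Qed.

End PathClasses.

(** * Classes of motions of labelled wickets *)

Section ConfigClasses.
Variables (R : realType) (n : nat).
Local Notation cfg := ('I_n -> wk R).
Local Notation valid := (@valid R _ [set: 'I_n]%SET).
Local Notation ctsF f := (forall i, continuous (fun t => f t i : R * R * R * R)).
Local Notation W := (wicket_space R n).

Definition unit_itv (t : R) := ival (clamp t).
Lemma unit_itvP t : 0 <= unit_itv t <= 1. Proof. exact: ival_itv. Qed.
Lemma unit_itvE t : 0 <= t <= 1 -> unit_itv t = t. Proof. exact: ivalK. Qed.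
Lemma unit_itv_cts (T : topologicalType) (f : T -> R) : continuous f ->
  continuous (fun t => unit_itv (f t)).
Proof. by move=> cf; rewrite /unit_itv; cts. Qed.

Definition path_ok (f : R -> cfg) : Prop := ctsF f /\ forall t, 0 <= t <= 1 -> valid (f t).
Definition square_ok (F : R * R -> cfg) : Prop :=
  ctsF F /\ forall s t, 0 <= s <= 1 -> 0 <= t <= 1 -> valid (F (s, t)).

(** Clamping the parameter makes only the values on the unit interval matter. *)
Definition Hc (f : R -> cfg) : wicket_group R n :=
  cls (base_config R n) (fun t => U (f (unit_itv t))).

Lemma path_ok_cts f : path_ok f -> continuous (fun t => U (f (unit_itv t))).
Proof.
move=> [cf vf]; apply: U_cts => [i|t]; last exact/vf/unit_itvP.
have c := @unit_itv_cts _ _ (@id_cts R).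
exact: (compose_continuous c (cf i)).
Qed.

Lemma Hc_ext f g : path_ok f -> path_ok g -> (forall t, 0 <= t <= 1 -> U (f t) = U (g t)) ->
  Hc f = Hc g.
Proof.
move=> of' og e; apply: cls_ext; [exact: path_ok_cts..|] => t t01.
by rewrite unit_itvE// e.
Qed.

Lemma Hc_loop f (p : loop (R := R) (base_config R n)) : path_ok f ->
  (forall t : unit_interval R, p t = U (f (ival t))) -> Hc f = pi1_class p.
Proof.
move=> ok e; apply: cls_loop; first exact: path_ok_cts.
by move=> t; rewrite e unit_itvE// ival_itv.
Qed.

Lemma Hc_diag F : square_ok F ->
  (Hc (fun t => F (t, 0)) * Hc (fun t => F (1%R, t)))%g = Hc (fun t => F (t, t)).
Proof.
move=> [cF vF]; have cu (T : topologicalType) := @unit_itv_cts T.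
pose G (z : R * R) : W := U (F (unit_itv z.1, unit_itv z.2)).
have cG : continuous G.
  apply: U_cts => [i|z]; last by apply: vF; exact: unit_itvP.
  apply: (@compose_continuous _ _ _ (fun z : R * R => (unit_itv z.1, unit_itv z.2)) (fun z => F z i)) => //.
  by apply: pair_continuous; apply: cu; cts.
have h01 : (0 <= (0 : R) <= 1)%R by lra.
have h11 : (0 <= (1 : R) <= 1)%R by lra.
have := cls_diag (base_config R n) cG.
by rewrite /G /Hc /= (unit_itvE h01) (unit_itvE h11).
Qed.

Lemma square_swap F : square_ok F -> square_ok (fun z => F (z.2, z.1)).
Proof.
move=> [cF vF]; split=> [i|s t hs ht]; last exact: vF.
by apply: (@compose_continuous _ _ _ (fun z : R * R => (z.2, z.1)) (fun z => F z i)) => //; cts.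
Qed.

Lemma Hc_square F : square_ok F ->
  (Hc (fun t => F (t, 0)) * Hc (fun t => F (1%R, t)))%g =
  (Hc (fun t => F (0, t)) * Hc (fun t => F (t, 1%R)))%g.
Proof. by move=> ok; rewrite Hc_diag// (Hc_diag (square_swap ok)). Qed.

Lemma path_ok_cst c : valid c -> path_ok (fun=> c).
Proof. by move=> v; split=> // i; cts. Qed.

(** This class is idempotent. *)
Lemma Hc_cst c : valid c -> Hc (fun=> c) = 1%g.
Proof.
move=> v; have : square_ok (fun=> c) by split=> // i; cts.
by move=> /Hc_diag /= h; apply: (mulgI (Hc (fun=> c))); rewrite mulg1.
Qed.

Lemma path_ok_comp f (a : R -> R) : path_ok f -> continuous a ->
  (forall t, 0 <= t <= 1 -> 0 <= a t <= 1) -> path_ok (fun t => f (a t)).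
Proof.
move=> [cf vf] ca ha; split=> [i|t t01]; last exact/vf/ha.
exact: (compose_continuous ca (cf i)).
Qed.

Lemma square_ok_comp f (a : R * R -> R) : path_ok f -> continuous a ->
  (forall s t, 0 <= s <= 1 -> 0 <= t <= 1 -> 0 <= a (s, t) <= 1) -> square_ok (fun z => f (a z)).
Proof.
move=> [cf vf] ca ha; split=> [i|s t s1 t1]; last exact/vf/ha.
exact: (compose_continuous ca (cf i)).
Qed.

(** In the square obtained from [Num.max 0 (z.1 - z.2)] two sides are the path and its reverse,
    while the diagonal is constant. *)
Lemma Hc_rev f : path_ok f -> Hc (fun t => f (1 - t)%R) = (Hc f)^-1%g.
Proof.
move=> ok; pose a (z : R * R) := Num.max 0 (z.1 - z.2).
have oka : square_ok (fun z => f (a z)).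
  apply: square_ok_comp => //; first by rewrite /a; cts.
  move=> s t /andP[? ?] /andP[? ?]; rewrite /a /= le_max lexx ge_max ler01 /=; lra.
have := Hc_diag oka.
have -> : Hc (fun t => f (a (t, t))) = 1%g.
  rewrite -(Hc_cst (ok.2 0 _)); last by lra.
  by congr Hc; apply/funext => t; rewrite /a /= subrr maxxx.
have e1 t : (0 <= t <= 1)%R -> a (t, 0) = t.
  by move=> /andP[? ?]; rewrite /a /= subr0; apply/max_idPr.
have e2 t : (0 <= t <= 1)%R -> a (1, t) = (1 - t)%R.
  by move=> /andP[? ?]; rewrite /a /=; apply/max_idPr; lra.
have ca : continuous a by rewrite /a; cts.
have -> : Hc (fun t => f (a (t, 0))) = Hc f.
  apply: Hc_ext => // [|t /e1 -> //]; apply: path_ok_comp => //; first by cts.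
  by move=> t /[dup] /e1 ->.
have -> : Hc (fun t => f (a (1, t))) = Hc (fun t => f (1 - t)%R).
  apply: Hc_ext => // [||t /e2 -> //]; apply: path_ok_comp => //.
  - by cts.
  - by move=> t /[dup] /e2 -> /andP[? ?]; apply/andP; split; lra.
  - by cts.
  - by move=> t /andP[? ?]; apply/andP; split; lra.
by move=> h; rewrite -[LHS]mul1g -(mulVg (Hc f)) -mulgA h mulg1.
Qed.

Lemma Hc_part f (a b c : R) : path_ok f -> (0 <= a <= 1)%R -> (0 <= b <= 1)%R -> (0 <= c <= 1)%R ->
  (Hc (fun t => f (a + t * (b - a))%R) * Hc (fun t => f (b + t * (c - b))%R))%g =
  Hc (fun t => f (a + t * (c - a))%R).
Proof.
move=> ok /andP[a0 a1] /andP[b0 b1] /andP[c0 c1].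
pose z (u : R * R) := (a + u.1 * (b - a) + u.2 * (c - b))%R.
pose d (u : R * R) := Num.max 0 (Num.min 1 (z u)).
have okd : square_ok (fun u => f (d u)).
  apply: square_ok_comp => //; first by rewrite /d /z; cts.
  by move=> s t _ _; rewrite /d le_max lexx ge_max ler01 ge_min lexx.
have dE (u : R * R) : (0 <= z u <= 1)%R -> d u = z u.
  by move=> /andP[? ?]; rewrite /d (min_idPr _)// (max_idPr _).
have seg (x y t : R) : (0 <= x <= 1 -> 0 <= y <= 1 -> 0 <= t <= 1 -> 0 <= x + t * (y - x) <= 1)%R.
  move=> /andP[x0 x1] /andP[y0 y1] /andP[t0 t1]; apply/andP; split; nra.
have okseg (x y : R) : (0 <= x <= 1)%R -> (0 <= y <= 1)%R ->
    path_ok (fun t => f (x + t * (y - x))%R).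
  move=> hx hy; apply: path_ok_comp => //; first by cts.
  by move=> t; exact: seg.
have cd : continuous d by rewrite /d /z; cts.
have okc (u : R -> R * R) : continuous u -> path_ok (fun t => f (d (u t))).
  move=> cu; apply: (path_ok_comp (a := fun t => d (u t))) => //; first by cts.
  by move=> t _; rewrite /d le_max lexx ge_max ler01 ge_min lexx.
have E (u : R -> R * R) (x y : R) : continuous u -> (0 <= x <= 1)%R -> (0 <= y <= 1)%R ->
    (forall t, z (u t) = x + t * (y - x))%R ->
    Hc (fun t => f (d (u t))) = Hc (fun t => f (x + t * (y - x))%R).
  move=> cu hx hy e; apply: Hc_ext; [exact: okc|exact: okseg|].
  by move=> t t01; rewrite dE e//; exact: seg.
have := Hc_diag okd; rewrite (E (fun t => (t, 0)) a b) ?(E (fun t => (1, t)) b c) ?(E (fun t => (t, t)) a c) //;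
  rewrite ?a0 ?b0 ?c0 ?a1 ?b1 ?c1 //; try (by cts); by move=> t; rewrite /z /=; ring.
Qed.

End ConfigClasses.

(** * Words sorting a sequence of labels *)

Section SortingWords.
Variables (G : groupType) (n : nat) (X : nat -> 'I_n -> 'I_n -> G).
Implicit Types (a b c : 'I_n) (s u v : seq 'I_n).
Local Open Scope group_scope.

(** [X k a b] is the letter for exchanging labels [a] and [b] standing in places [k] and [k.+1]. The
    hypotheses are the Coxeter relations in groupoid form: undoing an exchange, distant exchanges,
    and the two ways to reverse three labels. *)
Hypothesis X_inv : forall k a b, a != b -> X k b a = (X k a b)^-1.
Hypothesis X_far : forall k l a b c d, (k.+1 < l)%N -> X k a b * X l c d = X l c d * X k a b.
Hypothesis X_hex : forall k a b c, (k.+2 < n)%N -> a != b -> a != c -> b != c ->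
  X k a b * X k.+1 a c * X k b c = X k.+1 b c * X k a c * X k.+1 a b.

(* ins k a s: the labels a :: s in places k, k.+1, ...; a moves past the
   smaller labels at the head of s. *)
Fixpoint ins k a s : G :=
  if s is b :: s' then if (b < a)%N then X k a b * ins k.+1 a s' else 1 else 1.

Fixpoint insl a s : seq 'I_n :=
  if s is b :: s' then if (b < a)%N then b :: insl a s' else a :: s else [:: a].

Fixpoint srt s : seq 'I_n := if s is a :: s' then insl a (srt s') else [::].

(** Insertion sort: the tail is sorted first, then the head is inserted, and the letters of all
    exchanges are multiplied. *)
Fixpoint sorting_word k s : G :=
  if s is a :: s' then sorting_word k.+1 s' * ins k a (srt s') else 1.

Lemma perm_insl a s : perm_eq (insl a s) (a :: s).
Proof.
elim: s => //= b s IH; case: ifP => // _.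
by rewrite -(perm_cons b) in IH; apply: perm_trans IH _; apply/permP => p /=; rewrite addnCA.
Qed.

Lemma perm_srt s : perm_eq (srt s) s.
Proof.
by elim: s => //= a s IH; apply: perm_trans (perm_insl _ _) _; rewrite perm_cons.
Qed.

Lemma insl_swap a b s : a != b -> insl a (insl b s) = insl b (insl a s).
Proof.
move=> ab; have tot c d : c != d -> (c < d)%N = ~~ (d < c)%N.
  by move=> cd; rewrite -leqNgt ltn_neqAle (inj_eq val_inj) cd.
have E : (a < b)%N = ~~ (b < a)%N by exact: tot.
elim: s => [|c s IH] /=; first by rewrite E; case: ifP.
have [cb|cb] := ltnP c b; have [ca|ca] := ltnP c a => /=.
- by rewrite ca cb IH.
- have ba : (b < a)%N = false by apply/negbTE; rewrite -leqNgt; apply: leq_trans (ltnW cb).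
  by rewrite (ltnNge c a) ca /= E ba /= cb.
- have ba : (b < a)%N by exact: leq_ltn_trans cb ca.
  by rewrite ba ca ltnNge cb.
- by rewrite (ltnNge c b) cb (ltnNge c a) ca /= E; case: (b < a)%N.
Qed.

Lemma ins_far l k a b c s : (l.+1 < k)%N -> X l b c * ins k a s = ins k a s * X l b c.
Proof.
elim: s k => [|d s IH] k lk /=; first by rewrite mulg1 mul1g.
case: ifP => _; last by rewrite mulg1 mul1g.
by rewrite mulgA X_far// -!mulgA IH// (ltn_trans lk).
Qed.

Lemma sorting_word_far l k b c s : (l.+1 < k)%N ->
  X l b c * sorting_word k s = sorting_word k s * X l b c.
Proof.
elim: s k => [|d s IH] k lk /=; first by rewrite mulg1 mul1g.
by rewrite mulgA IH ?(ltn_trans lk)// -!mulgA ins_far.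
Qed.

(** Inserting two labels in either order gives the same product up to their own exchange. A label
    passed by both is handled by the hexagon relation, and the case [a < b] reduces to the other one
    by inverting the letter. *)
Lemma ins_swap k a b s : (k + (size s).+2 <= n)%N -> a != b -> a \notin s -> b \notin s ->
  ins k.+1 b s * ins k a (insl b s) = X k a b * ins k.+1 a s * ins k b (insl a s).
Proof.
wlog ba : a b / (b < a)%N.
  move=> H kn ab sa sb; have [ba|] := ltnP b a; first exact: H.
  rewrite leq_eqVlt => /orP[/eqP/val_inj e|ba]; first by rewrite e eqxx in ab.
  have ba' : b != a by rewrite eq_sym.
  by rewrite -(mulgA (X k a b)) (H b a ba kn ba' sb sa) (@X_inv k a b ab) !mulgA mulgV mul1g.
elim: s k => [|c s IH] k kn ab; first by rewrite /= ba ltnNge (ltnW ba) /= !mulg1 mul1g.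
rewrite !inE !negb_or => /andP[ac sa] /andP[bc sb] /=.
have [cb|cb] := ltnP c b; last first.
  have -> : ins k b (if (c < a)%N then c :: insl a s else a :: c :: s) = 1.
    by case: ifP => _ /=; rewrite ltnNge ?cb ?(ltnW ba).
  by rewrite mul1g mulg1 /= ba.
have ca := ltn_trans cb ba; rewrite ca /= cb ca.
transitivity (X k.+1 b c * X k a c * (ins k.+2 b s * ins k.+1 a (insl b s))).
  by rewrite -!mulgA; congr (_ * _); rewrite !mulgA ins_far.
rewrite (IH k.+1)//; last by move: kn => /=; rewrite addnS addSn.
rewrite !mulgA -X_hex//; last by apply: leq_trans kn; rewrite /= !addnS !ltnS leq_addr.
by rewrite -!mulgA; do 2 congr (_ * _); rewrite !mulgA ins_far.
Qed.

(** The sorting word is thus a potential: along any chain of adjacent exchanges the letters multiply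
    to a quotient of two of its values. *)
Lemma sorting_word_swap k u a b v : (k + size (u ++ a :: b :: v) <= n)%N ->
  uniq (u ++ a :: b :: v) ->
  sorting_word k (u ++ a :: b :: v) = X (k + size u) a b * sorting_word k (u ++ b :: a :: v).
Proof.
elim: u k => [|d u IH] k /=.
  rewrite addn0 inE negb_or => kn /and3P[/andP[ab av] bv _].
  rewrite -(mulgA _ _ (ins k a _)) ins_swap ?(perm_mem (perm_srt v)) ?(perm_size (perm_srt v))//.
  by rewrite !mulgA sorting_word_far.
move=> kn /andP[_ uq].
have -> : srt (u ++ a :: b :: v) = srt (u ++ b :: a :: v).
  elim: u uq {IH kn} => [|e u IH] /=; last by move=> /andP[_ /IH ->].
  by rewrite inE negb_or => /and3P[/andP[ab _] _ _]; exact: insl_swap.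
by rewrite IH// ?mulgA ?addSnnS//; rewrite addSnnS.
Qed.

End SortingWords.

(** * Reordering by adjacent exchanges *)

Section Swaps.
Variable T : eqType.
Implicit Types (Q : T -> T -> Prop) (L : seq T).

Inductive swaps Q : seq T -> seq T -> Prop :=
| swaps_refl L : swaps Q L L
| swaps_step u a b v L : Q a b -> swaps Q (u ++ b :: a :: v) L -> swaps Q (u ++ a :: b :: v) L.

Lemma swaps_trans Q L1 L2 L3 : swaps Q L1 L2 -> swaps Q L2 L3 -> swaps Q L1 L3.
Proof. by elim=> // u a b v L q _ IH /IH; exact: swaps_step. Qed.

Lemma swaps_cons Q x L1 L2 : swaps Q L1 L2 -> swaps Q (x :: L1) (x :: L2).
Proof.
elim=> [L|u a b v L q _ IH]; first exact: swaps_refl.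
exact: (@swaps_step Q (x :: u)).
Qed.

Definition before L (a b : T) : bool := (index a L < index b L)%N.

Lemma swaps_front Q x u v : (forall y, y \in u -> Q y x) -> swaps Q (u ++ x :: v) (x :: u ++ v).
Proof.
elim/last_ind: u v => [|u y IH] v Qu; first exact: swaps_refl.
rewrite !cat_rcons; apply: swaps_step; first by apply: Qu; rewrite mem_rcons mem_head.
by apply: IH => z zu; apply: Qu; rewrite mem_rcons inE zu orbT.
Qed.

(** The head of the target is moved to the front past the labels preceding it in [L], all of which
    form inversions with it; induction does the rest. *)
Lemma swaps_of_inversions Q L L' : uniq L -> perm_eq L L' ->
  (forall a b, a \in L -> b \in L -> before L a b -> before L' b a -> Q a b) -> swaps Q L L'.
Proof.
elim: L' L => [|x s' IH] L uq pm inv.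
  by rewrite (perm_nilP pm); exact: swaps_refl.
have xL : x \in L by rewrite (perm_mem pm) mem_head.
have [u [v [EL xu]]] : exists u v, L = u ++ x :: v /\ x \notin u.
  by case/splitPr: xL uq => u v; rewrite cat_uniq /= negb_or => /and3P[_ /andP[h _] _]; exists u, v.
subst L.
have xv : x \notin v by move: uq; rewrite cat_uniq /= => /and3P[_ _ /andP[]].
have pm' : perm_eq (u ++ v) s'.
  by move: pm; rewrite -(cat1s x v) perm_catCA perm_cons.
have uq' : uniq (u ++ v).
  by move: uq; rewrite -(cat1s x v) uniq_catCA /= => /andP[].
have Qu y : y \in u -> Q y x.
  move=> yu; have yx : y != x by apply: contraNneq xu => <-.
  apply: inv; rewrite ?mem_cat ?yu ?mem_head ?orbT//.
    rewrite /before !index_cat yu (negbTE xu) /= eqxx addn0.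
    by rewrite index_mem.
  by rewrite /before /= eqxx eq_sym (negbTE yx).
apply: swaps_trans (swaps_front v Qu) _; apply: swaps_cons; apply: IH => // a b aL bL ab ba.
have ax : a != x by apply: contraNneq xu => xa; move: aL; rewrite xa mem_cat (negbTE xv) orbF.
have bx : b != x by apply: contraNneq xu => xb; move: bL; rewrite xb mem_cat (negbTE xv) orbF.
have lift c : c != x -> index c (u ++ x :: v) =
    if c \in u then index c (u ++ v) else (index c (u ++ v)).+1.
  move=> cx; rewrite !index_cat; case: ifP => // _.
  by rewrite /= eq_sym (negbTE cx) addnS.
apply: inv.
- by move: aL; rewrite !mem_cat inE => /orP[] ->; rewrite ?orbT.
- by move: bL; rewrite !mem_cat inE => /orP[] ->; rewrite ?orbT.
- move: ab; rewrite /before !lift// !index_cat; case: (boolP (a \in u)) => au;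
    case: (boolP (b \in u)) => bu //= h.
    by apply: leq_trans h _; rewrite addnC.
  have : (size u <= index b u)%N by apply: leq_trans (leq_addr _ _) (ltnW h).
  by rewrite leqNgt index_mem bu.
- by rewrite /before /= eq_sym (negbTE bx) eq_sym (negbTE ax).
Qed.

End Swaps.

(** * The group defined by a presentation *)

Section PresentedGroup.
Variables (S : Type) (rel : word S -> word S -> Prop).
Local Notation peq := (presented_eq rel).
Local Open Scope quotient_scope.

HB.instance Definition _ := Choice.copy (word S) {classic (word S)}.

Definition peqb (u v : word S) : bool := `[< peq u v >].

Lemma peqb_refl : reflexive peqb. Proof. by move=> u; apply/asboolP; exact: peq_refl. Qed.
Lemma peqb_sym : symmetric peqb. Proof. by move=> u v; apply/asboolP/asboolP; exact: peq_sym. Qed.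
Lemma peqb_trans : transitive peqb.
Proof. by move=> v u w /asboolP uv /asboolP vw; apply/asboolP; exact: peq_trans uv vw. Qed.

Canonical peqb_equiv := EquivRel peqb peqb_refl peqb_sym peqb_trans.

Definition presented_group : Type := {eq_quot peqb}.
HB.instance Definition _ := Choice.on presented_group.
Local Notation PG := presented_group.

Definition pclass (u : word S) : PG := \pi_{eq_quot peqb} u.
Definition prepr (g : PG) : word S := repr (g : {eq_quot peqb}).

Lemma pclassP u v : pclass u = pclass v <-> peq u v.
Proof. by split=> [/eqmodP/asboolP|h]; [|apply/eqmodP/asboolP]. Qed.

Lemma preprK g : pclass (prepr g) = g. Proof. exact: reprK. Qed.

Lemma peq_prepr u : peq (prepr (pclass u)) u. Proof. by apply/pclassP; rewrite preprK. Qed.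

Definition pmul g h : PG := pclass (prepr g ++ prepr h).
Definition pinv g : PG := pclass (word_inv (prepr g)).

Lemma pmulE u v : pmul (pclass u) (pclass v) = pclass (u ++ v).
Proof. by apply/pclassP/peq_cat; exact: peq_prepr. Qed.

Lemma word_inv_cat (u v : word S) : word_inv (u ++ v) = word_inv v ++ word_inv u.
Proof. by rewrite /word_inv map_cat rev_cat. Qed.

Lemma word_invK : involutive (@word_inv S).
Proof.
move=> u; rewrite /word_inv map_rev revK -map_comp -[RHS]map_id.
by apply: eq_map => -[s e] /=; rewrite negbK.
Qed.

Lemma peq_word_inv u : peq (u ++ word_inv u) [::].
Proof.
elim: u => [|[s e] u IH]; first exact: peq_refl.
rewrite -cat1s word_inv_cat -catA (catA u).
apply: peq_trans (peq_cat (peq_refl _ _) (peq_cat IH (peq_refl _ _))) _.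
by rewrite cat0s; exact: peq_cancel.
Qed.

Lemma pmulA : associative pmul.
Proof.
move=> g h k; rewrite -(preprK g) -(preprK h) -(preprK k) !pmulE.
by rewrite catA.
Qed.

Lemma pmul1g : left_id (pclass [::]) pmul.
Proof. by move=> g; rewrite -(preprK g) pmulE. Qed.
Lemma pmulg1 : right_id (pclass [::]) pmul.
Proof. by move=> g; rewrite -(preprK g) pmulE cats0. Qed.
Lemma pmulgV : right_inverse (pclass [::]) pinv pmul.
Proof.
move=> g; rewrite -{1}(preprK g) pmulE; apply/pclassP.
exact: peq_word_inv.
Qed.

Lemma pmulVg : left_inverse (pclass [::]) pinv pmul.
Proof.
move=> g; rewrite -{2}(preprK g) pmulE; apply/pclassP.
by rewrite -{2}(word_invK (prepr g)); exact: peq_word_inv.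
Qed.

HB.instance Definition _ := isGroup.Build PG pmulA pmul1g pmulg1 pmulVg pmulgV.

Definition pgen (s : S) : PG := pclass (letter s true).

Lemma word_eval_cat (G : groupType) (f : S -> G) (u v : word S) :
  word_eval f (u ++ v) = (word_eval f u * word_eval f v)%g.
Proof. by elim: u => [|l u IH] /=; rewrite ?mul1g// IH mulgA. Qed.

Lemma word_eval_inv (G : groupType) (f : S -> G) (u : word S) :
  word_eval f (word_inv u) = (word_eval f u)^-1%g.
Proof.
elim: u => [|[s e] u IH]; first by rewrite invg1.
rewrite -cat1s word_inv_cat word_eval_cat IH /= mulg1 invgM.
by congr (_ * _)%g; case: e => //=; rewrite invgK.
Qed.

Lemma word_eval_letter (G : groupType) (f : S -> G) s e :
  word_eval f (letter s e) = if e then f s else (f s)^-1%g.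
Proof. by rewrite /= mulg1. Qed.

Lemma word_eval_pgen u : word_eval pgen u = pclass u.
Proof.
elim: u => // -[s e] u IH; rewrite -cat1s word_eval_cat IH -[RHS]pmulE.
congr (_ * _)%g; rewrite word_eval_letter; case: e => //.
apply: (mulgI (pgen s)); rewrite mulgV -[RHS]/(pmul _ _) pmulE; apply/esym/pclassP.
exact: peq_cancel.
Qed.

Definition satisfies (G : groupType) (f : S -> G) : Prop :=
  forall u v, rel u v -> word_eval f u = word_eval f v.

Lemma satisfies_pgen : satisfies pgen.
Proof. by move=> u v uv; rewrite !word_eval_pgen; apply/pclassP/peq_rel. Qed.

Lemma satisfies_peq (G : groupType) (f : S -> G) u v :
  satisfies f -> peq u v -> word_eval f u = word_eval f v.
Proof.
move=> sf; elim=> {u v} [//|u v _ -> //|u v w _ -> _ -> //|u u' v v' _ e _ e'|s e|u v].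
- by rewrite !word_eval_cat e e'.
- by rewrite word_eval_cat !word_eval_letter; case: e => /=; rewrite ?mulgV ?mulVg.
- exact: sf.
Qed.

End PresentedGroup.

(** * Relative positions of two wickets in one plane *)

Section Kinds.
Variable R : realType.
Implicit Types a b c : wk R.

Inductive kind := In | Has | Ab | Be.

Definition opp_kind k := match k with In => Has | Has => In | Ab => Be | Be => Ab end.

Definition inside a b : bool := (cy b - rd b < cy a - rd a) && (cy a + rd a < cy b + rd b).
Definition above a b : bool := cy b + rd b < cy a - rd a.

Definition of_kind k a b : bool :=
  match k with In => inside a b | Has => inside b a | Ab => above a b | Be => above b a end.

(** [Be] is also the default value for pairs that cross. *)
Definition kind_of a b : kind :=
  if inside a b then In else if inside b a then Has else if above a b then Ab else Be.

Definition laminar a b : bool := [|| inside a b, inside b a, above a b | above b a].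

Lemma kind_ofP a b : laminar a b -> of_kind (kind_of a b) a b.
Proof.
by rewrite /laminar /kind_of; case: ifP => //= _; case: ifP => //= _; case: ifP.
Qed.

Lemma of_kind_laminar k a b : of_kind k a b -> laminar a b.
Proof. by rewrite /laminar; case: k => /= ->; rewrite ?orbT. Qed.

Lemma of_kind_unique k a b : 0 < rd a -> 0 < rd b -> of_kind k a b -> kind_of a b = k.
Proof.
move=> ra rb; rewrite /kind_of /inside /above.
case: k => /=; rewrite /inside /above => h.
- by rewrite h.
- move: (h) => /andP[? ?]; case: ifP => [/andP[? ?]|_]; first by exfalso; lra.
  by rewrite h.
- case: ifP => [/andP[? ?]|_]; first by exfalso; lra.
  case: ifP => [/andP[? ?]|_]; first by exfalso; lra.
  by rewrite h.
- case: ifP => [/andP[? ?]|_]; first by exfalso; lra.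
  case: ifP => [/andP[? ?]|_]; first by exfalso; lra.
  by case: ifP => // ?; exfalso; lra.
Qed.

Lemma of_kind_opp k a b : of_kind (opp_kind k) b a = of_kind k a b.
Proof. by case: k. Qed.

Lemma laminar_sym a b : laminar a b = laminar b a.
Proof. by rewrite /laminar orbCA; do 2 congr (_ || _); rewrite orbC. Qed.

Lemma kind_of_opp a b : 0 < rd a -> 0 < rd b -> laminar a b ->
  kind_of b a = opp_kind (kind_of a b).
Proof.
by move=> ra rb lab; apply: of_kind_unique => //; rewrite of_kind_opp kind_ofP.
Qed.

End Kinds.

(** * Letters of crossings and their hexagon relations *)

Section Letters.
Variables (G : groupType) (n : nat) (f : wicket_generator n -> G).
Local Open Scope group_scope.

(** Places are natural numbers; a place out of range has the letter 1. *)
Definition at_place (h : 'I_n.-1 -> G) (k : nat) : G := oapp h 1 (insub k).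

Definition kletter (k : nat) (t : kind) : G :=
  match t with
  | In => at_place (f \o @Rho n) k
  | Has => (at_place (f \o @Rho n) k)^-1
  | Ab => at_place (f \o @Sigma n) k
  | Be => (at_place (f \o @Sigma n) k)^-1
  end.

Lemma kletter_opp k t : kletter k (opp_kind t) = (kletter k t)^-1.
Proof. by case: t => //=; rewrite invgK. Qed.

Hypothesis sat : satisfies (@wicket_relation n) f.

Lemma commuteV (x y : G) : x * y = y * x -> x^-1 * y = y * x^-1.
Proof. by move=> e; apply: (mulgI x); rewrite !mulgA mulgV mul1g e mulgK. Qed.

Lemma comm_eval (s t : wicket_generator n) :
  wicket_relation (word_comm (letter s true) (letter t true)) [::] -> f s * f t = f t * f s.
Proof.
move=> /sat /=; rewrite !mulg1 => h.
apply: (mulIg (f s)^-1); rewrite -[RHS]mulgA mulgV mulg1; apply: (mulIg (f t)^-1).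
by rewrite mulgV -!mulgA.
Qed.

Lemma at_place_far (h h' : 'I_n.-1 -> G) k l :
  (forall i j : 'I_n.-1, (i.+1 < j)%N -> h i * h' j = h' j * h i) -> (k.+1 < l)%N ->
  at_place h k * at_place h' l = at_place h' l * at_place h k.
Proof.
move=> H kl; rewrite /at_place.
case: (insubP _ k) => [i _ ik|_] /=; last by rewrite mul1g mulg1.
case: (insubP _ l) => [j _ jl|_] /=; last by rewrite mul1g mulg1.
by apply: H; rewrite ik jl.
Qed.

Lemma kletter_far k l t t' : (k.+1 < l)%N ->
  kletter k t * kletter l t' = kletter l t' * kletter k t.
Proof.
move=> kl.
have V (x y : G) : x * y = y * x ->
    [/\ x^-1 * y = y * x^-1, x * y^-1 = y^-1 * x & x^-1 * y^-1 = y^-1 * x^-1].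
  move=> e; have e1 := commuteV e; have e2 := commuteV (esym e); split=> //.
  exact: commuteV (esym e2).
have far (i j : 'I_n.-1) : (i.+1 < j)%N -> far_apart i j by rewrite /far_apart => ->.
have far' (i j : 'I_n.-1) : (i.+1 < j)%N -> far_apart j i by rewrite /far_apart orbC => ->.
have rr := at_place_far (h := f \o @Rho n) (h' := f \o @Rho n) (fun i j ij => comm_eval (rel_rho_rho (far i j ij))) kl.
have ss := at_place_far (h := f \o @Sigma n) (h' := f \o @Sigma n) (fun i j ij => comm_eval (rel_sigma_sigma (far i j ij))) kl.
have rs := at_place_far (h := f \o @Rho n) (h' := f \o @Sigma n) (fun i j ij => comm_eval (rel_rho_sigma (far i j ij))) kl.
have sr := at_place_far (h := f \o @Sigma n) (h' := f \o @Rho n) (fun i j ij => esym (comm_eval (rel_rho_sigma (far' i j ij)))) kl.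
by case: t; case: t' => /=; do ?[by [] | by case: (V _ _ rr) | by case: (V _ _ ss) | by case: (V _ _ rs) | by case: (V _ _ sr)].
Qed.

(** The two ways of reversing three coplanar wickets; [A], [B], [C] are the kinds of the pairs
    first-second, first-third and second-third. *)
Definition hexagon k (A B C : kind) : Prop :=
  kletter k A * kletter k.+1 B * kletter k C = kletter k.+1 C * kletter k B * kletter k.+1 A.

(** Renaming the first two wickets moves their letter to the other side as its inverse. *)
Lemma hexagon_swap12 k A B C : hexagon k (opp_kind A) C B -> hexagon k A B C.
Proof.
rewrite /hexagon !kletter_opp => h; apply: (mulgI (kletter k A)^-1).
by rewrite !mulgA mulVg mul1g; apply: (mulIg (kletter k.+1 A)^-1); rewrite mulgK.
Qed.

Lemma hexagon_swap23 k A B C : hexagon k B A (opp_kind C) -> hexagon k A B C.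
Proof.
rewrite /hexagon !kletter_opp => h; apply: (mulgI (kletter k.+1 C)^-1).
rewrite !mulgA mulVg mul1g; apply: (mulIg (kletter k C)^-1); rewrite mulgK.
by rewrite -h.
Qed.

(** Renaming the wickets reduces every geometrically possible triple of kinds to one of the five
    relations on adjacent indices without [Tau]. The wickets [a], [b], [c] serve to exclude the
    impossible triples. *)
Lemma hexagon_laminar k A B C (R : realType) (a b c : wk R) : (k.+2 < n)%N ->
  0 < rd a -> 0 < rd b -> 0 < rd c ->
  of_kind A a b -> of_kind B a c -> of_kind C b c -> hexagon k A B C.
Proof.
move=> kn ra rb rc.
have k1 : (k < n.-1)%N by rewrite -ltnS prednK ?(leq_ltn_trans (leq0n _) kn)// ltnW.
have k2 : (k.+1 < n.-1)%N by rewrite -ltnS prednK ?(leq_ltn_trans (leq0n _) kn).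
have E (h : 'I_n.-1 -> G) : at_place h k = h (Ordinal k1) /\ at_place h k.+1 = h (Ordinal k2).
  by rewrite /at_place !insubT.
have e : Ordinal k2 = (Ordinal k1).+1 :> nat by [].
have b1 : hexagon k In In In.
  rewrite /hexagon /= !(E _).1 !(E _).2; have := sat (rel_braid_rho e).
  by rewrite !word_eval_cat !word_eval_letter /= !mulgA.
have b2 : hexagon k Ab Ab Ab.
  rewrite /hexagon /= !(E _).1 !(E _).2; have := sat (rel_braid_sigma e).
  by rewrite !word_eval_cat !word_eval_letter /= !mulgA.
have b3 : hexagon k In Ab Ab.
  rewrite /hexagon /= !(E _).1 !(E _).2; have := sat (rel_rho_sigma_sigma e).
  by rewrite !word_eval_cat !word_eval_letter /= !mulgA.
have b4 : hexagon k Ab Ab In.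
  rewrite /hexagon /= !(E _).1 !(E _).2; have := sat (rel_sigma_sigma_rho e).
  by rewrite !word_eval_cat !word_eval_letter /= !mulgA.
have b5 : hexagon k Ab In In.
  rewrite /hexagon /= !(E _).1 !(E _).2; have := sat (rel_sigma_rho_rho e).
  by rewrite !word_eval_cat !word_eval_letter /= !mulgA.
(* At most three renamings are needed; an impossible triple is a contradictory system of linear
   inequalities. *)
case: A; case: B; case: C; rewrite /= /inside /above => h1 h2 h3;
  do ?[move: h1 => /andP[? ?]]; do ?[move: h2 => /andP[? ?]]; do ?[move: h3 => /andP[? ?]];
  first [ exact: b1 | exact: b2 | exact: b3 | exact: b4 | exact: b5
  | apply: hexagon_swap12 => /=; first [exact: b1 | exact: b2 | exact: b3 | exact: b4 | exact: b5
    | apply: hexagon_swap23 => /=; first [exact: b1 | exact: b2 | exact: b3 | exact: b4 | exact: b5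
      | apply: hexagon_swap12 => /=; first [exact: b1 | exact: b2 | exact: b3 | exact: b4 | exact: b5]]]
  | apply: hexagon_swap23 => /=; first [exact: b1 | exact: b2 | exact: b3 | exact: b4 | exact: b5
    | apply: hexagon_swap12 => /=; first [exact: b1 | exact: b2 | exact: b3 | exact: b4 | exact: b5
      | apply: hexagon_swap23 => /=; first [exact: b1 | exact: b2 | exact: b3 | exact: b4 | exact: b5]]]
  | by exfalso; lra].
Qed.

End Letters.

(** * Flat configurations *)

Section FlatWickets.
Variable R : realType.
Implicit Types a b : wk R.

(** The squared height of a half circle over a point is the product of the distances from the point
    to the ends of the diameter; comparing these products excludes laminar positions. Conversely,
    the radical axis of two crossing circles passes through a common point. *)
Lemma flat_meetP a b : an a = 0 -> an b = 0 -> 0 < rd a -> 0 < rd b ->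
  meet a b <-> cx a = cx b /\ ~~ laminar a b.
Proof.
move=> ta tb ra rb; rewrite /meet ta tb sin0 cos0.
split=> [[l [m [/andP[l0 l1] /andP[m0 m1] hx hy hz]]]|[ex]].
  split; first by lra.
  set p := cy a + l * rd a * 1 in hy; have pb : p = cy b + m * rd b * 1 by [].
  have pw : (p - (cy a - rd a)) * (cy a + rd a - p) = (p - (cy b - rd b)) * (cy b + rd b - p).
    transitivity (rd a ^+ 2 * (1 - l ^+ 2)); first by rewrite /p; ring.
    by rewrite hz pb; ring.
  have [a1 a2] : cy a - rd a <= p /\ p <= cy a + rd a by rewrite /p; split; nra.
  have [b1 b2] : cy b - rd b <= p /\ p <= cy b + rd b by rewrite pb; split; nra.
  rewrite /laminar /inside /above; apply/negP => /or4P[/andP[h1 h2]|/andP[h1 h2]|h|h].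
  - nra.
  - nra.
  - lra.
  - lra.
rewrite /laminar !negb_or !negb_and -!leNgt => /and4P[h1 h2 h3 h4].
have [ey|ne] := eqVneq (cy a) (cy b).
  have er : rd a = rd b by rewrite ey in h1 h2; case/orP: h1 => ?; case/orP: h2 => ?; lra.
  by exists 0, 0; rewrite ex ey er; split=> //; lra.
pose D := cy b - cy a; have D0 : D != 0 by rewrite subr_eq0 eq_sym.
(* Position of the radical axis relative to the center of [a]. *)
pose s := (D ^+ 2 + rd a ^+ 2 - rd b ^+ 2) / (2 * D).
have sD : s * (2 * D) = D ^+ 2 + rd a ^+ 2 - rd b ^+ 2 by rewrite divfK// mulf_neq0// pnatr_eq0.
have bnd (x r : R) : 0 < r -> (x - r) * (x + r) <= 0 -> -1 <= x / r <= 1.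
  by move=> r0 h; rewrite ler_pdivlMr// ler_pdivrMr//; apply/andP; split; nra.
have D2 : 0 < D ^+ 2 by rewrite exprn_even_gt0.
(* The triangle inequalities for the two radii and the distance of the centers, in factored form. *)
have tri : (D ^+ 2 - (rd a - rd b) ^+ 2) * (D ^+ 2 - (rd a + rd b) ^+ 2) <= 0.
  have q1 : (rd a - rd b) ^+ 2 <= D ^+ 2.
    by case/orP: h1 => ?; case/orP: h2 => ?; rewrite /D; nra.
  have q2 : D ^+ 2 <= (rd a + rd b) ^+ 2 by rewrite /D; nra.
  by rewrite mulr_ge0_le0// ?subr_ge0// subr_le0.
exists (s / rd a), ((s - D) / rd b); split.
- apply: bnd => //; have : (2 * D) ^+ 2 * ((s - rd a) * (s + rd a)) <= 0.
    rewrite (_ : _ * _ = (s * (2 * D)) ^+ 2 - (2 * D * rd a) ^+ 2); last by ring.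
    by rewrite sD (_ : _ - _ = (D ^+ 2 - (rd a - rd b) ^+ 2) * (D ^+ 2 - (rd a + rd b) ^+ 2)); last by ring.
  by rewrite pmulr_rle0// exprn_even_gt0//= mulf_neq0// pnatr_eq0.
- apply: bnd => //; have : (2 * D) ^+ 2 * ((s - D - rd b) * (s - D + rd b)) <= 0.
    rewrite (_ : _ * _ = (s * (2 * D) - 2 * D ^+ 2) ^+ 2 - (2 * D * rd b) ^+ 2); last by ring.
    by rewrite sD (_ : _ - _ = (D ^+ 2 - (rd a - rd b) ^+ 2) * (D ^+ 2 - (rd a + rd b) ^+ 2)); last by ring.
  by rewrite pmulr_rle0// exprn_even_gt0//= mulf_neq0// pnatr_eq0.
- by rewrite !mulr0 !addr0.
- by rewrite !mulr1 !divfK ?gt_eqF// /D; ring.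
- have E (x r : R) : 0 < r -> r ^+ 2 * (1 - (x / r) ^+ 2) = r ^+ 2 - x ^+ 2.
    by move=> r0; field; rewrite gt_eqF.
  rewrite !E//; apply/eqP; rewrite -subr_eq0; apply/eqP.
  transitivity (D ^+ 2 + rd a ^+ 2 - rd b ^+ 2 - s * (2 * D)); first by ring.
  by rewrite sD subrr.
Qed.

Definition lin a b (t : R) : wk R :=
  ((1 - t) * cx a + t * cx b, (1 - t) * cy a + t * cy b,
   (1 - t) * rd a + t * rd b, (1 - t) * an a + t * an b).

Lemma lin0 a b : lin a b 0 = a.
Proof. by apply: wk_eq => /=; rewrite subr0 mul1r mul0r addr0. Qed.
Lemma lin1 a b : lin a b 1 = b.
Proof. by apply: wk_eq => /=; rewrite subrr mul1r mul0r add0r. Qed.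
Lemma linxx a t : lin a a t = a.
Proof. by apply: wk_eq => /=; ring. Qed.

Lemma lt_conv (x y x' y' t : R) : 0 <= t <= 1 -> x < y -> x' < y' ->
  (1 - t) * x + t * x' < (1 - t) * y + t * y'.
Proof. by move=> /andP[t0 t1] h h'; have [->|t'] := eqVneq t 0; [lra|nra]. Qed.

Lemma le_conv (x y x' y' t : R) : 0 <= t <= 1 -> x <= y -> x' <= y' ->
  (1 - t) * x + t * x' <= (1 - t) * y + t * y'.
Proof. by move=> /andP[t0 t1] h h'; nra. Qed.

Lemma lt_le_conv (x y x' y' t : R) : 0 <= t < 1 -> x < y -> x' <= y' ->
  (1 - t) * x + t * x' < (1 - t) * y + t * y'.
Proof. by move=> /andP[t0 t1] h h'; nra. Qed.

Lemma le_lt_conv (x y x' y' t : R) : 0 < t <= 1 -> x <= y -> x' < y' ->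
  (1 - t) * x + t * x' < (1 - t) * y + t * y'.
Proof. by move=> /andP[t0 t1] h h'; nra. Qed.

Lemma lin_rd a b t : 0 <= t <= 1 -> 0 < rd a -> 0 < rd b -> 0 < rd (lin a b t).
Proof. by move=> t01 ra rb; have := lt_conv t01 ra rb; rewrite !mulr0 addr0. Qed.

(** Each kind is a conjunction of strict linear inequalities, a convex condition. *)
Lemma of_kind_lin k a b a' b' t : 0 <= t <= 1 -> of_kind k a b -> of_kind k a' b' ->
  of_kind k (lin a a' t) (lin b b' t).
Proof.
move=> t01.
have F x y : inside x y -> forall x' y', inside x' y' -> inside (lin x x' t) (lin y y' t).
  move=> /andP[h1 h2] x' y' /andP[h1' h2']; apply/andP; split.
    by have := lt_conv t01 h1 h1'; rewrite /=; lra.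
  by have := lt_conv t01 h2 h2'; rewrite /=; lra.
have F' x y : above x y -> forall x' y', above x' y' -> above (lin x x' t) (lin y y' t).
  by move=> h x' y' h'; have := lt_conv t01 h h'; rewrite /above /=; lra.
by case: k => /= h h'; [exact: F|exact: F|exact: F'|exact: F'].
Qed.

Lemma lin_cts (T : topologicalType) (a b : T -> wk R) (t : T -> R) :
  continuous (a : T -> R * R * R * R) -> continuous (b : T -> R * R * R * R) -> continuous t ->
  continuous (fun z => lin (a z) (b z) (t z) : R * R * R * R).
Proof. by move=> ca cb ct; rewrite /lin; cts. Qed.

End FlatWickets.

(** * Cones of flat configurations *)

Section FlatConfigs.
Variables (R : realType) (n : nat).
Local Notation cfg := ('I_n -> wk R).
Local Notation valid := (@valid R _ [set: 'I_n]%SET).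
Local Notation flat := (@flat R _ [set: 'I_n]%SET).
Local Notation ctsF f := (forall i, continuous (fun t => f t i : R * R * R * R)).
Implicit Types (c : cfg) (L : seq 'I_n).

Lemma flatP c : flat c <-> forall i, an (c i) = 0.
Proof. by split=> [h i|h i _]; exact: h. Qed.

Lemma flat_validP c : (forall i, an (c i) = 0) ->
  valid c <-> (forall i, 0 < rd (c i)) /\
    forall i j, i != j -> cx (c i) = cx (c j) -> laminar (c i) (c j).
Proof.
move=> f; split=> [v|[r0 h]].
  split=> [i|i j ij ex]; first exact: valid_rd.
  apply/negPn/negP => nl; apply: (valid_meet v ij).
  by apply/flat_meetP => //; exact: valid_rd.
by apply: validP => // i j ij /flat_meetP[] // /(h _ _ ij) ->.
Qed.

Definition line c c' (t : R) : cfg := fun i => lin (c i) (c' i) t.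

Lemma line0 c c' : line c c' 0 = c. Proof. by apply/funext => i; exact: lin0. Qed.
Lemma line1 c c' : line c c' 1 = c'. Proof. by apply/funext => i; exact: lin1. Qed.
Lemma linexx c t : line c c t = c. Proof. by apply/funext => i; exact: linxx. Qed.

Lemma line_cts (T : topologicalType) (f g : T -> cfg) (t : T -> R) :
  ctsF f -> ctsF g -> continuous t -> ctsF (fun z => line (f z) (g z) (t z)).
Proof. by move=> cf cg ct i; apply: lin_cts. Qed.

Lemma line_flat c c' t : flat c -> flat c' -> flat (line c c' t).
Proof. by move=> f f' i iA /=; rewrite f// f'// !mulr0 addr0. Qed.

Definition order L : Prop := perm_eq L (enum 'I_n).

Lemma order_uniq L : order L -> uniq L.
Proof. by move=> /perm_uniq ->; exact: enum_uniq. Qed.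
Lemma order_mem L i : order L -> i \in L.
Proof. by move=> /perm_mem ->; rewrite mem_enum. Qed.
Lemma order_size L : order L -> size L = n.
Proof. by move=> /perm_size ->; rewrite size_enum_ord. Qed.
Lemma order_index_lt L i : order L -> (index i L < n)%N.
Proof. by move=> oL; rewrite -[ltnRHS](order_size oL) index_mem order_mem. Qed.
Lemma order_index_inj L i j : order L -> index i L = index j L -> i = j.
Proof. by move=> oL e; rewrite -(nth_index i (order_mem i oL)) e nth_index// order_mem. Qed.
Lemma order_enum : order (enum 'I_n). Proof. exact: perm_refl. Qed.

(** Ties are allowed, so a configuration with coinciding planes is sorted by several orders. *)
Definition sorted_by L c : Prop :=
  forall i j, (index i L < index j L)%N -> cx (c i) <= cx (c j).

Lemma order_exists c : exists L, order L /\ sorted_by L c.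
Proof.
pose r : rel 'I_n := fun i j => cx (c i) <= cx (c j).
have r_tot : total r by move=> i j; exact: le_total.
have r_tr : transitive r by move=> j i k; exact: le_trans.
have oL : order (sort r (enum 'I_n)) by rewrite /order perm_sort.
exists (sort r (enum 'I_n)); split=> // i j ij.
have := sort_sorted r_tot (enum 'I_n); rewrite sorted_pairwise// => /(pairwiseP i) h.
have := h _ _ _ _ ij; rewrite !nth_index ?order_mem//; apply; by rewrite inE index_mem order_mem.
Qed.

Definition transpose_places (k p : nat) : nat :=
  if p == k then k.+1 else if p == k.+1 then k else p.

Lemma index_swap u a b (v : seq 'I_n) i : uniq (u ++ a :: b :: v) ->
  index i (u ++ b :: a :: v) = transpose_places (size u) (index i (u ++ a :: b :: v)).
Proof.
rewrite cat_uniq /= !inE !negb_or => /and4P[_ /and3P[au bu _] /andP[ab _] _].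
rewrite !index_cat; case: ifP => iu.
  have lt : (index i u < size u)%N by rewrite index_mem.
  by rewrite /transpose_places !ifF//; apply/negbTE; rewrite neq_ltn ?lt ?(ltn_trans lt).
rewrite /= /transpose_places; have [ia|ia] := eqVneq a i.
  by rewrite -ia eq_sym (negbTE ab) addn0 eqxx addn1.
have [ib|ib] := eqVneq b i; first by do ?case: eqP; lia.
by do ?case: eqP; lia.
Qed.

Lemma order_swap u a b v : order (u ++ a :: b :: v) -> order (u ++ b :: a :: v).
Proof.
rewrite /order => h; apply: perm_trans h.
by rewrite perm_cat2l; apply/permP => p /=; rewrite addnCA.
Qed.

Lemma transpose_places_lt k p q : (q < p)%N ->
  (transpose_places k p < transpose_places k q)%N -> q = k /\ p = k.+1.
Proof. by rewrite /transpose_places; do ?case: eqP; lia. Qed.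

Lemma index_adjacent u a b (v : seq 'I_n) : uniq (u ++ a :: b :: v) ->
  index a (u ++ a :: b :: v) = size u /\ index b (u ++ a :: b :: v) = (size u).+1.
Proof.
rewrite cat_uniq /= !inE !negb_or => /and4P[_ /and3P[au bu _] /andP[ab _] _].
by rewrite !index_cat (negbTE au) (negbTE bu) /= eqxx (negbTE ab) eqxx addn0 addn1.
Qed.

Lemma sorted_by_swap u a b v c : order (u ++ a :: b :: v) -> cx (c a) = cx (c b) ->
  sorted_by (u ++ a :: b :: v) c -> sorted_by (u ++ b :: a :: v) c.
Proof.
move=> oL ex sL i j; have uq := order_uniq oL; rewrite !(index_swap _ uq) => h.
have [h'|h'|e] := ltngtP (index i (u ++ a :: b :: v)) (index j (u ++ a :: b :: v)).
- exact: sL.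
- have [ej ei] := transpose_places_lt h' h.
  have [ia ib] := index_adjacent uq.
  have -> : j = a by apply: (order_index_inj oL); rewrite ia.
  have -> : i = b by apply: (order_index_inj oL); rewrite ib.
  by rewrite ex.
- by rewrite (order_index_inj oL e).
Qed.

Definition standard (p : nat) : wk R := (4 * p.+1%:R, 0, 1, 0).
Definition conf L : cfg := fun i => standard (index i L).

Lemma standard_lt p q : (p < q)%N -> cx (standard p) < cx (standard q).
Proof. by move=> pq; rewrite /= ltr_pM2l// ltr_nat. Qed.

(** For [s < 1] the strict inequalities of [conf L] make those of [c] strict, so no two planes
    coincide before the end of the segment. *)
Lemma cone_valid L c s : order L -> valid c -> flat c -> sorted_by L c -> 0 <= s <= 1 ->
  valid (line (conf L) c s) /\ flat (line (conf L) c s).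
Proof.
move=> oL v f sL s01; have fl : flat (line (conf L) c s) by apply: line_flat.
split=> //; have [e|ne] := eqVneq s 1; first by rewrite e line1.
have s01' : 0 <= s < 1 by rewrite lt_neqAle ne.
apply/flat_validP; first exact/flatP.
split=> [i|i j ij]; first by apply: lin_rd => //; exact: valid_rd.
wlog h : i j ij / (index i L < index j L)%N.
  move=> H; have [h|h|e] := ltngtP (index i L) (index j L); first exact: H.
    by move=> e; rewrite laminar_sym; apply: H => //; rewrite eq_sym.
  by rewrite (order_index_inj oL e) eqxx in ij.
move=> e; have lt : cx (line (conf L) c s i) < cx (line (conf L) c s j).
  exact: lt_le_conv s01' (standard_lt h) (sL _ _ h).
by rewrite e ltxx in lt.
Qed.

Lemma conf_valid L : order L -> valid (conf L) /\ flat (conf L).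
Proof.
move=> oL; have f : flat (conf L) by [].
split=> //; apply/flat_validP => //; split=> [i|i j ij]; first exact: ltr01.
move=> /= /(mulfI _) -/(_ _)/eqP; rewrite pnatr_eq0 eqr_nat eqSS => /(_ isT)/eqP.
by move=> /(order_index_inj oL) e; rewrite e eqxx in ij.
Qed.

Definition flat_path (e : R -> cfg) : Prop :=
  path_ok e /\ forall t, 0 <= t <= 1 -> flat (e t).

(** The class of the segment from the apex [conf L] serves as a coordinate on the cone of [L]. *)
Definition nu L c : wicket_group R n := Hc (line (conf L) c).

(** The cone over the path is a square with one side collapsed to the apex. *)
Lemma nu_path L (e : R -> cfg) : order L -> flat_path e ->
  (forall t, 0 <= t <= 1 -> sorted_by L (e t)) -> (nu L (e 0%R) * Hc e)%g = nu L (e 1%R).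
Proof.
move=> oL [[ce ve] fe] se.
have ok : square_ok (fun z => line (conf L) (e z.2) z.1).
  split=> [i|s t s01 t01]; last by have [] := cone_valid oL (ve t t01) (fe t t01) (se t t01) s01.
  apply: line_cts => [j|j|]; [by cts|by have c := ce j; cts|by cts].
have := Hc_square ok; rewrite /=.
have -> : (fun t => line (conf L) (e t) 1) = e by apply/funext => t; rewrite line1.
have -> : (fun t => line (conf L) (e t) 0) = fun=> conf L by apply/funext => t; rewrite line0.
by rewrite (Hc_cst (conf_valid oL).1) mul1g => h; exact: h.
Qed.

Lemma nu_conf L : order L -> nu L (conf L) = 1%g.
Proof.
move=> oL; rewrite /nu -(Hc_cst (conf_valid oL).1); congr Hc.
by apply/funext => t; rewrite linexx.
Qed.

(** The loop from [conf L] to [c] and back to [conf L']; without labels both ends are the base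
    configuration. *)
Definition jump_at L L' c : wicket_group R n := (nu L c * (nu L' c)^-1)%g.

(** Wickets coplanar in [c0] keep their kind even when their planes separate. The condition is
    convex and holds for all flat configurations close to [c0]. *)
Definition nearby c0 c : Prop := [/\ flat c, forall i, 0 < rd (c i) &
  forall i j, i != j -> (cx (c0 i) < cx (c0 j) -> cx (c i) < cx (c j)) /\
    (cx (c0 i) = cx (c0 j) -> of_kind (kind_of (c0 i) (c0 j)) (c i) (c j))].

Lemma nearby_refl c : valid c -> flat c -> nearby c c.
Proof.
move=> v f; have [r0 h] := (flat_validP ((flatP _).1 f)).1 v.
by split=> // i j ij; split=> // /(h i j ij); exact: kind_ofP.
Qed.

Lemma nearby_valid c0 c : nearby c0 c -> valid c.
Proof.
move=> [f r0 h]; apply/flat_validP; first exact/flatP.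
split=> // i j ij e; have [h1|h1|h1] := ltgtP (cx (c0 i)) (cx (c0 j)).
- by have := (h i j ij).1 h1; rewrite e ltxx.
- by rewrite eq_sym in ij; have := (h j i ij).1 h1; rewrite e ltxx.
- exact: of_kind_laminar ((h i j ij).2 h1).
Qed.

Lemma nearby_line c0 c c' t : 0 <= t <= 1 -> nearby c0 c -> nearby c0 c' ->
  nearby c0 (line c c' t).
Proof.
move=> t01 [f r h] [f' r' h']; split; first exact: line_flat.
  by move=> i; exact: lin_rd.
move=> i j ij; have [h1 h2] := h i j ij; have [h1' h2'] := h' i j ij; split=> [lt|e].
  exact: (lt_conv t01 (h1 lt) (h1' lt)).
exact: (of_kind_lin t01 (h2 e) (h2' e)).
Qed.

Lemma nearby_sorted c0 c L : nearby c0 c -> sorted_by L c -> sorted_by L c0.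
Proof.
move=> [_ _ h] sL i j ij; rewrite leNgt; apply/negP => lt.
have nij : j != i by apply: contraTneq ij => ->; rewrite ltnn.
by have := (h j i nij).1 lt; rewrite ltNge sL.
Qed.

Lemma sorted_line c c' L t : 0 <= t <= 1 -> sorted_by L c -> sorted_by L c' ->
  sorted_by L (line c c' t).
Proof. by move=> t01 s s' i j ij; apply: (le_conv t01); [exact: s|exact: s']. Qed.

Lemma near_nearby (T : topologicalType) (f : T -> cfg) (x : T) : ctsF f -> valid (f x) ->
  flat (f x) -> \forall y \near x, flat (f y) -> nearby (f x) (f y).
Proof.
move=> cf v fl; have [r0 h] := (flat_validP ((flatP _).1 fl)).1 v.
have c0 : continuous (fun=> 0 : R) := @cst_fun_continuous T R 0.
have H1 : \forall y \near x, forall i, 0 < rd (f y i).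
  apply: (@filter_forall _ _ (fun i y => 0 < rd (f y i)) _ (nbhs_filter x)) => i.
  by apply: (near_lt c0); [have c := cf i; cts|exact: r0].
have H2 : \forall y \near x, forall ij : 'I_n * 'I_n, ij.1 != ij.2 ->
    (cx (f x ij.1) < cx (f x ij.2) -> cx (f y ij.1) < cx (f y ij.2)) /\
    (cx (f x ij.1) = cx (f x ij.2) ->
      of_kind (kind_of (f x ij.1) (f x ij.2)) (f y ij.1) (f y ij.2)).
  apply: (@filter_forall _ _ (fun (ij : 'I_n * 'I_n) y => ij.1 != ij.2 ->
    (cx (f x ij.1) < cx (f x ij.2) -> cx (f y ij.1) < cx (f y ij.2)) /\
    (cx (f x ij.1) = cx (f x ij.2) ->
      of_kind (kind_of (f x ij.1) (f x ij.2)) (f y ij.1) (f y ij.2))) _ (nbhs_filter x)) => -[i j] /=.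
  have [->|ij] := eqVneq i j; first by apply: nearW.
  have ci := cf i; have cj := cf j.
  have N1 : \forall y \near x, cx (f x i) < cx (f x j) -> cx (f y i) < cx (f y j).
    have [lt|_] := boolP (cx (f x i) < cx (f x j)); last exact: nearW.
    have : \forall y \near x, cx (f y i) < cx (f y j).
      by apply: (@near_lt R T (fun y => cx (f y i)) (fun y => cx (f y j))); [cts|cts|].
    by apply: filterS.
  have N2 : \forall y \near x, cx (f x i) = cx (f x j) ->
      of_kind (kind_of (f x i) (f x j)) (f y i) (f y j).
    have [e|ne] := eqVneq (cx (f x i)) (cx (f x j)); last by apply: nearW => y /eqP; rewrite (negbTE ne).
    have I1 (a b : 'I_n) : inside (f x a) (f x b) -> \forall y \near x, inside (f y a) (f y b).
      move=> /andP[h1 h2]; have ca := cf a; have cb := cf b.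
      have n1 : \forall y \near x, cy (f y b) - rd (f y b) < cy (f y a) - rd (f y a).
        by apply: (@near_lt R T (fun y => cy (f y b) - rd (f y b)) (fun y => cy (f y a) - rd (f y a))); [cts|cts|].
      have n2 : \forall y \near x, cy (f y a) + rd (f y a) < cy (f y b) + rd (f y b).
        by apply: (@near_lt R T (fun y => cy (f y a) + rd (f y a)) (fun y => cy (f y b) + rd (f y b))); [cts|cts|].
      by apply: filterS2 n1 n2 => y k1 k2; apply/andP.
    have A1 (a b : 'I_n) : above (f x a) (f x b) -> \forall y \near x, above (f y a) (f y b).
      move=> h1; have ca := cf a; have cb := cf b.
      by apply: (@near_lt R T (fun y => cy (f y b) + rd (f y b)) (fun y => cy (f y a) - rd (f y a))); [cts|cts|].
    have := kind_ofP (h i j ij e); case: (kind_of _ _) => /= k.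
    - by apply: filterS (I1 _ _ k).
    - by apply: filterS (I1 _ _ k).
    - by apply: filterS (A1 _ _ k).
    - by apply: filterS (A1 _ _ k).
  by apply: filterS2 N1 N2.
apply: filterS2 H1 H2 => y h1 h2 fy; split=> // i j.
exact: (h2 (i, j)).
Qed.

Lemma flat_line_path c0 c c' : nearby c0 c -> nearby c0 c' -> flat_path (line c c').
Proof.
move=> h h'; split; first split.
- by move=> i; apply: line_cts => [j|j|]; cts.
- by move=> t t01; apply: nearby_valid (nearby_line t01 h h').
- by move=> t t01; case: (nearby_line t01 h h').
Qed.

(** The whole path contracts to [c0] among the nearby configurations, and its ends do so inside the
    cones of [L] and [L']. Only the transition at [c0] is left. *)
Lemma jump_local c0 (e : R -> cfg) L L' : order L -> order L' -> valid c0 -> flat c0 ->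
  path_ok e -> (forall t, 0 <= t <= 1 -> nearby c0 (e t)) ->
  sorted_by L (e 0) -> sorted_by L' (e 1) ->
  (nu L (e 0%R) * Hc e)%g = (jump_at L L' c0 * nu L' (e 1%R))%g.
Proof.
move=> oL oL' v0 f0 [ce ve] he s0 s1; have h0 := nearby_refl v0 f0.
have h00 : (0 <= (0 : R) <= 1)%R by lra.
have h11 : (0 <= (1 : R) <= 1)%R by lra.
have to_c0 K c : order K -> nearby c0 c -> sorted_by K c ->
    (nu K c * Hc (line c c0))%g = nu K c0.
  move=> oK hc sK; have := nu_path oK (flat_line_path hc h0); rewrite line0 line1; apply.
  by move=> t t01; apply: sorted_line => //; exact: nearby_sorted hc sK.
have ok : square_ok (fun z => line (e z.1) c0 z.2).
  split=> [i|s t s01 t01]; last exact: nearby_valid (nearby_line t01 (he s s01) h0).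
  by apply: line_cts => [j|j|]; [have c := ce j; cts|cts|cts].
have := Hc_square ok; rewrite /=.
have -> : (fun t => line (e t) c0 0) = e by apply/funext => t; rewrite line0.
have -> : (fun t => line (e t) c0 1) = fun=> c0 by apply/funext => t; rewrite line1.
rewrite (Hc_cst v0) mulg1 => E.
have E0 := to_c0 L _ oL (he _ h00) s0; have E1 := to_c0 L' _ oL' (he _ h11) s1.
by rewrite /jump_at -E0 -E1 -E invgM !mulgA mulgK mulgVK.
Qed.

End FlatConfigs.

(** * Transitions between orders *)

Section Jumps.
Variables (R : realType) (n : nat).
Local Notation cfg := ('I_n -> wk R).
Local Notation valid := (@valid R _ [set: 'I_n]%SET).
Local Notation flat := (@flat R _ [set: 'I_n]%SET).
Local Notation ctsF f := (forall i, continuous (fun t => f t i : R * R * R * R)).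
Local Notation E := (enum 'I_n).
Implicit Types (c : cfg) (L : seq 'I_n).

(** By [jump_local] a short piece of the path changes the coordinate by one transition;
    [real_induction] accumulates their product. *)
Lemma flat_path_class (P : wicket_group R n -> Prop) : P 1%g ->
  (forall g h, P g -> P h -> P (g * h)%g) ->
  (forall c L L', valid c -> flat c -> order L -> order L' -> sorted_by L c -> sorted_by L' c ->
     P (jump_at L L' c)) ->
  forall (e : R -> cfg) L L', flat_path e -> order L -> order L' ->
    sorted_by L (e 0) -> sorted_by L' (e 1) ->
    P (nu L (e 0%R) * Hc e * (nu L' (e 1%R))^-1)%g.
Proof.
move=> P1 PM PJ e L L' [[ce ve] fe] oL oL' s0 s1.
have h00 : (0 <= (0 : R) <= 1)%R by lra.
have h11 : (0 <= (1 : R) <= 1)%R by lra.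
suff H : forall u : R, (0 <= u <= 1)%R -> forall K, order K -> sorted_by K (e u) ->
    P (nu L (e 0%R) * Hc (fun t => e (0 + t * (u - 0))%R) * (nu K (e u))^-1)%g.
  have := H 1%R h11 L' oL' s1; suff -> : (fun t => e (0 + t * (1 - 0))%R) = e by [].
  by apply/funext => t; rewrite subr0 mulr1 add0r.
apply: real_induction => [u u01|K oK sK]; last first.
  have -> : (fun t => e (0 + t * (0 - 0))%R) = fun=> e 0%R.
    by apply/funext => t; rewrite subrr mulr0 addr0.
  by rewrite (Hc_cst (ve _ h00)) mulg1; apply: PJ => //; [exact: ve|exact: fe].
have := near_nearby ce (ve u u01) (fe u u01) => /nbhs_ballP[d d0 hd].
exists d => // v w v01 w01 vu wu IH K oK sK.
have [Kv [oKv sKv]] := order_exists (e v).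
have seg t : (0 <= t <= 1)%R -> (0 <= v + t * (w - v) <= 1)%R /\ `|v + t * (w - v) - u| < d.
  move: v01 w01 vu wu; rewrite !ltr_norml.
  move=> /andP[v0 v1] /andP[w0 w1] /andP[vu0 vu1] /andP[wu0 wu1] /andP[t0 t1].
  have t01 : (0 <= t <= 1)%R by rewrite t0.
  have k1 := lt_conv t01 vu1 wu1; have k2 := lt_conv t01 vu0 wu0.
  have k3 := le_conv t01 v0 w0; have k4 := le_conv t01 v1 w1.
  by split; apply/andP; split; lra.
have ok : path_ok (fun t => e (v + t * (w - v))%R).
  by apply: path_ok_comp => // [|t /seg[]//]; cts.
have near_e t : (0 <= t <= 1)%R -> nearby (e u) (e (v + t * (w - v))%R).
  move=> /seg[h1 h2]; apply: hd; last exact: fe.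
  by rewrite /ball /= distrC.
have e0 : (v + 0 * (w - v) = v)%R by ring.
have e1 : (v + 1 * (w - v) = w)%R by ring.
have := jump_local oKv oK (ve u u01) (fe u u01) ok near_e.
rewrite e0 e1 => /(_ sKv sK) J.
rewrite -(Hc_part (conj ce ve) h00 v01 w01).
have -> : (nu L (e 0%R) * (Hc (fun t => e (0 + t * (v - 0))%R) * Hc (fun t => e (v + t * (w - v))%R)) *
    (nu K (e w))^-1 = (nu L (e 0%R) * Hc (fun t => e (0 + t * (v - 0))%R) * (nu Kv (e v))^-1) *
    jump_at Kv K (e u))%g.
  rewrite -[jump_at _ _ _](mulgK (nu K (e w))) -J !mulgA mulgVK.
  by rewrite -!mulgA.
apply: PM; first exact: IH.
have hv : nearby (e u) (e v) by have := near_e 0%R h00; rewrite e0.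
have hw : nearby (e u) (e w) by have := near_e 1%R h11; rewrite e1.
by apply: PJ => //; [exact: ve|exact: fe|exact: nearby_sorted hv sKv|exact: nearby_sorted hw sK].
Qed.

Definition relabel L L' (i : 'I_n) : 'I_n := nth i L' (index i L).

Lemma index_relabel L L' i : order L -> order L' -> index (relabel L L' i) L' = index i L.
Proof.
move=> oL oL'; rewrite /relabel index_uniq ?order_uniq//.
by rewrite (order_size oL'); exact: order_index_lt.
Qed.

Lemma relabel_inj L L' : order L -> order L' -> injective (relabel L L').
Proof.
move=> oL oL' i j e; apply: (order_index_inj oL).
by rewrite -(index_relabel i oL oL') -(index_relabel j oL oL') e.
Qed.

Lemma U_relabel L L' (g : nat -> wk R) : order L -> order L' ->
  valid (fun i => g (index i L)) ->
  valid (fun i => g (index i L')) /\ U (fun i => g (index i L')) = U (fun i => g (index i L)).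
Proof.
move=> oL oL' v; have h i : same (g (index i L')) (g (index (relabel L' L i) L)).
  by rewrite index_relabel//; exact: same_refl.
have v' : valid (fun i => g (index i L')) := valid_same v (relabel_inj oL' oL) h.
by split=> //; apply/(U_eqP v v'); exists (relabel L' L); split=> //; exact: relabel_inj.
Qed.

(** A motion prescribed by places has the same underlying unordered motion for every assignment of
    labels to places. *)
Lemma Hc_relabel L L' (G : R -> nat -> wk R) : order L -> order L' ->
  path_ok (fun t i => G t (index i L)) ->
  Hc (fun t (i : 'I_n) => G t (index i L')) = Hc (fun t (i : 'I_n) => G t (index i L)).
Proof.
move=> oL oL' [cG vG]; apply: Hc_ext => [||t t01]; last 1 first.
- exact: (U_relabel oL oL' (vG t t01)).2.
- split=> [i|t t01]; last exact: (U_relabel oL oL' (vG t t01)).1.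
  by have := cG (relabel L' L i); rewrite index_relabel.
- by [].
Qed.

(** For each kind, the coordinates [(y, r)] of a model pair. *)
Definition tied_pair (t : kind) : (R * R) * (R * R) :=
  match t with
  | In => ((0, 2^-1), (0, 1))
  | Has => ((0, 1), (0, 2^-1))
  | Ab => ((2, 1), (-2, 1))
  | Be => ((-2, 1), (2, 1))
  end.

(* All wickets in standard position except for those in places k and k.+1,
   which are in the same plane and in relative position t. *)
Definition tied (k : nat) (t : kind) (p : nat) : wk R :=
  if p == k then (4 * k.+1%:R + 2, (tied_pair t).1.1, (tied_pair t).1.2, 0)
  else if p == k.+1 then (4 * k.+1%:R + 2, (tied_pair t).2.1, (tied_pair t).2.2, 0)
  else standard R p.

(** The model crossing: two adjacent places meet halfway in position [t] and separate exchanged. *)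
Definition jump (k : nat) (t : kind) : wicket_group R n :=
  (Hc (line (conf R E) (fun i => tied k t (index i E))) *
   (Hc (line (fun i => standard R (transpose_places k (index i E)))
             (fun i => tied k t (index i E))))^-1)%g.

Lemma tied_kind k t : of_kind t (tied k t k) (tied k t k.+1).
Proof.
rewrite /tied eqxx gtn_eqF// eqxx.
by case: t; rewrite /= /inside /above /=; try (apply/andP; split); lra.
Qed.

Lemma tied_rd k t p : 0 < rd (tied k t p).
Proof. by rewrite /tied; case: eqP => _; [|case: eqP => _]; case: t => /=; lra. Qed.

Lemma tied_lt k t p q : (p < q)%N -> ~~ ((p == k) && (q == k.+1)) ->
  cx (tied k t p) < cx (tied k t q).
Proof.
move=> pq npq; have pq' : (p.+1%:R + 1 : R) <= q.+1%:R by rewrite natr1 ler_nat.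
rewrite /tied; have [ep|np] := eqVneq p k; have [eq|nq] := eqVneq q k => /=.
- by lia.
- rewrite ifF /=; last by apply/negbTE; move: npq; rewrite ep eqxx.
  have : (k.+1%:R + 2 : R) <= q.+1%:R by rewrite -natrD ler_nat; lia.
  by lra.
- rewrite ifF /=; last by lia.
  by move: pq'; rewrite eq; lra.
- case: ifP => [/eqP ep|_]; case: ifP => [/eqP eq|_] /=.
  + by lia.
  + have : (k.+1%:R + 2 : R) <= q.+1%:R by rewrite -natrD ler_nat; lia.
    by lra.
  + have : (p.+1%:R + 1 : R) <= k.+1%:R by rewrite natr1 ler_nat; lia.
    by lra.
  + by lra.
Qed.

Lemma tied_eq k t : cx (tied k t k) = cx (tied k t k.+1).
Proof. by rewrite /tied eqxx gtn_eqF// eqxx. Qed.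

Lemma tied_an k t p : an (tied k t p) = 0.
Proof. by rewrite /tied; case: ifP => // _; case: ifP. Qed.

(** On the segment to the model all pairs other than [a], [b] have strictly ordered planes as soon
    as [s > 0], while [a] and [b] stay coplanar with a constant kind. *)
Lemma line_tied u a b v c s : order (u ++ a :: b :: v) -> valid c -> flat c ->
  sorted_by (u ++ a :: b :: v) c -> cx (c a) = cx (c b) -> 0 <= s <= 1 ->
  let c' := line c (fun i => tied (size u) (kind_of (c a) (c b)) (index i (u ++ a :: b :: v))) s in
  [/\ valid c', flat c', sorted_by (u ++ a :: b :: v) c' & cx (c' a) = cx (c' b)].
Proof.
set L := u ++ a :: b :: v; set t := kind_of _ _; set d := fun i => _ => oL va fl sL ab s01 c'.
have [ia ib] := index_adjacent (order_uniq oL); rewrite -/L in ia ib.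
have fd : flat d by move=> i _; exact: tied_an.
have sd : sorted_by L d.
  move=> i j ij; rewrite /d; have [/andP[/eqP -> /eqP ->]|h] := boolP ((index i L == size u) && (index j L == (size u).+1)).
    by rewrite tied_eq.
  exact/ltW/tied_lt.
have nab : a != b by apply: contra_eq_neq ia => ->; rewrite ib gtn_eqF.
have eab : cx (c' a) = cx (c' b) by rewrite /c' /= /d ia ib ab tied_eq.
split=> //; [|exact: line_flat|exact: sorted_line].
have [s0|s0] := eqVneq s 0; first by rewrite /c' s0 line0.
have s01' : 0 < s <= 1 by rewrite lt_neqAle eq_sym s0.
apply/flat_validP; first exact/flatP/line_flat.
split=> [i|i j ij]; first by apply: lin_rd => //; [exact: valid_rd|exact: tied_rd].
wlog h : i j ij / (index i L < index j L)%N.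
  move=> H; have [h|h|e] := ltngtP (index i L) (index j L); first exact: H.
    by move=> e; rewrite laminar_sym; apply: H => //; rewrite eq_sym.
  by rewrite (order_index_inj oL e) eqxx in ij.
have [/andP[/eqP ei /eqP ej] _|nk] := boolP ((index i L == size u) && (index j L == (size u).+1)).
  have -> : i = a by apply: (order_index_inj oL); rewrite ei.
  have -> : j = b by apply: (order_index_inj oL); rewrite ej.
  apply: (@of_kind_laminar _ t); apply: of_kind_lin => //.
    apply: kind_ofP; apply: ((flat_validP ((flatP _).1 fl)).1 va).2 => //.
  by rewrite /d ia ib; exact: tied_kind.
move=> e; have lt : cx (c' i) < cx (c' j).
  exact: le_lt_conv s01' (sL _ _ h) (tied_lt _ h nk).
by rewrite e ltxx in lt.
Qed.

(** The segment of [line_tied] lies in the cones of both orders, so the transition is the same at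
    its two ends; relabelling identifies the end with the model. *)
Lemma jump_swap u a b v c : order (u ++ a :: b :: v) -> valid c -> flat c ->
  sorted_by (u ++ a :: b :: v) c -> cx (c a) = cx (c b) ->
  jump_at (u ++ a :: b :: v) (u ++ b :: a :: v) c = jump (size u) (kind_of (c a) (c b)).
Proof.
set L := u ++ a :: b :: v; set L' := u ++ b :: a :: v; set t := kind_of _ _.
move=> oL va fl sL ab; pose d i := tied (size u) t (index i L).
have H s : 0 <= s <= 1 -> _ := line_tied oL va fl sL ab.
have fp : flat_path (line c d).
  split; first split.
  - by move=> i; apply: line_cts => [j|j|]; cts.
  - by move=> s /H[].
  - by move=> s /H[].
have oL' : order L' := order_swap oL.
have E1 : (nu L c * Hc (line c d))%g = nu L d.
  by have := nu_path oL fp; rewrite line0 line1; apply=> s /H[].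
have E2 : (nu L' c * Hc (line c d))%g = nu L' d.
  have := nu_path oL' fp; rewrite line0 line1; apply=> s /H[_ _ s1 s2].
  exact: sorted_by_swap.
have -> : jump_at L L' c = (nu L d * (nu L' d)^-1)%g.
  by rewrite /jump_at -E1 -E2 invgM !mulgA mulgK.
have [vd fd sd abd] : [/\ valid d, flat d, sorted_by L d & cx (d a) = cx (d b)].
  by have := @H 1; rewrite line1; apply; rewrite ler01 lexx.
have sd' : sorted_by L' d by exact: sorted_by_swap.
have ok K : order K -> sorted_by K d -> path_ok (line (conf R K) d).
  move=> oK sK; split=> [i|s s01]; last by have [] := cone_valid oK vd fd sK s01.
  by apply: line_cts => [j|j|]; cts.
congr (_ * _^-1)%g.
  apply/esym/(Hc_relabel (G := fun s p => lin (standard R p) (tied (size u) t p) s) oL).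
    exact: order_enum.
  exact: ok oL sd.
have eL' : conf R L' = fun i => standard R (transpose_places (size u) (index i L)).
  by apply/funext => i; rewrite /conf (index_swap _ (order_uniq oL)).
apply/esym; rewrite /nu eL'.
apply: (Hc_relabel (G := fun s p => lin (standard R (transpose_places (size u) p))
  (tied (size u) t p) s) oL); first exact: order_enum.
by have := ok L' oL' sd'; rewrite eL'.
Qed.

End Jumps.

(** * The generators and their relations *)

Section Generators.
Variables (R : realType) (n : nat).
Local Notation I := (unit_interval R).
Local Notation cfg := ('I_n -> wk R).
Local Notation valid := (@valid R _ [set: 'I_n]%SET).
Local Notation flat := (@flat R _ [set: 'I_n]%SET).
Local Notation ctsF f := (forall i, continuous (fun t => f t i : R * R * R * R)).
Local Notation E := (enum 'I_n).
Local Notation base := (base_config R n).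
Implicit Types (c : cfg) (L : seq 'I_n).

Lemma enum_split (i : 'I_n.-1) :
  exists u v, E = u ++ left_wicket i :: right_wicket i :: v /\ size u = i.
Proof.
have i1 : (i < size E)%N by rewrite size_enum_ord; exact: (ltn_ord (left_wicket i)).
have i2 : (i.+1 < size E)%N by rewrite size_enum_ord; exact: (ltn_ord (right_wicket i)).
exists (take i E), (drop i.+2 E); rewrite size_take i1; split=> //.
rewrite -[LHS](cat_take_drop i); congr (_ ++ _).
rewrite (drop_nth (left_wicket i))// (drop_nth (left_wicket i) i2).
have -> : nth (left_wicket i) E i = left_wicket i.
  by apply: val_inj; rewrite /= nth_enum_ord// -[X in (_ < X)%N](size_enum_ord n).
have -> // : nth (left_wicket i) E i.+1 = right_wicket i.
by apply: val_inj; rewrite /= nth_enum_ord// -[X in (_ < X)%N](size_enum_ord n).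
Qed.

Lemma ordered_valid c (e : ordered_wickets R n) : (forall i, 0 < rd (c i)) ->
  set_val e = ends_of c -> valid c /\ U c = unordered e.
Proof.
move=> r0 ee; have De : disjoint_wickets (set_val e).
  by apply/set_mem; rewrite set_valE; exact: valP.
have v : valid c.
  apply: validP => // i j ij; apply/wicket_meet => //.
  by have := De.2 i j ij; rewrite ee.
split=> //; rewrite (UE v); congr unordered; apply: val_inj.
by move: ee; rewrite set_valE => ->.
Qed.

Lemma ends_flat (x y r : R) : ends (x, y, r, 0) = xwicket x y r.
Proof. by rewrite /ends /endpt /xwicket /= sin0 cos0 expr0 expr1 !mulr0 !mulr1 !addr0; congr ((_, _), (_, _)); ring. Qed.

Lemma U_conf L : order L -> U (conf R L) = base.
Proof.
have U0 : U (conf R E) = base.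
  apply: (ordered_valid (c := conf R E) _ _).2 => [i|]; first exact: ltr01.
  rewrite set_valE /=; apply/funext => i.
  by rewrite /ends_of /conf index_enum_ord /standard ends_flat.
move=> oL; rewrite -U0.
by apply: (U_relabel (g := standard R) (order_enum n) oL _).2; case: (conf_valid R (order_enum n)).
Qed.

Lemma sign_const (g : R -> R) (a b : R) : continuous g ->
  (forall t : R, 0 <= t <= 1 -> g (a + t * (b - a)) != 0) -> 0 < g a -> 0 < g b.
Proof.
move=> cg ne g0; pose h t := g (a + t * (b - a)).
have ch : continuous h by apply: (compose_continuous _ cg); cts.
suff /(_ 1) : forall t, 0 <= t <= 1 -> 0 < h t by rewrite /h mul1r addrCA subrr addr0; apply; lra.
apply: real_induction; last by rewrite /h mul0r addr0.
move=> u u01; have c0 := @cst_fun_continuous R R 0.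
have : \forall v \near u, (0 < h v) = (0 < h u).
  have [h0|h0|h0] := ltgtP 0 (h u).
  - by have := near_lt c0 ch h0; apply: filterS => v ->.
  - have := near_lt ch c0 h0; apply: filterS => v hv.
    by apply/negbTE; rewrite -leNgt ltW.
  - by have := ne u u01; rewrite -/(h u) -h0 eqxx.
move=> /nbhs_ballP[d d0 hd]; exists d => // v w _ _; rewrite !(distrC _ u) => hv hw.
by rewrite (hd v hv) (hd w hw).
Qed.

Lemma between (a b t : R) : 0 <= t <= 1 -> a <= b -> a <= a + t * (b - a) <= b.
Proof. by move=> /andP[? ?] ?; apply/andP; split; nra. Qed.

(** Until [t0] the motion stays in the cone of the initial order, afterwards in that of the
    exchanged order, so only the transition at [t0] contributes. Hence the class does not depend on
    the loop chosen. *)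
Lemma exchange_jump (i : 'I_n.-1) (t : kind) (p : loop (R := R) base) (t0 : I)
    (x y r : 'I_n -> I -> R) :
  let k := left_wicket i in let l := right_wicket i in
  follows p (fun s j => xwicket (x j s) (y j s) (r j s)) -> exchange k l t0 x y r ->
  of_kind t (x k t0, y k t0, r k t0, 0) (x l t0, y l t0, r l t0, 0) ->
  pi1_class p = jump R n i t.
Proof.
move=> k l fol [cxyr r0 fixed [[xk0 yk0 rk0] [xl0 yl0 rl0] [xk1 yk1 rk1] [xl1 yl1 rl1] tie]] kd.
pose e (s : R) : cfg := fun j => (x j (clamp s), y j (clamp s), r j (clamp s), 0).
have ce : ctsF e by move=> j; have [c1 c2 c3] := cxyr j; rewrite /e; cts.
have lk : l = k.+1 :> nat by [].
have kl : k != l by rewrite -(inj_eq val_inj) /= ltn_eqF.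
have ve (s : R) : valid (e s) /\ p (clamp s) = U (e s).
  have [w [w1 w2]] := fol (clamp s); rewrite w2.
  have [|h1 h2] := @ordered_valid (e s) w (fun j => r0 j _); last by rewrite h2.
  by rewrite w1; apply/funext => j; rewrite /ends_of ends_flat.
have fe s : flat (e s) by move=> j _.
have fpe (a b : R) : flat_path (fun s => e (a + s * (b - a))).
  split; first split.
  - by move=> j; apply: (@compose_continuous _ _ _ (fun s : R => a + s * (b - a)) (fun s => e s j)) => //; cts.
  - by move=> s _; case: (ve (a + s * (b - a))).
  - by move=> s _; exact: fe.
have e0 : e 0 = conf R E.
  apply/funext => j; rewrite /conf index_enum_ord; apply: wk_eq => //=; rewrite -[clamp 0]/zero.
  - have [->|jk] := eqVneq j k; first exact: xk0.
    have [->|jl] := eqVneq j l; first exact: xl0.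
    by have [->] := fixed j zero jk jl.
  - have [->|jk] := eqVneq j k; first exact: yk0.
    have [->|jl] := eqVneq j l; first exact: yl0.
    by have [_ ->] := fixed j zero jk jl.
  - have [->|jk] := eqVneq j k; first exact: rk0.
    have [->|jl] := eqVneq j l; first exact: rl0.
    by have [_ _ ->] := fixed j zero jk jl.
have [u [v [Euv su]]] := enum_split i.
set L' := u ++ l :: k :: v.
have oE : order (u ++ k :: l :: v) by rewrite -Euv; exact: order_enum.
have oL' : order L' := order_swap oE.
have iL' j : index j L' = transpose_places i j.
  by rewrite /L' (index_swap _ (order_uniq oE)) su -Euv index_enum_ord.
have e1 : e 1 = conf R L'.
  apply/funext => j; rewrite /conf iL' /transpose_places; apply: wk_eq => //=; rewrite -[clamp 1]/one.
  - have [->|jk] := eqVneq j k; first by rewrite /= eqxx; exact: xk1.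
    have [->|jl] := eqVneq j l; first by rewrite /= gtn_eqF// eqxx; exact: xl1.
    have [-> _ _ _ _] := fixed j one jk jl.
    have -> : (j == i :> nat) = false by exact: negbTE jk.
    by have -> : (j == i.+1 :> nat) = false by exact: negbTE jl.
  - have [->|jk] := eqVneq j k; first exact: yk1.
    have [->|jl] := eqVneq j l; first exact: yl1.
    by have [_ ->] := fixed j one jk jl.
  - have [->|jk] := eqVneq j k; first exact: rk1.
    have [->|jl] := eqVneq j l; first exact: rl1.
    by have [_ _ ->] := fixed j one jk jl.
have cxe j : continuous (fun s => cx (e s j)) by have c := ce j; cts.
have ne_other (a b : 'I_n) s : a != b -> ~~ ((a == k) && (b == l)) -> ~~ ((a == l) && (b == k)) ->
    cx (e s a) != cx (e s b).
  move=> ab nkl nlk; rewrite /e /=.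
  have out j m : j != k -> j != l -> (m == k) || (m == l) -> x m (clamp s) != x j (clamp s).
    by move=> jk jl /orP[] /eqP ->; apply/eqP; have [] := fixed j (clamp s) jk jl.
  have [ak|nak] := boolP ((a == k) || (a == l)); have [bk|nbk] := boolP ((b == k) || (b == l)).
  - move: ak bk => /orP[/eqP ea|/eqP ea] /orP[/eqP eb|/eqP eb];
      by move: ab nkl nlk; rewrite ea eb ?eqxx.
  - by apply: out => //; move: nbk; rewrite negb_or => /andP[].
  - by rewrite eq_sym; apply: out => //; move: nak; rewrite negb_or => /andP[].
  - move: nak nbk; rewrite !negb_or => /andP[ak al] /andP[bk bl].
    have [-> _ _ _ _] := fixed a (clamp s) ak al; have [-> _ _ _ _] := fixed b (clamp s) bk bl.
    apply: contra_neq ab => /(mulfI _) -/(_ _)/eqP; rewrite pnatr_eq0 => /(_ isT).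
    by rewrite eqr_nat eqSS => /eqP/val_inj.
(* The difference of the two [x]-coordinates never vanishes, hence keeps its initial sign. *)
have lt_other (a b : 'I_n) (s : R) : (a < b)%N -> ~~ ((a == k) && (b == l)) -> cx (e s a) < cx (e s b).
  move=> ab nkl; rewrite -subr_gt0.
  apply: (@sign_const (fun s => cx (e s b) - cx (e s a)) 0 s); first by have c1 := cxe a; have c2 := cxe b; cts.
    move=> s' _; rewrite subr_eq0 eq_sym; apply: ne_other => //.
      by rewrite -(inj_eq val_inj) ltn_eqF.
    by apply/negP => /andP[/eqP ea /eqP eb]; move: ab; rewrite ea eb /=; lia.
  by rewrite subr_gt0 e0 /conf !index_enum_ord; exact: standard_lt.
pose T0 := ival t0; have T01 : 0 <= T0 <= 1 := ival_itv t0.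
have eT0 : cx (e T0 k) = cx (e T0 l).
  by rewrite /e /= /T0 clampK; apply/tie.
have ne_kl (s : R) : 0 <= s <= 1 -> s != T0 -> cx (e s k) != cx (e s l).
  move=> s01; apply: contra_neq => /tie; rewrite /T0 => <-.
  by rewrite ivalK.
have h0 : cx (e 0 k) < cx (e 0 l).
  by rewrite e0 /conf !index_enum_ord; apply: standard_lt.
have h1 : cx (e 1 l) < cx (e 1 k).
  by rewrite e1 /conf !iL' /transpose_places /= eqxx gtn_eqF// eqxx; exact: standard_lt.
move: T01 => /andP[T00 T11].
have le0 (s : R) : 0 <= s <= T0 -> cx (e s k) <= cx (e s l).
  move=> /andP[s0 sT]; have [->|sT'] := eqVneq s T0; first by rewrite eT0.
  have {sT'}sT : s < T0 by rewrite lt_neqAle sT'.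
  rewrite ltW// -subr_gt0; apply: (@sign_const (fun s => cx (e s l) - cx (e s k)) 0 s).
  - by have c1 := cxe k; have c2 := cxe l; cts.
  - move=> z z01; rewrite subr_eq0 eq_sym; have /andP[h2 h3] := between z01 s0.
    by apply: ne_kl; rewrite ?h2 ?(le_trans h3 (le_trans (ltW sT) T11))// lt_eqF// (le_lt_trans h3).
  - by rewrite subr_gt0.
have le1 (s : R) : T0 <= s <= 1 -> cx (e s l) <= cx (e s k).
  move=> /andP[Ts s1]; have [->|sT'] := eqVneq s T0; first by rewrite eT0.
  have {sT'}Ts : T0 < s by rewrite lt_neqAle eq_sym sT'.
  rewrite ltW// -subr_gt0; apply: (@sign_const (fun s => cx (e s k) - cx (e s l)) 1 s).
  - by have c1 := cxe k; have c2 := cxe l; cts.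
  - move=> z /andP[z0 z1]; rewrite subr_eq0; have z01 : 0 <= 1 - z <= 1 by apply/andP; split; lra.
    have := between z01 s1; rewrite (_ : s + _ = 1 + z * (s - 1)); last by ring.
    move=> /andP[h2 h3]; apply: ne_kl; last by rewrite gt_eqF// (lt_le_trans Ts).
    by rewrite h3 (le_trans (le_trans T00 (ltW Ts)) h2).
  - by rewrite subr_gt0.
have sE (s : R) : 0 <= s <= T0 -> sorted_by E (e s).
  move=> hs a b; rewrite !index_enum_ord => ab.
  have [/andP[/eqP -> /eqP ->]|nkl] := boolP ((a == k) && (b == l)); first exact: le0.
  exact/ltW/lt_other.
have sL' (s : R) : T0 <= s <= 1 -> sorted_by L' (e s).
  move=> hs a b; rewrite !iL' => ab.
  have [ba|ab'] := ltnP b a.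
    have [eb ea] := transpose_places_lt ba ab.
    have -> : a = l by apply: val_inj.
    have -> : b = k by apply: val_inj.
    exact: le1.
  have {}ab' : (a < b)%N.
    by rewrite ltn_neqAle ab' andbT; apply: contraTneq ab => ->; rewrite ltnn.
  apply/ltW/lt_other => //; apply/negP => /andP[/eqP ea /eqP eb].
  by move: ab; rewrite ea eb /transpose_places /= eqxx gtn_eqF// eqxx; lia.
have h00 : 0 <= (0 : R) <= 1 by lra.
have h11 : 0 <= (1 : R) <= 1 by lra.
have hT : 0 <= T0 <= 1 by rewrite T00.
have P1 : (nu E (e 0%R) * Hc (fun s => e (0 + s * (T0 - 0))%R))%g = nu E (e T0).
  have := nu_path (order_enum n) (fpe 0 T0).
  have -> : 0 + 0 * (T0 - 0) = 0 by ring.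
  have -> : 0 + 1 * (T0 - 0) = T0 by ring.
  by apply=> s s01; apply: sE; exact: between.
have P2 : (nu L' (e T0) * Hc (fun s => e (T0 + s * (1 - T0))%R))%g = nu L' (e 1%R).
  have := nu_path oL' (fpe T0 1).
  have -> : T0 + 0 * (1 - T0) = T0 by ring.
  have -> : T0 + 1 * (1 - T0) = 1 by ring.
  by apply=> s s01; apply: sL'; exact: between.
have oke : path_ok e by split=> // s _; case: (ve s).
rewrite e1 nu_conf// in P2; rewrite e0 nu_conf ?mul1g in P1; last exact: order_enum.
have <- : Hc e = pi1_class p.
  by apply: Hc_loop => // s; have [_] := ve (ival s); rewrite clampK.
have := Hc_part oke h00 hT h11.
have -> : (fun s => e (0 + s * (1 - 0))) = e by apply/funext => s; rewrite subr0 mulr1 add0r.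
move=> <-; rewrite P1.
have -> : Hc (fun s => e (T0 + s * (1 - T0))) = (nu L' (e T0))^-1%g.
  by apply: (mulgI (nu L' (e T0))); rewrite P2 mulgV.
have [vT _] := ve T0.
have sET : sorted_by (u ++ k :: l :: v) (e T0) by rewrite -Euv; apply: sE; rewrite T00 lexx.
have := jump_swap oE vT (fe T0) sET eT0; rewrite su -Euv /jump_at => ->.
congr jump; apply: of_kind_unique; [exact: r0|exact: r0|].
by rewrite /e /T0 clampK.
Qed.

End Generators.

(** * Explicit exchanging loops *)

Section Exchanges.
Variables (R : realType) (n : nat).
Local Notation I := (unit_interval R).
Local Notation cfg := ('I_n -> wk R).
Local Notation valid := (@valid R _ [set: 'I_n]%SET).
Local Notation flat := (@flat R _ [set: 'I_n]%SET).
Local Notation ctsF f := (forall i, continuous (fun t => f t i : R * R * R * R)).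
Local Notation E := (enum 'I_n).
Local Notation base := (base_config R n).
Implicit Types (c : cfg).

(** For [b] of angle 0 the right-hand side is the squared distance from the center of [a] to the
    nearer endpoint of [b]. The angle of [a] does not enter, so [a] may turn. *)
Definition clear (a b : wk R) : Prop :=
  rd a ^+ 2 < (cx a - cx b) ^+ 2 + (`|cy a - cy b| - rd b) ^+ 2.

Lemma clear_flat a b : an b = 0 -> 0 <= rd b -> clear a b -> ~ meet a b.
Proof.
move=> tb rb h; apply: clear_nmeet => //; apply: lt_le_trans h _.
have E2 (d r : R) : (`|d| - r) ^+ 2 = d ^+ 2 + r ^+ 2 - 2 * r * `|d|.
  by rewrite sqrrB real_normK ?num_real//; ring.
by rewrite /dst2 /along tb sin0 cos0 mulr0 mulr1 add0r E2 !addrA.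
Qed.

Definition rotate (a : 'I_n) (th : R) c : cfg :=
  fun j => if j == a then (cx (c j), cy (c j), rd (c j), an (c j) + th) else c j.

Lemma rotate_valid a th c : valid c -> flat c -> (forall j, j != a -> clear (c a) (c j)) ->
  valid (rotate a th c).
Proof.
move=> v f cl; have clr j : j != a -> ~ meet (rotate a th c a) (c j).
  by move=> ja; apply: clear_flat; [exact: f|exact/ltW/valid_rd|rewrite /rotate eqxx; exact: cl].
have rj j : j != a -> rotate a th c j = c j by rewrite /rotate => /negbTE ->.
apply: validP => [j|i j ij].
  by rewrite /rotate; case: ifP => _; exact: (valid_rd j v).
have [ei|ia] := eqVneq i a; have [ej|ja] := eqVneq j a.
- by rewrite ei ej eqxx in ij.
- by rewrite ei (rj j)//; exact: clr.
- by rewrite ej (rj i)// => /meet_sym; exact: clr.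
- by rewrite !rj//; exact: valid_meet.
Qed.

Lemma rotate_cts (T : topologicalType) a (th : T -> R) (f : T -> cfg) :
  continuous th -> ctsF f -> ctsF (fun t => rotate a (th t) (f t)).
Proof.
move=> ct cf j; rewrite /rotate; case: (j == a); last exact: cf.
by have c := cf j; cts.
Qed.

(* nested = true for rho and false for sigma. *)
Definition exch (i : 'I_n.-1) (nested : bool) (s : R) : cfg := fun j =>
  if j == left_wicket i then
    (4 * i.+1%:R + 4 * s, (if nested then 0 else 12) * (s * (1 - s)),
     1 - (if nested then 2 else 0) * (s * (1 - s)), 0)
  else if j == right_wicket i then (4 * i.+2%:R - 4 * s, 0, 1, 0)
  else standard R j.

Section FixedPlace.
Variables (i : 'I_n.-1) (nested : bool).
Local Notation k := (left_wicket i).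
Local Notation l := (right_wicket i).
Local Notation e := (exch i nested).

Lemma lr_neq : (k == l) = false.
Proof. by apply/negbTE; rewrite -(inj_eq val_inj) /= ltn_eqF. Qed.

Lemma exch_left s : e s k = (4 * i.+1%:R + 4 * s, (if nested then 0 else 12) * (s * (1 - s)),
  1 - (if nested then 2 else 0) * (s * (1 - s)), 0).
Proof. by rewrite /exch eqxx. Qed.

Lemma exch_right s : e s l = (4 * i.+2%:R - 4 * s, 0, 1, 0).
Proof. by rewrite /exch eq_sym lr_neq eqxx. Qed.

Lemma exch_other s j : j != k -> j != l -> e s j = standard R j.
Proof. by rewrite /exch => /negbTE -> /negbTE ->. Qed.

Lemma exch_cts : ctsF e.
Proof.
have M : continuous (fun t : R => 4 * t) by apply: mulr_continuous; cts.
by move=> j; rewrite /exch; case: (j == k); [cts|case: (j == l); cts].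
Qed.

Lemma exch_flat s : flat (e s).
Proof. by move=> j _; rewrite /exch; case: ifP => // _; case: ifP. Qed.

Lemma exch_rd s j : 0 <= s <= 1 -> 0 < rd (e s j) <= 1.
Proof.
move=> /andP[s0 s1]; rewrite /exch; case: ifP => _ /=; last by case: ifP => _ /=; lra.
by case: nested; apply/andP; split; nra.
Qed.

Lemma exch_far s a b : 0 <= s <= 1 -> a != b -> ~~ ((a == k) && (b == l)) ->
  ~~ ((a == l) && (b == k)) -> 16 <= (cx (e s a) - cx (e s b)) ^+ 2.
Proof.
move=> /andP[s0 s1] ab h1 h2.
wlog lt : a b ab h1 h2 / (a < b)%N.
  move=> H; have [lt|lt|eq] := ltngtP a b; first exact: H.
    rewrite -sqrrN opprB; apply: H => //; first by rewrite eq_sym.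
      by rewrite andbC.
    by rewrite andbC.
  by rewrite (val_inj eq) eqxx in ab.
have sq (x y : R) : x + 4 <= y -> 16 <= (x - y) ^+ 2 by move=> ?; nra.
have i12 : (i.+2%:R : R) = i.+1%:R + 1 by rewrite -natr1.
have mid j : (j == k) || (j == l) -> 4 * i.+1%:R <= cx (e s j) <= 4 * i.+2%:R.
  by case/orP => /eqP ->; rewrite ?exch_left ?exch_right /= i12; apply/andP; split; lra.
have oth j : ~~ ((j == k) || (j == l)) -> cx (e s j) = 4 * j.+1%:R.
  by rewrite negb_or => /andP[jk jl]; rewrite exch_other.
have le (p q : nat) : (p < q)%N -> (p.+1%:R + 1 : R) <= q.+1%:R by rewrite natr1 ler_nat.
have ek (j : 'I_n) : (j == k) = (j == i :> nat) by [].
have el (j : 'I_n) : (j == l) = (j == i.+1 :> nat) by [].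
apply: sq; have [am|ao] := boolP ((a == k) || (a == l)); have [bm|bo] := boolP ((b == k) || (b == l)).
- by move: am bm h1 h2 lt; rewrite !ek !el; lia.
- have /andP[_ h] := mid a am; rewrite (oth b bo); have : (i.+1 < b)%N.
    by move: am bo lt; rewrite !ek !el; lia.
  by move=> /le; lra.
- have /andP[h _] := mid b bm; rewrite (oth a ao); have : (a < i)%N.
    by move: ao bm lt; rewrite !ek !el; lia.
  by move=> /le; lra.
- by rewrite (oth a ao) (oth b bo); have := le _ _ lt; lra.
Qed.

Lemma exch_clear_far s a b : 0 <= s <= 1 -> a != b -> ~~ ((a == k) && (b == l)) ->
  ~~ ((a == l) && (b == k)) -> clear (e s a) (e s b).
Proof.
move=> s01 ab h1 h2; have := exch_far s01 ab h1 h2; have /andP[r0 r1] := exch_rd a s01.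
by rewrite /clear => h; have := sqr_ge0 (`|cy (e s a) - cy (e s b)| - rd (e s b)); nra.
Qed.

(** With [q = s * (1 - s)], at most 1/4, the squared distance of the planes is [16 - 64 * q]. The
    moving wicket has radius [1 - 2 * q] in the nested case and is displaced by [12 * q] in the
    other. *)
Lemma exch_clear_left s : 0 <= s <= 1 -> clear (e s k) (e s l).
Proof.
move=> /andP[s0 s1]; rewrite /clear exch_left exch_right /= subr0.
have -> : (i.+2%:R : R) = i.+1%:R + 1 by rewrite -natr1.
rewrite ger0_norm; last by case: nested; rewrite ?mul0r//; nra.
have q0 : 0 <= s * (1 - s) <= 4^-1.
  rewrite mulr_ge0 ?subr_ge0//= -subr_ge0.
  have -> : 4^-1 - s * (1 - s) = (s - 2^-1) ^+ 2 by field.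
  exact: sqr_ge0.
set q := s * (1 - s) in q0 *.
have -> : (4 * i.+1%:R + 4 * s - (4 * (i.+1%:R + 1) - 4 * s)) ^+ 2 = 16 - 64 * q :> R.
  by rewrite /q; ring.
by case: nested; nra.
Qed.

Lemma exch_valid s : 0 <= s <= 1 -> valid (e s).
Proof.
move=> s01; apply: validP => [j|a b ab]; first by case/andP: (exch_rd j s01).
have nm (x y : 'I_n) : clear (e s x) (e s y) -> ~ meet (e s x) (e s y).
  by apply: clear_flat; [exact: exch_flat|rewrite ltW//; case/andP: (exch_rd y s01)].
have [/andP[/eqP -> /eqP ->]|h1] := boolP ((a == k) && (b == l)).
  exact/nm/exch_clear_left.
have [/andP[/eqP -> /eqP ->]|h2] := boolP ((a == l) && (b == k)).
  by move=> /meet_sym; exact/nm/exch_clear_left.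
exact/nm/exch_clear_far.
Qed.

Lemma exch_ok : path_ok e.
Proof. by split; [exact: exch_cts|exact: exch_valid]. Qed.

Lemma exch_0 : e 0 = conf R E.
Proof.
apply/funext => j; rewrite /conf index_enum_ord.
have [->|jk] := eqVneq j k; first by rewrite exch_left; apply: wk_eq => //=; ring.
have [->|jl] := eqVneq j l; first by rewrite exch_right; apply: wk_eq => //=; ring.
exact: exch_other.
Qed.

Lemma exch_1 : exists2 L, order L &
  e 1 = conf R L /\ forall j, index j L = transpose_places i j.
Proof.
have [u [v [Euv su]]] := enum_split i.
have oE : order (u ++ k :: l :: v) by rewrite -Euv; exact: order_enum.
exists (u ++ l :: k :: v); first exact: order_swap.
have iL j : index j (u ++ l :: k :: v) = transpose_places i j.
  by rewrite (index_swap _ (order_uniq oE)) su -Euv index_enum_ord.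
split=> //; apply/funext => j; rewrite /conf iL /transpose_places; have [->|jk] := eqVneq j k.
  by rewrite /= eqxx exch_left; apply: wk_eq => //=; rewrite -?natr1; ring.
have -> : (j == i :> nat) = false by exact: negbTE jk.
have [->|jl] := eqVneq j l.
  by rewrite /= eqxx exch_right; apply: wk_eq => //=; rewrite -?natr1; ring.
have -> : (j == i.+1 :> nat) = false by exact: negbTE jl.
exact: exch_other.
Qed.

End FixedPlace.

(** Without nesting both radii are 1 and the condition is symmetric. With nesting it fails for the
    outer wicket, which is why [passing_relation] uses another motion. *)
Lemma exch_clear_right i s : 0 <= s <= 1 ->
  clear (exch i false s (right_wicket i)) (exch i false s (left_wicket i)).
Proof.
move=> s01; have := exch_clear_left i false s01; rewrite /clear exch_left exch_right /=.
rewrite !mul0r !subr0 sub0r normrN => h; apply: lt_le_trans h _.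
by rewrite le_eqVlt; apply/orP; left; apply/eqP; ring.
Qed.

Lemma loop_of (f : R -> cfg) : path_ok f -> U (f 0) = base -> U (f 1) = base ->
  exists p : loop (R := R) base, (forall t : I, p t = U (f (ival t))) /\
    follows p (fun t => ends_of (f (ival t))).
Proof.
move=> ok u0 u1; have c := path_ok_cts ok.
have c' : continuous (fun t : I => U (f (ival t))).
  have -> : (fun t : I => U (f (ival t))) = fun t => U (f (unit_itv (ival t))).
    by apply/funext => t; rewrite unit_itvE// ival_itv.
  exact: (@compose_continuous _ _ _ (@ival R) (fun t => U (f (unit_itv t)))) (@ival_continuous R) c.
have p0 : U (f (ival (zero : I))) = base by rewrite ival0.
have p1 : U (f (ival (one : I))) = base by rewrite ival1.
exists (mk_path c' p0 p1); split=> // t.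
have v := ok.2 _ (ival_itv t); exists (ordered v); split; last exact: UE.
by rewrite set_valE.
Qed.

Lemma exch_loop i nested : exists (p : loop (R := R) base) t0 x y r,
  [/\ Hc (exch i nested) = pi1_class p, follows p (fun t j => xwicket (x j t) (y j t) (r j t)),
      exchange (left_wicket i) (right_wicket i) t0 x y r &
      of_kind (if nested then In else Ab)
        (x (left_wicket i) t0, y (left_wicket i) t0, r (left_wicket i) t0, 0)
        (x (right_wicket i) t0, y (right_wicket i) t0, r (right_wicket i) t0, 0)].
Proof.
set k := left_wicket i; set l := right_wicket i; pose e := exch i nested.
have [L oL [e1 _]] := exch_1 i nested.
have [p [pU pf]] : exists p : loop (R := R) base, (forall t : I, p t = U (e (ival t))) /\
    follows p (fun t => ends_of (e (ival t))).
  apply: loop_of; first exact: exch_ok.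
    by rewrite /e exch_0 U_conf//; exact: order_enum.
  by rewrite /e e1 U_conf.
have i2 : (i.+2%:R : R) = i.+1%:R + 1 by rewrite -natr1.
exists p, (clamp 2^-1), (fun j t => cx (e (ival t) j)), (fun j t => cy (e (ival t) j)),
  (fun j t => rd (e (ival t) j)); split.
- by apply: Hc_loop pU; exact: exch_ok.
- have <- // : (fun (t : I) j => ends (e (ival t) j)) =
    fun t j => xwicket (cx (e (ival t) j)) (cy (e (ival t) j)) (rd (e (ival t) j)).
  apply/funext => t; apply/funext => j; rewrite -ends_flat; congr ends.
  by apply: wk_eq => //=; apply: (exch_flat i nested).
- have ee (j : 'I_n) : e 0 j = standard R j by rewrite /e exch_0 /conf index_enum_ord.
  split.
  + move=> j; have c : continuous (fun t : I => e (ival t) j : R * R * R * R).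
      exact: (@compose_continuous _ _ _ (@ival R) (fun t => e t j)) (@ival_continuous R) (@exch_cts i nested j).
    by split; cts.
  + by move=> j t; case/andP: (exch_rd i nested j (ival_itv t)).
  + move=> j t jk jl; rewrite /e exch_other//; split=> //.
      move=> h; have := exch_far nested (ival_itv t) (a := k) (b := j) (i := i).
      rewrite -/k -/l (eq_sym k j) jk (negbTE jl) (negbTE jk) !andbF /=.
      by rewrite (@exch_other i nested (ival t) j jk jl) h subrr expr0n /= => /(_ isT isT isT); lra.
    move=> h; have := exch_far nested (ival_itv t) (a := l) (b := j) (i := i).
    rewrite -/k -/l (eq_sym l j) jl (negbTE jl) (negbTE jk) !andbF /=.
    by rewrite (@exch_other i nested (ival t) j jk jl) h subrr expr0n /= => /(_ isT isT isT); lra.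
  + rewrite ival0 ival1 !ee /e !exch_left !exch_right; split.
    * by split.
    * by split.
    * by split=> /=; rewrite /base_x /= ?i2; ring.
    * by split=> /=; rewrite /base_x /= ?i2; ring.
    * move=> t; rewrite exch_left exch_right /= i2; split=> [h|->]; last by rewrite ivalK; lra.
      by apply: ival_inj; rewrite ivalK; lra.
- rewrite /e !exch_left !exch_right ivalK; last by lra.
  by clear - i2; case: nested; rewrite /= /inside /above /=; try (apply/andP; split); lra.
Qed.

Lemma rho_jump i (g : wicket_group R n) : is_rho i g -> g = jump R n i In.
Proof.
move=> [p [t0 [x [y [r [-> fol ex [h1 h2]]]]]]]; apply: (exchange_jump fol ex).
by apply/andP.
Qed.

Lemma sigma_jump i (g : wicket_group R n) : is_sigma i g -> g = jump R n i Ab.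
Proof. by move=> [p [t0 [x [y [r [-> fol ex h]]]]]]; apply: (exchange_jump fol ex). Qed.

Lemma rho_exists i : exists g : wicket_group R n, is_rho i g.
Proof.
have [p [t0 [x [y [r [_ fol ex /andP[h1 h2]]]]]]] := exch_loop i true.
by exists (pi1_class p), p, t0, x, y, r.
Qed.

Lemma sigma_exists i : exists g : wicket_group R n, is_sigma i g.
Proof.
have [p [t0 [x [y [r [_ fol ex h]]]]]] := exch_loop i false.
by exists (pi1_class p), p, t0, x, y, r.
Qed.

Lemma exch_class i (nested : bool) :
  Hc (exch i nested) = jump R n i (if nested then In else Ab).
Proof.
have [p [t0 [x [y [r [-> fol ex kd]]]]]] := exch_loop i nested.
exact: exchange_jump fol ex kd.
Qed.

End Exchanges.

(** * Relations between crossings *)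

Section JumpRelations.
Variables (R : realType) (n : nat).
Local Notation cfg := ('I_n -> wk R).
Local Notation valid := (@valid R _ [set: 'I_n]%SET).
Local Notation flat := (@flat R _ [set: 'I_n]%SET).
Local Notation E := (enum 'I_n).
Local Notation jump := (jump R n).
Implicit Types (c : cfg) (L : seq 'I_n).
Local Open Scope group_scope.

Lemma jump_at_trans L1 L2 L3 c : jump_at L1 L2 c * jump_at L2 L3 c = jump_at L1 L3 c.
Proof. by rewrite /jump_at mulgA mulgVK. Qed.

Lemma jump_atV L1 L2 c : jump_at L2 L1 c = (jump_at L1 L2 c)^-1.
Proof. by rewrite /jump_at invgM invgK. Qed.

(* Places with the same value of m share a plane. *)
Definition stacked (m : nat -> nat) (yr : nat -> R * R) (p : nat) : wk R :=
  (2 * (m p)%:R, (yr p).1, (yr p).2, 0)%R.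

Lemma stacked_valid m yr : (forall p, 0 < (yr p).2)%R ->
  (forall p q, (p < q)%N -> (m p < m q)%N \/
     m p = m q /\ laminar (stacked m yr p) (stacked m yr q)) ->
  let c : cfg := fun i => stacked m yr i in [/\ valid c, flat c & sorted_by E c].
Proof.
move=> r0 h c; split=> //.
  apply/flat_validP => //; split=> [i|i j ij]; first exact: r0.
  wlog lt : i j ij / (i < j)%N.
    move=> H; have [lt|lt|e] := ltngtP i j; first exact: H.
      by move=> e; rewrite laminar_sym; apply: H => //; rewrite eq_sym.
    by rewrite (val_inj e) eqxx in ij.
  move=> /(mulfI _) -/(_ _)/eqP; rewrite pnatr_eq0 => /(_ isT); rewrite eqr_nat => /eqP e.
  by case: (h i j lt) => [|[]//]; rewrite e ltnn.
move=> i j; rewrite !index_enum_ord => ij /=; rewrite ler_pM2l// ler_nat.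
by case: (h i j ij) => [/ltnW|[->]].
Qed.

Lemma jump_stacked L u a b v c : order L -> L = u ++ a :: b :: v -> valid c -> flat c ->
  sorted_by L c -> cx (c a) = cx (c b) ->
  let L' := u ++ b :: a :: v in
  [/\ order L', sorted_by L' c & jump_at L L' c = jump (size u) (kind_of (c a) (c b))].
Proof.
move=> oL EL va f sL ab; rewrite EL in oL sL *; split; first exact: order_swap.
  exact: sorted_by_swap.
exact: jump_swap.
Qed.

Lemma enum_split_at (k : nat) : (k.+1 < n)%N -> exists u a b v,
  [/\ E = u ++ a :: b :: v, size u = k, a = k :> nat & b = k.+1 :> nat].
Proof.
move=> kn; have kn1 : (k < n.-1)%N by rewrite -ltnS prednK// (leq_ltn_trans _ kn).
have [u [v [e s]]] := enum_split (Ordinal kn1).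
by exists u, (left_wicket (Ordinal kn1)), (right_wicket (Ordinal kn1)), v.
Qed.

(** At one tied configuration the transition and its inverse are crossings of opposite kinds. *)
Lemma jump_opp k t : (k.+1 < n)%N -> jump k (opp_kind t) = (jump k t)^-1.
Proof.
move=> /enum_split_at[u [a [b [v [e s ak bk]]]]].
(* Even values give the standard planes [x = 4 * p.+1]; the odd value is the plane halfway between
   places [k] and [k.+1]. *)
pose m p := if p == k.+1 then (k.*2.+3)%N else if p == k then (k.*2.+3)%N else p.*2.+2.
pose yr (p : nat) := if p == k then (tied_pair R t).1 else if p == k.+1 then (tied_pair R t).2 else (0, 1)%R.
have kd : of_kind t (stacked m yr k) (stacked m yr k.+1).
  rewrite /stacked /yr eqxx gtn_eqF// eqxx; case: t {yr}; rewrite /= /inside /above /=;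
    try (apply/andP; split); lra.
have [|p q pq|va f sE] := @stacked_valid m yr.
- by move=> p; rewrite /yr; case: eqP => _; [|case: eqP => _]; case: (t) => /=; lra.
- have [ek|nk] := boolP ((p == k) && (q == k.+1)).
    move: ek => /andP[/eqP -> /eqP ->]; right; split; last exact: of_kind_laminar kd.
    by rewrite /m !eqxx ltn_eqF.
  by left; rewrite /m; do ?case: eqP => ?; move: nk pq; do ?case: eqP => ? //=; lia.
set c := fun i => _ in va f sE.
have ab : cx (c a) = cx (c b) by rewrite /c ak bk /= /m !eqxx ltn_eqF.
have [oL' sL' J] := jump_stacked (order_enum n) e va f sE ab.
have ba : cx (c b) = cx (c a) by [].
have [_ _ J'] := jump_stacked oL' erefl va f sL' ba.
rewrite -e in J'; rewrite jump_atV J in J'.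
have ra : (0 < rd (c a))%R by exact: valid_rd.
have rb : (0 < rd (c b))%R by exact: valid_rd.
have kab : kind_of (c a) (c b) = t by apply: of_kind_unique => //; rewrite /c ak bk.
have lab : laminar (c a) (c b) by apply: (@of_kind_laminar _ t); rewrite /c ak bk.
by move: J'; rewrite (kind_of_opp ra rb lab) kab s => ->.
Qed.

(** A configuration with three wickets in one plane is sorted by all six orders of these. The two
    ways around the hexagon, from one order to its reverse, have the same product of transitions. *)
Lemma jump_hexagon k (d1 d2 d3 : R * R) A B C : (k.+2 < n)%N ->
  let w (d : R * R) : wk R := (0, d.1, d.2, 0)%R in
  (0 < d1.2)%R -> (0 < d2.2)%R -> (0 < d3.2)%R ->
  of_kind A (w d1) (w d2) -> of_kind B (w d1) (w d3) -> of_kind C (w d2) (w d3) ->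
  jump k A * jump k.+1 B * jump k C = jump k.+1 C * jump k B * jump k.+1 A.
Proof.
move=> kn w r1 r2 r3 kA kB kC; have [u [a [b [v [e s ak bk]]]]] := enum_split_at (ltnW kn).
have [x [v' ev]] : exists (x : 'I_n) v', v = x :: v'.
  case: v e => [|x v'] e; last by exists x, v'.
  by move: kn; rewrite -(size_enum_ord n) e size_cat s /= ; lia.
subst v; have ck : x = k.+2 :> nat.
  have oE := order_enum n; have := index_adjacent (u := rcons u a) (a := b) (b := x) (v := v').
  rewrite cat_rcons -e => /(_ (order_uniq oE)) [_]; rewrite index_enum_ord size_rcons s => ->.
  by [].
(* The three wickets share the plane of the middle place. *)
pose m p := if (k <= p <= k.+2)%N then (k.*2.+4)%N else p.*2.+2.
pose yr (p : nat) := if p == k then d1 else if p == k.+1 then d2 else if p == k.+2 then d3 else (0, 1)%R.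
have y1 : yr k = d1 by rewrite /yr eqxx.
have y2 : yr k.+1 = d2 by rewrite /yr gtn_eqF// eqxx.
have y3 : yr k.+2 = d3 by rewrite /yr; do ?case: eqP => ? //; exfalso; lia.
have m1 : m k = k.*2.+4 by rewrite /m ifT//; lia.
have m2 : m k.+1 = k.*2.+4 by rewrite /m ifT//; lia.
have m3 : m k.+2 = k.*2.+4 by rewrite /m ifT//; lia.
have lam p q t : of_kind t (w (yr p)) (w (yr q)) -> laminar (stacked m yr p) (stacked m yr q).
  by move=> h; apply: (@of_kind_laminar _ t); case: t h.
have [|p q pq|va f sE] := @stacked_valid m yr.
- by move=> p; rewrite /yr; do ?case: eqP => _ //; rewrite /=; lra.
- have [h|h] := boolP ((k <= p)%N && (q <= k.+2)%N); last by left; rewrite /m; do ?case: ifP; lia.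
  right; split; first by rewrite /m !ifT//; lia.
  have [[-> ->]|[[-> ->]|[-> ->]]] : (p = k /\ q = k.+1) \/ (p = k /\ q = k.+2) \/ (p = k.+1 /\ q = k.+2) by lia.
  + by apply: (lam _ _ A); rewrite y1 y2.
  + by apply: (lam _ _ B); rewrite y1 y3.
  + by apply: (lam _ _ C); rewrite y2 y3.
set g := fun i => _ in va f sE.
have kd (i j : 'I_n) t : of_kind t (w (yr i)) (w (yr j)) -> kind_of (g i) (g j) = t.
  by move=> h; apply: of_kind_unique; [exact: valid_rd|exact: valid_rd|case: t h].
have kab : kind_of (g a) (g b) = A by apply: kd; rewrite ak bk y1 y2.
have kac : kind_of (g a) (g x) = B by apply: kd; rewrite ak ck y1 y3.
have kbc : kind_of (g b) (g x) = C by apply: kd; rewrite bk ck y2 y3.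
have xab : cx (g a) = cx (g b) by rewrite /g /= ak bk m1 m2.
have xac : cx (g a) = cx (g x) by rewrite /g /= ak ck m1 m3.
have xbc : cx (g b) = cx (g x) by rewrite /g /= bk ck m2 m3.
have [o1 s1 J1] := jump_stacked (order_enum n) e va f sE xab.
have [o2 s2 J2] := jump_stacked o1 (esym (cat_rcons b u (a :: x :: v'))) va f s1 xac.
rewrite cat_rcons in o2 s2 J2.
have [o3 s3 J3] := jump_stacked o2 erefl va f s2 xbc.
have [o4 s4 J4] := jump_stacked (order_enum n) (etrans e (esym (cat_rcons a u (b :: x :: v')))) va f sE xbc.
rewrite cat_rcons in o4 s4 J4.
have [o5 s5 J5] := jump_stacked o4 erefl va f s4 xac.
have [o6 s6 J6] := jump_stacked o5 (esym (cat_rcons x u (a :: b :: v'))) va f s5 xab.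
rewrite cat_rcons in o6 s6 J6.
rewrite !size_rcons s kab kac kbc in J1 J2 J3 J4 J5 J6.
have T K0 K1 K2 K3 c (x1 x2 x3 : wicket_group R n) : jump_at K0 K1 c = x1 -> jump_at K1 K2 c = x2 ->
    jump_at K2 K3 c = x3 -> x1 * x2 * x3 = jump_at K0 K3 c.
  by move=> <- <- <-; rewrite !jump_at_trans.
exact: etrans (T _ _ _ _ _ _ _ _ J1 J2 J3) (esym (T _ _ _ _ _ _ _ _ J4 J5 J6)).
Qed.

(** In a configuration with two separate coplanar pairs the two exchanges can be made in either
    order. *)
Lemma jump_far k l t t' : (k.+1 < l)%N -> (l.+1 < n)%N ->
  jump k t * jump l t' = jump l t' * jump k t.
Proof.
move=> kl ln; have [u [a [b [v [e s ak bk]]]]] := enum_split_at (ltn_trans kl (ltnW ln)).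
have [u' [c [d [v' [e' s' cl dl]]]]] := enum_split_at ln.
have [z ev] : exists z, v = z ++ c :: d :: v'.
  exists (take (l - k.+2) v); rewrite -[LHS](cat_take_drop (l - k.+2)); congr (_ ++ _).
  have : drop l E = c :: d :: v' by rewrite e' drop_size_cat.
  rewrite e drop_cat s ltnNge (leq_trans (leq_trans (leqnSn k) (leqnSn _)) kl) /=.
  by rewrite -[(l - k)%N](subnK (m := 2)) ?addn2 //=; [rewrite -subnDA addn2|lia].
pose m p := if (p == k.+1) || (p == k) then (k.*2.+3)%N
  else if (p == l.+1) || (p == l) then l.*2.+3 else p.*2.+2.
pose yr (p : nat) := if p == k then (tied_pair R t).1 else if p == k.+1 then (tied_pair R t).2
  else if p == l then (tied_pair R t').1 else if p == l.+1 then (tied_pair R t').2 else (0, 1)%R.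
have yk1 : yr k.+1 = (tied_pair R t).2 by rewrite /yr gtn_eqF// eqxx.
have yk : yr k = (tied_pair R t).1 by rewrite /yr eqxx.
have yl : yr l = (tied_pair R t').1 by rewrite /yr; do ?case: eqP => ? //; exfalso; lia.
have yl1 : yr l.+1 = (tied_pair R t').2 by rewrite /yr; do ?case: eqP => ? //; exfalso; lia.
have kd1 : of_kind t (stacked m yr k) (stacked m yr k.+1).
  by rewrite /stacked yk yk1; case: (t); rewrite /= /inside /above /=; try (apply/andP; split); lra.
have kd2 : of_kind t' (stacked m yr l) (stacked m yr l.+1).
  by rewrite /stacked yl yl1; case: (t'); rewrite /= /inside /above /=; try (apply/andP; split); lra.
have mk : m k = m k.+1 by rewrite /m !eqxx orbT.
have ml : m l = m l.+1 by rewrite /m !eqxx orbT !ifF //; lia.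
have [|p q pq|va f sE] := @stacked_valid m yr.
- have tp x : (0 < (tied_pair R x).1.2)%R /\ (0 < (tied_pair R x).2.2)%R by case: x => /=; lra.
  by move=> p; rewrite /yr; do ?[case: eqP => _; first by case: (tp t); case: (tp t')]; exact: ltr01.
- have [/andP[/eqP -> /eqP ->]|nk] := boolP ((p == k) && (q == k.+1)).
    by right; split=> //; exact: of_kind_laminar kd1.
  have [/andP[/eqP -> /eqP ->]|nl] := boolP ((p == l) && (q == l.+1)).
    by right; split=> //; exact: of_kind_laminar kd2.
  by left; rewrite /m; do ?case: ifP; lia.
set g := fun i => _ in va f sE.
have kab : kind_of (g a) (g b) = t.
  by apply: of_kind_unique; [exact: valid_rd|exact: valid_rd|rewrite /g ak bk].
have kcd : kind_of (g c) (g d) = t'.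
  by apply: of_kind_unique; [exact: valid_rd|exact: valid_rd|rewrite /g cl dl].
have xab : cx (g a) = cx (g b) by rewrite /g /= ak bk mk.
have xcd : cx (g c) = cx (g d) by rewrite /g /= cl dl ml.
have su : size (u ++ a :: b :: z) = l.
  have := congr1 (index c) e'; rewrite index_enum_ord cl => _.
  have := order_uniq (order_enum n); rewrite e ev -(cat1s b) -cat1s !catA => uq.
  have := index_adjacent uq; rewrite -!catA /= -ev -e index_enum_ord cl => -[<- _].
  by [].
have E2 : E = (u ++ a :: b :: z) ++ c :: d :: v' by rewrite e ev -catA.
have [o1 s1 J1] := jump_stacked (order_enum n) e va f sE xab.
have e1 : u ++ b :: a :: v = (u ++ b :: a :: z) ++ c :: d :: v' by rewrite ev -catA.
have [o2 s2 J2] := jump_stacked o1 e1 va f s1 xcd.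
have [o3 s3 J3] := jump_stacked (order_enum n) E2 va f sE xcd.
have e3 : (u ++ a :: b :: z) ++ d :: c :: v' = u ++ a :: b :: (z ++ d :: c :: v') by rewrite -catA.
have [o4 s4 J4] := jump_stacked o3 e3 va f s3 xab.
have su' : size (u ++ b :: a :: z) = l by rewrite -su !size_cat.
rewrite s su su' kab kcd -catA in J1 J2 J3 J4.
have T K0 K1 K2 c' (x1 x2 : wicket_group R n) : jump_at K0 K1 c' = x1 -> jump_at K1 K2 c' = x2 ->
    x1 * x2 = jump_at K0 K2 c'.
  by move=> <- <-; rewrite jump_at_trans.
exact: etrans (T _ _ _ _ _ _ J1 J2) (esym (T _ _ _ _ _ _ J3 J4)).
Qed.

End JumpRelations.

(** The computation that ends [passing_relation]: multiplication by [al] and [be] converts the sides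
    of a square into elements of the group. *)
Lemma conj_square (G : groupType) (al be r s tk tl A B B' T0 T1 : G) :
  (al * A = r^-1 * be -> al * B = s * be -> be * B' = s * al -> al * T0 = tk * al ->
   be * T1 = tl * be -> A * (B' * T0) = B * T1 * A^-1 -> r^-1 * s * tk = s * tl * r)%g.
Proof.
move=> EA EB EB' E0 E1 S.
have : (al * (A * (B' * T0)) * A = al * (B * T1))%g by rewrite S -(mulgA al) mulgVK.
have -> : (al * (A * (B' * T0)) * A = r^-1 * s * tk * r^-1 * be)%g.
  by rewrite !mulgA EA -(mulgA _ be) EB' mulgA -(mulgA _ al) E0 mulgA -(mulgA _ al) EA !mulgA.
have -> : (al * (B * T1) = s * tl * be)%g by rewrite mulgA EB -mulgA E1 mulgA.
by move=> /mulIg <-; rewrite mulgVK.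
Qed.

(** * Half turns *)

Section Rotations.
Variables (R : realType) (n : nat).
Local Notation I := (unit_interval R).
Local Notation cfg := ('I_n -> wk R).
Local Notation valid := (@valid R _ [set: 'I_n]%SET).
Local Notation flat := (@flat R _ [set: 'I_n]%SET).
Local Notation ctsF f := (forall i, continuous (fun t => f t i : R * R * R * R)).
Local Notation E := (enum 'I_n).
Local Notation base := (base_config R n).
Implicit Types (c : cfg) (L : seq 'I_n).

Lemma far_nmeet (a b : wk R) : 0 < rd a <= 1 -> 0 < rd b <= 1 ->
  9 <= (cx a - cx b) ^+ 2 -> ~ meet a b.
Proof.
move=> /andP[ra ra1] /andP[rb rb1] far; apply: clear_nmeet; first exact: ltW.
have d9 : 9 <= dst2 a b by rewrite /dst2; have := sqr_ge0 (cy a - cy b); lra.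
have := along_le a b; set z := `|_|; set d := dst2 a b in d9 * => zd.
have z0 : 0 <= z by rewrite normr_ge0.
have z3 : 3 * z <= d by nra.
by nra.
Qed.

Lemma U_same c c' : valid c -> (forall i, same (c' i) (c i)) -> valid c' /\ U c' = U c.
Proof.
move=> v h; have v' : valid c' by apply: (valid_same (s := id) v).
by split=> //; apply/(U_eqP v v'); exists id; split=> // x y.
Qed.

Lemma rotate0 a c : rotate a 0 c = c.
Proof.
apply/funext => j; rewrite /rotate; case: eqP => // _.
by apply: wk_eq => //=; rewrite addr0.
Qed.

Lemma same_rotate_pi a c j : same (rotate a pi c j) (c j).
Proof.
rewrite /rotate; case: eqP => _; last exact: same_refl.
by split=> //; exists true; rewrite /= expr1 !mulN1r sinDpi cosDpi.
Qed.

Definition tau_class (a : 'I_n) : wicket_group R n :=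
  Hc (fun t => rotate a (pi * t) (conf R E)).

Lemma conf_far L (a b : 'I_n) : order L -> a != b -> 16 <= (cx (conf R L a) - cx (conf R L b)) ^+ 2.
Proof.
move=> oL; wlog lt : a b / (index a L < index b L)%N.
  move=> H ab; have [lt|lt|e] := ltngtP (index a L) (index b L); first exact: H.
    by rewrite -sqrrN opprB; apply: H => //; rewrite eq_sym.
  by rewrite (order_index_inj oL e) eqxx in ab.
move=> _; have : ((index a L).+1%:R + 1 : R) <= (index b L).+1%:R by rewrite natr1 ler_nat.
by rewrite /conf /standard /=; nra.
Qed.

Lemma conf_clear L (a j : 'I_n) : order L -> j != a -> clear (conf R L a) (conf R L j).
Proof.
move=> oL ja; have aj : a != j by rewrite eq_sym.
have := conf_far oL aj; have := sqr_ge0 (`|cy (conf R L a) - cy (conf R L j)| - rd (conf R L j)).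
have r1 : rd (conf R L a) ^+ 2 = 1 by rewrite /= expr1n.
by rewrite /clear r1; lra.
Qed.

Lemma rotate_conf_ok L a (g : R -> R) : order L -> continuous g ->
  path_ok (fun t => rotate a (g t) (conf R L)).
Proof.
move=> oL cg; have [v f] := conf_valid R oL; split=> [i|t _].
  by apply: rotate_cts => // j; cts.
by apply: rotate_valid => // j ja; exact: conf_clear.
Qed.

Lemma pi_cts : continuous (fun t : R => pi * t).
Proof. by apply: mulr_continuous; cts. Qed.

Lemma tau_relabel L (a b : 'I_n) : order L -> b = index a L :> nat ->
  Hc (fun t => rotate a (pi * t) (conf R L)) = tau_class b.
Proof.
move=> oL e; pose G t p : wk R :=
  if p == b :> nat then (4 * p.+1%:R, 0, 1, 0 + pi * t) else standard R p.
have E1 (K : seq 'I_n) (x : 'I_n) : order K -> b = index x K :> nat ->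
    (fun t => rotate x (pi * t) (conf R K)) = fun t i => G t (index i K).
  move=> oK ex; apply/funext => t; apply/funext => j; rewrite /rotate /G ex.
  have -> : (index j K == index x K) = (j == x) by apply/eqP/eqP => [/(order_index_inj oK)|->].
  by case: eqP => // ->.
rewrite /tau_class (E1 L a oL e) (E1 E b (order_enum n)) ?index_enum_ord//.
apply/esym/(Hc_relabel oL (order_enum n)); rewrite -(E1 L a oL e).
by apply: rotate_conf_ok => //; exact: pi_cts.
Qed.

Lemma ends_rotate a th : ends_of (rotate a th (conf R E)) =
  fun j => rotated_wicket (base_x R j) (if j == a then th else 0).
Proof.
apply/funext => j; rewrite /ends_of /rotate /conf index_enum_ord /rotated_wicket /ends /endpt.
by case: (j == a); rewrite /= ?expr0 ?expr1 ?sin0 ?cos0 ?add0r; congr ((_, _), (_, _)); rewrite /base_x /=; ring.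
Qed.

Lemma is_tau_class a (g : wicket_group R n) : is_tau a g -> g = tau_class a.
Proof.
move=> [p [-> fol]]; apply/esym/Hc_loop.
  by apply: rotate_conf_ok; [exact: order_enum|exact: pi_cts].
move=> t; have [w [w1 w2]] := fol t; rewrite w2; apply/esym.
apply: (ordered_valid (c := rotate a (pi * ival t) (conf R E)) _ _).2.
  by move=> j; rewrite /rotate; case: eqP => _ /=; exact: ltr01.
by rewrite w1 ends_rotate.
Qed.

Lemma U_rotate_pi a L : order L -> U (rotate a pi (conf R L)) = base.
Proof.
move=> oL; have [v f] := conf_valid R oL.
by rewrite (U_same v (same_rotate_pi a _)).2 U_conf.
Qed.

Lemma tau_exists a : exists g : wicket_group R n, is_tau a g.
Proof.
have ok : path_ok (fun t => rotate a (pi * t) (conf R E)).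
  by apply: rotate_conf_ok; [exact: order_enum|exact: pi_cts].
have u0 : U (rotate a (pi * 0) (conf R E)) = base.
  by rewrite mulr0 rotate0 U_conf//; exact: order_enum.
have u1 : U (rotate a (pi * 1) (conf R E)) = base.
  by rewrite mulr1 U_rotate_pi//; exact: order_enum.
have [p [_ pf]] := loop_of ok u0 u1.
exists (pi1_class p), p; split=> //.
rewrite (_ : (fun t j => _) = fun t : I => ends_of (rotate a (pi * ival t) (conf R E)))//.
by apply/funext => t; rewrite ends_rotate.
Qed.

(** Moving and turning fill a square. On the side where the half turn is complete, the unordered
    motion is again that of [e]. *)
Lemma rotate_square (e : R -> cfg) a : path_ok e ->
  (forall s th, 0 <= s <= 1 -> valid (rotate a th (e s))) ->
  (Hc e * Hc (fun t => rotate a (pi * t) (e 1%R)))%g =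
  (Hc (fun t => rotate a (pi * t) (e 0%R)) * Hc e)%g.
Proof.
move=> ok vr; have [ce ve] := ok.
have sq : square_ok (fun z => rotate a (pi * z.2) (e z.1)).
  split=> [i|s t s01 t01]; last exact: vr.
  apply: rotate_cts => [|j].
    by apply: mulr_continuous; cts.
  by have c := ce j; apply: (@compose_continuous _ _ _ fst (fun s => e s j)); cts.
have := Hc_square sq; rewrite /=.
have -> : (fun t => rotate a (pi * 0) (e t)) = e by apply/funext => t; rewrite mulr0 rotate0.
move=> ->; congr (_ * _)%g; rewrite mulr1.
apply: Hc_ext => // [|t t01]; last exact: (U_same (ve t t01) (same_rotate_pi a _)).2.
split=> [i|t t01]; last exact: vr.
by apply: (rotate_cts (T := R)) => //; cts.
Qed.

Lemma tau_commute a b : a != b -> (tau_class a * tau_class b = tau_class b * tau_class a)%g.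
Proof.
move=> ab; have oE := order_enum n; have [v f] := conf_valid R oE.
pose e t := rotate b (pi * t) (conf R E).
have ok : path_ok e by apply: rotate_conf_ok => //; exact: pi_cts.
have vr s th : valid (rotate a th (e s)).
  have r1 j : 0 < rd (rotate a th (e s) j) <= 1 by rewrite /e /rotate; do 2 case: eqP => _ /=; lra.
  have xj j : cx (rotate a th (e s) j) = cx (conf R E j) by rewrite /e /rotate; do 2 case: eqP => _.
  apply: validP => [j|i j ij]; first by case/andP: (r1 j).
  by apply: far_nmeet => //; rewrite !xj; have := conf_far oE ij; lra.
have := rotate_square (a := a) ok (fun s th _ => vr s th).
have -> : Hc (fun t => rotate a (pi * t) (e 0)) = tau_class a.
  by congr Hc; apply/funext => t; rewrite /e mulr0 rotate0.
have -> : Hc e = tau_class b by [].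
move=> <-; congr (_ * _)%g.
have okb : path_ok (fun t => rotate a (pi * t) (e 1)).
  split=> [i|t _]; last exact: vr.
  by apply: rotate_cts => [|j]; [exact: pi_cts|cts].
apply: Hc_ext => [||t t01]; last 1 first.
- have oka := rotate_conf_ok a oE pi_cts.
  apply: (U_same (oka.2 t t01) _).2 => j; rewrite /e mulr1 /rotate.
  have [->|ja] := eqVneq j a; first by rewrite (negbTE ab); exact: same_refl.
  have := same_rotate_pi b (conf R E) j; by rewrite /rotate; case: eqP => // _ _; exact: same_refl.
- exact: okb.
- by apply: rotate_conf_ok => //; exact: pi_cts.
Qed.

(** Label [a] is turned before or after the exchange; afterwards it stands in place [b]. *)
Lemma exch_commute (i : 'I_n.-1) (nested : bool) (a b : 'I_n) :
  b = transpose_places i a :> nat ->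
  (forall (s : R) j, 0 <= s <= 1 -> j != a -> clear (exch i nested s a) (exch i nested s j)) ->
  (jump R n i (if nested then In else Ab) * tau_class b =
   tau_class a * jump R n i (if nested then In else Ab))%g.
Proof.
move=> eb cl; have [L oL [e1 iL]] := exch_1 R i nested.
have vr s th : 0 <= s <= 1 -> valid (rotate a th (exch i nested s)).
  by move=> s01; apply: rotate_valid => //; [exact: exch_valid|exact: exch_flat|move=> j; exact: cl].
have := rotate_square (exch_ok R i nested) vr.
rewrite exch_class exch_0 e1 => h.
have <- : Hc (fun t => rotate a (pi * t) (conf R L)) = tau_class b.
  by apply: tau_relabel => //; rewrite eb iL.
exact: h.
Qed.

Lemma tau_far (i : 'I_n.-1) (a : 'I_n) (nested : bool) : a != left_wicket i -> a != right_wicket i ->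
  (jump R n i (if nested then In else Ab) * tau_class a =
   tau_class a * jump R n i (if nested then In else Ab))%g.
Proof.
move=> ak al; apply: exch_commute.
  rewrite /transpose_places.
  have -> : (a == i :> nat) = false by exact: negbTE ak.
  by have -> : (a == i.+1 :> nat) = false by exact: negbTE al.
move=> s j s01 ja; apply: exch_clear_far => //; first by rewrite eq_sym.
  by rewrite (negbTE ak).
by rewrite (negbTE al).
Qed.

Lemma tau_left (i : 'I_n.-1) (nested : bool) :
  (jump R n i (if nested then In else Ab) * tau_class (right_wicket i) =
   tau_class (left_wicket i) * jump R n i (if nested then In else Ab))%g.
Proof.
apply: exch_commute; first by rewrite /transpose_places eqxx.
move=> s j s01 jk; have [->|jl] := eqVneq j (right_wicket i); first exact: exch_clear_left.
apply: exch_clear_far => //; first by rewrite eq_sym.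
  by rewrite (negbTE jl) andbF.
by rewrite (negbTE jk) andbF.
Qed.

Lemma tau_right_sigma (i : 'I_n.-1) :
  (jump R n i Ab * tau_class (left_wicket i) = tau_class (right_wicket i) * jump R n i Ab)%g.
Proof.
apply: (@exch_commute i false); first by rewrite /transpose_places /= gtn_eqF// eqxx.
move=> s j s01 jl; have [->|jk] := eqVneq j (left_wicket i); first exact: exch_clear_right.
apply: exch_clear_far => //; first by rewrite eq_sym.
  by rewrite (negbTE jl) andbF.
by rewrite (negbTE jk) andbF.
Qed.

(** * A small wicket passing under a turning one *)

Section PassingUnder.
Variable i : 'I_n.-1.
Local Notation k := (left_wicket i).
Local Notation l := (right_wicket i).

(* Wicket k has radius 1, and the center of the smaller wicket l lies at w from
   the center of k. *)
Definition orbiting (w : R * R) : cfg := fun j =>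
  if j == k then (4 * i.+1%:R + 2, 0, 1, 0)
  else if j == l then (4 * i.+1%:R + 2 + w.1, w.2, 4^-1, 0)
  else standard R j.

Lemma orbiting_l w : orbiting w l = (4 * i.+1%:R + 2 + w.1, w.2, 4^-1, 0).
Proof. by rewrite /orbiting eq_sym lr_neq eqxx. Qed.

Lemma orbiting_k w : orbiting w k = (4 * i.+1%:R + 2, 0, 1, 0).
Proof. by rewrite /orbiting eqxx. Qed.

Lemma orbiting_rd w j : 0 < rd (orbiting w j) <= 1.
Proof. by rewrite /orbiting; case: ifP => _ /=; [|case: ifP => _ /=]; lra. Qed.

Lemma orbiting_flat w : flat (orbiting w).
Proof. by move=> j _; rewrite /orbiting; case: ifP => // _; case: ifP. Qed.

Lemma other_far j (x : R) : j != k -> j != l -> -3 <= x <= 3 ->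
  9 <= (4 * i.+1%:R + 2 + x - cx (standard R j)) ^+ 2.
Proof.
move=> jk jl /andP[x3 x3']; have i2 : (i.+2%:R : R) = i.+1%:R + 1 by rewrite -natr1.
have [ji|ij] := ltnP j i.
  have : (j.+1%:R + 1 : R) <= i.+1%:R by rewrite natr1 ler_nat.
  by rewrite /=; nra.
have : (i.+2%:R + 1 : R) <= j.+1%:R.
  by rewrite natr1 ler_nat; move: jk jl ij; rewrite -!(inj_eq val_inj) /=; lia.
by rewrite /=; nra.
Qed.

Lemma orbiting_valid w th : -3 <= w.1 <= 3 ->
  4^-1 ^+ 2 < w.1 ^+ 2 + w.2 ^+ 2 + 1 - 2 * `|w.1 * sin th + w.2 * cos th| ->
  valid (rotate k th (orbiting w)).
Proof.
move=> w3 hw; have r1 j : 0 < rd (rotate k th (orbiting w) j) <= 1.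
  have := orbiting_rd w j; rewrite /rotate; case: eqP => //.
have xj j : cx (rotate k th (orbiting w) j) = cx (orbiting w j) by rewrite /rotate; case: eqP.
have kl : ~ meet (rotate k th (orbiting w) l) (rotate k th (orbiting w) k).
  apply: clear_nmeet; first by case/andP: (r1 k) => /ltW.
  rewrite /dst2 /along /rotate eqxx eq_sym lr_neq orbiting_l orbiting_k /= add0r subr0.
  have -> : 4 * i.+1%:R + 2 + w.1 - (4 * i.+1%:R + 2) = w.1 by ring.
  by rewrite expr1n mulr1.
have far (a j : 'I_n) : (a == k) || (a == l) -> j != k -> j != l ->
    9 <= (cx (orbiting w a) - cx (orbiting w j)) ^+ 2.
  move=> al jk jl; have -> : orbiting w j = standard R j by rewrite /orbiting (negbTE jk) (negbTE jl).
  case/orP: al => /eqP ->; rewrite ?orbiting_k ?orbiting_l; last exact: other_far.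
  by have := @other_far j 0 jk jl; rewrite addr0; apply; lra.
apply: validP => [j|a b ab]; first by case/andP: (r1 j).
have [ea|na] := boolP ((a == k) || (a == l)); have [eb|nb] := boolP ((b == k) || (b == l)).
- move: ab; case/orP: ea => /eqP ->; case/orP: eb => /eqP ->; rewrite ?eqxx// => _.
  by move=> /meet_sym.
- by apply: far_nmeet => //; rewrite !xj; move: nb; rewrite negb_or => /andP[? ?]; exact: far.
- apply: far_nmeet => //; rewrite !xj -sqrrN opprB.
  by move: na; rewrite negb_or => /andP[? ?]; exact: far.
- move: na nb; rewrite !negb_or => /andP[ak al] /andP[bk bl].
  apply: far_nmeet => //; rewrite !xj /orbiting (negbTE ak) (negbTE al) (negbTE bk) (negbTE bl).
  by have := conf_far (order_enum n) ab; rewrite /conf !index_enum_ord; lra.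
Qed.

Lemma orbiting_cts (T : topologicalType) (w : T -> R * R) (th : T -> R) :
  continuous w -> continuous th -> ctsF (fun t => rotate k (th t) (orbiting (w t))).
Proof.
move=> cw ct; apply: rotate_cts => // j; rewrite /orbiting.
by case: (j == k); [cts|case: (j == l); cts].
Qed.

Lemma orbiting_le w (a b : 'I_n) : (a < b)%N -> ~~ ((a == k) && (b == l)) -> -3 <= w.1 <= 3 ->
  cx (orbiting w a) <= cx (orbiting w b).
Proof.
move=> ab nkl /andP[w3 w3']; have i2 : (i.+2%:R : R) = i.+1%:R + 1 by rewrite -natr1.
have ab1 : (a.+1%:R + 1 : R) <= b.+1%:R by rewrite natr1 ler_nat.
have other j : j != k -> j != l -> orbiting w j = standard R j.
  by rewrite /orbiting => /negbTE -> /negbTE ->.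
have [ak|ak] := eqVneq a k.
  have [bl|bl] := eqVneq b l; first by rewrite ak bl !eqxx in nkl.
  have bk : b != k by rewrite -ak -(inj_eq val_inj) gtn_eqF.
  have : (i.+2%:R + 1 : R) <= b.+1%:R.
    by rewrite natr1 ler_nat; move: bl ab; rewrite ak -(inj_eq val_inj) /=; lia.
  by rewrite ak orbiting_k other//=; lra.
have [al|al] := eqVneq a l.
  have bk : b != k by apply: contraTneq ab => ->; rewrite al /=; lia.
  have bl : b != l by apply: contraTneq ab => ->; rewrite al ltnn.
  have : (i.+2%:R + 1 : R) <= b.+1%:R by rewrite natr1 ler_nat; move: ab; rewrite al /=; lia.
  by rewrite al orbiting_l other//=; lra.
have [bk|bk] := eqVneq b k.
  by move: ab1; rewrite bk orbiting_k other//=; lra.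
have [bl|bl] := eqVneq b l.
  have : (a.+1%:R + 1 : R) <= i.+1%:R.
    by rewrite natr1 ler_nat; move: ak ab; rewrite bl -(inj_eq val_inj) /=; lia.
  by rewrite bl orbiting_l other//=; lra.
by rewrite !other//=; lra.
Qed.

Lemma orbiting_sortedE w : 0 <= w.1 <= 3 -> sorted_by E (orbiting w).
Proof.
move=> /andP[w0 w3] a b; rewrite !index_enum_ord => ab.
have [/andP[/eqP -> /eqP ->]|h] := boolP ((a == k) && (b == l)).
  by rewrite orbiting_k orbiting_l /=; lra.
by apply: orbiting_le => //; lra.
Qed.

Lemma orbiting_sorted_swap w L : (forall j, index j L = transpose_places i j) ->
  -3 <= w.1 <= 0 -> sorted_by L (orbiting w).
Proof.
move=> iL /andP[w3 w0] a b; rewrite !iL => ab.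
have [ba|] := ltnP b a.
  have [eb ea] := transpose_places_lt ba ab.
  have -> : a = l by apply: val_inj.
  have -> : b = k by apply: val_inj.
  by rewrite orbiting_k orbiting_l /=; lra.
rewrite leq_eqVlt => /orP[/eqP e|lt]; first by rewrite e ltnn in ab.
apply: orbiting_le => //; last by lra.
apply/negP => /andP[/eqP ea /eqP eb].
by move: ab; rewrite ea eb /transpose_places /= eqxx gtn_eqF// eqxx; lia.
Qed.

(** Orthogonal to the direction [(sin th, cos th)]: a point on the axis of a wicket of angle
    [th]. *)
Definition polar_point (r th : R) : R * R := (r * cos th, - (r * sin th)).

Lemma polar_bound r th : -3 <= r <= 3 -> -3 <= (polar_point r th).1 <= 3.
Proof.
move=> /andP[r0 r1]; have := cos_max th; rewrite ler_norml => /andP[c0 c1] /=.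
by apply/andP; split; nra.
Qed.

Lemma polar_norm r th : (polar_point r th).1 ^+ 2 + (polar_point r th).2 ^+ 2 = r ^+ 2.
Proof.
rewrite /=; transitivity (r ^+ 2 * (sin th ^+ 2 + cos th ^+ 2)); first by ring.
by rewrite sincos subrK mulr1.
Qed.

(** From a point of the axis of [k] the squared distance to both endpoints of [k] is
    [r ^+ 2 + 1]. *)
Lemma orbiting_perp r th : -3 <= r <= 3 -> valid (rotate k th (orbiting (polar_point r th))).
Proof.
move=> r3; apply: orbiting_valid; first exact: polar_bound.
rewrite polar_norm /=.
have -> : r * cos th * sin th + - (r * sin th) * cos th = 0 by ring.
by rewrite normr0; have := sqr_ge0 r; lra.
Qed.

(** At distance 3 from the center, the endpoints of [k] are at distance at least 2 for all
    angles. *)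
Lemma orbiting_circle r th ph : r = 3 \/ r = -3 ->
  valid (rotate k ph (orbiting (polar_point r th))).
Proof.
move=> r3; apply: orbiting_valid; first by apply: polar_bound; case: r3 => ->; lra.
rewrite polar_norm /=.
have -> : r * cos th * sin ph + - (r * sin th) * cos ph = r * sin (ph - th) by rewrite sinB; ring.
have := sin_max (ph - th); rewrite normrM.
have -> : `|r| = 3 by case: r3 => ->; [rewrite ger0_norm|rewrite ler0_norm]; lra.
have -> : r ^+ 2 = 9 by case: r3 => ->; ring.
by lra.
Qed.

Lemma polar_cts (T : topologicalType) (r th : T -> R) : continuous r -> continuous th ->
  continuous (fun t => polar_point (r t) (th t)).
Proof. by move=> cr ct; rewrite /polar_point; cts. Qed.

Lemma orbiting_path (r th : R -> R) : continuous r -> continuous th ->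
  (forall t, 0 <= t <= 1 -> valid (orbiting (polar_point (r t) (th t)))) ->
  flat_path (fun t => orbiting (polar_point (r t) (th t))).
Proof.
move=> cr ct v; split; last by move=> t _; exact: orbiting_flat.
split=> // j; have := @orbiting_cts R (fun t => polar_point (r t) (th t)) (fun=> 0) (polar_cts cr ct)
  (@cst_fun_continuous R R 0) j.
by under eq_fun do rewrite rotate0.
Qed.

Lemma flat_path_jump (e : R -> cfg) L L' s : order L -> order L' -> flat_path e -> 0 <= s <= 1 ->
  (forall t, 0 <= t <= s -> sorted_by L (e t)) -> (forall t, s <= t <= 1 -> sorted_by L' (e t)) ->
  (nu L (e 0%R) * Hc e)%g = (jump_at L L' (e s) * nu L' (e 1%R))%g.
Proof.
move=> oL oL' [ok fe] /andP[s0 s1] sL sL'.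
have fpe (a b : R) : 0 <= a <= 1 -> 0 <= b <= 1 -> flat_path (fun t => e (a + t * (b - a))).
  move=> a01 b01; have seg t : 0 <= t <= 1 -> 0 <= a + t * (b - a) <= 1.
    by move: a01 b01 => /andP[? ?] /andP[? ?] /andP[? ?]; apply/andP; split; nra.
  split; last by move=> t /seg; exact: fe.
  by apply: path_ok_comp => //; cts.
have h0 : 0 <= (0 : R) <= 1 by lra.
have h1 : 0 <= (1 : R) <= 1 by lra.
have hs : 0 <= s <= 1 by rewrite s0.
have P1 := nu_path oL (fpe _ _ h0 hs); have P2 := nu_path oL' (fpe _ _ hs h1).
have e1 : 0 + 0 * (s - 0) = 0 by ring.
have e2 : 0 + 1 * (s - 0) = s by ring.
have e3 : s + 0 * (1 - s) = s by ring.
have e4 : s + 1 * (1 - s) = 1 by ring.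
rewrite e1 e2 in P1; rewrite e3 e4 in P2.
have Q := Hc_part ok h0 hs h1.
have E0 : (fun t => e (0 + t * (1 - 0))) = e by apply/funext => t; rewrite subr0 mulr1 add0r.
rewrite E0 in Q; rewrite -Q mulgA P1; last first.
  by move=> t /andP[t0 t1]; apply: sL; apply/andP; split; nra.
rewrite /jump_at -P2 ?mulgA ?mulgVK//.
by move=> t /andP[t0 t1]; apply: sL'; apply/andP; split; nra.
Qed.

(** Along the segment to [c] the other centers keep an [x]-distance of at least 3 from [a], so
    [rotate_square] applies to it. *)
Lemma rotate_conj L c (a b : 'I_n) : order L -> b = index a L :> nat ->
  valid c -> flat c -> sorted_by L c -> rd (c a) <= 1 ->
  (forall j, (index a L < index j L)%N -> cx (c a) + 3 <= cx (c j)) ->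
  (forall j, (index j L < index a L)%N -> cx (c j) + 3 <= cx (c a)) ->
  (nu L c * Hc (fun t => rotate a (pi * t) c))%g = (tau_class b * nu L c)%g.
Proof.
move=> oL eb v f sL r1 gt lt.
have ok : path_ok (line (conf R L) c).
  split=> [i'|s s01]; last by have [] := cone_valid oL v f sL s01.
  by apply: line_cts => [j|j|]; cts.
have vr s th : 0 <= s <= 1 -> valid (rotate a th (line (conf R L) c s)).
  move=> s01; have [v' f'] := cone_valid oL v f sL s01; apply: rotate_valid => // j ja.
  have r0 := valid_rd a v'; have /andP[s0 s1] := s01.
  have r1' : rd (line (conf R L) c s a) <= 1 by rewrite /=; nra.
  suff d9 : 9 <= (cx (line (conf R L) c s a) - cx (line (conf R L) c s j)) ^+ 2.
    rewrite /clear; have := sqr_ge0 (`|cy (line (conf R L) c s a) - cy (line (conf R L) c s j)| -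
      rd (line (conf R L) c s j)); nra.
  have cf p q : (p < q)%N -> cx (standard R p) + 4 <= cx (standard R q).
    by move=> pq; have : (p.+1%:R + 1 : R) <= q.+1%:R; [rewrite natr1 ler_nat|rewrite /=; lra].
  have [h|h|e] := ltngtP (index a L) (index j L).
  - have := gt j h; have := cf _ _ h; rewrite /line /lin /conf /= => h1 h2.
    set x := (X in 9 <= X ^+ 2); suff : x <= -3 by move=> ?; nra.
    by rewrite /x; nra.
  - have := lt j h; have := cf _ _ h; rewrite /line /lin /conf /= => h1 h2.
    set x := (X in 9 <= X ^+ 2); suff : 3 <= x by move=> ?; nra.
    by rewrite /x; nra.
  - by rewrite (order_index_inj oL e) eqxx in ja.
have := rotate_square ok vr; rewrite line0 line1 -/(nu L c) => ->.
by rewrite (tau_relabel oL eb).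
Qed.

Lemma cos_pi_sign (t : R) : (0 <= t <= 2^-1 -> 0 <= cos (pi * t)) /\
  (2^-1 <= t <= 1 -> cos (pi * t) <= 0).
Proof.
have p0 : 0 < pi :> R := pi_gt0 R.
split=> /andP[t0 t1]; first by apply: cos_ge0_pihalf; apply/andP; split; nra.
have -> : pi * t = (pi * t - pi) + pi by ring.
rewrite cosDpi oppr_le0; apply: cos_ge0_pihalf; apply/andP; split; nra.
Qed.

(* When l has radius 1/4, the motion of l relative to k commutes with a rigid
   rotation of the pair around the axis of k.  Take for this motion the passage
   of l under k; half turns of l around k decompose into a flat half turn
   followed by a rotation of k. *)
Lemma passing_relation :
  ((jump R n i In)^-1 * jump R n i Ab * tau_class k = jump R n i Ab * tau_class l * jump R n i In)%g.
Proof.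
have [u [v [Euv su]]] := enum_split i.
have oE : order (u ++ k :: l :: v) by rewrite -Euv; exact: order_enum.
pose L := u ++ l :: k :: v; have oL : order L := order_swap oE.
have iL j : index j L = transpose_places i j.
  by rewrite /L (index_swap _ (order_uniq oE)) su -Euv index_enum_ord.
have oE' := order_enum n.
have h0 : 0 <= (0 : R) <= 1 by lra.
have h1 : 0 <= (1 : R) <= 1 by lra.
have hh : 0 <= (2^-1 : R) <= 1 by lra.
pose r (s : R) : R := 3 - 6 * s.
have cr : continuous r by rewrite /r; apply: subr_continuous; [cts|apply: mulr_continuous; cts].
have cc (x : R) : continuous (fun _ : R => x) by cts.
have r3 s : 0 <= s <= 1 -> -3 <= r s <= 3 by rewrite /r => /andP[? ?]; apply/andP; split; lra.
(* The passage of [l] under [k] from right to left, without any turning. *)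
pose A s := orbiting (polar_point (r s) 0).
have fA : flat_path A.
  apply: orbiting_path => // t t01.
  by have := orbiting_perp 0 (r3 t t01); rewrite rotate0.
(* Half a revolution of [l] around [k], flat throughout. *)
pose B q t := orbiting (polar_point q (pi * t)).
have fB q : q = 3 \/ q = -3 -> flat_path (B q).
  move=> hq; apply: orbiting_path => //; first exact: pi_cts.
  by move=> t _; have := orbiting_circle (pi * t) 0 hq; rewrite rotate0.
have A0 : A 0 = orbiting (3, 0).
  by rewrite /A /polar_point /r cos0 sin0 !mulr0 mulr1 subr0 oppr0.
have A1 : A 1 = orbiting (-3, 0).
  by rewrite /A /polar_point /r cos0 sin0 !mulr0 !mulr1 oppr0; congr (orbiting (_, _)); ring.
have B0 : B 3 0 = A 0 by rewrite A0 /B /polar_point mulr0 cos0 sin0 !mulr0 mulr1 oppr0.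
have B1 : B 3 1 = A 1 by rewrite A1 /B /polar_point mulr1 cospi sinpi mulr0 oppr0 mulrN1.
have B'0 : B (-3) 0 = A 1 by rewrite A1 /B /polar_point mulr0 cos0 sin0 !mulr0 mulr1 oppr0.
have B'1 : B (-3) 1 = A 0 by rewrite A0 /B /polar_point mulr1 cospi sinpi mulr0 oppr0 mulrN1 opprK.
have cmax (x : R) : -1 <= cos x <= 1 by have := cos_max x; rewrite ler_norml.
have cpos (t : R) := (cos_pi_sign t).1; have cneg (t : R) := (cos_pi_sign t).2.
pose al := nu E (A 0); pose be := nu L (A 1).
(* Midway the wicket on the left contains the other one, which is the inverse of the nested
   exchange. *)
have EA : (al * Hc A = (jump R n i In)^-1 * be)%g.
  have vh := (fA.1.2 _ hh); have fh := fA.2 _ hh.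
  have sE t : 0 <= t <= 2^-1 -> sorted_by E (A t).
    by move=> /andP[t0 t1]; apply: orbiting_sortedE; rewrite /= cos0 mulr1 /r; lra.
  have sL t : 2^-1 <= t <= 1 -> sorted_by L (A t).
    by move=> /andP[t0 t1]; apply: orbiting_sorted_swap => //; rewrite /= cos0 mulr1 /r; lra.
  rewrite (flat_path_jump oE' oL fA hh sE sL); congr (_ * _)%g.
  have tie : cx (A 2^-1 k) = cx (A 2^-1 l).
    by rewrite /A orbiting_k orbiting_l /= cos0 mulr1 /r; field.
  have sh : sorted_by (u ++ k :: l :: v) (A 2^-1) by rewrite -Euv; apply: sE; lra.
  have := jump_swap oE vh fh sh tie; rewrite -Euv -/L su => ->.
  rewrite -jump_opp; last by have := ltn_ord l.
  congr jump; apply: of_kind_unique; [exact: valid_rd|exact: valid_rd|].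
  by rewrite /A orbiting_k orbiting_l /= /inside /= sin0 mulr0 oppr0; apply/andP; split; lra.
have EB : (al * Hc (B 3) = jump R n i Ab * be)%g.
  have fb := fB 3 (or_introl erefl); have vh := (fb.1.2 _ hh); have fh := fb.2 _ hh.
  have sE t : 0 <= t <= 2^-1 -> sorted_by E (B 3 t).
    move=> /cpos c0; apply: orbiting_sortedE; have /andP[_ c1] := cmax (pi * t).
    by rewrite /=; lra.
  have sL t : 2^-1 <= t <= 1 -> sorted_by L (B 3 t).
    move=> /cneg c0; apply: orbiting_sorted_swap => //; have /andP[c1 _] := cmax (pi * t).
    by rewrite /=; lra.
  have := flat_path_jump oE' oL fb hh sE sL; rewrite B0 B1 => ->; congr (_ * _)%g.
  have tie : cx (B 3 2^-1 k) = cx (B 3 2^-1 l).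
    by rewrite /B orbiting_k orbiting_l /= cos_pihalf; ring.
  have sh : sorted_by (u ++ k :: l :: v) (B 3 2^-1) by rewrite -Euv; apply: sE; lra.
  have := jump_swap oE vh fh sh tie; rewrite -Euv -/L su => ->.
  congr jump; apply: of_kind_unique; [exact: valid_rd|exact: valid_rd|].
  by rewrite /B orbiting_k orbiting_l /= /above /= sin_pihalf; lra.
have EB' : (be * Hc (B (-3)) = jump R n i Ab * al)%g.
  have fb := fB (-3) (or_intror erefl); have vh := (fb.1.2 _ hh); have fh := fb.2 _ hh.
  have sL t : 0 <= t <= 2^-1 -> sorted_by L (B (-3) t).
    move=> /cpos c0; apply: orbiting_sorted_swap => //; have /andP[_ c1] := cmax (pi * t).
    by rewrite /=; lra.
  have sE t : 2^-1 <= t <= 1 -> sorted_by E (B (-3) t).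
    move=> /cneg c0; apply: orbiting_sortedE; have /andP[c1 _] := cmax (pi * t).
    by rewrite /=; lra.
  have := flat_path_jump oL oE' fb hh sL sE; rewrite B'0 B'1 => ->; congr (_ * _)%g.
  have tie : cx (B (-3) 2^-1 l) = cx (B (-3) 2^-1 k).
    by rewrite /B orbiting_k orbiting_l /= cos_pihalf; ring.
  have := jump_swap oL vh fh (sL _ _) tie; rewrite -Euv su => -> //; last by lra.
  congr jump; apply: of_kind_unique; [exact: valid_rd|exact: valid_rd|].
  by rewrite /B orbiting_k orbiting_l /= /above /= sin_pihalf; lra.
have vA t : 0 <= t <= 1 -> valid (A t) by move=> /fA.1.2.
have i2 : (i.+2%:R : R) = i.+1%:R + 1 by rewrite -natr1.
have other j w : j != k -> j != l -> orbiting w j = standard R j.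
  by rewrite /orbiting => /negbTE -> /negbTE ->.
have T0 : (al * Hc (fun t => rotate k (pi * t) (A 0)) = tau_class k * al)%g.
  have fa := fA.2 _ h0.
  apply: (rotate_conj oE' _ (vA 0 h0) fa).
  - by rewrite index_enum_ord.
  - by rewrite A0; apply: orbiting_sortedE => /=; lra.
  - by rewrite A0 orbiting_k /=; lra.
  - move=> j; rewrite !index_enum_ord A0 orbiting_k => kj.
    have jk : j != k by rewrite -(inj_eq val_inj) gtn_eqF.
    have [->|jl] := eqVneq j l; first by rewrite orbiting_l /=; lra.
    rewrite other//; have : (i.+2%:R + 1 : R) <= j.+1%:R.
      by rewrite natr1 ler_nat; move: jl kj; rewrite -(inj_eq val_inj) /=; lia.
    by rewrite /=; lra.
  - move=> j; rewrite !index_enum_ord A0 orbiting_k => kj.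
    have jk : j != k by rewrite -(inj_eq val_inj) ltn_eqF.
    have jl : j != l by rewrite -(inj_eq val_inj) ltn_eqF// ltnS ltnW.
    rewrite other//; have : (j.+1%:R + 1 : R) <= i.+1%:R by rewrite natr1 ler_nat.
    by rewrite /=; lra.
have T1 : (be * Hc (fun t => rotate k (pi * t) (A 1%R)) = tau_class l * be)%g.
  have fa := fA.2 _ h1; have iLk : index k L = i.+1 by rewrite iL /transpose_places eqxx.
  apply: (rotate_conj oL _ (vA 1 h1) fa).
  - by rewrite iLk.
  - by rewrite A1; apply: orbiting_sorted_swap => //=; lra.
  - by rewrite A1 orbiting_k /=; lra.
  - move=> j; rewrite iLk iL A1 orbiting_k => kj.
    have jk : j != k by apply: contraTneq kj => ->; rewrite /transpose_places eqxx ltnn.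
    have jl : j != l.
      by apply: contraTneq kj => ->; rewrite /transpose_places /= gtn_eqF// eqxx -leqNgt.
    move: kj; rewrite /transpose_places.
    have -> : (j == i :> nat) = false by exact: negbTE jk.
    have -> : (j == i.+1 :> nat) = false by exact: negbTE jl.
    move=> kj; rewrite other//; have : (i.+2%:R + 1 : R) <= j.+1%:R by rewrite natr1 ler_nat.
    by rewrite /=; lra.
  - move=> j; rewrite iLk iL A1 orbiting_k => kj.
    have jk : j != k by apply: contraTneq kj => ->; rewrite /transpose_places eqxx ltnn.
    have [->|jl] := eqVneq j l; first by rewrite orbiting_l /=; lra.
    move: kj; rewrite /transpose_places.
    have ji : (j == i :> nat) = false by exact: negbTE jk.
    rewrite ji; have -> : (j == i.+1 :> nat) = false by exact: negbTE jl.
    move=> kj; rewrite other//; have : (j.+1%:R + 1 : R) <= i.+1%:R.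
      by rewrite natr1 ler_nat; lia.
    by rewrite /=; lra.
(* The half revolution with [k] turning along. As [l] is at distance 3, it is homotopic to the flat
   half revolution followed by a half turn of [k]. *)
pose D q t := rotate k (pi * t) (orbiting (polar_point q (pi * t))).
have ED q : q = 3 \/ q = -3 -> Hc (D q) = (Hc (B q) * Hc (fun t => rotate k (pi * t) (B q 1%R)))%g.
  move=> hq; have sq : square_ok (fun z => rotate k (pi * z.2) (B q z.1)).
    split=> [j|s t _ _]; last exact: orbiting_circle.
    apply: orbiting_cts; last by apply: mulr_continuous; cts.
    by apply: polar_cts; [cts|apply: mulr_continuous; cts].
  rewrite -(Hc_diag sq) /=; congr (Hc _ * _)%g.
  by apply/funext => t; rewrite mulr0 rotate0.
have sq : square_ok (fun z => rotate k (pi * z.2) (orbiting (polar_point (r z.1) (pi * z.2)))).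
  split=> [j|s t s01 t01]; last exact/orbiting_perp/r3.
  have c2 : continuous (fun z : R * R => pi * z.2) by apply: mulr_continuous; cts.
  apply: orbiting_cts => //; apply: polar_cts => //.
  by apply: (@compose_continuous _ _ _ fst r) => //; cts.
have := Hc_square sq; rewrite /=.
have -> : (fun t => rotate k (pi * 0) (orbiting (polar_point (r t) (pi * 0)))) = A.
  by apply/funext => t; rewrite mulr0 rotate0.
(* After the half turn the passage runs backwards. *)
have -> : Hc (fun t => rotate k (pi * 1) (orbiting (polar_point (r t) (pi * 1)))) = (Hc A)^-1%g.
  rewrite -(Hc_rev fA.1); have e t : orbiting (polar_point (r t) (pi * 1)) = A (1 - t).
    by rewrite /A /polar_point mulr1 cospi sinpi cos0 sin0 !mulr0 /r; congr (orbiting (_, _)); ring.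
  have t01' (t : R) : 0 <= t <= 1 -> 0 <= 1 - t <= 1 by move=> /andP[? ?]; apply/andP; split; lra.
  have vr t : 0 <= t <= 1 -> valid (A (1 - t)) by move=> /t01'/vA.
  apply: Hc_ext => [||t t01].
  - split=> [j|t t01]; last by rewrite e mulr1; have [] := U_same (vr t t01) (same_rotate_pi k _).
    by apply: orbiting_cts => //; apply: polar_cts.
  - by apply: path_ok_comp => //; [exact: fA.1|cts].
  - by rewrite e mulr1; have [] := U_same (vr t t01) (same_rotate_pi k _).
have -> : r 1 = -3 by rewrite /r; ring.
have -> : r 0 = 3 by rewrite /r; ring.
rewrite -/(D 3) -/(D (-3)) (ED _ (or_introl erefl)) (ED _ (or_intror erefl)) B1 B'1 => S.
exact: conj_square EA EB EB' T0 T1 S.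
Qed.

End PassingUnder.
End Rotations.

(** * Consequences of the passing relation *)

Section TauAlgebra.
Variables (G : groupType) (r s tl tr : G).
Local Open Scope group_scope.
Implicit Types (x : G) (e h : bool).

Definition pw (x : G) e : G := if e then x else x^-1.

Lemma pwN x e : pw x (~~ e) = (pw x e)^-1.
Proof. by case: e; rewrite /= ?invgK. Qed.

Lemma exchange_pw (x y z : G) e : x * z = z * y -> pw x e * z = z * pw y e.
Proof.
case: e => //= h; apply: (mulgI x); rewrite mulgA mulgV mul1g mulgA h.
by rewrite mulgK.
Qed.

Lemma exchange_pwV (x y z : G) e : x * z = z * y -> pw y e * z^-1 = z^-1 * pw x e.
Proof.
move=> /(exchange_pw e) h; apply: (mulgI z); rewrite mulgA -h mulgK.
by rewrite mulgA mulgV mul1g.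
Qed.

Lemma exchange_pw2 (x y z : G) e h : x * z = z * y -> y * z = z * x ->
  pw x e * pw z h = pw z h * pw y e.
Proof. by move=> h1 h2; case: h; [exact: exchange_pw|exact: exchange_pwV]. Qed.

(** For one index, [r] and [s] are the nested and the unnested crossing, [tl] and [tr] the half
    turns of the left and right places; [h4] is [passing_relation]. *)
Hypothesis h1 : s * tr = tl * s.
Hypothesis h2 : s * tl = tr * s.
Hypothesis h4 : r^-1 * s * tl = s * tr * r.

Lemma tau_passing_alg : r * tl * s * r = s * tl.
Proof. by apply: (mulgI r^-1); rewrite !mulgA mulVg mul1g h4 h1. Qed.

Lemma tau_right_rho_alg e : pw tr e * r = pw s (~~ e) * (r^-1 * (pw s e * pw tl e)).
Proof.
case: e => /=; first by apply: (mulgI s); rewrite !mulgA mulgV mul1g h4.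
by apply: (mulgI tr); rewrite !mulgA mulgV mul1g -h2 -tau_passing_alg !mulgK.
Qed.

Lemma tau_left_rhoV_alg e : pw tl e * r^-1 = pw s (~~ e) * (r * (pw s e * pw tr e)).
Proof.
case: e => /=.
  apply: (mulgI s); rewrite !mulgA mulgV mul1g -tau_passing_alg mulgK.
  by rewrite -(mulgA r s) h1 !mulgA.
have h : r * tl = tr * s * r^-1 * s^-1 by rewrite -h2 -tau_passing_alg !mulgK.
by rewrite -invgM h !invgM !invgK !mulgA.
Qed.

End TauAlgebra.

Lemma eval_letter_pw (S : Type) (G : groupType) (f : S -> G) s e :
  word_eval f (letter s e) = pw (f s) e.
Proof. by rewrite word_eval_letter; case: e. Qed.

(** * Validity of the relations *)

Section Soundness.
Variables (R : realType) (n : nat) (f : wicket_generator n -> wicket_group R n).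
Hypothesis gen : standard_generators f.
Local Open Scope group_scope.

Lemma gen_rho i : f (Rho i) = jump R n i In.
Proof. by case: gen => h _ _; exact/rho_jump/h. Qed.
Lemma gen_sigma i : f (Sigma i) = jump R n i Ab.
Proof. by case: gen => _ h _; exact/sigma_jump/h. Qed.
Lemma gen_tau a : f (Tau a) = tau_class R a.
Proof. by case: gen => _ _ h; exact/is_tau_class/h. Qed.

Lemma kletter_jump k t : (k.+1 < n)%N -> kletter f k t = jump R n k t.
Proof.
move=> kn; have k1 : (k < n.-1)%N by rewrite -ltnS prednK// (leq_ltn_trans _ kn).
have at1 (h : 'I_n.-1 -> wicket_group R n) : at_place h k = h (Ordinal k1).
  by rewrite /at_place insubT.
by case: t; rewrite /= !at1 /= ?gen_rho ?gen_sigma//= -jump_opp.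
Qed.

Lemma comm_sound s t : f s * f t = f t * f s ->
  word_eval f (word_comm (letter s true) (letter t true)) = word_eval f [::].
Proof. by move=> h; rewrite /= !mulg1 !mulgA h mulgK mulgV. Qed.

Lemma jump_far_sym i j t t' : far_apart (n := n) i j ->
  jump R n i t * jump R n j t' = jump R n j t' * jump R n i t.
Proof.
have lt (k : 'I_n.-1) : (k.+1 < n)%N by exact: ltn_ord (right_wicket k).
by move=> /orP[h|h]; [|apply/esym]; apply: jump_far.
Qed.

Lemma hexagon_sound (i j : 'I_n.-1) (d1 d2 d3 : R * R) A B C : j = i.+1 :> nat ->
  let w (d : R * R) : wk R := (0, d.1, d.2, 0)%R in
  (0 < d1.2)%R -> (0 < d2.2)%R -> (0 < d3.2)%R ->
  of_kind A (w d1) (w d2) -> of_kind B (w d1) (w d3) -> of_kind C (w d2) (w d3) ->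
  jump R n i A * (jump R n j B * jump R n i C) = jump R n j C * (jump R n i B * jump R n j A).
Proof.
move=> ji w r1 r2 r3 kA kB kC.
have kn : (i.+2 < n)%N by have := ltn_ord (right_wicket j); rewrite /= ji.
have := @jump_hexagon R n i d1 d2 d3 A B C kn r1 r2 r3 kA kB kC; rewrite -ji.
by move: (jump R n i A) (jump R n j B) => a b; move: (jump R n _ _) (jump R n _ _) => c d;
  move: (jump R n _ _) (jump R n _ _) => c' d'; rewrite !mulgA.
Qed.

Lemma generators_sound : satisfies (@wicket_relation n) f.
Proof.
have st (i : 'I_n.-1) := tau_left R i false.
have st' (i : 'I_n.-1) := tau_right_sigma R i.
have rt (i : 'I_n.-1) := tau_left R i true.
have pr (i : 'I_n.-1) := passing_relation R i.
rewrite /= in st rt.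
move=> u v; case=> {u v}.
- by move=> i j ij; apply: comm_sound; rewrite !gen_rho; exact: jump_far_sym.
- by move=> i j ij; apply: comm_sound; rewrite !gen_sigma; exact: jump_far_sym.
- by move=> i j ij; apply: comm_sound; rewrite gen_rho gen_sigma; exact: jump_far_sym.
- move=> i j ji; rewrite !word_eval_cat !word_eval_letter !gen_rho.
  (* Coordinates [(y, r)] of three coplanar wickets of the kinds in the relation, here successively
     nested; likewise in the next four cases. *)
  apply: (hexagon_sound (d1 := (0, 1)%R) (d2 := (0, 2)%R) (d3 := (0, 3)%R) ji) => /=;
    rewrite /inside /above /=; try (apply/andP; split); lra.
- move=> i j ji; rewrite !word_eval_cat !word_eval_letter !gen_sigma.
  apply: (hexagon_sound (d1 := (8, 1)%R) (d2 := (4, 1)%R) (d3 := (0, 1)%R) ji) => /=;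
    rewrite /inside /above /=; try (apply/andP; split); lra.
- move=> i j ji; rewrite !word_eval_cat !word_eval_letter !gen_rho !gen_sigma.
  apply: (hexagon_sound (d1 := (4, 1)%R) (d2 := (4, 2)%R) (d3 := (0, 1)%R) ji) => /=;
    rewrite /inside /above /=; try (apply/andP; split); lra.
- move=> i j ji; rewrite !word_eval_cat !word_eval_letter !gen_rho !gen_sigma.
  apply: (hexagon_sound (d1 := (8, 1)%R) (d2 := (0, 1)%R) (d3 := (0, 2)%R) ji) => /=;
    rewrite /inside /above /=; try (apply/andP; split); lra.
- move=> i j ji; rewrite !word_eval_cat !word_eval_letter !gen_rho !gen_sigma.
  apply: (hexagon_sound (d1 := (2, 1)%R) (d2 := (-2, 1)%R) (d3 := (0, 4)%R) ji) => /=;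
    rewrite /inside /above /=; try (apply/andP; split); lra.
- by move=> a b ab; apply: comm_sound; rewrite !gen_tau; exact: tau_commute.
- move=> i a ak al; apply: comm_sound; rewrite gen_rho gen_tau.
  exact: (tau_far R true ak al).
- move=> i a ak al; apply: comm_sound; rewrite gen_sigma gen_tau.
  exact: (tau_far R false ak al).
- move=> i e h; rewrite !word_eval_cat !eval_letter_pw !gen_tau gen_sigma.
  by apply: exchange_pw2; [rewrite -st|rewrite -st'].
- move=> i e h; rewrite !word_eval_cat !eval_letter_pw !gen_tau gen_sigma.
  by apply: exchange_pw2; [rewrite -st'|rewrite -st].
- move=> i e; rewrite !word_eval_cat !eval_letter_pw !gen_tau gen_rho /=.
  by apply: exchange_pw; rewrite -rt.
- move=> i e; rewrite !word_eval_cat !eval_letter_pw !gen_tau gen_rho gen_sigma /=.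
  exact: (tau_right_rho_alg (st i) (st' i) (pr i) e).
- move=> i e; rewrite !word_eval_cat !eval_letter_pw !gen_tau gen_rho gen_sigma /=.
  exact: (tau_left_rhoV_alg (st i) (st' i) (pr i) e).
- move=> i e; rewrite !word_eval_cat !eval_letter_pw !gen_tau gen_rho /=.
  by apply: exchange_pwV; rewrite -rt.
Qed.

End Soundness.

(** * Generation *)

Section Turning.
Variables (R : realType) (n : nat).
Local Notation cfg := ('I_n -> wk R).
Local Notation valid := (@valid R _ [set: 'I_n]%SET).
Local Notation E := (enum 'I_n).
Local Notation base := (base_config R n).
Implicit Types (c : cfg) (L : seq 'I_n) (a b th : nat -> R) (t : seq ('I_n * bool)).

Definition turned L th : cfg := fun i => (4 * (index i L).+1%:R, 0, 1, th (index i L)).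

Lemma turned_valid L th : order L -> valid (turned L th).
Proof.
move=> oL; apply: validP => [i|i j ij]; first exact: ltr01.
by apply: far_nmeet; rewrite ?ltr01 ?lexx//; have := conf_far R oL ij; rewrite /=; lra.
Qed.

Lemma same_shift (x y r u v : R) : sin u = 0 -> same (x, y, r, u + v : R) (x, y, r, v).
Proof.
move=> su; have := cos2Dsin2 u; rewrite su expr0n addr0 => /eqP; rewrite sqrf_eq1 => cu.
by split=> //; case/orP: cu => /eqP cu; [exists false|exists true];
  rewrite /= sinD cosD su cu ?expr0 ?expr1 !mul0r add0r subr0.
Qed.

Lemma U_turned L a b : order L -> (forall p, sin (a p) = 0) ->
  U (turned L (a \+ b)) = U (turned L b).
Proof. by move=> oL s0; apply: (U_same (turned_valid b oL) _).2 => i; exact: same_shift. Qed.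

Lemma U_turned_base L a : order L -> (forall p, sin (a p) = 0) -> U (turned L a) = base.
Proof.
move=> oL s0; rewrite -(U_conf R oL) -[conf R L]/(turned L (fun=> 0)) -(U_turned (fun=> 0) oL s0).
by congr (U (turned _ _)); apply/funext => p /=; rewrite addr0.
Qed.

Lemma sin_intmul_pi (m : int) : sin (m%:~R * pi : R) = 0.
Proof.
suff h (k : nat) : sin (k%:R * pi : R) = 0 by case: m => k; rewrite ?NegzE ?mulrNz ?mulNr ?sinN ?h ?oppr0.
by elim: k => [|k IH]; rewrite ?mul0r ?sin0// -natr1 mulrDl mul1r sinDpi IH oppr0.
Qed.

Lemma sin_eq0 (x : R) : sin x = 0 -> exists m : int, x = m%:~R * pi.
Proof.
move=> sx; exists (Num.floor (x / pi)); set m := Num.floor _.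
have p0 : 0 < pi :> R := pi_gt0 R.
have /andP[h1 h2] := floor_itv (x / pi); rewrite -/m in h1 h2.
have sm := sin_intmul_pi m; pose y := x - m%:~R * pi.
have y0 : 0 <= y by rewrite subr_ge0 -ler_pdivlMr.
have y1 : y < pi.
  by rewrite ltrBlDr addrC -[X in _ + X]mul1r -mulrDl -ltr_pdivrMr// (_ : _ + 1 = (m + 1)%:~R)// intrD.
have : sin x = cos (m%:~R * pi) * sin y.
  by rewrite -[x in LHS](subrK (m%:~R * pi)) addrC -/y sinD sm mul0r add0r.
rewrite sx => /esym/eqP; rewrite mulf_eq0 => /orP[/eqP c0|/eqP sy].
  by have := cos2Dsin2 (m%:~R * pi : R); rewrite c0 sm expr0n addr0 => /eqP; rewrite eq_sym oner_eq0.
have [yp|] := ltP 0 y; first by have := sin_gt0_pi (x := y); rewrite yp y1 sy ltxx => /(_ isT).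
by move=> yn; apply/eqP; rewrite -subr_eq0 -/y eq_le yn y0.
Qed.

Definition turn L a b (t : R) : cfg := turned L (fun p => (1 - t) * a p + t * b p).

Lemma turn_ok L a b : order L -> path_ok (turn L a b).
Proof.
by move=> oL; split=> [i|t _]; [rewrite /turn /turned; cts|exact: turned_valid].
Qed.

Lemma turn_mul L a b d : order L -> (Hc (turn L a b) * Hc (turn L b d))%g = Hc (turn L a d).
Proof.
move=> oL; pose F (z : R * R) := turned L (fun p => a p + z.1 * (b p - a p) + z.2 * (d p - b p)).
have /Hc_diag : square_ok F.
  by split=> [i|s t _ _]; [rewrite /F /turned; cts|exact: turned_valid].
have e f g : (forall p s, f s p = g s p) -> Hc (fun s => turned L (f s)) = Hc (fun s => turned L (g s)).
  by move=> h; congr Hc; apply/funext => s; congr turned; apply/funext => p.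
by move=> h; rewrite /turn -[RHS](e (fun s p => a p + s * (b p - a p) + s * (d p - b p))) => [|p s];
  [rewrite -h; congr (_ * _)%g; apply: e => p s /=; ring|ring].
Qed.

Lemma turn_id L a : order L -> Hc (turn L a a) = 1%g.
Proof. by move=> oL; apply: (mulgI (Hc (turn L a a))); rewrite turn_mul// mulg1. Qed.

Lemma turn_shift L a b d : order L -> (forall p, sin (a p) = 0) ->
  Hc (turn L (a \+ b) (a \+ d)) = Hc (turn L b d).
Proof.
move=> oL s0; apply: Hc_ext => [||t t01]; [exact: turn_ok..|].
rewrite -[RHS](U_turned _ oL s0); congr (U (turned _ _)); apply/funext => p /=; ring.
Qed.

Definition half_turn (e : bool) (q p : nat) : R := if q == p then (if e then pi else - pi) else 0.

Lemma sin_half_turn e q p : sin (half_turn e q p) = 0.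
Proof. by rewrite /half_turn; case: eqP => _; case: e; rewrite ?sinN ?sinpi ?oppr0 ?sin0. Qed.

Lemma turn_half L e (x : 'I_n) : order L ->
  Hc (turn L (fun=> 0) (half_turn e x)) = pw (tau_class R x) e.
Proof.
move=> oL; have pos : Hc (turn L (fun=> 0) (half_turn true x)) = tau_class R x.
  have xs : (x < size L)%N by rewrite (order_size oL).
  rewrite -(tau_relabel (a := nth x L x) R oL) ?index_uniq ?(order_uniq oL)//.
  congr Hc; apply/funext => t; apply/funext => j; rewrite /turn /turned /rotate /half_turn.
  have -> : (x == index j L :> nat) = (j == nth x L x).
    apply/eqP/eqP => [->|->]; last by rewrite index_uniq ?(order_uniq oL).
    by rewrite nth_index// order_mem.
  by case: eqP => [->|_]; apply: wk_eq => //=; ring.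
case: e => //=; apply: (mulgI (tau_class R x)); rewrite mulgV -pos.
rewrite -(turn_shift (a := half_turn true x) (fun=> 0) (half_turn false x) oL); last exact: sin_half_turn.
have e1 : half_turn true x \+ (fun=> 0) = half_turn true x by apply/funext => p /=; rewrite addr0.
have e2 : half_turn true x \+ half_turn false x = fun=> 0.
  by apply/funext => p /=; rewrite /half_turn; case: eqP => _; rewrite ?addr0 ?subrr.
by rewrite e1 e2 turn_mul// turn_id.
Qed.

Definition turning (G : groupType) (f : wicket_generator n -> G) t : G :=
  foldr (fun l g => pw (f (Tau l.1)) l.2 * g)%g 1%g t.

(** By [turning_eq1] these angles detect whether the word of half turns is trivial. *)
Definition angle t (p : nat) : R := \sum_(l <- t) half_turn l.2 l.1 p.

Lemma sin_angle t p : sin (angle t p) = 0.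
Proof.
rewrite /angle; elim: t => [|l t IH]; first by rewrite big_nil sin0.
by rewrite big_cons sinD sin_half_turn IH mul0r mulr0 addr0.
Qed.

(** Standard wickets turn independently of one another, so successive half turns can be replaced by
    turning all wickets at once, linearly in time. *)
Lemma turn_angle L t (f : wicket_generator n -> wicket_group R n) : order L ->
  (forall x, f (Tau x) = tau_class R x) ->
  Hc (turn L (fun=> 0) (angle t)) = turning f t.
Proof.
move=> oL ft; elim: t => [|[x e] t IH] /=.
  by rewrite (_ : angle [::] = fun=> 0) ?turn_id//; apply/funext => p; rewrite /angle big_nil.
rewrite ft -(turn_half e x oL) -IH -(turn_shift (fun=> 0) (angle t) oL (sin_half_turn e x)).
have -> : half_turn e x \+ (fun=> 0) = half_turn e x by apply/funext => p /=; rewrite addr0.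
by rewrite turn_mul//; congr (Hc (turn _ _ _)); apply/funext => p; rewrite /angle big_cons.
Qed.

Lemma angle_exists th : (forall p, sin (th p) = 0) ->
  exists t, forall p, (p < n)%N -> angle t p = th p.
Proof.
move=> s0; have /choice[m hm] p := sin_eq0 (s0 p).
pose tm (x : 'I_n) := nseq `|m x|%N (x, 0 <= m x).
exists (flatten [seq tm x | x <- E]) => p pn.
rewrite /angle big_flatten big_map big_enum (bigD1 (Ordinal pn))//= [X in _ + X]big1 => [|x xp].
  rewrite addr0 big_nseq /= hm /half_turn eqxx.
  have it (x : R) k : iter k (+%R x) 0 = k%:R * x.
    by elim: k => [|k IH]; rewrite ?mul0r//= IH -natr1; ring.
  rewrite it; case: (m p) => k /=; first by [].
  by rewrite NegzE mulrNz mulrN mulNr.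
rewrite big_nseq /= /half_turn ifF; last by apply/negP => /eqP e; move/eqP: xp; apply; apply: val_inj.
by elim: `|_|%N => //= k ->; rewrite addr0.
Qed.

End Turning.

(** * Normal form of words *)

Section NormalForm.
Variable n : nat.
Implicit Types (G : groupType) (s : seq ('I_n.-1 * kind)) (t : seq ('I_n * bool)).
Local Open Scope group_scope.

Definition crossing G (f : wicket_generator n -> G) s : G :=
  foldr (fun (l : 'I_n.-1 * kind) g => kletter f l.1 l.2 * g) 1 s.

Lemma crossing_cat G (f : wicket_generator n -> G) s s' :
  crossing f (s ++ s') = crossing f s * crossing f s'.
Proof. by elim: s => [|l s IH] /=; rewrite ?mul1g// IH mulgA. Qed.

Lemma turning_cat G (f : wicket_generator n -> G) t t' :
  turning f (t ++ t') = turning f t * turning f t'.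
Proof. by elim: t => [|l t IH] /=; rewrite ?mul1g// IH mulgA. Qed.

Lemma at_place_ord G (h : 'I_n.-1 -> G) (i : 'I_n.-1) : at_place h i = h i.
Proof. by rewrite /at_place insubT//= => p; congr h; apply: val_inj. Qed.

(** The word and the label found are the same for all groups satisfying the relations, so that the
    normal form can be evaluated both in the presented group and in [wicket_group]. *)
Lemma turn_past_crossing (a : 'I_n) (e : bool) (i : 'I_n.-1) (k : kind) : exists s (b : 'I_n),
  forall G f, satisfies (@wicket_relation n) f ->
    pw (f (Tau a)) e * kletter f i k = crossing (G := G) f s * pw (f (Tau b)) e.
Proof.
have [al|ar|[al ar]] : [\/ a = left_wicket i, a = right_wicket i | a != left_wicket i /\ a != right_wicket i].
- by case: (eqVneq a (left_wicket i)); case: (eqVneq a (right_wicket i)); move=> *; [exact: Or31|exact: Or31|exact: Or32|exact: Or33].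
- subst a; case: k.
  + exists [:: (i, In)], (right_wicket i) => G f sf.
    have := sf _ _ (rel_tau_left_rho i e).
    by rewrite !word_eval_cat !eval_letter_pw /= !at_place_ord !mulg1.
  + exists [:: (i, if e then Be else Ab); (i, In); (i, if e then Ab else Be)], (right_wicket i) => G f sf.
    have := sf _ _ (rel_tau_left_rhoV i e).
    by rewrite !word_eval_cat !eval_letter_pw /= !mulg1; case: e => /= h; rewrite !at_place_ord /= h !mulgA.
  + exists [:: (i, Ab)], (right_wicket i) => G f sf.
    have := sf _ _ (rel_tau_left_sigma i e true).
    by rewrite !word_eval_cat !eval_letter_pw /= !at_place_ord !mulg1.
  + exists [:: (i, Be)], (right_wicket i) => G f sf.
    have := sf _ _ (rel_tau_left_sigma i e false).
    by rewrite !word_eval_cat !eval_letter_pw /= !at_place_ord !mulg1.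
- subst a; case: k.
  + exists [:: (i, if e then Be else Ab); (i, Has); (i, if e then Ab else Be)], (left_wicket i) => G f sf.
    have := sf _ _ (rel_tau_right_rho i e).
    by rewrite !word_eval_cat !eval_letter_pw /= !mulg1; case: e => /= h; rewrite !at_place_ord /= h !mulgA.
  + exists [:: (i, Has)], (left_wicket i) => G f sf.
    have := sf _ _ (rel_tau_right_rhoV i e).
    by rewrite !word_eval_cat !eval_letter_pw /= !at_place_ord !mulg1.
  + exists [:: (i, Ab)], (left_wicket i) => G f sf.
    have := sf _ _ (rel_tau_right_sigma i e true).
    by rewrite !word_eval_cat !eval_letter_pw /= !at_place_ord !mulg1.
  + exists [:: (i, Be)], (left_wicket i) => G f sf.
    have := sf _ _ (rel_tau_right_sigma i e false).
    by rewrite !word_eval_cat !eval_letter_pw /= !at_place_ord !mulg1.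
- exists [:: (i, k)], a => G f sf; rewrite /= mulg1.
  have r := comm_eval sf (rel_rho_tau al ar); have s := comm_eval sf (rel_sigma_tau al ar).
  case: k; rewrite /= at_place_ord /=; [exact: exchange_pw (esym r)|exact: exchange_pwV (esym r)|exact: exchange_pw (esym s)|].
  exact: exchange_pwV (esym s).
Qed.

Lemma turn_past_crossings a e s : exists s' b,
  forall G f, satisfies (@wicket_relation n) f ->
    pw (f (Tau a)) e * crossing (G := G) f s = crossing f s' * pw (f (Tau b)) e.
Proof.
elim: s a => [|[i k] s IH] a; first by exists [::], a => G f sf; rewrite /= mulg1 mul1g.
have [s1 [b h1]] := turn_past_crossing a e i k; have [s2 [b' h2]] := IH b.
exists (s1 ++ s2), b' => G f sf; rewrite /= mulgA h1// -mulgA h2// mulgA.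
by rewrite crossing_cat.
Qed.

Lemma normal_form (w : word (wicket_generator n)) : exists s t,
  forall G f, satisfies (@wicket_relation n) f ->
    word_eval (G := G) f w = crossing f s * turning f t.
Proof.
elim: w => [|[x e] w [s [t IH]]]; first by exists [::], [::] => G f _; rewrite /= mulg1.
case: x => [i|i|a].
- exists ((i, if e then In else Has) :: s), t => G f sf.
  by rewrite /= IH// mulgA; case: e; rewrite /= at_place_ord.
- exists ((i, if e then Ab else Be) :: s), t => G f sf.
  by rewrite /= IH// mulgA; case: e; rewrite /= at_place_ord.
- have [s' [b h]] := turn_past_crossings a e s; exists s', ((b, e) :: t) => G f sf.
  by rewrite /= IH// mulgA -[if e then _ else _]/(pw (f (Tau a)) e) h// -mulgA.
Qed.

(** Half turns commute. If the first letter had no inverse in the rest of the word, the angle at its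
    place would be a nonzero multiple of [pi]; otherwise the two cancel. *)
Lemma turning_eq1 G (f : wicket_generator n -> G) (R : realType) t :
  satisfies (@wicket_relation n) f -> (forall p, (p < n)%N -> angle R t p = 0%R) -> turning f t = 1.
Proof.
move=> sf; have cm (a b : 'I_n) e e' : pw (f (Tau a)) e * pw (f (Tau b)) e' = pw (f (Tau b)) e' * pw (f (Tau a)) e.
  have [->|ab] := eqVneq a b; first by case: e; case: e' => //=; rewrite ?mulgV ?mulVg.
  by apply: exchange_pw2; [have := comm_eval sf (rel_tau_tau ab)|
    have := comm_eval sf (rel_tau_tau ab)].
have cmt (a : 'I_n) e u : pw (f (Tau a)) e * turning f u = turning f u * pw (f (Tau a)) e.
  by elim: u => [|l u IH] /=; rewrite ?mulg1 ?mul1g// mulgA cm -mulgA IH mulgA.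
have [m] := ubnP (size t); elim: m t => // m IH [|[a e] t] //= tm at0.
have : (a, ~~ e) \in t.
  apply/negPn/negP => na; have := at0 a (ltn_ord a); rewrite /angle big_cons /=.
  have -> : \sum_(l <- t) half_turn R l.2 l.1 a = (if e then pi else - pi) *+ (count (fun l => l.1 == a) t).
    elim: t na {IH tm at0} => [|[b e'] t IHt]; first by rewrite big_nil mulr0n.
    rewrite in_cons negb_or big_cons /= => /andP[h1 /IHt ->]; rewrite /half_turn (inj_eq val_inj).
    have [ba|_] := eqVneq b a; last by rewrite add0r.
    rewrite add1n mulrS; congr (_ + _)%R; move: h1; rewrite ba xpair_eqE eqxx /=.
    by clear; case: e; case: e'.
  rewrite /half_turn eqxx -mulrS => /eqP; case: e {na at0}; rewrite ?mulNrn ?oppr_eq0;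
  by rewrite mulrn_eq0 /= gt_eqF// pi_gt0.
move=> mem; case/splitPr: mem tm at0 => t1 t2 tm at0.
rewrite turning_cat mulgA cmt /= -(mulgA _ _ (_ * _)) (mulgA (pw _ e)) pwN mulgV mul1g -turning_cat.
apply: IH => [|p pn]; first by move: tm; rewrite !size_cat /=; lia.
have := at0 p pn; rewrite /angle big_cons !big_cat big_cons /= /half_turn.
by case: eqP => _; case: e {tm at0} => /=; lra.
Qed.

End NormalForm.

(** * Concatenation of motions *)

Section Gluing.
Variables (R : realType) (n : nat).
Local Notation I := (unit_interval R).
Local Notation cfg := ('I_n -> wk R).
Local Notation valid := (@valid R _ [set: 'I_n]%SET).
Local Notation flat := (@flat R _ [set: 'I_n]%SET).
Local Notation ctsF f := (forall i, continuous (fun t => f t i : R * R * R * R)).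
Local Notation E := (enum 'I_n).
Local Notation base := (base_config R n).
Implicit Types (c : cfg) (L : seq 'I_n) (e : R -> cfg).

Lemma comp_cts (S T : topologicalType) (a : T -> S) (f : S -> cfg) :
  continuous a -> ctsF f -> ctsF (fun t => f (a t)).
Proof. by move=> ca cf i; exact: (compose_continuous ca (cf i)). Qed.

Definition chain e e' (t : R) : cfg := if t <= 2^-1 then e (2 * t) else e' (2 * t - 1).

Lemma chain_fst e e' t : t <= 2^-1 -> chain e e' t = e (2 * t).
Proof. by rewrite /chain => ->. Qed.

Lemma chain_snd e e' t : e 1 = e' 0 -> 2^-1 <= t -> chain e e' t = e' (2 * t - 1).
Proof.
move=> ee; rewrite /chain; case: ltgtP => // <- _.
by rewrite mulfV ?pnatr_eq0// subrr.
Qed.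

Lemma chain0 e e' : chain e e' 0 = e 0.
Proof. by rewrite chain_fst ?mulr0// invr_ge0. Qed.

Lemma chain1 e e' : e 1 = e' 0 -> chain e e' 1 = e' 1.
Proof. by move=> ee; rewrite chain_snd//; [congr e'; lra|lra]. Qed.

Lemma chain_forall (P : cfg -> Prop) e e' : e 1 = e' 0 ->
  (forall t, 0 <= t <= 1 -> P (e t)) -> (forall t, 0 <= t <= 1 -> P (e' t)) ->
  forall t, 0 <= t <= 1 -> P (chain e e' t).
Proof.
move=> ee h h' t /andP[t0 t1]; have [t2|/ltW t2] := leP t 2^-1.
  by rewrite chain_fst//; apply: h; apply/andP; split; lra.
by rewrite chain_snd//; apply: h'; apply/andP; split; lra.
Qed.

Lemma chain_ok e e' : e 1 = e' 0 -> path_ok e -> path_ok e' -> path_ok (chain e e').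
Proof.
move=> ee [ce ve] [ce' ve']; split=> [i|]; last exact: chain_forall.
rewrite /chain; under eq_fun do rewrite (fun_if (fun c : cfg => c i)).
apply: if_cts; first by cts.
- by apply: (comp_cts (a := fun t : R => 2 * t)) => //; cts.
- apply: (comp_cts (a := fun t : R => 2 * t - 1)) => //.
  by apply: subr_continuous; [apply: mul2_continuous; cts|cts].
- by move=> t ->; rewrite mulfV ?pnatr_eq0// subrr ee.
Qed.

Lemma chain_flat e e' : e 1 = e' 0 -> flat_path e -> flat_path e' -> flat_path (chain e e').
Proof. by move=> ee [ok fl] [ok' fl']; split; [exact: chain_ok|exact: chain_forall]. Qed.

Lemma Hc_chain e e' : e 1 = e' 0 -> path_ok e -> path_ok e' ->
  Hc (chain e e') = (Hc e * Hc e')%g.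
Proof.
move=> ee ok ok'; have okg := chain_ok ee ok ok'.
have h01 : (0 <= (0 : R) <= 1)%R by lra.
have h21 : (0 <= (2^-1 : R) <= 1)%R by lra.
have h11 : (0 <= (1 : R) <= 1)%R by lra.
have := Hc_part okg h01 h21 h11.
have -> : (fun t => chain e e' (0 + t * (1 - 0))) = chain e e'.
  by apply/funext => t; congr chain; ring.
move=> <-; congr (_ * _)%g; apply: Hc_ext => //.
- by apply: path_ok_comp => //; [cts|move=> t /andP[? ?]; apply/andP; split; lra].
- by move=> t /andP[? ?]; rewrite chain_fst; [congr (U (e _)); field|lra].
- by apply: path_ok_comp => //; [cts|move=> t /andP[? ?]; apply/andP; split; lra].
- by move=> t /andP[? ?]; rewrite chain_snd//; [congr (U (e' _)); field|lra].
Qed.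

Lemma sorted_conf L : sorted_by L (conf R L).
Proof. by move=> i j ij; exact/ltW/standard_lt. Qed.

End Gluing.

(** * Every class is a product of generators *)

Section Surjectivity.
Variables (R : realType) (n : nat).
Local Notation I := (unit_interval R).
Local Notation cfg := ('I_n -> wk R).
Local Notation valid := (@valid R _ [set: 'I_n]%SET).
Local Notation flat := (@flat R _ [set: 'I_n]%SET).
Local Notation ctsF f := (forall i, continuous (fun t => f t i : R * R * R * R)).
Local Notation E := (enum 'I_n).
Local Notation base := (base_config R n).
Implicit Types (c : cfg) (L : seq 'I_n) (e : R -> cfg).

(** Labels that two orders sorting [c] arrange oppositely have equal [x]-coordinates. *)
Lemma sorted_swaps L L' c : order L -> order L' -> sorted_by L c -> sorted_by L' c ->
  swaps (fun a b => cx (c a) = cx (c b)) L L'.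
Proof.
move=> oL oL' sL sL'; apply: swaps_of_inversions; first exact: order_uniq.
  by rewrite (perm_trans oL)// perm_sym.
by move=> a b _ _ /sL h /sL' h'; apply/eqP; rewrite eq_le h h'.
Qed.

Section FlatClass.
Variable P : wicket_group R n -> Prop.
Hypotheses (P1 : P 1%g) (PM : forall g h, P g -> P h -> P (g * h)%g).
Hypothesis PJ : forall k t, (k.+1 < n)%N -> P (jump R n k t).

Lemma jump_at_class c L L' : valid c -> flat c -> order L -> order L' ->
  sorted_by L c -> sorted_by L' c -> P (jump_at L L' c).
Proof.
move=> v fl oL oL' sL sL'; have sw := sorted_swaps oL oL' sL sL'.
elim: sw oL sL {oL' sL'} => [K|u a b w K ab _ IH] oL sL; first by rewrite /jump_at mulgV.
rewrite -(jump_at_trans _ (u ++ b :: a :: w)); apply: PM; last first.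
  by apply: IH; [exact: order_swap|exact: sorted_by_swap].
rewrite jump_swap//; apply: PJ.
by rewrite -[X in (_ < X)%N](order_size oL) size_cat /=; lia.
Qed.

(** Straightening relative to the ends of [e] gives a square whose three other sides are flat: the
    tracks of both ends and the straightened path. [flat_path_class] applies to each. *)
Lemma straight_class e L L' : (forall g, P g -> P g^-1%g) -> path_ok e -> order L -> order L' ->
  e 0 = conf R L -> e 1 = conf R L' -> P (Hc e).
Proof.
move=> PV ok oL oL' e0 e1.
have K : compact [set t : R | 0 <= t <= 1].
  have -> : [set t : R | 0 <= t <= 1] = `[0, 1]%classic by apply/seteqP; split=> t /=; rewrite in_itv.
  exact: segment_compact.
have B01 (t : R) : [set 0; 1] t -> flat (e t).
  by case=> ->; rewrite ?e0 ?e1; apply: (conf_valid _ _).2.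
have [g [[F [cF F0 F1 FK FB]] gK]] := straighten (B := [set 0; 1] : set R) K ok.1 ok.2 B01.
have i0 : (0 <= (0 : R) <= 1)%R by lra.
have i1 : (0 <= (1 : R) <= 1)%R by lra.
have okF : square_ok F by split=> // s t; exact: FK.
have fl (s : R) : s = 0 \/ s = 1 -> flat_path (fun u => F (s, u)).
  move=> s01; split=> [|u]; last by apply: FB.
  split=> [i|u u01]; last by apply: FK => //; case: s01 => ->.
  by apply: (comp_cts (a := fun u : R => (s, u))) => //; cts.
have flg : flat_path (fun s => F (s, 1)).
  split=> [|s s01]; last by rewrite F1; exact: gK.
  split=> [i|s s01]; last exact: FK.
  by apply: (comp_cts (a := fun s : R => (s, 1 : R))) => //; cts.
have [K0 [oK0 sK0]] := order_exists (F (0, 1)); have [K1 [oK1 sK1]] := order_exists (F (1, 1)).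
have c0 : F (0, 0) = conf R L by rewrite F0.
have c1 : F (1, 0) = conf R L' by rewrite F0.
have A := flat_path_class P1 PM jump_at_class (fl 0 (or_introl erefl)) oL oK0.
have B := flat_path_class P1 PM jump_at_class (fl 1 (or_intror erefl)) oL' oK1.
have C := flat_path_class P1 PM jump_at_class flg oK0 oK1.
rewrite c0 nu_conf// mul1g in A; rewrite c1 nu_conf// mul1g in B.
have {}A := A (@sorted_conf R n L) sK0; have {}B := B (@sorted_conf R n L') sK1; have {}C := C sK0 sK1.
have := Hc_square okF; rewrite (_ : (fun t => F (t, 0)) = e); last by apply/funext => t; rewrite F0.
move=> h; rewrite -[Hc e](mulgK (Hc (fun u => F (1, u)))) h.
have := PM (PM A C) (PV _ B); rewrite invgM invgK !mulgA.
by rewrite !mulgVK.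
Qed.

End FlatClass.

Section Generated.
Variable f : wicket_generator n -> wicket_group R n.
Hypothesis gen : standard_generators f.
Local Notation generated g := (exists w, word_eval f w = g).

Lemma generated_mul g h : generated g -> generated h -> generated (g * h)%g.
Proof. by move=> [u <-] [v <-]; exists (u ++ v); rewrite word_eval_cat. Qed.

Lemma generated_inv g : generated g -> generated g^-1%g.
Proof. by move=> [u <-]; exists (word_inv u); rewrite word_eval_inv. Qed.

Lemma generated1 : generated (1%g : wicket_group R n). Proof. by exists [::]. Qed.

Lemma generated_jump k t : (k.+1 < n)%N -> generated (jump R n k t).
Proof.
move=> kn; have k1 : (k < n.-1)%N by rewrite -ltnS prednK// (leq_ltn_trans _ kn).
rewrite -(kletter_jump gen t kn) -[k]/(val (Ordinal k1)).
have g1 s (b : bool) : generated (if b then f s else (f s)^-1)%g by exists (letter s b); rewrite word_eval_letter.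
by case: t; rewrite /kletter at_place_ord /=;
  [exact: (g1 _ true)|exact: (g1 _ false)|exact: (g1 _ true)|exact: (g1 _ false)].
Qed.

Lemma generated_turning t : generated (turning f t).
Proof.
elim: t => [|[x e] t IH]; first exact: generated1.
by apply: generated_mul IH; exists (letter (Tau x) e); rewrite eval_letter_pw.
Qed.

(** The lift of a loop ends at the base configuration with permuted labels and with angles that are
    multiples of [pi]. Turning these back costs a product of half turns and leaves a path between
    flat configurations. *)
Lemma generators_generate g : generated g.
Proof.
have [p ->{g}] := pi1_class_surj g.
have cp : continuous p by exact: cts_fun.
have oE := order_enum n; have [vE flE] := conf_valid R oE.
have pz : p zero = base := path_zero.
have [h [h0 ch hp]] := lift_exists cp (@unit_interval_compact R) (@contract1_cts R) (@contract1_0 R)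
  (@contract1_1 R) (@contract1_zero R) vE (etrans (U_conf R oE) (esym pz)).
pose e (t : R) := h (clamp t).
have ok : path_ok e.
  split=> [i|t _]; last by have [] := hp (clamp t).
  exact: (compose_continuous (@clamp_continuous R) (ch i)).
rewrite -(Hc_loop ok) => [|t]; last by rewrite /e clampK; have [_ ->] := hp t.
have [v1 U1] := hp one; rewrite path_one -(U_conf R oE) in U1.
have [s [s_inj hs]] := (U_eqP vE v1).1 U1.
pose g : 'I_n -> 'I_n := invF s_inj; have g_inj : injective g := can_inj (f_invF s_inj).
(* The labels in the order of the places at which the lift ends. *)
pose L : seq 'I_n := [seq g k | k <- enum 'I_n].
have oL : order L.
  apply: uniq_perm => [||k]; [by rewrite map_inj_uniq// enum_uniq|exact: enum_uniq|rewrite mem_enum].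
  by apply/mapP; exists (s k); rewrite ?mem_enum// /g invF_f.
have iL i : index i L = s i by rewrite -{1}(invF_f s_inj i) index_map// index_enum_ord.
pose th (p : nat) : R := oapp (fun k => an (h one (g k))) 0 (insub p).
have thE i : th (index i L) = an (h one i) by rewrite /th iL valK /= /g invF_f.
have [|t ht] := @angle_exists R n th.
  move=> q; rewrite /th; case: insub => [k|] /=; last by rewrite sin0.
  by have [_ _ _ [b [-> _]]] := hs (g k); rewrite /= sin0 mulr0.
have e1 : e 1 = turned L (angle R t).
  apply/funext => i; rewrite /e -[clamp 1]/one /turned ht ?order_index_lt// thE.
  by have [x1 x2 x3 _] := hs i; apply: wk_eq; rewrite ?x1 ?x2 ?x3 //= /conf index_enum_ord iL.
pose e' := turn L (angle R t) (fun=> 0).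
have ok' : path_ok e' by exact: turn_ok.
have ee : e 1 = e' 0.
  by rewrite e1; congr turned; apply/funext => q; rewrite subr0 mul0r mul1r addr0.
have e'1 : e' 1 = conf R L.
  by rewrite -[conf R L]/(turned L (fun=> 0)); congr turned; apply/funext => q; rewrite subrr mul0r mulr0 addr0.
rewrite -[Hc e](mulgK (Hc e')) -Hc_chain//; apply: generated_mul.
  apply: (straight_class generated1 generated_mul generated_jump generated_inv (chain_ok ee ok ok') oE oL).
    by rewrite chain0 /e -[clamp 0]/zero h0.
  by rewrite chain1.
apply: generated_inv; rewrite -[Hc e']invgK; apply: generated_inv.
rewrite (_ : (Hc e')^-1 = turning f t)%g; first exact: generated_turning.
rewrite -(turn_angle t oL (gen_tau gen)); apply: (mulIg (Hc e')).
by rewrite mulVg turn_mul// turn_id.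
Qed.

End Generated.
End Surjectivity.

(** * Faithfulness *)

Section Transfer.
Variables (R : realType) (n : nat) (G : groupType) (f : wicket_generator n -> G).
Hypothesis sat : satisfies (@wicket_relation n) f.
Local Notation cfg := ('I_n -> wk R).
Local Notation valid := (@valid R _ [set: 'I_n]%SET).
Local Notation flat := (@flat R _ [set: 'I_n]%SET).
Local Notation ctsF f := (forall i, continuous (fun t => f t i : R * R * R * R)).
Local Notation E := (enum 'I_n).
Implicit Types (c : cfg) (L : seq 'I_n).

(** Steeper than any line from the lower end of one wicket to the upper end of another. Pairs in one
    plane contribute 0, since division by 0 gives 0. *)
Definition slope c : R := 1 + \big[Num.max/0]_(p : 'I_n * 'I_n)
  ((cy (c p.2) + rd (c p.2) - (cy (c p.1) - rd (c p.1))) / (cx (c p.2) - cx (c p.1))).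

(* Any two wickets become comparable: those further to the left end up above. *)
Definition shear c : cfg := fun i => (0, cy (c i) - slope c * cx (c i), rd (c i), 0).

Lemma shear_above c a b : cx (c a) < cx (c b) -> above (shear c a) (shear c b).
Proof.
move=> ab; have d0 : 0 < cx (c b) - cx (c a) by rewrite subr_gt0.
have : (cy (c b) + rd (c b) - (cy (c a) - rd (c a))) / (cx (c b) - cx (c a)) < slope c.
  by rewrite /slope -[X in X < _]add0r ltr_leD ?ltr01// (le_bigmax_cond _ _ (j := (a, b))).
by rewrite ltr_pdivrMr// /above /shear /= => h; lra.
Qed.

Section Flat.
Variable c : cfg.
Hypotheses (v : valid c) (fl : flat c).

Lemma tied_laminar a b : a != b -> cx (c a) = cx (c b) -> laminar (c a) (c b).
Proof. by move/flatP: fl => /flat_validP/iffLR/(_ v) [_ h]; exact: h. Qed.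

Lemma shear_tied a b : a != b -> cx (c a) = cx (c b) ->
  kind_of (shear c a) (shear c b) = kind_of (c a) (c b).
Proof.
move=> ab e; apply: of_kind_unique; [exact: (valid_rd _ v)..|].
have := kind_ofP (tied_laminar ab e).
case: kind_of; rewrite /= /inside /above /shear /= e => h; rewrite ?andbb; try lra;
  case/andP: h => ? ?; apply/andP; split; lra.
Qed.

Lemma shear_laminar a b : a != b -> laminar (shear c a) (shear c b).
Proof.
move=> ab; have [lt|lt|e] := ltgtP (cx (c a)) (cx (c b)).
- exact: (@of_kind_laminar _ Ab) (shear_above lt).
- exact: (@of_kind_laminar _ Be) (shear_above lt).
- apply: (@of_kind_laminar _ (kind_of (c a) (c b))); rewrite -(shear_tied ab e).
  have := kind_ofP (tied_laminar ab e); rewrite (shear_tied ab e).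
  case: kind_of; rewrite /= /inside /above /shear /= e => h; rewrite ?andbb; try lra;
    case/andP: h => ? ?; apply/andP; split; lra.
Qed.

End Flat.

Definition cross c k a b : G := kletter f k (kind_of (shear c a) (shear c b)).
(** After the shear every pair has a kind, so the sorting word makes sense for all orders, including
    those that do not sort [c]. *)
Definition unravel c L : G := sorting_word (cross c) 0 L.

Lemma unravel_swap c u a b w : valid c -> flat c -> order (u ++ a :: b :: w) ->
  unravel c (u ++ a :: b :: w) = (cross c (size u) a b * unravel c (u ++ b :: a :: w))%g.
Proof.
move=> v fl oL; have r i : 0 < rd (shear c i) by exact: (valid_rd _ v).
rewrite -[size u]add0n; apply: (@sorting_word_swap G n (cross c)) => //.
- by move=> k x y xy; rewrite /cross kind_of_opp ?kletter_opp//; exact: shear_laminar.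
- by move=> *; exact: kletter_far.
- move=> k x y z kn xy xz yz.
  by apply: (hexagon_laminar sat kn (r x) (r y) (r z)); apply/kind_ofP/shear_laminar.
- by rewrite add0n (order_size oL).
- exact: order_uniq.
Qed.

(** A quotient of two values of one function of the order, so transitions at [c] compose. *)
Definition transfer c L L' : G := (unravel c L * (unravel c L')^-1)%g.

Lemma transfer_swap c u a b w : valid c -> flat c -> order (u ++ a :: b :: w) ->
  cx (c a) = cx (c b) ->
  transfer c (u ++ a :: b :: w) (u ++ b :: a :: w) = kletter f (size u) (kind_of (c a) (c b)).
Proof.
move=> v fl oL e; rewrite /transfer unravel_swap// mulgK /cross shear_tied//.
by have := order_uniq oL; rewrite cat_uniq /= inE negb_or; case: eqP; rewrite ?andbF.
Qed.

(** The sheared kinds at [c] and [c0] may differ, but between two orders sorting [c] only labels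
    tied in [c] are exchanged. These are tied in [c0] as well, with the same kind. *)
Lemma transfer_nearby c0 c L L' : valid c0 -> flat c0 -> nearby c0 c -> order L -> order L' ->
  sorted_by L c -> sorted_by L' c -> transfer c L L' = transfer c0 L L'.
Proof.
move=> v0 f0 nb oL oL' sL sL'; have v := nearby_valid nb; have fl : flat c by case: nb.
have sw := sorted_swaps oL oL' sL sL'.
elim: sw oL sL {oL' sL'} => [K|u a b w K ab _ IH] oL sL; first by rewrite /transfer !mulgV.
have ne : a != b.
  by have := order_uniq oL; rewrite cat_uniq /= inE negb_or; case: eqP; rewrite ?andbF.
have tr d K' : transfer d (u ++ a :: b :: w) K' =
    (transfer d (u ++ a :: b :: w) (u ++ b :: a :: w) * transfer d (u ++ b :: a :: w) K')%g.
  by rewrite /transfer mulgA mulgVK.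
have [_ _ h] := nb; have ab0 : cx (c0 a) = cx (c0 b).
  have [lt|lt|//] := ltgtP (cx (c0 a)) (cx (c0 b)).
    by have := (h a b ne).1 lt; rewrite ab ltxx.
  by rewrite eq_sym in ne; have := (h b a ne).1 lt; rewrite ab ltxx.
rewrite tr [RHS]tr !transfer_swap// IH; [|exact: order_swap|exact: sorted_by_swap].
congr (kletter f _ _ * _)%g; apply: of_kind_unique; [exact: (valid_rd _ v)..|].
exact: (h a b ne).2.
Qed.

Definition some_order c : seq 'I_n := projT1 (cid (order_exists c)).
Lemma some_orderP c : order (some_order c) /\ sorted_by (some_order c) c.
Proof. exact: projT2 (cid (order_exists c)). Qed.

Section OverSpace.
Variables (T : topologicalType) (h : T -> cfg).
Hypotheses (ch : ctsF h) (vh : forall x, valid (h x)) (fh : forall x, flat (h x)).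
Implicit Types s : T -> G.

(** The value [s y] is read in the chart of the chosen order at [h y]; the sorting words at [h x]
    compare it with [s x]. Coherence is local constancy after this change of charts. *)
Definition coherent_at x s : Prop := \forall y \near x,
  (s y * unravel (h x) (some_order (h y)) = s x * unravel (h x) (some_order (h x)))%g.

Lemma coherent_germ x s s' : (\forall y \near x, s y = s' y) -> coherent_at x s -> coherent_at x s'.
Proof.
move=> e cs; have ex := nbhs_singleton e; rewrite /coherent_at -ex.
by apply: filterS2 e cs => y ->.
Qed.

Lemma coherent_uniq x s s' : coherent_at x s -> coherent_at x s' ->
  \forall y \near x, s y = s' y <-> s x = s' x.
Proof.
apply: filterS2 => y e e'; split=> h1.
  by apply: (mulIg (unravel (h x) (some_order (h x)))); rewrite -e -e' h1.
by apply: (mulIg (unravel (h x) (some_order (h y)))); rewrite e e' h1.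
Qed.

(** The section is written with the sorting words at [h x] alone; by [transfer_nearby] those at
    [h z] give the same comparison between points close to [z]. *)
Lemma coherent_ex (x : T) : exists2 V : set T, nbhs x V &
  forall y e, V y -> True -> exists2 s, s y = e & forall z, V z -> coherent_at z s.
Proof.
exists [set y | nearby (h x) (h y)].
  by have := near_nearby ch (vh x) (fh x); apply: filterS => y /(_ (fh y)).
move=> y e Vy _; pose g z := unravel (h x) (some_order (h z)).
exists (fun z => e * g y * (g z)^-1)%g => [|z Vz]; first by rewrite mulgK.
rewrite /coherent_at; have := near_nearby ch (vh z) (fh z); apply: filterS => w /(_ (fh w)) nw.
have [ow sw] := some_orderP (h w); have [oz sz] := some_orderP (h z).
have := transfer_nearby (vh x) (fh x) Vz ow oz (nearby_sorted nw sw) sz.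
rewrite /transfer -/(g w) -/(g z) => tr; rewrite -!mulgA; congr (_ * (_ * _))%g.
apply: (mulgI (g w)); rewrite !mulgA mulgV mul1g -tr.
by rewrite mulgVK.
Qed.

End OverSpace.

(** The condition [coherent_at] along a path, confined to parameters of the unit interval. *)
Definition carried (d : R -> cfg) (s : R -> G) : Prop := forall t : R, 0 <= t <= 1 ->
  \forall y \near t, 0 <= y <= 1 ->
    (s y * unravel (d t) (some_order (d y)) = s t * unravel (d t) (some_order (d t)))%g.

Lemma carried_comp d d' s (a : R -> R) : continuous a ->
  (forall t, 0 <= t <= 1 -> 0 <= a t <= 1) -> (forall t, 0 <= t <= 1 -> d' t = d (a t)) ->
  carried d s -> carried d' (fun t => s (a t)).
Proof.
move=> ca a01 e cr t t01; have := ca t _ (cr (a t) (a01 t t01)).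
by rewrite nbhs_filterE /=; apply: filterS => y hy y01; rewrite !e//; exact/hy/a01.
Qed.

Lemma coherent_carried (T : topologicalType) (h : T -> cfg) s (a : R -> T) d : continuous a ->
  (forall x, coherent_at h x s) -> (forall t, 0 <= t <= 1 -> d t = h (a t)) ->
  carried d (fun t => s (a t)).
Proof.
move=> ca cs e t t01; have := ca t _ (cs (a t)).
by rewrite nbhs_filterE /=; apply: filterS => y hy y01; rewrite !e.
Qed.

(** Inside the cone of [L] the value read in the chart of [L] is locally constant. *)
Lemma carried_sorted d s L : flat_path d -> carried d s -> order L ->
  (forall t, 0 <= t <= 1 -> sorted_by L (d t)) ->
  (s 0%R * transfer (d 0%R) (some_order (d 0%R)) L = s 1%R * transfer (d 1%R) (some_order (d 1%R)) L)%g.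
Proof.
move=> [[cd vd] fd] cr oL sL; apply/esym.
pose val t := (s t * transfer (d t) (some_order (d t)) L)%g.
suff h t : 0 <= t <= 1 -> val t = val 0 by apply: (h 1); rewrite ler01 lexx.
apply: (@real_induction R (fun t => val t = val 0)) => // u u01.
have : \forall y \near u, 0 <= y <= 1 -> val y = val u.
  have := near_nearby cd (vd u u01) (fd u u01); apply: filterS2 (cr u u01) => y hy nb y01.
  have [oy sy] := some_orderP (d y).
  rewrite /val (transfer_nearby (vd u u01) (fd u u01) (nb (fd y y01)) oy oL sy (sL y y01)).
  by rewrite /transfer !mulgA hy.
move=> /nbhs_ballP[r r0 hr]; exists r => // y z y01 z01.
by rewrite ![`|_ - u|]distrC => /hr hy /hr hz; rewrite hy// hz.
Qed.

Lemma carried_const d s c : valid c -> flat c -> (forall t, 0 <= t <= 1 -> d t = c) ->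
  carried d s -> s 0 = s 1.
Proof.
move=> v fl e cr; have [oL sL] := some_orderP c.
have cr' : carried (fun=> c) (fun t => s t).
  by apply: carried_comp cr => // [t|t /e ->//]; exact: cvg_id.
have fp : flat_path (fun=> c) by split=> //; exact: path_ok_cst.
by have := carried_sorted fp cr' oL (fun _ _ => sL); apply: mulIg.
Qed.

(** The planes of [conf L] are distinct, so [L] is the only order sorting it. *)
Lemma transfer_conf L : order L -> transfer (conf R L) (some_order (conf R L)) L = 1%g.
Proof.
move=> oL; have [oK sK] := some_orderP (conf R L).
have := sorted_swaps oK oL sK (@sorted_conf R n L).
move: (some_order _) oK {sK} => K oK sw.
suff -> : K = L by rewrite /transfer mulgV.
have inj a b : cx (conf R L a) = cx (conf R L b) -> a = b.
  move=> e; apply: (order_index_inj oL); case: (ltngtP (index a L) (index b L)) => // /(standard_lt R);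
    by rewrite /conf in e; rewrite e ltxx.
have H K1 K2 : swaps (fun a b => cx (conf R L a) = cx (conf R L b)) K1 K2 -> order K1 -> K1 = K2.
  elim=> // u a b w K' /inj ab _ _ /order_uniq.
  by rewrite ab cat_uniq /= inE eqxx !andbF.
exact: H sw oK.
Qed.

End Transfer.

(** * Paths realizing the letters *)

Section CrossingPaths.
Variables (R : realType) (n : nat) (G : groupType) (f : wicket_generator n -> G).
Hypothesis sat : satisfies (@wicket_relation n) f.
Local Notation cfg := ('I_n -> wk R).
Local Notation valid := (@valid R _ [set: 'I_n]%SET).
Local Notation flat := (@flat R _ [set: 'I_n]%SET).
Local Notation E := (enum 'I_n).
Implicit Types (c : cfg) (L : seq 'I_n).

Lemma tied_config L u a b w t : order L -> L = u ++ a :: b :: w ->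
  let c : cfg := fun i => tied R (size u) t (index i L) in
  [/\ valid c, flat c, sorted_by L c, cx (c a) = cx (c b) & kind_of (c a) (c b) = t].
Proof.
move=> oL e c; set k := size u in c *.
have [ia ib] : index a L = k /\ index b L = k.+1 by rewrite e; apply: index_adjacent; rewrite -e order_uniq.
have fl i : an (c i) = 0 := tied_an _ _ _ _.
have eab : cx (c a) = cx (c b) by rewrite /c ia ib tied_eq.
have kd : of_kind t (c a) (c b) by rewrite /c ia ib; exact: tied_kind.
have rd0 i : 0 < rd (c i) := tied_rd _ _ _ _.
have lt i j : (index i L < index j L)%N -> cx (c i) < cx (c j) \/ i = a /\ j = b.
  move=> ij; case: (boolP ((index i L == k) && (index j L == k.+1))) => [/andP[/eqP ei /eqP ej]|ne].
    by right; split; apply: (order_index_inj oL); rewrite ?ei ?ej.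
  by left; exact: tied_lt.
split=> //; last exact: of_kind_unique.
- apply/flat_validP => //; split=> // i j ij ex.
  have [h|h|h] := ltngtP (index i L) (index j L).
  + have [h'|[-> ->]] := lt i j h; [by rewrite ex ltxx in h'|exact: of_kind_laminar kd].
  + have [h'|[-> ->]] := lt j i h; first by rewrite ex ltxx in h'.
    by rewrite laminar_sym; exact: of_kind_laminar kd.
  + by rewrite (order_index_inj oL h) eqxx in ij.
- by move=> i j /lt[/ltW//|[-> ->]]; rewrite eab.
Qed.

Lemma rev_path (e : R -> cfg) : flat_path e -> flat_path (fun t => e (1 - t)).
Proof.
have r01 (t : R) : 0 <= t <= 1 -> 0 <= 1 - t <= 1 by move=> /andP[? ?]; apply/andP; split; lra.
move=> [ok fl]; split=> [|t /r01]; last exact: fl.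
by apply: (path_ok_comp (a := fun t => 1 - t)) => //; cts.
Qed.

Lemma cone_path L c : order L -> valid c -> flat c -> sorted_by L c ->
  [/\ flat_path (line (conf R L) c), flat_path (fun t => line (conf R L) c (1 - t)) &
      forall t, 0 <= t <= 1 -> sorted_by L (line (conf R L) c t)].
Proof.
move=> oL v fl sL; have fp : flat_path (line (conf R L) c).
  have cv s := cone_valid oL v fl sL (s := s).
  split=> [|t /cv[]//]; split=> [i|t /cv[]//].
  by apply: line_cts => [j|j|]; cts.
split=> //; first exact: rev_path.
by move=> t t01; apply: sorted_line => //; exact: sorted_conf.
Qed.

Lemma carried_chain (d1 d2 : R -> cfg) s : d1 1 = d2 0 -> carried f (chain d1 d2) s ->
  carried f d1 (fun x => s (2^-1 * x)) /\ carried f d2 (fun x => s (2^-1 + 2^-1 * x)).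
Proof.
move=> j12 cr; split.
- apply: (carried_comp (a := fun x => 2^-1 * x)) cr => [|x|x]; first by apply: mulr_continuous; cts.
  + by move=> /andP[? ?]; apply/andP; split; lra.
  + by move=> /andP[? ?]; rewrite chain_fst; [congr d1; field|lra].
- apply: (carried_comp (a := fun x => 2^-1 + 2^-1 * x)) cr => [|x|x].
  + by apply: addr_continuous; [cts|apply: mulr_continuous; cts].
  + by move=> /andP[? ?]; apply/andP; split; lra.
  + by move=> /andP[? ?]; rewrite chain_snd//; [congr d2; field|lra].
Qed.

Lemma crossing_step L (k : 'I_n.-1) t : order L -> exists (d : R -> cfg) L',
  [/\ order L', flat_path d, d 0 = conf R L, d 1 = conf R L' & Hc d = jump R n k t /\
      forall s, carried f d s -> s 1 = (s 0%R * kletter f k t)%g].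
Proof.
move=> oL.
have [u [a [b [w [e su]]]]] : exists u a b w, L = u ++ a :: b :: w /\ size u = k.
  have k2 : (k.+1 < n)%N := ltn_ord (right_wicket k).
  exists (take k L); move: (order_size oL) (cat_take_drop k L).
  have := size_drop k L; case: (drop k L) => [|a [|b w]] /= sd sL;
    try by move: sd; rewrite sL; lia.
  by move=> eL; exists a, b, w; rewrite eL size_takel//; lia.
have [v fl sL eab kd] := tied_config t oL e; move: v fl sL eab kd; set c := fun i => _ => v fl sL eab kd.
pose L' := u ++ b :: a :: w.
have oL' : order L' by apply: order_swap; rewrite -e.
have sL' : sorted_by L' c by apply: sorted_by_swap; rewrite -?e.
have [fp _ sl] := cone_path oL v fl sL; have [fp' fr' sl'] := cone_path oL' v fl sL'.
pose d1 := line (conf R L) c; pose d2 (x : R) := line (conf R L') c (1 - x).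
have j12 : d1 1 = d2 0 by rewrite /d1 /d2 subr0 !line1.
have fg : flat_path (chain d1 d2) by exact: chain_flat.
exists (chain d1 d2), L'; split=> //.
- by rewrite chain0 /d1 line0.
- by rewrite chain1// /d2 subrr line0.
split.
  rewrite Hc_chain//; [|by case: fp|by case: fr'].
  rewrite [Hc d2](Hc_rev fp'.1) /jump; congr (_ * _^-1)%g.
    apply/esym; rewrite -su.
    exact: (@Hc_relabel R n L E (fun s p => lin (standard R p) (tied R (size u) t p) s) oL (order_enum n) fp.1).
  have eL' : line (conf R L') c = fun s i => lin (standard R (transpose_places (size u) (index i L)))
      (tied R (size u) t (index i L)) s.
    by apply/funext => s; apply/funext => i; rewrite /line /conf /L' index_swap -?e// order_uniq.
  have ok' := fp'.1; rewrite eL' in ok' *; apply/esym; rewrite -su.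
  exact: (@Hc_relabel R n L E (fun s p => lin (standard R (transpose_places (size u) p))
    (tied R (size u) t p) s) oL (order_enum n) ok').
move=> s cr.
have [c1 c2] := carried_chain j12 cr.
have r01 (x : R) : 0 <= x <= 1 -> 0 <= 1 - x <= 1 by move=> /andP[? ?]; apply/andP; split; lra.
have E1 := carried_sorted sat fp c1 oL sl.
have E2 := carried_sorted sat fr' c2 oL' (fun x x01 => sl' _ (r01 x x01)).
move: E1 E2; rewrite /d1 /d2 subr0 subrr !line0 !line1 !transfer_conf// !mulg1 mulr0 mulr1 addr0.
rewrite (_ : 2^-1 + 2^-1 = 1 :> R); last by field.
move=> -> E2; rewrite -[LHS]E2 -mulgA; congr (_ * _)%g.
rewrite -su -kd -(transfer_swap sat (u := u) (w := w) v fl _ eab) -?e//.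
by rewrite /transfer mulgA mulgVK.
Qed.

Lemma crossing_path (fw : wicket_generator n -> wicket_group R n) (x : seq ('I_n.-1 * kind)) L :
  standard_generators fw -> order L -> exists (d : R -> cfg) L',
  [/\ order L', flat_path d, d 0 = conf R L, d 1 = conf R L' & Hc d = crossing fw x /\
      forall s, carried f d s -> s 1 = (s 0%R * crossing f x)%g].
Proof.
move=> gen; elim: x L => [|[k t] x IH] L oL.
  exists (fun=> conf R L), L; have [v fl] := conf_valid R oL.
  split=> //; first by split=> //; exact: path_ok_cst.
  split=> [|s cr]; first exact: Hc_cst.
  by rewrite /= mulg1; apply/esym/(carried_const sat v fl _ cr).
have [d1 [L1 [oL1 f1 d10 d11 [H1 c1]]]] := crossing_step k t oL.
have [d2 [L2 [oL2 f2 d20 d21 [H2 c2]]]] := IH L1 oL1.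
have ee : d1 1 = d2 0 by rewrite d11 d20.
exists (chain d1 d2), L2; split=> //; [exact: chain_flat|by rewrite chain0|by rewrite chain1|].
split=> [|s cr].
  rewrite (Hc_chain ee f1.1 f2.1) H1 H2 /=; congr (_ * _)%g; apply/esym/(kletter_jump gen).
  exact: ltn_ord (right_wicket k).
have [cr1 cr2] := carried_chain ee cr.
have := c1 _ cr1; have := c2 _ cr2; rewrite mulr0 mulr1 addr0 (_ : 2^-1 + 2^-1 = 1 :> R); last by field.
by move=> -> ->; rewrite /= mulgA.
Qed.

End CrossingPaths.

(** * Lifting null homotopies *)

Section NullHomotopy.
Variables (R : realType) (n : nat).
Local Notation I := (unit_interval R).
Local Notation cfg := ('I_n -> wk R).
Local Notation valid := (@valid R _ [set: 'I_n]%SET).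
Local Notation flat := (@flat R _ [set: 'I_n]%SET).
Local Notation ctsF f := (forall i, continuous (fun t => f t i : R * R * R * R)).
Local Notation E := (enum 'I_n).
Local Notation base := (base_config R n).

(** Uniqueness of lifts makes the lift constant on the three sides where the homotopy is constant.
    In particular [e] ends at the labelled configuration where it began, angles included. *)
Lemma null_lift (e : R -> cfg) : path_ok e -> e 0 = conf R E -> U (e 1) = base -> Hc e = 1%g ->
  exists H : I * I -> cfg, [/\ ctsF H, forall x, valid (H x), forall t, H (zero, t) = e (ival t) &
    [/\ forall t, H (one, t) = conf R E, forall s, H (s, zero) = conf R E &
        forall s, H (s, one) = conf R E]].
Proof.
move=> ok e0 U1 h1; have oE := order_enum n; have [vE _] := conf_valid R oE.
have UE := U_conf R oE.
have [p [pE _]] : exists p : loop (R := R) base, (forall t : I, p t = U (e (ival t))) /\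
    follows p (fun t => ends_of (e (ival t))) by apply: loop_of; rewrite ?e0.
have : pi1_class p = pi1_class (const_path base) by rewrite -(Hc_loop ok pE).
move=> /pi1_classP[K [cK K0 K1 Kx Ky]].
have Uc : U (conf R E) = K (zero, zero) by rewrite Kx UE.
have [H [H00 cH HK]] := lift_exists cK (@unit_square_compact R) (@contract2_cts R) (@contract2_0 R)
  (@contract2_1 R) (@contract2_zero R) vE Uc.
have edge (a : I -> I * I) (g : I -> cfg) : continuous a -> ctsF g -> (forall t, valid (g t)) ->
    (forall t, K (a t) = U (g t)) -> H (a zero) = g zero -> forall t, H (a t) = g t.
  move=> ca cg vg Kg; apply: lift_unique => // [i|t|t];
    [exact: (compose_continuous ca (cH i))|by case: (HK (a t))|by rewrite -Kg; case: (HK (a t))].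
have cstc c : ctsF (fun _ : I => c : cfg) by move=> i; cts.
have bot s : H (s, zero) = conf R E.
  apply: (edge (fun s => (s, zero)) (fun=> conf R E)) => //; first by cts.
  by move=> t; rewrite Kx UE.
have lft t : H (zero, t) = e (ival t).
  apply: (edge (fun t => (zero, t)) (fun t => e (ival t))) => //.
  - by cts.
  - by move=> i; apply: (compose_continuous (@ival_continuous R) (ok.1 i)).
  - by move=> x; apply: ok.2; exact: ival_itv.
  - by move=> x; rewrite K0 pE.
  - by rewrite bot ival0 e0.
have rgt t : H (one, t) = conf R E.
  apply: (edge (fun t => (one, t)) (fun=> conf R E)) => //; first by cts.
  by move=> x; rewrite K1 UE.
have top s : H (s, one) = e 1.
  apply: (edge (fun s => (s, one)) (fun=> e 1)) => //; first by cts.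
  - by move=> _; apply: ok.2; rewrite ler01 lexx.
  - by move=> x; rewrite Ky U1.
  - by rewrite lft ival1.
exists H; split=> // [x|]; first by case: (HK x).
by split=> // s; rewrite top -(top one) rgt.
Qed.

End NullHomotopy.

(** * Monodromy over a disc of flat configurations *)

Section Monodromy.
Variables (R : realType) (n : nat) (G : groupType) (f : wicket_generator n -> G).
Hypothesis sat : satisfies (@wicket_relation n) f.
Local Notation I := (unit_interval R).
Local Notation cfg := ('I_n -> wk R).
Local Notation valid := (@valid R _ [set: 'I_n]%SET).
Local Notation flat := (@flat R _ [set: 'I_n]%SET).
Local Notation ctsF f := (forall i, continuous (fun t => f t i : R * R * R * R)).
Local Notation E := (enum 'I_n).
Local Notation base := (base_config R n).

Lemma clamp_le0 (x : R) : x <= 0 -> clamp x = zero.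
Proof.
by move=> x0; apply: ival_inj; rewrite ival0 /ival set_valE /= (min_idPr _) ?(max_idPl _)//; lra.
Qed.

Lemma clamp_ge1 (x : R) : 1 <= x -> clamp x = one.
Proof.
by move=> x1; apply: ival_inj; rewrite ival1 /ival set_valE /= (min_idPl _) ?(max_idPr _)//; lra.
Qed.

(* The square is enlarged to [-1, 2]^2; outside of [0, 1]^2 the deformation is
   undone along its boundary, where it stays flat. *)
Definition enlarge (t : I) : R := 3 * ival t - 1.
Definition excess (z : I * I) : R :=
  Num.max `|enlarge z.1 - unit_itv (enlarge z.1)| `|enlarge z.2 - unit_itv (enlarge z.2)|.
Definition collar (F : (I * I) * R -> cfg) (z : I * I) : cfg :=
  F ((clamp (enlarge z.1), clamp (enlarge z.2)), unit_itv (1 - excess z)).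

Definition on_edge (t : I) : Prop := t = zero \/ t = one.

Lemma collar_cts F : ctsF F -> ctsF (collar F).
Proof.
move=> cF; have ce (T : topologicalType) (a : T -> I) : continuous a -> continuous (fun z => enlarge (a z)).
  by move=> ca; rewrite /enlarge; cts.
have c1 : continuous (fun z : I * I => enlarge z.1) by apply: ce; cts.
have c2 : continuous (fun z : I * I => enlarge z.2) by apply: ce; cts.
apply: (comp_cts (a := fun z : I * I => ((clamp (enlarge z.1), clamp (enlarge z.2)), unit_itv (1 - excess z)))) => //.
have u1 := unit_itv_cts c1; have u2 := unit_itv_cts c2.
have cx : continuous excess by rewrite /excess; cts.
apply: pair_continuous; first by cts.
by apply: unit_itv_cts; cts.
Qed.

Lemma edge_excess (t : I) : on_edge t -> `|enlarge t - unit_itv (enlarge t)| = 1.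
Proof.
rewrite /enlarge /unit_itv => -[] ->; rewrite ?ival0 ?ival1.
  by rewrite clamp_le0 ?ival0; [rewrite (_ : _ - _ = -1) ?normrN1//; ring|lra].
by rewrite clamp_ge1 ?ival1; [rewrite (_ : _ - _ = 1) ?normr1//; ring|lra].
Qed.

Lemma collar_edge F z : on_edge z.1 \/ on_edge z.2 ->
  collar F z = F ((clamp (enlarge z.1), clamp (enlarge z.2)), 0).
Proof.
move=> h; have x1 : 1 <= excess z.
  by rewrite /excess le_max; case: h => /edge_excess ->; rewrite lexx ?orbT.
by rewrite /collar /unit_itv (clamp_le0 (x := 1 - excess z)) ?ival0//; lra.
Qed.

Lemma collar_flat F z : (forall x, flat (F (x, 1))) ->
  (forall x (u : R), on_edge x.1 \/ on_edge x.2 -> 0 <= u <= 1 -> flat (F (x, u))) -> flat (collar F z).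
Proof.
move=> f1 fe; have out (t : I) : ~ (0 <= enlarge t <= 1) -> on_edge (clamp (enlarge t)).
  move=> h; have [h0|h0] := leP (enlarge t) 0; first by left; exact: clamp_le0.
  right; apply: clamp_ge1; rewrite leNgt; apply/negP => h1; apply: h; lra.
have [h1|h1] := pselect (0 <= enlarge z.1 <= 1); last first.
  by apply: fe; [left; exact: out|exact: unit_itvP].
have [h2|h2] := pselect (0 <= enlarge z.2 <= 1); last first.
  by apply: fe; [right; exact: out|exact: unit_itvP].
by rewrite /collar /excess !unit_itvE// !subrr normr0 maxxx subr0 ?ler01 ?lexx//; exact: f1.
Qed.

(** The disc carries a coherent section with values in [G]. On its boundary this section is constant
    except along [d], where it is multiplied by [g]; going around once forces [g = 1]. *)
Lemma monodromy (d : R -> cfg) L (g : G) : order L -> flat_path d -> d 0 = conf R E ->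
  d 1 = conf R L -> Hc d = 1%g ->
  (forall s, carried f d s -> s 1 = (s 0%R * g)%g) -> g = 1%g.
Proof.
move=> oL [ok fd] d0 d1 h1 cd; have oE := order_enum n; have [vE fE] := conf_valid R oE.
have U1 : U (d 1) = base by rewrite d1 U_conf.
have [H [cH vH Hl [Hr Hb Ht]]] := null_lift ok d0 U1 h1.
have edge x : on_edge x.1 \/ on_edge x.2 -> flat (H x).
  case: x => x y /= [[]|[]] ->; rewrite ?Hl ?Hr ?Hb ?Ht//.
  exact/fd/ival_itv.
have [h [[F [cF F0 F1 FK FB]] hf]] := straighten (@unit_square_compact R) cH (fun x _ => vH x) edge.
pose phi := collar F.
have cphi : ctsF phi by exact: collar_cts.
have vphi z : valid (phi z) by apply: FK => //; exact: unit_itvP.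
have fphi z : flat (phi z).
  by apply: collar_flat => [x|x u]; [rewrite F1; exact: hf|exact: FB].
have [s s0 cs] := section_exists (@coherent_germ R n G f _ phi) (fun _ _ _ => Logic.I)
  (@coherent_uniq R n G f _ phi) (coherent_ex sat cphi vphi fphi)
  (@unit_square_compact R) (@contract2_cts R) (@contract2_0 R) (@contract2_1 R) (@contract2_zero R)
  (e0 := 1%g) Logic.I.
have phiE z : on_edge z.1 \/ on_edge z.2 -> phi z = H (clamp (enlarge z.1), clamp (enlarge z.2)).
  by move=> /(collar_edge F) e; rewrite /phi e F0.
have z_e : on_edge zero by left. have o_e : on_edge one by right.
have eE (x : R) : 0 <= x <= 1 -> enlarge (clamp x) = 3 * x - 1 by move=> x01; rewrite /enlarge ivalK.
have const (a : R -> I * I) : continuous a -> (forall t, 0 <= t <= 1 -> phi (a t) = conf R E) ->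
    s (a 0) = s (a 1).
  move=> ca e; apply: (carried_const sat (d := fun t => phi (a t)) (s := fun t => s (a t)) vE fE e).
  exact: (coherent_carried ca cs).
have e0 : enlarge zero = -1 :> R by rewrite /enlarge ival0; ring.
have e1 : enlarge one = 2 :> R by rewrite /enlarge ival1; ring.
have cl0 : clamp (enlarge zero) = zero :> I by rewrite e0 clamp_le0//; lra.
have cl1 : clamp (enlarge one) = one :> I by rewrite e1 clamp_ge1//; lra.
have bot : s (zero, zero) = s (one, zero).
  apply: (const (fun t => (clamp t, zero))) => [|t t01].
    by apply: pair_continuous; [exact: clamp_continuous|cts].
  by rewrite phiE /= ?cl0 ?Hb//; right.
have rgt : s (one, zero) = s (one, one).
  apply: (const (fun t => (one, clamp t))) => [|t t01].
    by apply: pair_continuous; [cts|exact: clamp_continuous].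
  by rewrite phiE /= ?cl1 ?Hr//; left.
have top : s (zero, one) = s (one, one).
  apply: (const (fun t => (clamp t, one))) => [|t t01].
    by apply: pair_continuous; [exact: clamp_continuous|cts].
  by rewrite phiE /= ?cl1 ?Ht//; right.
(* The left edge is cut into thirds: the enlarged family is constant on the outer two and runs
   through [d] on the middle one. *)
pose a (x y : R) (t : R) : I * I := (zero, clamp (x + y * t)).
have ca x y : continuous (a x y).
  apply: pair_continuous; first by cts.
  by apply: clamp_comp_continuous; apply: addr_continuous; [cts|apply: mulr_continuous; cts].
have phia x y t : 0 <= x + y * t <= 1 -> phi (a x y t) = H (zero, clamp (3 * (x + y * t) - 1)).
  by move=> h01; rewrite phiE /= ?cl0 ?eE//; left.
have start : s (a 0 3^-1 0) = s (a 0 3^-1 1).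
  apply: const => // t /andP[t0 t1]; rewrite phia; last by apply/andP; split; lra.
  by rewrite clamp_le0 ?Hb//; lra.
have stop : s (a (2/3) 3^-1 0) = s (a (2/3) 3^-1 1).
  apply: const => // t /andP[t0 t1]; rewrite phia; last by apply/andP; split; lra.
  by rewrite clamp_ge1 ?Ht//; lra.
pose b := a 3^-1 3^-1; have mid : s (b 1) = (s (b 0%R) * g)%g.
  apply: (cd (fun t => s (b t))); apply: coherent_carried (ca _ _) cs _ => t t01.
  case/andP: (t01) => t0 t1; rewrite /b phia; last by apply/andP; split; lra.
  by rewrite (_ : 3 * _ - 1 = t); [rewrite Hl ivalK|field].
have E1 : a 0 3^-1 1 = b 0 by congr (zero, clamp _); ring.
have E2 : b 1 = a (2/3) 3^-1 0 by congr (zero, clamp _); field.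
have E0 : a 0 3^-1 0 = (zero, zero) by congr (zero, _); apply: clamp_le0; lra.
have E3 : a (2/3) 3^-1 1 = (zero, one) by congr (zero, _); apply: clamp_ge1; lra.
apply: (mulgI (s (zero, zero))); rewrite mulg1 -{1}E0 start E1 -mid E2 stop E3.
by rewrite top -rgt -bot.
Qed.

End Monodromy.

(** * The presentation of the wicket group *)

Section Presentation.
Variables (R : realType) (n : nat).
Local Notation E := (enum 'I_n).
Variable f : wicket_generator n -> wicket_group R n.
Hypothesis gen : standard_generators f.

(** The normal form is evaluated twice: through [f], where the null homotopy shows that all angles
    vanish and that the crossings have trivial class, and through [pgen], where [monodromy] applies
    with the presented group in the role of [G]. *)
Lemma faithful (w : word (wicket_generator n)) : word_eval f w = 1%g ->
  presented_eq (@wicket_relation n) w [::].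
Proof.
have sf := generators_sound gen; have sp := @satisfies_pgen _ (@wicket_relation n).
have [x [t nf]] := normal_form w; rewrite (nf _ _ sf) => h1.
have oE := order_enum n.
have [d [L [oL fd d0 d1 [Hd cd]]]] := crossing_path sp x gen oE.
pose e := chain d (turn L (fun=> 0) (angle R t)).
have okt : path_ok (turn L (fun=> 0) (angle R t)) := turn_ok _ _ oL.
have t0 : turn L (fun=> 0) (angle R t) 0 = conf R L.
  by rewrite -[conf R L]/(turned L (fun=> 0)); congr turned; apply/funext => p; rewrite mulr0 mul0r addr0.
have t1 : turn L (fun=> 0) (angle R t) 1 = turned L (angle R t).
  by congr turned; apply/funext => p; rewrite mulr0 mul1r add0r.
have dt : d 1 = turn L (fun=> 0) (angle R t) 0 by rewrite d1 t0.
have e1 : e 1 = turned L (angle R t) by rewrite /e chain1// t1.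
have Ue : U (e 1) = base_config R n by rewrite e1; apply: U_turned_base => // p; exact: sin_angle.
have He : Hc e = 1%g by rewrite Hc_chain//; [rewrite Hd (turn_angle t oL (gen_tau gen))|case: fd].
have [H [_ _ Hl [_ _ Ht]]] := null_lift (chain_ok dt fd.1 okt) (etrans (chain0 _ _) d0) Ue He.
have eE : turned L (angle R t) = conf R E.
  by rewrite -e1 -(Ht zero) Hl ival1.
have a0 p : (p < n)%N -> angle R t p = 0.
  move=> pn; have pL : (p < size L)%N by rewrite (order_size oL).
  have /(congr1 (fun c => an (c (nth (Ordinal pn) L p)))) := eE.
  by rewrite /turned /= index_uniq// order_uniq.
have h2 : crossing f x = 1%g by rewrite -h1 (turning_eq1 sf a0) mulg1.
apply/pclassP; rewrite -word_eval_pgen (nf _ _ sp) (turning_eq1 sp a0) mulg1.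
by apply: (monodromy sp oL fd d0 d1 _ cd); rewrite Hd.
Qed.

Lemma generators_present : has_presentation (@wicket_relation n) f.
Proof.
split; first exact: generators_generate.
move=> u v; split=> [e|]; last exact: satisfies_peq (generators_sound gen).
have h : word_eval f (u ++ word_inv v) = 1%g by rewrite word_eval_cat word_eval_inv e mulgV.
have /pclassP := faithful h; rewrite -!word_eval_pgen word_eval_cat word_eval_inv => h1.
apply/pclassP; rewrite -!word_eval_pgen; apply: (mulIg (word_eval (pgen (@wicket_relation n)) v)^-1%g).
by rewrite h1 mulgV.
Qed.

End Presentation.

(* First conjunct: loops as in the descriptions of the generators exist.
   Second conjunct: any choice of such loops gives the presentation. *)
Theorem proposition3p6 (R : realType) (n : nat) (n_gt0 : (0 < n)%N) :
  (exists f : wicket_generator n -> wicket_group R n, standard_generators f) /\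
  (forall f : wicket_generator n -> wicket_group R n,
     standard_generators f -> has_presentation (@wicket_relation n) f).
Proof.
split=> [|f]; last exact: generators_present.
have /choice[r hr] := @rho_exists R n; have /choice[s hs] := @sigma_exists R n.
have /choice[t ht] := @tau_exists R n.
exists (fun x => match x with Rho i => r i | Sigma i => s i | Tau a => t a end).
by split.
Qed.
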